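(* Let $\mathbf P_n$, $n\ge1$, be classes of data-generating processes such that every sequence $\{P_n\}$ with $P_n\in\mathbf P_n$ satisfies either (1) conditions (I), (II), (III) of the context with first-stage estimators having no additional randomness in the estimated supports, or (2) conditions (I)-(V) of the context, with supports that may contain additional randomness. Let $G:\mathbb R^{\overline{\mathcal T}}\to\mathbb R$ be a fixed, twice uniformly continuously differentiable function with gradient $\nabla_G$ such that $\liminf_{n\to\infty}\|\nabla_G(\boldsymbol\mu)\|_2$ is bounded away from zero. Then for $c_\alpha=\Phi^{-1}(1-\alpha/2)$, $\alpha\in(0,1)$, $$\sup_{P\in\mathbf P_n}\left|\mathbb P_P\left[G(\boldsymbol\mu)\in\left\{G(\hat{\boldsymbol\mu})\pm c_\alpha\sqrt{\nabla_G(\hat{\boldsymbol\mu})'\hat V_{\boldsymbol\mu}\nabla_G(\hat{\boldsymbol\mu})/n}\right\}\right]-(1-\alpha)\right|\to0 .$$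
   Context: **Setting.** For each $n$, $P_n$ is the joint law of $(Y,D,X')'$ and the latent potential outcomes; it may vary with $n$. $D\in\{0,\dots,\mathcal T\}$, $\mathcal T\ge1$ fixed, $\overline{\mathcal T}=\mathcal T+1$; $\{Y(t)\}$ are scalar potential outcomes, $Y=\sum_t\mathbf 1\{D=t\}Y(t)$. $p_t(x)=\mathbb P[D=t\mid X=x]$, $\mu_t(x)=\mathbb E[Y\mid D=t,X=x]$, $\mu_t=\mathbb E[Y(t)]$, $\boldsymbol\mu=(\mu_0,\dots,\mu_{\mathcal T})'$, $U=Y(t)-\mu_t(X)$ (for each $t$). $d_i^t=\mathbf 1\{d_i=t\}$, $\mathbb I_t=\{i:d_i=t\}$, $n_t=|\mathbb I_t|$, $u_i=y_i-\mu_{d_i}(x_i)$, $\mathbb E_n[w_i]=\frac1n\sum_iw_i$, $\mathbb E_{n,t}[w_i]=\frac1{n_t}\sum_{i\in\mathbb I_t}w_i$. $X_D^*,X_Y^*$ (generically $X^*$) are $p$-dimensional transformations of $X$ used for treatment and outcome models, not depending on $t$; $p$ may exceed $n$. $o_{P_n},O_{P_n}$ use measure $P_n$ for each $n$. $\Phi$ is the standard normal distribution function. **Estimators.** $\hat\mu_t=\frac1n\sum_{i=1}^n\{d_i^t(y_i-\hat\mu_t(x_i))/\hat p_t(x_i)+\hat\mu_t(x_i)\}$, $\hat{\boldsymbol\mu}=(\hat\mu_0,\dots,\hat\mu_{\mathcal T})'$. $\hat V_{\boldsymbol\mu}$ is the $\overline{\mathcal T}\times\overline{\mathcal T}$ matrix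 with entries $\hat V_{\boldsymbol\mu}[t,t']=\mathbf 1\{t=t'\}\hat V^W_{\boldsymbol\mu}(t)+\hat V^B_{\boldsymbol\mu}(t,t')$, where $\hat V^W_{\boldsymbol\mu}(t)=\mathbb E_n[d_i^t(y_i-\hat\mu_t(x_i))^2/\hat p_t(x_i)^2]$, $\hat V^B_{\boldsymbol\mu}(t,t')=\mathbb E_n[(\hat\mu_t(x_i)-\hat\mu_t)(\hat\mu_{t'}(x_i)-\hat\mu_{t'})]$. **(I) Identification.** For all $t$ and almost surely in $X$: $\mathbb E[Y(t)\mid D,X=x]=\mathbb E[Y(t)\mid X=x]$ and $\mathbb P[D=t\mid X=x]\ge p_{\min}>0$, $p_{\min}$ not depending on $n$. **(II) DGP**, bounds uniform in $n$: (a) $\{(y_i,d_i,x_i')'\}_{i=1}^n$ is i.i.d. from $(Y,D,X')'$. (b) $\max_{j\le p}|X_j^*|\le\mathcal X<\infty$; transformations may depend on $n$ but not on the DGP. (c) $\mathbb E[|U|^4\mid X]\le\mathcal U^4$. (d) $\min_{j\le p,\,t}\mathbb E[(X_j^* )^2U^2]\wedge\mathbb E[(X_j^* )^2(\mathbf 1\{D=t\}-p_t(X))^2]$ is bounded away from zero. (e) For some $r>0$, $\mathbb E[|\mu_t(x_i)\mu_{t'}(x_i)|^{1+r}]$ and $\mathbb E[|u_i|^{4+r}]$ are bounded. **(III) First stage**, uniformly in $t\in\{0,\dots,\mathcal T\}$: (a) $\mathbb E_n[(\hat p_t(x_i)-p_t(x_i))^2]=o_{P_n}(1)$ and $\mathbb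 E_n[(\hat\mu_t(x_i)-\mu_t(x_i))^2]=o_{P_n}(1)$; (b) $\mathbb E_n[(\hat\mu_t(x_i)-\mu_t(x_i))^2]^{1/2}\,\mathbb E_n[(\hat p_t(x_i)-p_t(x_i))^2]^{1/2}=o_{P_n}(n^{-1/2})$; (c) $\mathbb E_n[(\hat\mu_t(x_i)-\mu_t(x_i))(1-d_i^t/p_t(x_i))]=o_{P_n}(n^{-1/2})$. **(IV) Sparsity.** For each $n$: $\log(p_t(x)/p_0(x))=x_D^{*\prime}\gamma_t^*+B_t^D$ for $1\le t\le\mathcal T$ and $\mu_t(x)=x_Y^{*\prime}\beta_t^*+B_t^Y$ for $0\le t\le\mathcal T$, where $S_*^D=\bigcup_{t=1}^{\mathcal T}\mathrm{supp}(\gamma_t^* )$ has $|S_*^D|=s_d<n$, $S_*^Y=\bigcup_{t=0}^{\mathcal T}\mathrm{supp}(\beta_t^* )$ has $|S_*^Y|=s_y<n$, and, with $\hat p_t(\{m_t\})=e^{m_t}/(1+\sum_{r=1}^{\mathcal T}e^{m_r})$, $\mathbb E_n[(\hat p_t(\{x_i^{*\prime}\gamma_t^*\})-p_t(x_i))^2]^{1/2}\le b_s^d$ and $\mathbb E_n[B_t^Y(x_i)^2]^{1/2}\vee\mathbb E_{n,t}[B_t^Y(x_i)^2]^{1/2}\le b_s^y$, with $b_s^d,b_s^y\to0$. **(V) Union estimators.** $\log p=o(n^{1/3})$ and, uniformly in $t$, $(\max_{i\in\mathbb I_t}|u_i|)\,\mathbb E_n[(\hat p_t(x_i)-p_t(x_i))^2]=o_{P_n}(n^{-1/2})$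 and $\|\hat\gamma_t-\gamma_t^*\|_1\vee\|\hat\beta_t-\beta_t^*\|_1=o_{P_n}(\log(p\vee n)^{-1/2})$. **Additional randomness.** First-stage estimators arise from data-driven selection of covariate sets $\tilde S^D$ (for the propensity score, from the treatment data $\{(d_i,x_i)\}$) and $\tilde S^Y$ (for the outcome regressions), followed by refitting using final sets $\hat S^D\supseteq\tilde S^D$, $\hat S^Y\supseteq\tilde S^Y$. There is no additional randomness in the estimated supports if the added variables $\hat S^D\setminus\tilde S^D$, $\hat S^Y\setminus\tilde S^Y$ are nonrandomly selected; in particular $\hat p_t(\cdot)$ then depends on the sample only through $\{(x_i,d_i)\}$. Supports contain additional randomness if the added variables may be selected by a random process beyond that in $\tilde S$ (for instance adding $\tilde S^Y$ to $\hat S^D$ or vice versa). In that case $\hat p_t(x_i)=\hat p_t(\{x_i^{*\prime}\hat\gamma_t\})$ and $\hat\mu_t(x_i)=x_i^{*\prime}\hat\beta_t$, with $\hat\gamma_t,\hat\beta_t$ supported in $\hat S^D,\hat S^Y$.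
   Formalization: In case (1) it is also assumed that the maximum over i of 1/p̂_{d_i}(x_i) is O_{P_n}(1); in (II)(d) the first moment is taken over the units with D=t, i.e. E[1{D=t}(X_j^* )²U²] is bounded away from zero. Both literal versions admit counterexamples. *)

(* Defs.v *)
From HB Require Import structures.
From mathcomp Require Import all_boot all_order all_algebra.
From mathcomp Require Import all_classical all_reals all_analysis.

Set Implicit Arguments.
Unset Strict Implicit.
Unset Printing Implicit Defensive.

Import Order.TTheory GRing.Theory Num.Theory numFieldNormedType.Exports.

Local Open Scope classical_set_scope.
Local Open Scope ring_scope.

(* Discrete sigma-algebra on the set of treatment levels. *)
HB.instance Definition _ (n : nat) := isPointed.Build 'I_n.+1 ord0.
HB.instance Definition _ (n : nat) :=
  @isMeasurable.Build default_measure_display 'I_n.+1 discrete_measurable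
    discrete_measurable0 discrete_measurableC discrete_measurableU.

Section analysis.
Context {R : realType}.

Definition Phi (x : R) : R := fine (normal_prob 0 1 `]-oo, x]).

Definition dot p (v w : 'cV[R]_p) : R := \sum_j v j 0 * w j 0.
Definition norm1 p (v : 'cV[R]_p) : R := \sum_j `|v j 0|.
Definition norm2 p (v : 'cV[R]_p) : R := Num.sqrt (\sum_j v j 0 ^+ 2).
Definition supp p (v : 'cV[R]_p) : {set 'I_p} := [set j | v j 0 != 0]%SET.

Definition partial k (t : 'I_k.+1) (G : 'cV[R]_k.+1 -> R) (x : 'cV[R]_k.+1) : R :=
  'D_(delta_mx t 0) G x.

Definition grad k (G : 'cV[R]_k.+1 -> R) (x : 'cV[R]_k.+1) : 'cV[R]_k.+1 :=
  \col_t partial t G x.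

(* The second-order derivative exists everywhere and is uniformly continuous. *)
Definition twice_unif_cont_diff k (G : 'cV[R]_k.+1 -> R) :=
  [/\ forall x, differentiable G x,
      forall t x, differentiable (partial t G) x
    & forall s t, unif_continuous (partial s (partial t G))].

(* [g] is a version of x |-> E[W | V = x]. *)
Definition is_condE d d' (Z : measurableType d) (V : measurableType d')
    (P : probability Z R) (v : Z -> V) (W : Z -> R) (g : V -> R) :=
  [/\ P.-integrable setT (EFin \o W),
      measurable_fun setT g,
      P.-integrable setT (EFin \o (g \o v))
    & forall A : set V, measurable A ->
        (\int[P]_(z in v @^-1` A) (W z)%:E = \int[P]_(z in v @^-1` A) (g (v z))%:E)%E].

(* Multinomial logit: level 0 is the base category, with index 0, and
   [m r] is the index of level r + 1. *)
Definition logit T (m : 'I_T -> R) (t : 'I_T.+1) : R :=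
  (if unlift ord0 t is Some r then expR (m r) else 1) / (1 + \sum_(r < T) expR (m r)).

End analysis.

(* Latent vector ((Y(0), ..., Y(T)), D, X) and observed vector (Y, D, X). *)
Notation latent R T X := (T.+1.-tuple R * 'I_T.+1 * X)%type (only parsing).
Notation observed R T X := (R * 'I_T.+1 * X)%type (only parsing).

(* A data-generating process for sample size n: the joint law of the latent
   vector, and the law of the sample.  Their relation (the sample is i.i.d. from
   the observed vector) is the condition [iid_sample] below. *)
Record dgp (R : realType) (T : nat) d (X : measurableType d) (n : nat) := DGP {
  pop : probability (latent R T X) R ;
  smp : probability (n.-tuple (observed R T X)) R }.

Section model.
Context {R : realType} {T : nat} {d : measure_display} {X : measurableType d}.
Local Notation Z := (latent R T X).
Local Notation O := (observed R T X).

Definition lY (t : 'I_T.+1) (z : Z) : R := tnth z.1.1 t.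
Definition lD (z : Z) : 'I_T.+1 := z.1.2.
Definition lX (z : Z) : X := z.2.
Definition obsY (z : Z) : R := \sum_(t < T.+1) (lD z == t)%:R * lY t z.
Definition obs (z : Z) : O := (obsY z, lD z, lX z).

Definition oy (o : O) : R := o.1.1.
Definition od (o : O) : 'I_T.+1 := o.1.2.
Definition ox (o : O) : X := o.2.

Implicit Types (ps mu : 'I_T.+1 -> X -> R).

(* u = y - mu_d(x) *)
Definition resid mu (o : O) : R := oy o - mu (od o) (ox o).
(* U = Y(t) - mu_t(X) *)
Definition lU mu (t : 'I_T.+1) (z : Z) : R := lY t z - mu t (lX z).

Section sample.
Context {n : nat}.
Implicit Types (w : n.-tuple O).

Definition En w (f : O -> R) : R := n%:R^-1 * \sum_(i < n) f (tnth w i).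
Definition nt w (t : 'I_T.+1) : nat := #|[set i : 'I_n | od (tnth w i) == t]%SET|.
Definition Ent w (t : 'I_T.+1) (f : O -> R) : R :=
  (nt w t)%:R^-1 * \sum_(i < n | od (tnth w i) == t) f (tnth w i).

Definition treatment_data w : n.-tuple ('I_T.+1 * X)%type :=
  [tuple (od (tnth w i), ox (tnth w i)) | i < n].

Definition muhat_vec (ph mh : 'I_T.+1 -> X -> R) w : 'cV[R]_T.+1 :=
  \col_t En w (fun o => (od o == t)%:R * (oy o - mh t (ox o)) / ph t (ox o)
                         + mh t (ox o)).

Definition VhatW (ph mh : 'I_T.+1 -> X -> R) w (t : 'I_T.+1) : R :=
  En w (fun o => (od o == t)%:R * (oy o - mh t (ox o)) ^+ 2 / ph t (ox o) ^+ 2).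
Definition VhatB (ph mh : 'I_T.+1 -> X -> R) w (t t' : 'I_T.+1) : R :=
  En w (fun o => (mh t (ox o) - muhat_vec ph mh w t 0)
                 * (mh t' (ox o) - muhat_vec ph mh w t' 0)).
Definition Vhat (ph mh : 'I_T.+1 -> X -> R) w : 'M[R]_T.+1 :=
  \matrix_(t, t') ((t == t')%:R * VhatW ph mh w t + VhatB ph mh w t t').

Definition conf_interval (G : 'cV[R]_T.+1 -> R) (c : R)
    (ph mh : 'I_T.+1 -> X -> R) w : set R :=
  let m := muhat_vec ph mh w in
  let h := c * Num.sqrt (((grad G m)^T *m Vhat ph mh w *m grad G m) 0 0 / n%:R) in
  `[G m - h, G m + h].

End sample.

Definition mean_vec n (P : dgp R T X n) : 'cV[R]_T.+1 :=
  \col_t fine ('E_(pop P)[lY t])%E.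

(* [ps t] and [mu t] are versions of P[D = t | X = x] and E[Y | D = t, X = x]. *)
Definition is_nuisance n (P : dgp R T X n) ps mu :=
  (forall t, is_condE (pop P) lX (fun z => (lD z == t)%:R) (ps t)) /\
  is_condE (pop P) (fun z => (lD z, lX z)) obsY (fun dx => mu dx.1 dx.2).

Definition mean_independence n (P : dgp R T X n) :=
  forall t, exists (g : X -> R) (h : 'I_T.+1 * X -> R),
    [/\ is_condE (pop P) lX (lY t) g,
        is_condE (pop P) (fun z => (lD z, lX z)) (lY t) h
      & {ae pop P, forall z, h (lD z, lX z) = g (lX z)}].

Definition iid_sample n (P : dgp R T X n) :=
  forall A : 'I_n -> set O, (forall i, measurable (A i)) ->
    (smp P [set w | forall i, A i (tnth w i)] = \prod_(i < n) pop P (obs @^-1` A i))%E.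

End model.

Record first_stage (R : realType) (T p : nat) d (X : measurableType d) (n : nat) :=
  FirstStage {
  tildeSD : n.-tuple ('I_T.+1 * X)%type -> {set 'I_p} ;
  tildeSY : n.-tuple (observed R T X) -> {set 'I_p} ;
  hatSD : n.-tuple (observed R T X) -> {set 'I_p} ;
  hatSY : n.-tuple (observed R T X) -> {set 'I_p} ;
  phat : n.-tuple (observed R T X) -> 'I_T.+1 -> X -> R ;
  muhat : n.-tuple (observed R T X) -> 'I_T.+1 -> X -> R ;
  tildeSD_sub : forall w, tildeSD (treatment_data w) \subset hatSD w ;
  tildeSY_sub : forall w, tildeSY w \subset hatSY w ;
  phat_meas : forall t, measurable_fun setT
    (fun wx : n.-tuple (observed R T X) * X => phat wx.1 t wx.2) ;
  muhat_meas : forall t, measurable_fun setT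
    (fun wx : n.-tuple (observed R T X) * X => muhat wx.1 t wx.2) }.

Section conditions.
Context {R : realType} {T : nat} {p : nat -> nat}
  {d : nat -> measure_display} {X : forall n, measurableType (d n)}.
Local Notation sample n := (n.-tuple (observed R T (X n))).

Implicit Types (XD XY : forall n, X n -> 'cV[R]_(p n))
  (FS : forall n, first_stage R T (p n) (X n) n)
  (P : forall n, dgp R T (X n) n)
  (ps mu : forall n, 'I_T.+1 -> X n -> R).

(* Z_n = o_{P_n}(a_n) *)
Definition oP P (Z : forall n, sample n -> R) (a : nat -> R) :=
  forall eps : R, 0 < eps ->
    smp (P n) [set w | eps * a n < `|Z n w|] @[n --> \oo] --> 0%E.

(* The same, uniformly over the treatment levels. *)
Definition oP_unif P (Z : forall n, 'I_T.+1 -> sample n -> R) (a : nat -> R) :=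
  oP P (fun n w => \big[Num.max/0]_(t < T.+1) `|Z n t w|) a.

Definition rootn (n : nat) : R := (Num.sqrt n%:R)^-1.

Definition identification P ps :=
  (forall n, (0 < n)%N -> mean_independence (P n)) /\
  exists2 pmin : R, 0 < pmin &
    forall n, (0 < n)%N -> forall t,
      {ae pop (P n), forall z, pmin <= ps n t (lX z)}.

Definition bounded_regressors P (Xs : forall n, X n -> 'cV[R]_(p n)) :=
  exists B : R, forall n, (0 < n)%N ->
    {ae pop (P n), forall z, forall j, `|Xs n (lX z) j 0| <= B}.

Definition bounded_fourth_moment P mu :=
  exists B : R, forall n, (0 < n)%N -> forall t,
    exists2 g : X n -> R,
      is_condE (pop (P n)) lX (fun z => `|lU (mu n) t z| ^+ 4) g
      & {ae pop (P n), forall z, g (lX z) <= B ^+ 4}.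

(* The residual of level t is only observed, and only matters, on {D = t}; the
   second moment for level t is taken over that part of the population. *)
Definition moments_bounded_below P ps mu (Xs : forall n, X n -> 'cV[R]_(p n)) :=
  exists2 c : R, 0 < c & forall n, (0 < n)%N -> forall j t,
    (c%:E <= 'E_(pop (P n))[(fun z =>
       (lD z == t)%:R * (Xs n (lX z) j 0 ^+ 2 * lU (mu n) t z ^+ 2))%R])%E /\
    (c%:E <= 'E_(pop (P n))[(fun z =>
       Xs n (lX z) j 0 ^+ 2 * ((lD z == t)%:R - ps n t (lX z)) ^+ 2)%R])%E.

Definition bounded_moments P mu :=
  exists r B : R, [/\ 0 < r,
    forall n, (0 < n)%N -> forall t t',
      ('E_(pop (P n))[(fun z =>
         `|mu n t (lX z) * mu n t' (lX z)| `^ (1 + r))%R] <= B%:E)%E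
    & forall n, (0 < n)%N ->
      ('E_(pop (P n))[(fun z => `|resid (mu n) (obs z)| `^ (4 + r))%R] <= B%:E)%E].

Definition dgp_conditions XD XY P ps mu :=
  [/\ forall n, (0 < n)%N -> iid_sample (P n),
      bounded_regressors P XD /\ bounded_regressors P XY,
      bounded_fourth_moment P mu,
      moments_bounded_below P ps mu XD /\ moments_bounded_below P ps mu XY
    & bounded_moments P mu].

Definition mse_p FS ps n t (w : sample n) : R :=
  En w (fun o => (phat (FS n) w t (ox o) - ps n t (ox o)) ^+ 2).
Definition mse_mu FS mu n t (w : sample n) : R :=
  En w (fun o => (muhat (FS n) w t (ox o) - mu n t (ox o)) ^+ 2).

Definition first_stage_conditions FS P ps mu :=
  [/\ oP_unif P (mse_p FS ps) (fun=> 1),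
      oP_unif P (mse_mu FS mu) (fun=> 1),
      oP_unif P (fun n t w =>
        Num.sqrt (mse_mu FS mu t w) * Num.sqrt (mse_p FS ps t w)) rootn
    & oP_unif P (fun n t w =>
        En w (fun o => (muhat (FS n) w t (ox o) - mu n t (ox o))
                       * (1 - (od o == t)%:R / ps n t (ox o)))) rootn].

(* The added variables are nonrandom; as a consequence the fitted propensity score is a
   (measurable) function of the treatment data. *)
Definition no_additional_randomness FS := forall n, (0 < n)%N ->
  [/\ exists A : {set 'I_(p n)}, forall w,
        hatSD (FS n) w = tildeSD (FS n) (treatment_data w) :|: A,
      exists A : {set 'I_(p n)}, forall w,
        hatSY (FS n) w = tildeSY (FS n) w :|: A
    & exists2 ph : n.-tuple ('I_T.+1 * X n)%type -> 'I_T.+1 -> X n -> R,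
        forall t, measurable_fun setT
          (fun wx : n.-tuple ('I_T.+1 * X n)%type * X n => ph wx.1 t wx.2)
        & forall w, phat (FS n) w = ph (treatment_data w)].

(* max_i 1 / phat_{d_i}(x_i) = O_{P_n}(1): the fitted scores by which the estimator
   divides stay away from zero.  Mean-square consistency alone allows a vanishing
   fraction of them to be arbitrarily small. *)
Definition fitted_overlap FS P := forall eps : R, 0 < eps ->
  exists2 c : R, 0 < c & \forall n \near \oo,
    (smp (P n) [set w | exists i, phat (FS n) w (od (tnth w i)) (ox (tnth w i)) < c]%R
       <= eps%:E)%E.

(* [gs n r] is the coefficient vector of level r + 1; the base level has none.
   The bounds on the sample averages hold almost surely. *)
Definition sparsity XD XY P ps mu (gs : forall n, 'I_T -> 'cV[R]_(p n))
    (bs : forall n, 'I_T.+1 -> 'cV[R]_(p n)) :=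
  exists (BD : forall n, 'I_T -> X n -> R) (BY : forall n, 'I_T.+1 -> X n -> R)
         (bD bY : nat -> R),
  [/\ forall n, (0 < n)%N -> forall r x,
        ln (ps n (lift ord0 r) x / ps n ord0 x) = dot (XD n x) (gs n r) + BD n r x,
      forall n, (0 < n)%N -> forall t x,
        mu n t x = dot (XY n x) (bs n t) + BY n t x,
      forall n, (0 < n)%N ->
        (#|(\bigcup_r supp (gs n r))%SET| < n)%N /\
        (#|(\bigcup_t supp (bs n t))%SET| < n)%N,
      forall n, (0 < n)%N ->
        {ae smp (P n), forall w,
          (forall r : 'I_T, Num.sqrt (En w (fun o =>
             (logit (fun s => dot (XD n (ox o)) (gs n s)) (lift ord0 r)
              - ps n (lift ord0 r) (ox o)) ^+ 2)) <= bD n) /\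
          (forall t, Num.max (Num.sqrt (En w (fun o => BY n t (ox o) ^+ 2)))
             (Num.sqrt (Ent w t (fun o => BY n t (ox o) ^+ 2))) <= bY n)}
    & bD n @[n --> \oo] --> 0 /\ bY n @[n --> \oo] --> 0].

(* First-stage fits of the multinomial logit and linear forms, with coefficients
   supported in the selected sets. *)
Definition parametric_fit XD XY FS
    (gh : forall n, sample n -> 'I_T -> 'cV[R]_(p n))
    (bh : forall n, sample n -> 'I_T.+1 -> 'cV[R]_(p n)) :=
  forall n, (0 < n)%N ->
  [/\ forall r j, measurable_fun setT (fun w => gh n w r j 0),
      forall t j, measurable_fun setT (fun w => bh n w t j 0),
      forall w, (forall r, supp (gh n w r) \subset hatSD (FS n) w) /\
                (forall t, supp (bh n w t) \subset hatSY (FS n) w)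
    & forall w t i,
        phat (FS n) w t (ox (tnth w i))
          = logit (fun r => dot (XD n (ox (tnth w i))) (gh n w r)) t /\
        muhat (FS n) w t (ox (tnth w i)) = dot (XY n (ox (tnth w i))) (bh n w t)].

Definition union_conditions FS P ps mu
    (gs : forall n, 'I_T -> 'cV[R]_(p n)) (bs : forall n, 'I_T.+1 -> 'cV[R]_(p n))
    (gh : forall n, sample n -> 'I_T -> 'cV[R]_(p n))
    (bh : forall n, sample n -> 'I_T.+1 -> 'cV[R]_(p n)) :=
  [/\ ln (p n)%:R / (n%:R `^ 3^-1) @[n --> \oo] --> (0 : R),
      oP_unif P (fun n t w =>
        (\big[Num.max/0]_(i < n | od (tnth w i) == t) `|resid (mu n) (tnth w i)|)
        * mse_p FS ps t w) rootn
    & oP P (fun n w =>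
        Num.max (\big[Num.max/0]_(r < T) norm1 (gh n w r - gs n r))
                (\big[Num.max/0]_(t < T.+1) norm1 (bh n w t - bs n t)))
        (fun n => (ln (maxn (p n) n)%:R) `^ (- 2^-1))].

(* Supports without additional randomness. *)
Definition regime1 XD XY FS P := exists ps mu,
  [/\ forall n, (0 < n)%N -> is_nuisance (P n) (ps n) (mu n),
      identification P ps, dgp_conditions XD XY P ps mu,
      first_stage_conditions FS P ps mu
    & no_additional_randomness FS /\ fitted_overlap FS P].

(* Supports that may contain additional randomness. *)
Definition regime2 XD XY FS P := exists ps mu gs bs gh bh,
  [/\ forall n, (0 < n)%N -> is_nuisance (P n) (ps n) (mu n),
      identification P ps, dgp_conditions XD XY P ps mu,
      first_stage_conditions FS P ps mu
    & [/\ sparsity XD XY P ps mu gs bs, parametric_fit XD XY FS gh bh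
        & union_conditions FS P ps mu gs bs gh bh]].

End conditions.

(* Main.v *)
(* Write the error of the estimator as an average of influence functions plus three
   remainders: the product of the two first-stage errors, which is small by Cauchy-Schwarz;
   the average of (muhat_t - mu_t)(1 - d^t / p_t), which is small by assumption; and the
   average of d^t u (1 / phat_t - 1 / p_t).

   If the fitted scores depend on the treatment data only, the residuals u are centered
   given the weights, so the last remainder has mean square of the order of the error of
   phat.  If the supports are random, the inverse logit scores are sums of exponentials, so
   1 / phat_t minus its population analogue is a sum of terms w_s (exp(x'theta_s) - 1) with
   fixed weights w_s and random theta_s.  Expanding the exponential to order n factors theta
   out of the averages, of which there remain those of d^t u w_s x_J over the monomials x_J of
   degree k < n.  After truncation of u at n^(1/3), an exponential inequality bounds all of
   them simultaneously by k B^k (log(max(p, n)) / n)^(1/2), up to a constant; the union bound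
   over the p^k monomials is affordable because log p = o(n^(1/3)).

   Lindeberg's replacement argument and the delta method then give the limit law along each
   sequence of processes, and uniformity follows by applying this to a nearly worst sequence. *)

From HB Require Import structures.
Require Import Defs.
From mathcomp Require Import all_boot all_order all_algebra.
From mathcomp Require Import all_classical all_reals all_analysis.
From mathcomp Require Import measurable_realfun ring lra.

Set Implicit Arguments.
Unset Strict Implicit.
Unset Printing Implicit Defensive.

Import Order.TTheory GRing.Theory Num.Theory numFieldNormedType.Exports.

Local Open Scope classical_set_scope.
Local Open Scope ring_scope.

(** * Expectations *)

(** The cutoff tau = n^(1/3) of the random-support case meets three demands at once. Truncating the
    weighted residual f biases its centred averages by at most E f^4 / tau^3, which is of order 1/n.
    It alters no observation of a typical sample, the largest f^4 being at most of order n while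
    tau^4 = n tau. And the exponential inequality wants sqrt(log(max(p, n)) / n) tau <= 1/2, which
    is where log p = o(n^(1/3)) enters. The factor k in the bound for monomials of degree k is
    absorbed by the k! of the exponential series.

    The assumptions hold almost surely in the population, whereas the lemmas on samples want bounds
    at every point. Scores, regressors and weights are therefore clipped to their almost sure
    ranges; the clipped versions agree with the originals on the points of almost every sample.

    No sample of normal variables is built: in the replacement argument a normal summand is the
    operator f -> E f(. + s Z), acting on a class of test functions that it preserves together with
    the constant. Normal moments are read off the moment generating function. *)

Lemma norm_mul_le_sqr (R : realType) (a b : R) : `|a * b| <= a ^+ 2 + b ^+ 2.
Proof.
have := sqr_ge0 (a + b); have := sqr_ge0 (a - b); have := sqr_ge0 a; have := sqr_ge0 b.
by rewrite ler_norml !expr2 => *; apply/andP; split; nra.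
Qed.

Section measurability.
Context {R : realType} {d : measure_display} {T : measurableType d}.

Lemma measurable_fun_bigop (op : R -> R -> R) (idx : R) I (s : seq I) (p : pred I)
    (F : I -> T -> R) :
  (forall f g : T -> R, measurable_fun setT f -> measurable_fun setT g ->
     measurable_fun setT (fun x => op (f x) (g x))) ->
  (forall i, p i -> measurable_fun setT (F i)) ->
  measurable_fun setT (fun x => \big[op/idx]_(i <- s | p i) F i x).
Proof.
move=> hop mF; elim: s => [|i s ih].
  rewrite (_ : (fun x => _) = cst idx)//.
  by apply/funext => x; rewrite big_nil.
have [pi|pi] := boolP (p i).
  rewrite (_ : (fun x => _) = (fun x => op (F i x) (\big[op/idx]_(j <- s | p j) F j x))).
    by apply: hop => //; exact: mF.
  by apply/funext => x; rewrite big_cons pi.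
rewrite (_ : (fun x => _) = (fun x => \big[op/idx]_(j <- s | p j) F j x))//.
by apply/funext => x; rewrite big_cons (negbTE pi).
Qed.

Lemma measurable_fun_sum I (s : seq I) (p : pred I) (F : I -> T -> R) :
  (forall i, p i -> measurable_fun setT (F i)) ->
  measurable_fun setT (fun x => \sum_(i <- s | p i) F i x).
Proof. by apply: measurable_fun_bigop => f g; exact: measurable_funD. Qed.

Lemma measurable_fun_prodr I (s : seq I) (p : pred I) (F : I -> T -> R) :
  (forall i, p i -> measurable_fun setT (F i)) ->
  measurable_fun setT (fun x => \prod_(i <- s | p i) F i x).
Proof. by apply: measurable_fun_bigop => f g; exact: measurable_funM. Qed.

Lemma measurable_fun_bigmax I (s : seq I) (p : pred I) (F : I -> T -> R) :
  (forall i, p i -> measurable_fun setT (F i)) ->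
  measurable_fun setT (fun x => \big[Num.max/0]_(i <- s | p i) F i x).
Proof. by apply: measurable_fun_bigop => f g; exact: measurable_maxr. Qed.

Lemma measurable_setlt (f g : T -> R) : measurable_fun setT f -> measurable_fun setT g ->
  measurable [set x | f x < g x].
Proof.
move=> mf mg; have mt : measurable [set true] by [].
have := measurable_fun_ltr mf mg measurableT mt; by rewrite setTI.
Qed.

Lemma measurable_setle (f g : T -> R) : measurable_fun setT f -> measurable_fun setT g ->
  measurable [set x | f x <= g x].
Proof.
move=> mf mg; have mt : measurable [set true] by [].
have := measurable_fun_ler mf mg measurableT mt; by rewrite setTI.
Qed.

End measurability.

Section expectation.
Context {R : realType} {d : measure_display} {T : measurableType d}.
Variable P : probability T R.
Implicit Types f g h : T -> R.

(** [Ex] goes through [fine], so an infinite integral becomes 0 and a bound on [Ex] alone says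
    little. Results below therefore often carry integrability and the value in one conjunction. *)
Definition L1 f := P.-integrable setT (EFin \o f).
Definition Ex f : R := \int[P]_x f x.

Lemma L1_meas f : L1 f -> measurable_fun setT f.
Proof. by move=> /measurable_int/measurable_EFinP. Qed.

Lemma L1_le f g : measurable_fun setT f -> (forall x, `|f x| <= g x) ->
  L1 g -> L1 f.
Proof.
move=> mf fg; apply: le_integrable => //; first exact/measurable_EFinP.
by move=> x _ /=; rewrite lee_fin (le_trans (fg x))// ler_norm.
Qed.

Lemma L1_bd f (K : R) : measurable_fun setT f -> (forall x, `|f x| <= K) -> L1 f.
Proof.
move=> mf fK; apply: (@L1_le _ (cst K)) => //.
exact: (@finite_measure_integrable_cst _ _ _ P setT K).
Qed.

Lemma L1_cst (k : R) : L1 (fun=> k).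
Proof. by apply: (@L1_bd _ `|k|). Qed.

Lemma L1D f g : L1 f -> L1 g -> L1 (fun x => f x + g x).
Proof. by move=> hf hg; exact: (integrableD _ hf hg). Qed.

Lemma L1Z (k : R) f : L1 f -> L1 (fun x => k * f x).
Proof. by move=> hf; exact: (integrableZl _ k hf). Qed.

Lemma L1N f : L1 f -> L1 (fun x => - f x).
Proof. by move=> hf; apply: eq_integrable (L1Z (-1) hf) => //= x _; rewrite mulN1r. Qed.

Lemma L1B f g : L1 f -> L1 g -> L1 (fun x => f x - g x).
Proof. by move=> hf hg; apply: L1D => //; exact: L1N. Qed.

Lemma L1_norm f : L1 f -> L1 (fun x => `|f x|).
Proof. by move=> hf; exact: (integrable_norm hf). Qed.

Lemma L1_sum I (s : seq I) (F : I -> T -> R) (p : pred I) : (forall i, p i -> L1 (F i)) ->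
  L1 (fun x => \sum_(i <- s | p i) F i x).
Proof.
move=> hF; have := @integrable_sum _ _ _ P setT measurableT _ s p (fun i => EFin \o F i) hF.
by apply: eq_integrable => // x _ /=; rewrite sumEFin.
Qed.

Lemma L1_mul_bd f h (K : R) : measurable_fun setT h -> (forall x, `|h x| <= K) ->
  L1 f -> L1 (fun x => h x * f x).
Proof.
move=> mh hK hf; apply: (@L1_le _ (fun x => K * `|f x|)).
- by apply: measurable_funM => //; exact: L1_meas.
- by move=> x; rewrite normrM ler_wpM2r.
- by apply: L1Z; exact: L1_norm.
Qed.

Lemma Ex_fin f : L1 f -> (\int[P]_x (f x)%:E)%E = (Ex f)%:E.
Proof. by move=> hf; rewrite fineK//; exact: integrable_fin_num. Qed.

Lemma ExD f g : L1 f -> L1 g -> Ex (fun x => f x + g x) = Ex f + Ex g.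
Proof. exact: RintegralD. Qed.

Lemma ExB f g : L1 f -> L1 g -> Ex (fun x => f x - g x) = Ex f - Ex g.
Proof. exact: RintegralB. Qed.

Lemma ExZ (k : R) f : L1 f -> Ex (fun x => k * f x) = k * Ex f.
Proof. by move=> hf; exact: RintegralZl. Qed.

Lemma ExN f : L1 f -> Ex (fun x => - f x) = - Ex f.
Proof.
move=> hf; rewrite -mulN1r -ExZ//; congr Ex.
by apply/funext => x; rewrite mulN1r.
Qed.

Lemma Ex_cst (k : R) : Ex (fun=> k) = k.
Proof. by rewrite /Ex Rintegral_cst//= probability_setT mulr1. Qed.

Lemma Ex_sum I (s : seq I) (F : I -> T -> R) (p : pred I) : (forall i, p i -> L1 (F i)) ->
  Ex (fun x => \sum_(i <- s | p i) F i x) = \sum_(i <- s | p i) Ex (F i).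
Proof.
move=> hF; elim: s => [|i s ih].
  under [X in Ex X]eq_fun do rewrite big_nil.
  by rewrite big_nil Ex_cst.
under [X in Ex X]eq_fun do rewrite big_cons.
rewrite big_cons; case: ifPn => // pi.
by rewrite ExD ?ih//; [exact: hF|exact: L1_sum].
Qed.

Lemma Ex_le f g : L1 f -> L1 g -> (forall x, f x <= g x) -> Ex f <= Ex g.
Proof. by move=> hf hg fg; exact: le_Rintegral. Qed.

Lemma Ex_ge0 f : (forall x, 0 <= f x) -> 0 <= Ex f.
Proof. by move=> hf; exact: Rintegral_ge0. Qed.

Lemma Ex_norm f : L1 f -> `|Ex f| <= Ex (fun x => `|f x|).
Proof. by move=> hf; exact: le_normr_Rintegral. Qed.

Lemma Ex_norm_le f (K : R) : L1 f -> (forall x, `|f x| <= K) -> `|Ex f| <= K.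
Proof.
move=> hf hK; rewrite (le_trans (Ex_norm hf))// -[leRHS]Ex_cst.
by apply: Ex_le => //; [exact: L1_norm|exact: L1_cst].
Qed.

Lemma L1_ge0 f (C : R) : measurable_fun setT f -> (forall x, 0 <= f x) ->
  (\int[P]_x (f x)%:E <= C%:E)%E -> L1 f /\ Ex f <= C.
Proof.
move=> mf f0 fC.
have L1f : L1 f.
  apply/integrableP; split; first exact/measurable_EFinP.
  under eq_integral do rewrite /= ger0_norm//.
  by rewrite (le_lt_trans fC)// ltry.
by split=> //; rewrite -lee_fin -Ex_fin.
Qed.

Lemma Ex_ae f g : L1 f -> measurable_fun setT g -> {ae P, forall x, f x = g x} ->
  L1 g /\ Ex f = Ex g.
Proof.
move=> hf mg fg.
have hg : L1 g.
  apply/integrableP; split; first exact/measurable_EFinP.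
  have -> : (\int[P]_x `|(EFin \o g) x| = \int[P]_x `|(EFin \o f) x|)%E.
    apply: ae_eq_integral => //.
    - by do 2 apply: measurableT_comp => //.
    - by do 2 apply: measurableT_comp => //; exact: L1_meas.
    - by apply: filterS fg => x /= -> _.
  by move/integrableP : hf => [].
split=> //; rewrite /Ex; congr fine; apply: ae_eq_integral => //.
- by apply/measurable_EFinP; exact: L1_meas.
- exact/measurable_EFinP.
- by apply: filterS fg => x /= -> _.
Qed.

(** The pointwise maximum of [f] and [g] equals [g] almost surely and dominates [f] at every
    point. *)
Lemma Ex_le_ae f g : L1 f -> L1 g -> {ae P, forall x, f x <= g x} -> Ex f <= Ex g.
Proof.
move=> hf hg fg.
have mM : measurable_fun setT (fun x => Num.max (f x) (g x)).
  by apply: measurable_maxr; exact: L1_meas.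
have [hM ->] : L1 (fun x => Num.max (f x) (g x)) /\ Ex g = Ex (fun x => Num.max (f x) (g x)).
  by apply: Ex_ae => //; apply: filterS fg => x /max_idPr ->.
by apply: Ex_le => // x; rewrite le_max lexx.
Qed.

Lemma Ex_eq0_ae f : L1 f -> (forall x, 0 <= f x) -> Ex f = 0 -> {ae P, forall x, f x = 0}.
Proof.
move=> hf f0 E0.
have mf : measurable_fun setT (EFin \o f) by apply/measurable_EFinP; exact: L1_meas.
have /(ae_eq_integral_abs _ measurableT mf) : (\int[P]_x `|(EFin \o f) x| = 0)%E.
  rewrite (eq_integral (EFin \o f)); first by rewrite Ex_fin// E0.
  by move=> x _ /=; rewrite ger0_norm.
by apply: filterS => x /= /(_ I) [].
Qed.

Lemma markov_Ex f (C eps : R) : L1 f -> (forall x, 0 <= f x) -> Ex f <= C -> 0 < eps ->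
  (P [set x | (eps < f x)%R] <= (C / eps)%:E)%E.
Proof.
move=> hf f0 fC e0.
have mA : measurable [set x | eps < f x].
  by apply: (@measurable_setlt _ _ _ (cst eps)) => //; exact: L1_meas hf.
have hI : L1 (\1_[set x | eps < f x]) by exact: integrable_indic.
have PE : P [set x | eps < f x] = (Ex (\1_[set x | eps < f x]))%:E.
  by rewrite -Ex_fin// integral_indic// setIT.
rewrite PE lee_fin ler_pdivlMr// mulrC -ExZ//.
apply: le_trans fC; apply: Ex_le => //; first exact: L1Z.
move=> x; rewrite indicE; case: (boolP (x \in _)); rewrite ?mulr0// mulr1.
by rewrite inE /= => /ltW.
Qed.

End expectation.

(** * Independent samples *)

Section iid.
Context {R : realType} {d : measure_display} {O : measurableType d}.
Variables (Q : probability O R) (n : nat) (S : probability (n.-tuple O) R).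

Definition iid := forall A : 'I_n -> set O, (forall i, measurable (A i)) ->
  S [set w | forall i, A i (tnth w i)] = (\prod_(i < n) Q (A i))%E.

(** Averaging over the fresh coordinate [ow.1] plays the part of conditioning on all the other
    observations. *)
Definition upd (i : 'I_n) (ow : O * n.-tuple O) : n.-tuple O :=
  [tuple if j == i then ow.1 else tnth ow.2 j | j < n].

Lemma tnth_upd i ow j : tnth (upd i ow) j = if j == i then ow.1 else tnth ow.2 j.
Proof. by rewrite tnth_mktuple. Qed.

Lemma tnth_upd_eq i ow : tnth (upd i ow) i = ow.1.
Proof. by rewrite tnth_upd eqxx. Qed.

Lemma tnth_upd_neq i ow j : j != i -> tnth (upd i ow) j = tnth ow.2 j.
Proof. by rewrite tnth_upd => /negbTE ->. Qed.

Lemma measurable_upd i : measurable_fun setT (upd i).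
Proof.
apply/measurable_fun_tnthP => j.
have [->|ji] := eqVneq j i.
  by rewrite (_ : _ \o _ = fst)//; apply/funext => ow /=; rewrite tnth_upd_eq.
rewrite (_ : _ \o _ = (@tnth n O ^~ j) \o snd).
  by apply: measurableT_comp => //; exact: measurable_tnth.
by apply/funext => ow /=; rewrite tnth_upd_neq.
Qed.

HB.instance Definition _ i :=
  isMeasurableFun.Build _ _ _ _ (upd i) (measurable_upd i).

Lemma measurable_updl i w : measurable_fun setT (fun o => upd i (o, w)).
Proof. by apply: measurableT_comp; [exact: measurable_upd|exact: measurable_pair2]. Qed.

Lemma measurable_cylinder (A : 'I_n -> set O) : (forall i, measurable (A i)) ->
  measurable [set w : n.-tuple O | forall i, A i (tnth w i)].
Proof.
move=> mA.
rewrite [X in measurable X](_ : _ = \big[setI/setT]_(i < n) ((@tnth n O ^~ i) @^-1` A i)).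
  apply: bigsetI_measurable => i _; rewrite -[X in measurable X]setTI.
  exact: measurable_tnth.
rewrite -bigcap_seq/=; apply/seteqP; split => w /=.
  by move=> h i _; exact: h.
by move=> h i; apply: (h i); rewrite /= mem_index_enum.
Qed.

Hypothesis S_iid : iid.

(* Encodes the independence of one observation from the others: a fresh copy of it leaves the
   law of the sample unchanged. *)
Lemma resample_set i A : measurable A -> S A = (Q \x S)%E (upd i @^-1` A).
Proof.
pose G := [set [set w : n.-tuple O | forall i, A i (tnth w i)] |
   A in [set A : 'I_n -> set O | forall i, measurable (A i)]].
move=> mA.
apply: (@measure_unique _ R (n.-tuple O) G (fun=> setT) _ _ _ _ S
  (pushforward (Q \x S)%E (upd i)) _ _ _ mA).
- apply/seteqP; split.
    apply: smallest_sub; first exact: smallest_sigma_algebra.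
    move=> B; rewrite -bigcup_seq => -[k _ [C mC <-]].
    apply: sub_sigma_algebra; exists (fun j => if j == k then C else setT).
      by move=> j /=; case: ifP.
    rewrite setTI; apply/seteqP; split => w /=.
      by move=> /(_ k); rewrite eqxx.
    by move=> Cw j; case: eqP => // ->.
  apply: smallest_sub; first exact: sigma_algebra_measurable.
  by move=> B [A' mA' <-]; exact: measurable_cylinder.
- move=> _ _ [A1 mA1 <-] [A2 mA2 <-]; exists (fun j => A1 j `&` A2 j).
    by move=> j; apply: measurableI.
  apply/seteqP; split => w /=; first by move=> h; split => j; case: (h j).
  by move=> [h1 h2] j; split.
- move=> _; exists (fun=> setT) => //.
  by apply/seteqP; split.
- by rewrite bigcup_const//.
- move=> _ [A' mA' <-].
  transitivity (\prod_(i < n) Q (A' i))%E; first exact: S_iid.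
  (* Without the constraint on coordinate i the preimage under [upd i] is a rectangle, whose product
     measure restores the missing factor. *)
  pose A'' j := if j == i then setT else A' j.
  have mA'' j : measurable (A'' j) by rewrite /A''; case: ifP.
  have mcyl : measurable [set w : n.-tuple O | forall j, A'' j (tnth w j)].
    exact: measurable_cylinder.
  transitivity ((Q \x S)%E (upd i @^-1` [set w | forall j, A' j (tnth w j)])); last by [].
  have -> : upd i @^-1` [set w | forall j, A' j (tnth w j)] =
      A' i `*` [set w | forall j, A'' j (tnth w j)].
    apply/seteqP; split => -[z w] /=.
      move=> h; split; first by have := h i; rewrite tnth_upd_eq.
      by move=> j; rewrite /A''; case: eqVneq => // ji; have := h j; rewrite tnth_upd_neq.
    move=> [ho h] j; rewrite tnth_upd; case: eqVneq => [->//|ji].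
    by have := h j; rewrite /A'' (negbTE ji).
  transitivity (Q (A' i) * S [set w | forall j, A'' j (tnth w j)])%E; last first.
    by apply/esym; exact: product_measure1E.
  rewrite S_iid// (bigD1 i)//= [in RHS](bigD1 i)//=.
  have -> : Q (A'' i) = 1%E by rewrite /A'' eqxx; exact: probability_setT.
  rewrite mul1e; congr (_ * _)%E.
  by apply: eq_bigr => j /negbTE ji; rewrite /A'' ji.
- by move=> _; exact: (le_lt_trans (probability_le1 S measurableT) (ltry 1)).
Qed.

Lemma resample_ge0 i (F : n.-tuple O -> \bar R) : measurable_fun setT F ->
  (forall w, 0 <= F w)%E ->
  (\int[S]_w F w = \int[S]_w \int[Q]_o F (upd i (o, w)))%E.
Proof.
move=> mF F0.
transitivity (\int[pushforward (Q \x S)%E (upd i)]_w F w)%E.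
  by apply: eq_measure_integral => A mA _; exact: resample_set.
rewrite ge0_integral_pushforward//.
rewrite fubini_tonelli2//=.
by apply: measurableT_comp => //; exact: measurable_upd.
Qed.

(** [H] is a conditional expectation of [F] given the coordinates other than i. The inner integral
    is finite at every [w], so Fubini's theorem leaves no exceptional set. *)
Lemma Ex_resample i (F H : n.-tuple O -> R) : L1 S F ->
  (forall w, \int[Q]_o (F (upd i (o, w)))%:E = (H w)%:E)%E ->
  L1 S H /\ Ex S F = Ex S H.
Proof.
move=> hF FH.
have mF := L1_meas hF.
have hF2 : (Q \x S)%E.-integrable setT (EFin \o (F \o upd i)).
  apply/integrableP; split.
    by apply/measurable_EFinP; apply: measurableT_comp => //; exact: measurable_upd.
  have /integrableP[_] := hF.
  rewrite (@eq_measure_integral _ _ R setT (pushforward (Q \x S)%E (upd i))); last first.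
    by move=> A mA _; exact: resample_set.
  rewrite ge0_integral_pushforward//.
  by apply: measurableT_comp => //; apply/measurable_EFinP.
have HE : EFin \o H = fubini_G Q (EFin \o (F \o upd i)).
  by apply/funext => w; rewrite /fubini_G /= FH.
have hH : L1 S H.
  have mG : measurable_fun setT (fubini_G Q (EFin \o (F \o upd i))).
    exact: (measurable_fubini_G hF2).
  have mF2 : measurable_fun setT (EFin \o (F \o upd i)) by exact: measurable_int hF2.
  rewrite /L1 HE; apply/integrableP; split => //.
  have /(integrable21ltyP Q S mF2) := hF2; apply: le_lt_trans; apply: ge0_le_integral => //.
  - exact: measurableT_comp.
  - have := @measurable_fun_fubini_tonelli_G _ _ _ _ R Q (fun z => `|(F (upd i z))%:E|)%E.
    by apply => //; exact: measurableT_comp mF2.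
  - move=> w _; apply: le_abse_integral => //.
    by apply: (measurableT_comp mF2); exact: measurable_pair2.
split=> //; apply: EFin_inj; rewrite -!Ex_fin//.
rewrite (@eq_measure_integral _ _ R setT (pushforward (Q \x S)%E (upd i))); last first.
  by move=> A mA _; exact: resample_set.
rewrite integral_pushforward//; last first.
  by apply/measurable_EFinP.
rewrite -integral21_prod_meas1//.
by apply: eq_integral => w _; rewrite /fubini_G /= FH.
Qed.

Lemma integral_tnth i (f : O -> \bar R) : measurable_fun setT f -> (forall o, 0 <= f o)%E ->
  (\int[S]_w f (tnth w i) = \int[Q]_o f o)%E.
Proof.
move=> mf f0; rewrite (@resample_ge0 i (fun w => f (tnth w i)))//; last first.
  by apply: measurableT_comp => //; exact: measurable_tnth.
transitivity (\int[S]_w (cst (\int[Q]_o f o) w))%E.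
  apply: eq_integral => w _; apply: eq_integral => o _; congr f.
  exact: tnth_upd_eq.
by rewrite integral_cst//= probability_setT mule1.
Qed.

Lemma L1_tnth i f : L1 Q f -> L1 S (fun w => f (tnth w i)).
Proof.
move=> hf; apply/integrableP; split.
  apply/measurable_EFinP; apply: measurableT_comp; last exact: measurable_tnth.
  exact: L1_meas hf.
rewrite (@integral_tnth i (fun o => `|(f o)%:E|)%E)//; first by move/integrableP : hf => [].
by apply: measurableT_comp => //; apply/measurable_EFinP; exact: L1_meas hf.
Qed.

Lemma Ex_tnth i f : L1 Q f -> Ex S (fun w => f (tnth w i)) = Ex Q f.
Proof.
move=> hf; have [|_ ->] := @Ex_resample i (fun w => f (tnth w i)) (fun=> Ex Q f) (L1_tnth i hf).
  by move=> w; rewrite -Ex_fin//; apply: eq_integral => o _; rewrite tnth_upd_eq.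
by rewrite Ex_cst.
Qed.

Lemma prob_tnth i A : measurable A -> S [set w | A (tnth w i)] = Q A.
Proof.
move=> mA; have mA' : measurable [set w : n.-tuple O | A (tnth w i)].
  by rewrite -[X in measurable X]setTI; exact: measurable_tnth.
have <- : (\int[S]_w (\1_[set w | A (tnth w i)] w)%:E = S [set w | A (tnth w i)])%E.
  by rewrite integral_indic// setIT.
have <- : (\int[Q]_z (\1_A z)%:E = Q A)%E by rewrite integral_indic// setIT.
rewrite -(@integral_tnth i)//; last exact/measurable_EFinP.
Qed.

(** Induction on the number of factors: resampling coordinate k leaves the first k factors alone and
    integrates the last one out. *)
Lemma integral_prod_iid (f : O -> R) (c : R) : measurable_fun setT f -> (forall o, 0 <= f o) ->
  (\int[Q]_o (f o)%:E = c%:E ->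
   \int[S]_w (\prod_(i < n) f (tnth w i))%:E = (c ^+ n)%:E)%E.
Proof.
move=> mf f0 fc.
have mprod k : measurable_fun setT (fun w : n.-tuple O => \prod_(i < n | (i < k)%N) f (tnth w i)).
  apply: measurable_fun_prodr => i _; apply: measurableT_comp => //; exact: measurable_tnth.
suff H k : (k <= n)%N -> (\int[S]_w (\prod_(i < n | (i < k)%N) f (tnth w i))%:E = (c ^+ k)%:E)%E.
  rewrite -(H n)//; apply: eq_integral => w _.
  by under [in RHS]eq_bigl do rewrite ltn_ord.
elim: k => [_|k ih kn].
  transitivity (\int[S]_w (cst 1%E w))%E.
    by apply: eq_integral => w _; rewrite big_pred0.
  by rewrite integral_cst//= probability_setT mule1.
pose i0 := Ordinal kn.
rewrite (@resample_ge0 i0); last 2 first.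
- exact/measurable_EFinP.
- by move=> w; rewrite lee_fin prodr_ge0.
have E w o : \prod_(i < n | (i < k.+1)%N) f (tnth (upd i0 (o, w)) i) =
    (\prod_(i < n | (i < k)%N) f (tnth w i)) * f o.
  rewrite (bigD1 i0)/=; last by rewrite ltnS.
  rewrite tnth_upd_eq mulrC; congr (_ * _); apply: eq_big => [i|i /andP[_ ii0]].
    by rewrite ltnS [RHS]ltn_neqAle andbC.
  by rewrite tnth_upd_neq.
transitivity (\int[S]_w ((\prod_(i < n | (i < k)%N) f (tnth w i))%:E * c%:E))%E.
  apply: eq_integral => w _.
  under eq_integral do rewrite E EFinM.
  rewrite ge0_integralZl//.
  - by rewrite fc.
  - exact/measurable_EFinP.
  - by move=> x _; rewrite lee_fin.
  - by rewrite lee_fin prodr_ge0.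
rewrite ge0_integralZr//.
- by rewrite ih ?(ltnW kn)// exprSr EFinM.
- exact/measurable_EFinP.
- by move=> x _; rewrite lee_fin prodr_ge0.
- by rewrite -fc integral_ge0// => x _; rewrite lee_fin.
Qed.

(** Off the diagonal, resampling coordinate i freezes [u (tnth w j)] and leaves the integral that is
    assumed to vanish. Only the n diagonal terms survive, although each weight may depend on the
    whole sample. *)
Lemma weighted_second_moment (u : O -> R) (b : 'I_n -> n.-tuple O -> R) (C K : R) :
  L1 Q u -> L1 Q (fun o => u o ^+ 2) ->
  (forall i, measurable_fun setT (b i)) -> (forall i w, `|b i w| <= K) ->
  (forall i j w, i != j ->
     Ex Q (fun o => b i (upd i (o, w)) * b j (upd i (o, w)) * u o) = 0) ->
  (forall i w, Ex Q (fun o => b i (upd i (o, w)) ^+ 2 * u o ^+ 2)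
     <= C * Ex Q (fun o => b i (upd i (o, w)) ^+ 2)) ->
  L1 S (fun w => (\sum_(i < n) b i w * u (tnth w i)) ^+ 2) /\
  Ex S (fun w => (\sum_(i < n) b i w * u (tnth w i)) ^+ 2)
    <= C * Ex S (fun w => \sum_(i < n) b i w ^+ 2).
Proof.
move=> hu hu2 mb bK H0 H1.
have K0 (i : 'I_n) : 0 <= K.
  have w : n.-tuple O := point.
  by rewrite (le_trans (normr_ge0 _) (bK i w)).
have mut i : measurable_fun setT (fun w : n.-tuple O => u (tnth w i)).
  by apply: measurableT_comp; [exact: L1_meas hu|exact: measurable_tnth].
have mbb i j : measurable_fun setT (fun w => b i w * b j w).
  exact: measurable_funM.
have bbK i j w : `|b i w * b j w| <= K ^+ 2.
  by rewrite normrM expr2 ler_pM.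
have b2K i w : `|b i w ^+ 2| <= K ^+ 2 by rewrite expr2.
pose F i j w := b i w * b j w * (u (tnth w i) * u (tnth w j)).
have hF i j : L1 S (F i j).
  apply: (L1_mul_bd (mbb i j) (bbK i j)).
  apply: (@L1_le _ _ _ _ _ (fun w => u (tnth w i) ^+ 2 + u (tnth w j) ^+ 2)).
  - exact: measurable_funM.
  - by move=> w; exact: norm_mul_le_sqr.
  - by apply: L1D; exact: (L1_tnth _ hu2).
have hF0 i j : i != j -> Ex S (F i j) = 0.
  move=> ij.
  have [|_ ->] := @Ex_resample i (F i j) (fun=> 0) (hF i j); last by rewrite Ex_cst.
  move=> w.
  have hh : L1 Q (fun o => b i (upd i (o, w)) * b j (upd i (o, w)) * u o).
    apply: (@L1_mul_bd _ _ _ _ _ _ (K ^+ 2)) => //.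
    by apply: (measurableT_comp (mbb i j)); exact: measurable_updl.
  rewrite -[in RHS](mulr0 (u (tnth w j))) -(H0 i j w ij) -ExZ// -Ex_fin.
    apply: eq_integral => o _; congr EFin.
    by rewrite /F tnth_upd_eq tnth_upd_neq 1?eq_sym//=; ring.
  exact: L1Z.
have hF1 i : Ex S (F i i) <= C * Ex S (fun w => b i w ^+ 2).
  have hb2 : L1 S (fun w => b i w ^+ 2).
    by apply: (L1_bd S _ (b2K i)); exact: measurable_funX.
  have mbu w : measurable_fun setT (fun o => b i (upd i (o, w))).
    by apply: (measurableT_comp (mb i)); exact: measurable_updl.
  have hh w : L1 Q (fun o => b i (upd i (o, w)) ^+ 2 * u o ^+ 2).
    apply: (@L1_mul_bd _ _ _ _ _ _ (K ^+ 2)) => //.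
    by apply: measurable_funX.
  have hh2 w : L1 Q (fun o => b i (upd i (o, w)) ^+ 2).
    by apply: (@L1_bd _ _ _ _ _ (K ^+ 2)) => //; exact: measurable_funX.
  have [|hA ->] := @Ex_resample i (F i i)
      (fun w => Ex Q (fun o => b i (upd i (o, w)) ^+ 2 * u o ^+ 2)) (hF i i).
    move=> w; rewrite -Ex_fin//; apply: eq_integral => o _.
    by rewrite /F tnth_upd_eq /= !expr2.
  have [|hB ->] := @Ex_resample i _
      (fun w => Ex Q (fun o => b i (upd i (o, w)) ^+ 2)) hb2.
    by move=> w; rewrite -Ex_fin.
  by rewrite -ExZ//; apply: Ex_le => //; exact: L1Z.
have sqE w : (\sum_(i < n) b i w * u (tnth w i)) ^+ 2 = \sum_(i < n) \sum_(j < n) F i j w.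
  rewrite expr2 mulr_suml; apply: eq_bigr => i _.
  by rewrite mulr_sumr; apply: eq_bigr => j _; rewrite /F; ring.
under eq_fun do rewrite sqE.
have hFs i : L1 S (fun w => \sum_(j < n) F i j w) by apply: L1_sum.
split; first exact: L1_sum.
rewrite Ex_sum//.
rewrite Ex_sum; last by move=> i _; apply: (L1_bd S _ (b2K i)); exact: measurable_funX.
rewrite mulr_sumr; apply: ler_sum => i _.
rewrite Ex_sum// (bigD1 i)//= big1 ?addr0//.
by move=> j ji; rewrite hF0// eq_sym.
Qed.

Lemma sum_second_moment (f : O -> R) : L1 Q f -> L1 Q (fun o => f o ^+ 2) -> Ex Q f = 0 ->
  L1 S (fun w => (\sum_(i < n) f (tnth w i)) ^+ 2) /\
  Ex S (fun w => (\sum_(i < n) f (tnth w i)) ^+ 2) <= n%:R * Ex Q (fun o => f o ^+ 2).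
Proof.
move=> hf hf2 f0.
have sumE : (fun w => (\sum_(i < n) f (tnth w i)) ^+ 2) =
    (fun w => (\sum_(i < n) 1 * f (tnth w i)) ^+ 2).
  by apply/funext => w; congr (_ ^+ 2); apply: eq_bigr => i _; rewrite mul1r.
have oneE : (fun w : n.-tuple O => \sum_(i < n) (1 : R) ^+ 2) = cst n%:R.
  by apply/funext => w; rewrite expr1n sumr_const card_ord.
have oneQ : (fun=> (1 : R) ^+ 2) = cst 1 :> (O -> R) by apply/funext => x; rewrite expr1n.
rewrite sumE -[n%:R](Ex_cst S) -[fun=> n%:R]oneE mulrC.
apply: (@weighted_second_moment f (fun _ _ => 1) _ 1) => //.
- by move=> i w; rewrite normr1.
- by move=> i j w _; rewrite -[RHS]f0; congr Ex; apply/funext => z; rewrite !mul1r.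
- move=> i w; rewrite oneQ Ex_cst mulr1 le_eqVlt; apply/orP; left; apply/eqP.
  by congr Ex; apply/funext => z; rewrite expr1n mul1r.
Qed.

End iid.

(** * Events of high probability, and stochastic order symbols *)

Section big.
Context {R : realType} {d : measure_display} {T : measurableType d}.
Variable P : probability T R.
Implicit Types (A B C : set T) (e : R).

(** [A] need not be measurable: its complement is only covered by a measurable set of small
    probability, so events that quantify over estimators combine freely. *)
Definition big e A := exists2 N, measurable N & (P N <= e%:E)%E /\ ~` N `<=` A.

Lemma bigS e e' A B : e <= e' -> A `<=` B -> big e A -> big e' B.
Proof.
move=> ee AB [N mN [PN NA]]; exists N => //; split; last exact: subset_trans NA AB.
by rewrite (le_trans PN)// lee_fin.
Qed.

Lemma bigI e e' A B : big e A -> big e' B -> big (e + e') (A `&` B).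
Proof.
move=> [N mN [PN NA]] [M mM [PM MB]]; exists (N `|` M); first exact: measurableU.
split; last first.
  by rewrite setCU => x [xN xM]; split; [exact: NA|exact: MB].
by rewrite EFinD; apply: (le_trans (measureU2 P mN mM)); exact: leeD.
Qed.

Lemma big_ae A : {ae P, forall x, A x} -> big 0 A.
Proof.
move=> [N [mN PN AN]]; exists N => //; split; first by rewrite PN.
by move=> x xN; apply: contrapT => /AN.
Qed.

Lemma big_setC e A : measurable A -> (P A <= e%:E)%E -> big e (~` A).
Proof. by move=> mA PA; exists A => //; split. Qed.

Lemma big_prob_le e A B C : measurable B -> measurable C -> big e A ->
  (forall x, A x -> B x -> C x) -> (P B <= P C + e%:E)%E.
Proof.
move=> mB mC [N mN [PN NA]] ABC.
apply: (@le_trans _ _ (P (C `|` N))).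
  apply: le_measure; rewrite ?inE//; first exact: measurableU.
  by move=> x Bx; have [Nx|Nx] := pselect (N x); [right|left; apply: ABC => //; exact: NA].
by rewrite (le_trans (measureU2 P mC mN))// leeD2l.
Qed.

Lemma big_gt0 e A : e < 1 -> big e A -> A !=set0.
Proof.
move=> e1 [N mN [PN NA]]; apply: contrapT => A0.
have NT : N = setT.
  by apply/seteqP; split => // x _; apply: contrapT => /NA Ax; apply: A0; exists x.
by move: PN; rewrite NT (probability_setT P) lee_fin leNgt e1.
Qed.

Lemma big_Ex_le (Z : T -> R) (C K : R) : L1 P Z -> (forall x, 0 <= Z x) -> Ex P Z <= C ->
  0 < K -> big (C / K) [set x | Z x <= K].
Proof.
move=> hZ Z0 ZC K0.
apply: (@bigS (C / K) _ (~` [set x | K < Z x])) => //.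
  by move=> x /= /negP; rewrite -leNgt.
apply: big_setC; last exact: markov_Ex.
by apply: measurable_setlt => //; exact: L1_meas hZ.
Qed.

End big.

Section whp.
Context {R : realType} {d : nat -> measure_display} {Om : forall n, measurableType (d n)}.
Variable S : forall n, probability (Om n) R.
Implicit Types (A B C : forall n, set (Om n)) (e : R) (Z : forall n, Om n -> R).

(** With these, [negl] is o_P(1) and [tight] is O_P(1) along the laws [S n]. A fixed [e] is kept in
    [oft] because some constants, such as the lower bound on fitted scores, depend on the
    exceptional probability. *)
Definition oft e A := \forall n \near \oo, big (S n) e (A n).
Definition whp A := forall e, 0 < e -> oft e A.
Definition negl Z := forall e, 0 < e -> whp (fun n => [set w | `|Z n w| <= e]).
Definition tight Z := forall e, 0 < e -> exists K, oft e (fun n => [set w | `|Z n w| <= K]).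

Lemma oft_near e A : 0 <= e -> (\forall n \near \oo, forall w, A n w) -> oft e A.
Proof.
move=> e0; apply: filterS => n h; exists set0 => //; split; last by move=> w _.
by rewrite measure0 lee_fin.
Qed.

Lemma whp_near A : (\forall n \near \oo, forall w, A n w) -> whp A.
Proof. by move=> h e e0; apply: oft_near => //; exact: ltW. Qed.

Lemma oftS e A C : oft e A -> (\forall n \near \oo, forall w, A n w -> C n w) -> oft e C.
Proof. by apply: filterS2 => n hA hAC; exact: (bigS (lexx e) hAC). Qed.

Lemma whpS A C : whp A -> (\forall n \near \oo, forall w, A n w -> C n w) -> whp C.
Proof. by move=> hA hAC e e0; exact: (oftS (hA e e0)). Qed.

Lemma oft2 e e' A B C : oft e A -> oft e' B -> (forall n w, A n w -> B n w -> C n w) ->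
  oft (e + e') C.
Proof.
move=> hA hB ABC; apply: filterS2 hA hB => n /bigI + hB => /(_ _ _ hB).
by apply: bigS => // w [? ?]; exact: ABC.
Qed.

Lemma oft2h e A B C : oft (e / 2) A -> oft (e / 2) B ->
  (forall n w, A n w -> B n w -> C n w) -> oft e C.
Proof. by move=> hA hB h; rewrite (_ : e = e / 2 + e / 2); [exact: oft2 h|lra]. Qed.

Lemma whp2 A B C : whp A -> whp B -> (forall n w, A n w -> B n w -> C n w) -> whp C.
Proof.
move=> hA hB ABC e e0; have e2 : 0 < e / 2 by rewrite divr_gt0.
exact: (oft2h (hA _ e2) (hB _ e2)).
Qed.

Lemma oft_whp e A B C : 0 < e -> oft (e / 2) A -> whp B ->
  (forall n w, A n w -> B n w -> C n w) -> oft e C.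
Proof. by move=> e0 hA hB; apply: (oft2h hA); apply: hB; rewrite divr_gt0. Qed.

Lemma whp_all k (A : 'I_k -> forall n, set (Om n)) : (forall i, whp (A i)) ->
  whp (fun n => [set w | forall i, A i n w]).
Proof.
move=> hA.
have H (s : seq 'I_k) : whp (fun n => [set w | forall i, i \in s -> A i n w]).
  elim: s => [|i s ih]; first by apply: whp_near; near=> n.
  apply: (whp2 (hA i) ih) => n w Ai As j; rewrite inE => /predU1P[->//|].
  exact: As.
by apply: (whpS (H (enum 'I_k))); near=> n; move=> w h i; apply: h; rewrite mem_enum.
Unshelve. all: by end_near. Qed.

Lemma whp_ae A : (\forall n \near \oo, {ae S n, forall w, A n w}) -> whp A.
Proof.
move=> h e e0; apply: filterS h => n /big_ae; apply: bigS => //; exact: ltW.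
Qed.

Lemma negl_tight Z : negl Z -> tight Z.
Proof. by move=> hZ e e0; exists 1; exact: hZ. Qed.

Lemma tight_dom Z Z' : tight Z ->
  (forall e, 0 < e -> exists K, oft e (fun n => [set w | `|Z' n w| <= K * `|Z n w|])) ->
  tight Z'.
Proof.
move=> hZ hd e e0; have e2 : 0 < e / 2 by rewrite divr_gt0.
have [K hK] := hd _ e2; have [L hL] := hZ _ e2.
exists (Num.max 0 K * L); apply: (oft2h hK hL) => n w /= h1 h2.
rewrite (le_trans h1)// (@le_trans _ _ (Num.max 0 K * `|Z n w|))//.
  by rewrite ler_wpM2r// le_max lexx orbT.
by rewrite ler_wpM2l// le_max lexx.
Qed.

(** The factor [K] may grow as [e] shrinks; this is how inverse fitted scores, bounded only in
    probability, are absorbed. *)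
Lemma negl_dom Z Z' : negl Z ->
  (forall e, 0 < e -> exists K, oft e (fun n => [set w | `|Z' n w| <= K * `|Z n w|])) ->
  negl Z'.
Proof.
move=> hZ hd c c0 e e0; have e2 : 0 < e / 2 by rewrite divr_gt0.
have [K hK] := hd _ e2.
have K1 : 0 < Num.max 1 K by rewrite lt_max ltr01.
have cK : 0 < c / Num.max 1 K by rewrite divr_gt0.
apply: (oft2h hK (hZ _ cK _ e2)) => n w /= h1 h2.
rewrite (le_trans h1)// (@le_trans _ _ (Num.max 1 K * `|Z n w|))//.
  by rewrite ler_wpM2r// le_max lexx orbT.
by rewrite mulrC -ler_pdivlMr.
Qed.

Lemma negl_le Z Z' : negl Z -> whp (fun n => [set w | `|Z' n w| <= `|Z n w|]) -> negl Z'.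
Proof.
move=> hZ h; apply: (negl_dom hZ) => e e0; exists 1.
by apply: (oftS (h _ e0)); near=> n; move=> w /=; rewrite mul1r.
Unshelve. all: by end_near. Qed.

Lemma negl_le0 Z Z' : negl Z -> (forall n w, `|Z' n w| <= `|Z n w|) -> negl Z'.
Proof. by move=> hZ h; apply: (negl_le hZ); apply: whp_near; near=> n; move=> w; exact: h.
Unshelve. all: by end_near. Qed.

Lemma tight_le Z Z' : tight Z -> whp (fun n => [set w | `|Z' n w| <= `|Z n w|]) -> tight Z'.
Proof.
move=> hZ h; apply: (tight_dom hZ) => e e0; exists 1.
by apply: (oftS (h _ e0)); near=> n; move=> w /=; rewrite mul1r.
Unshelve. all: by end_near. Qed.

Lemma tight_le0 Z Z' : tight Z -> (forall n w, `|Z' n w| <= `|Z n w|) -> tight Z'.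
Proof. by move=> hZ h; apply: (tight_le hZ); apply: whp_near; near=> n; move=> w; exact: h.
Unshelve. all: by end_near. Qed.

Lemma negl_eq Z Z' : negl Z -> (forall n w, Z' n w = Z n w) -> negl Z'.
Proof. by move=> hZ h; apply: (negl_le0 hZ) => n w; rewrite h. Qed.

Lemma negl_eqn Z Z' : negl Z -> (forall n w, (0 < n)%N -> Z' n w = Z n w) -> negl Z'.
Proof.
move=> hZ h; apply: (negl_le hZ); apply: whp_near; near=> n; move=> w /=; rewrite h//.
by near: n; exact: nbhs_infty_gt.
Unshelve. all: by end_near. Qed.

Lemma neglD Z Z' : negl Z -> negl Z' -> negl (fun n w => Z n w + Z' n w).
Proof.
move=> hZ hZ' e e0; have e2 : 0 < e / 2 by rewrite divr_gt0.
apply: (whp2 (hZ _ e2) (hZ' _ e2)) => n w /= h1 h2.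
by rewrite (le_trans (ler_normD _ _))// (_ : e = e / 2 + e / 2) ?lerD//; lra.
Qed.

Lemma negl0 : negl (fun n w => 0).
Proof.
by move=> e e0; apply: whp_near; near=> n; move=> w /=; rewrite normr0 ltW.
Unshelve. all: by end_near. Qed.

Lemma negl_sum I (s : seq I) (F : I -> forall n, Om n -> R) : (forall i, negl (F i)) ->
  negl (fun n w => \sum_(i <- s) F i n w).
Proof.
move=> hF; elim: s => [|i s ih].
  by apply: (negl_eq negl0) => n w; rewrite big_nil.
by apply: (negl_eq (neglD (hF i) ih)) => n w; rewrite big_cons.
Qed.

Lemma neglM Z Z' : negl Z -> tight Z' -> negl (fun n w => Z n w * Z' n w).
Proof.
move=> hZ hZ'; apply: (negl_dom hZ) => e e0; have [K hK] := hZ' _ e0.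
exists K; apply: (oftS hK); near=> n; move=> w /= h.
by rewrite normrM mulrC ler_wpM2r.
Unshelve. all: by end_near. Qed.

Lemma tightM Z Z' : tight Z -> tight Z' -> tight (fun n w => Z n w * Z' n w).
Proof.
move=> hZ hZ'; apply: (tight_dom hZ) => e e0; have [K hK] := hZ' _ e0.
exists K; apply: (oftS hK); near=> n; move=> w /= h.
by rewrite normrM mulrC ler_wpM2r.
Unshelve. all: by end_near. Qed.

Lemma tightD Z Z' : tight Z -> tight Z' -> tight (fun n w => Z n w + Z' n w).
Proof.
move=> hZ hZ' e e0; have e2 : 0 < e / 2 by rewrite divr_gt0.
have [K hK] := hZ _ e2; have [L hL] := hZ' _ e2.
exists (K + L); apply: (oft2h hK hL) => n w /= h1 h2.
by rewrite (le_trans (ler_normD _ _))// lerD.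
Qed.

Lemma tight_bd (z : nat -> R) (K : R) : (forall n, (0 < n)%N -> `|z n| <= K) ->
  tight (fun n w => z n).
Proof.
move=> hz e e0; exists K; apply: oft_near; first exact: ltW.
by near=> n; move=> w /=; apply: hz; near: n; exact: nbhs_infty_gt.
Unshelve. all: by end_near. Qed.

Lemma tight_cst (k : R) : tight (fun n w => k).
Proof. exact: (@tight_bd (fun=> k) `|k|). Qed.

Lemma tight_sum I (s : seq I) (F : I -> forall n, Om n -> R) : (forall i, tight (F i)) ->
  tight (fun n w => \sum_(i <- s) F i n w).
Proof.
move=> hF; elim: s => [|i s ih].
  by apply: (tight_le0 (tight_cst 0)) => n w; rewrite big_nil.
by apply: (tight_le0 (tightD (hF i) ih)) => n w; rewrite big_cons.
Qed.

Lemma neglZ (k : R) Z : negl Z -> negl (fun n w => k * Z n w).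
Proof.
by move=> hZ; apply: (negl_eq (neglM hZ (tight_cst k))) => n w; rewrite mulrC.
Qed.

Lemma negl_cvg (z : nat -> R) : z n @[n --> \oo] --> (0 : R) -> negl (fun n w => z n).
Proof.
move=> hz e e0; apply: whp_near.
by move/cvgrPdist_le : hz => /(_ e e0); apply: filterS => n; rewrite sub0r normrN.
Qed.

Lemma negl_sqrt Z : negl Z -> negl (fun n w => Num.sqrt (Z n w)).
Proof.
move=> hZ e e0; have e2 : 0 < e ^+ 2 by rewrite exprn_gt0.
apply: (whpS (hZ _ e2)); near=> n; move=> w /= h.
rewrite ger0_norm ?sqrtr_ge0// -[leRHS](gtr0_norm e0) -sqrtr_sqr ler_wsqrtr//.
by rewrite (le_trans (ler_norm _)).
Unshelve. all: by end_near. Qed.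

Lemma tight_sqrt Z : tight Z -> tight (fun n w => Num.sqrt (Z n w)).
Proof.
move=> hZ.
have h1 : tight (fun n w => 1 + `|Z n w|).
  by apply: tightD (tight_cst 1) _; apply: (tight_le0 hZ) => n w; rewrite normr_id.
apply: (tight_le0 h1) => n w; rewrite ger0_norm ?sqrtr_ge0// ger0_norm ?addr_ge0//.
apply: (@le_trans _ _ (Num.sqrt ((1 + `|Z n w|) ^+ 2))); last first.
  by rewrite sqrtr_sqr ger0_norm ?addr_ge0.
rewrite ler_wsqrtr//; have := ler_norm (Z n w); have := normr_ge0 (Z n w).
by rewrite expr2; nra.
Qed.

Lemma tight_Ex Z (C : R) : (forall n w, 0 <= Z n w) ->
  (\forall n \near \oo, L1 (S n) (Z n) /\ Ex (S n) (Z n) <= C) -> tight Z.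
Proof.
move=> Z0 h e e0; pose D := Num.max 1 C; have D0 : 0 < D by rewrite lt_max ltr01.
exists (D / e); apply: filterS h => n [hL hC].
have De : 0 < D / e by rewrite divr_gt0.
have := big_Ex_le hL (Z0 n) (le_trans hC _ : _ <= D) De.
rewrite /D le_max lexx orbT -/D => /(_ isT); apply: bigS.
  by rewrite invf_div mulrCA divff ?mulr1// gt_eqF.
by move=> w /=; rewrite ger0_norm.
Qed.

Lemma negl_Ex Z : (forall n w, 0 <= Z n w) ->
  (forall c : R, 0 < c -> \forall n \near \oo, L1 (S n) (Z n) /\ Ex (S n) (Z n) <= c) -> negl Z.
Proof.
move=> Z0 h c c0 e e0; have ec : 0 < e * c by rewrite mulr_gt0.
apply: filterS (h _ ec) => n [hL hC].
have := big_Ex_le hL (Z0 n) hC c0; apply: bigS.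
  by rewrite mulfK// gt_eqF.
by move=> w /=; rewrite ger0_norm.
Qed.

End whp.

(** * Sample averages *)

(** From exp(-x) >= 1 - x one gets exp(x) <= 1 / (1 - x), and (1 - x)(1 + x + 2 x^2) = 1 + x^2 (1 -
    2 x). *)
Lemma expR_le_quad (R : realType) (x : R) : x <= 1 / 2 -> expR x <= 1 + x + 2 * x ^+ 2.
Proof.
move=> x2; have h := expR_ge1Dx (- x).
have x1 : 0 < 1 - x by lra.
rewrite -[expR x]invrK -expRN.
apply: (@le_trans _ _ (1 - x)^-1).
  by rewrite lef_pV2// posrE ?expR_gt0.
rewrite -[leLHS]mul1r ler_pdivrMr// !expr2; have := sqr_ge0 x; rewrite expr2 => xx.
have : 0 <= x * x * (1 - 2 * x) by rewrite mulr_ge0//; lra.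
by nra.
Qed.

Section iid_tail.
Context {R : realType} {d : measure_display} {O : measurableType d}.
Variables (Q : probability O R) (n : nat) (S : probability (n.-tuple O) R).
Hypothesis S_iid : iid Q S.

(** Chernoff's bound at a given exponent [l], left unoptimised. The mean is only bounded by [b],
    since the truncated residuals to which the bound is applied have a small bias. *)
Lemma iid_tail (F : O -> R) (l b s a : R) : measurable_fun setT F -> 0 < l ->
  (forall z, `|l * F z| <= 1 / 2) -> `|Ex Q F| <= b -> Ex Q (fun z => F z ^+ 2) <= s ->
  (S [set w | (a < \sum_(i < n) F (tnth w i))%R]
     <= (expR (- (l * a) + n%:R * (l * b + 2 * l ^+ 2 * s)))%:E)%E.
Proof.
move=> mF l0 lF Fb Fs.
have Fl z : `|F z| <= l^-1.
  rewrite -(ler_pM2l l0) divff ?gt_eqF//; have := lF z; rewrite normrM gtr0_norm//.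
  by move=> /le_trans; apply; lra.
have hF : L1 Q F := L1_bd Q mF Fl.
have hF2 : L1 Q (fun z => F z ^+ 2).
  apply: (@L1_bd _ _ _ _ _ (l^-1 ^+ 2)); first exact: measurable_funX.
  by move=> z; rewrite normrX lerXn2r// nnegrE// ltW// invr_gt0.
pose f z := expR (l * F z).
have mf : measurable_fun setT f by do 2 apply: measurableT_comp => //.
have f0 z : 0 <= f z by exact: expR_ge0.
have fq z : f z <= 1 + (l * F z + 2 * l ^+ 2 * F z ^+ 2).
  have /ler_normlW lFz := lF z.
  rewrite (le_trans (expR_le_quad lFz))// le_eqVlt; apply/orP; left; apply/eqP; ring.
have hq : L1 Q (fun z => 1 + (l * F z + 2 * l ^+ 2 * F z ^+ 2)).
  by apply: L1D; [exact: L1_cst|apply: L1D; exact: L1Z].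
have hf : L1 Q f by apply: (L1_le mf _ hq) => z; rewrite ger0_norm.
have Ef : Ex Q f <= expR (l * b + 2 * l ^+ 2 * s).
  apply: (le_trans (Ex_le hf hq fq)).
  rewrite ExD ?Ex_cst//; [|exact: L1_cst|by apply: L1D; exact: L1Z].
  apply: le_trans (expR_ge1Dx _); rewrite lerD2l ExD; [|exact: L1Z|exact: L1Z].
  rewrite !ExZ// lerD//; first by rewrite ler_pM2l// (le_trans (ler_norm _)).
  by rewrite ler_wpM2l// mulr_ge0// exprn_ge0// ltW.
have Ef0 : 0 <= Ex Q f by exact: Ex_ge0.
have prodE w : \prod_(i < n) f (tnth w i) = expR (l * \sum_(i < n) F (tnth w i)).
  by rewrite mulr_sumr expR_sum.
pose Z := fun w : n.-tuple O => \prod_(i < n) f (tnth w i).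
have mZ : measurable_fun setT Z.
  by apply: measurable_fun_prodr => i _; apply: measurableT_comp => //; exact: measurable_tnth.
have Z0 w : 0 <= Z w by rewrite prodr_ge0.
have IZ : (\int[S]_w (Z w)%:E = (Ex Q f ^+ n)%:E)%E.
  by apply: (integral_prod_iid S_iid) => //; exact: Ex_fin.
have [|hZ EZ] := @L1_ge0 _ _ _ S Z (Ex Q f ^+ n) mZ Z0; first by rewrite IZ.
have := @markov_Ex _ _ _ S Z _ (expR (l * a)) hZ Z0 EZ (expR_gt0 _).
rewrite (_ : [set w | expR (l * a) < Z w] =
             [set w | a < \sum_(i < n) F (tnth w i)]); last first.
  by apply/seteqP; split => w /=; rewrite /Z prodE ltr_expR ltr_pM2l.
move=> /le_trans; apply; rewrite lee_fin expRD expRN [leRHS]mulrC.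
by rewrite ler_pM2r ?invr_gt0 ?expR_gt0// expRM_natl lerXn2r// nnegrE expR_ge0.
Qed.

End iid_tail.

Section averages.
Context {R : realType} {d : nat -> measure_display} {O : forall n, measurableType (d n)}.
Variables (Q : forall n, probability (O n) R) (S : forall n, probability (n.-tuple (O n)) R).
Hypothesis S_iid : forall n, (0 < n)%N -> iid (Q n) (S n).
Implicit Types (f g : forall n, O n -> R).

Definition avg n (w : n.-tuple (O n)) (f : O n -> R) : R :=
  n%:R^-1 * \sum_(i < n) f (tnth w i).

Lemma avgD n (w : n.-tuple (O n)) (f g : O n -> R) : avg w (fun z => f z + g z) = avg w f + avg w g.
Proof. by rewrite /avg big_split mulrDr. Qed.

Lemma avgZ n (w : n.-tuple (O n)) k (f : O n -> R) : avg w (fun z => k * f z) = k * avg w f.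
Proof. by rewrite /avg -mulr_sumr mulrCA. Qed.

Lemma avgB n (w : n.-tuple (O n)) (f g : O n -> R) : avg w (fun z => f z - g z) = avg w f - avg w g.
Proof. by rewrite /avg big_split mulrDr sumrN mulrN. Qed.

Lemma avg_sum n (w : n.-tuple (O n)) I (s : seq I) (F : I -> O n -> R) :
  avg w (fun z => \sum_(i <- s) F i z) = \sum_(i <- s) avg w (F i).
Proof. by rewrite /avg exchange_big mulr_sumr. Qed.

Lemma avg_cst n (w : n.-tuple (O n)) (k : R) : (0 < n)%N -> avg w (fun=> k) = k.
Proof.
move=> n0; rewrite /avg sumr_const card_ord -(mulr_natl k) mulrA mulVf ?mul1r//.
by rewrite pnatr_eq0 -lt0n.
Qed.

Lemma avg_le n (w : n.-tuple (O n)) (f g : O n -> R) :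
  (forall i, f (tnth w i) <= g (tnth w i)) -> avg w f <= avg w g.
Proof. by move=> fg; rewrite ler_wpM2l ?invr_ge0 ?ler0n//; apply: ler_sum. Qed.

Lemma eq_avg n (w : n.-tuple (O n)) (f g : O n -> R) :
  (forall i, f (tnth w i) = g (tnth w i)) -> avg w f = avg w g.
Proof. by move=> fg; congr (_ * _); apply: eq_bigr. Qed.

Lemma avg_ge0 n (w : n.-tuple (O n)) (f : O n -> R) : (forall i, 0 <= f (tnth w i)) -> 0 <= avg w f.
Proof. by move=> f0; rewrite mulr_ge0 ?invr_ge0 ?ler0n ?sumr_ge0. Qed.

Lemma avg_norm n (w : n.-tuple (O n)) (f : O n -> R) : `|avg w f| <= avg w (fun z => `|f z|).
Proof.
by rewrite /avg normrM ger0_norm ?invr_ge0 ?ler0n// ler_wpM2l ?invr_ge0 ?ler0n ?ler_norm_sum.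
Qed.

Lemma measurable_avg n (f : O n -> R) : measurable_fun setT f ->
  measurable_fun setT (fun w : n.-tuple (O n) => avg w f).
Proof.
move=> mf; apply: measurable_funM => //; apply: measurable_fun_sum => i _.
by apply: measurableT_comp => //; exact: measurable_tnth.
Qed.

Lemma cauchy_schwarz_avg n (w : n.-tuple (O n)) (f g : O n -> R) :
  `|avg w (fun z => f z * g z)| <=
    Num.sqrt (avg w (fun z => f z ^+ 2)) * Num.sqrt (avg w (fun z => g z ^+ 2)).
Proof.
set a := avg w (fun z => f z ^+ 2); set b := avg w (fun z => g z ^+ 2).
set c := avg w _.
have a0 : 0 <= a by apply: avg_ge0 => i; exact: sqr_ge0.
have b0 : 0 <= b by apply: avg_ge0 => i; exact: sqr_ge0.
have key x y : 0 <= x ^+ 2 * a + 2 * (x * y) * c + y ^+ 2 * b.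
  rewrite -!avgZ -!avgD; apply: avg_ge0 => i.
  rewrite (_ : _ + _ = (x * f (tnth w i) + y * g (tnth w i)) ^+ 2) ?sqr_ge0//; ring.
rewrite -sqrtrM// -sqrtr_sqr ler_wsqrtr//.
have [b00|b00] := eqVneq b 0.
  rewrite b00 mulr0.
  (* The quadratic form at (c, -(a + 1)) equals -c^2 (a + 2) when b = 0, which forces c = 0. *)
  have := key c (- (a + 1)); rewrite b00 mulr0 addr0 !expr2 => h.
  have : c * c * (a + 2) <= 0 by nra.
  by have := sqr_ge0 c; rewrite expr2 => c2 h2; nra.
have bp : 0 < b by rewrite lt_def b00.
(* At (b, -c) the form equals b (a b - c^2). *)
by have := key b (- c); rewrite !expr2 => h; rewrite -(ler_pM2l bp); nra.
Qed.

Lemma Ex_avg n (f : O n -> R) : (0 < n)%N -> L1 (Q n) f ->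
  L1 (S n) (fun w => avg w f) /\ Ex (S n) (fun w => avg w f) = Ex (Q n) f.
Proof.
move=> n0 hf; have hfi i := L1_tnth (S_iid n0) i hf.
have hs : L1 (S n) (fun w => \sum_(i < n) f (tnth w i)) by exact: L1_sum.
split; first exact: L1Z.
rewrite /avg ExZ// Ex_sum//.
under eq_bigr do rewrite (Ex_tnth (S_iid n0))//.
rewrite sumr_const card_ord -(mulr_natl (Ex _ _)) mulrA mulVf ?mul1r//.
by rewrite pnatr_eq0 -lt0n.
Qed.

Lemma tight_avg f (C : R) : (forall n, (0 < n)%N -> L1 (Q n) (f n) /\
    Ex (Q n) (fun z => `|f n z|) <= C) -> tight S (fun n w => avg w (f n)).
Proof.
move=> h; have H : tight S (fun n w => avg w (fun z => `|f n z|)).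
  apply: (@tight_Ex _ _ _ _ _ C).
    by move=> n w; apply: avg_ge0.
  near=> n; have n0 : (0 < n)%N by near: n; exact: nbhs_infty_gt.
  have [hf hC] := h _ n0; have [h1 ->] := Ex_avg n0 (L1_norm hf).
  by split.
apply: (tight_le0 H) => n w; rewrite [leRHS]ger0_norm ?avg_norm//.
by apply: avg_ge0.
Unshelve. all: by end_near. Qed.

Lemma Ex_sqrtn_avg n (f : O n -> R) (C : R) : (0 < n)%N -> L1 (Q n) f ->
  L1 (Q n) (fun z => f z ^+ 2) -> Ex (Q n) f = 0 -> Ex (Q n) (fun z => f z ^+ 2) <= C ->
  L1 (S n) (fun w => (Num.sqrt n%:R * avg w f) ^+ 2) /\
  Ex (S n) (fun w => (Num.sqrt n%:R * avg w f) ^+ 2) <= C.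
Proof.
move=> n0 hf hf2 f0 fC; have [h1 h2] := sum_second_moment (S_iid n0) hf hf2 f0.
have n0R : (n%:R : R) != 0 by rewrite pnatr_eq0 -lt0n.
have E : (fun w => (Num.sqrt n%:R * avg w f) ^+ 2) =
         (fun w : n.-tuple (O n) => n%:R^-1 * (\sum_(i < n) f (tnth w i)) ^+ 2).
  apply/funext => w; rewrite !exprMn sqr_sqrtr ?ler0n// mulrA; congr (_ * _).
  by rewrite expr2 mulrA divff// mul1r.
rewrite E; split; first exact: L1Z.
by rewrite ExZ// -ler_pdivlMl ?invr_gt0 ?ltr0n// invrK (le_trans h2)// ler_wpM2l ?ler0n.
Qed.

Lemma tight_sqrtn_avg f (C : R) : (forall n, (0 < n)%N -> [/\ L1 (Q n) (f n),
    L1 (Q n) (fun z => f n z ^+ 2), Ex (Q n) (f n) = 0 &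
    Ex (Q n) (fun z => f n z ^+ 2) <= C]) ->
  tight S (fun n w => Num.sqrt n%:R * avg w (f n)).
Proof.
move=> h.
have H : tight S (fun n w => (Num.sqrt n%:R * avg w (f n)) ^+ 2).
  apply: (@tight_Ex _ _ _ _ _ C); first by move=> n w; exact: sqr_ge0.
  near=> n; have n0 : (0 < n)%N by near: n; exact: nbhs_infty_gt.
  by have [h1 h2 h3 h4] := h _ n0; exact: Ex_sqrtn_avg.
apply: (tight_le0 (tight_sqrt H)) => n w.
by rewrite sqrtr_sqr normr_id.
Unshelve. all: by end_near. Qed.

Lemma negl_sqrtn_avg f (C : nat -> R) : (forall n, (0 < n)%N -> [/\ L1 (Q n) (f n),
    L1 (Q n) (fun z => f n z ^+ 2), Ex (Q n) (f n) = 0 &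
    Ex (Q n) (fun z => f n z ^+ 2) <= C n]) -> C n @[n --> \oo] --> (0 : R) ->
  negl S (fun n w => Num.sqrt n%:R * avg w (f n)).
Proof.
move=> h C0.
have H : negl S (fun n w => (Num.sqrt n%:R * avg w (f n)) ^+ 2).
  apply: negl_Ex; first by move=> n w; exact: sqr_ge0.
  move=> c c0; move/cvgrPdist_le : C0 => /(_ c c0); apply: filterS2 (nbhs_infty_gt 0).
  move=> n n0; rewrite sub0r normrN => Cc.
  have [h1 h2 h3 h4] := h _ n0; apply: Ex_sqrtn_avg => //.
  by rewrite (le_trans h4)// (le_trans (ler_norm _)).
apply: (negl_le0 (negl_sqrt H)) => n w.
by rewrite sqrtr_sqr normr_id.
Qed.

Lemma invn_sqrt_cvg : (Num.sqrt n%:R)^-1 @[n --> \oo] --> (0 : R).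
Proof.
apply/cvgrPdist_le => e e0; near=> n.
rewrite sub0r normrN ger0_norm ?invr_ge0 ?sqrtr_ge0//.
rewrite -[leRHS]invrK lef_pV2 ?posrE ?invr_gt0//; last first.
  by rewrite sqrtr_gt0 ltr0n; near: n; exact: nbhs_infty_gt.
rewrite -[leLHS](@gtr0_norm _ e^-1) ?invr_gt0// -sqrtr_sqr ler_wsqrtr//.
by near: n; exact: nbhs_infty_ger.
Unshelve. all: by end_near. Qed.

Lemma negl_of_tight_sqrtn (Z : forall n, n.-tuple (O n) -> R) :
  tight S (fun n w => Num.sqrt n%:R * Z n w) -> negl S Z.
Proof.
move=> hZ; apply: (negl_eqn (neglM (negl_cvg S invn_sqrt_cvg) hZ)) => n w n0.
by rewrite mulrA mulVf ?mul1r// gt_eqF// sqrtr_gt0 ltr0n.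
Qed.

Definition excess (A : R) n (f : O n -> R) (z : O n) : R :=
  if A < `|f z| then f z else 0.

(** Each [f n] lives under its own law, so uniform integrability over n >= 1 takes the place of
    integrability under a single law. *)
Definition unif_int f := forall e : R, 0 < e -> exists2 A : R, 0 < A &
  forall n, (0 < n)%N -> L1 (Q n) (f n) /\ Ex (Q n) (fun z => `|excess A (f n) z|) <= e.

Lemma measurable_excess A n (f : O n -> R) : measurable_fun setT f ->
  measurable_fun setT (excess A f).
Proof.
move=> mf; apply: measurable_fun_ifT => //.
by apply: measurable_fun_ltr => //; apply: measurableT_comp.
Qed.

Lemma excess_le A n (f : O n -> R) z : `|excess A f z| <= `|f z|.
Proof. by rewrite /excess; case: ifP => // _; rewrite normr0. Qed.

Lemma sub_excess_le A n (f : O n -> R) z : 0 <= A -> `|f z - excess A f z| <= A.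
Proof.
by move=> A0; rewrite /excess; case: ltP => [_|]; rewrite ?subrr ?normr0// subr0.
Qed.

Lemma unif_int_bound f : unif_int f -> exists C, forall n, (0 < n)%N ->
  L1 (Q n) (f n) /\ Ex (Q n) (fun z => `|f n z|) <= C.
Proof.
move=> /(_ 1 ltr01) [A A0 h]; exists (A + 1) => n n0; have [hf fA] := h _ n0.
have mf := L1_meas hf.
have he : L1 (Q n) (fun z => `|excess A (f n) z|).
  apply: L1_norm; apply: (L1_le _ _ (L1_norm hf)); first exact: measurable_excess.
  exact: excess_le.
split=> //; apply: (@le_trans _ _ (Ex (Q n) (fun z => A + `|excess A (f n) z|))).
  apply: Ex_le; [exact: L1_norm|by apply: L1D => //; exact: L1_cst|].
  move=> z; rewrite -[in leLHS](subrK (excess A (f n) z) (f n z)).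
  by rewrite (le_trans (ler_normD _ _))// lerD2r sub_excess_le// ltW.
by rewrite ExD ?Ex_cst ?lerD2l//; exact: L1_cst.
Qed.

(** Weak law for a triangular array with only first moments: the part of [f] below level [A]
    averages out at rate root n by its second moment, and the excess falls to Markov's
    inequality. *)
Lemma lln f : unif_int f -> negl S (fun n w => avg w (f n) - Ex (Q n) (f n)).
Proof.
move=> hf c c0 e e0.
(* The sample average and the expectation of the excess each have mean at most c e / 8; Markov's
   inequality at c / 2 turns the total c e / 4 into probability e / 2. *)
have ec : 0 < c * e / 8 by rewrite divr_gt0// mulr_gt0.
have [A A0 h] := hf _ ec.
have e2 : 0 < e / 2 by rewrite divr_gt0.
have c2 : 0 < c / 2 by rewrite divr_gt0.
pose h2 n (z : O n) := excess A (f n) z.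
pose g n (z : O n) := f n z - h2 n z.
have hh n : (0 < n)%N -> L1 (Q n) (h2 n).
  move=> n0; have [hfn _] := h _ n0; apply: (L1_le _ _ (L1_norm hfn)).
    by apply: measurable_excess; exact: L1_meas hfn.
  exact: excess_le.
have hg n : (0 < n)%N -> L1 (Q n) (g n).
  by move=> n0; have [hfn _] := h _ n0; apply: L1B => //; exact: hh.
have gA n z : `|g n z| <= A by apply: sub_excess_le; exact: ltW.
have N1 : negl S (fun n w => avg w (fun z => g n z - Ex (Q n) (g n))).
  apply: negl_of_tight_sqrtn.
  apply: (@tight_sqrtn_avg (fun n z => g n z - Ex (Q n) (g n)) ((A + A) ^+ 2)) => n n0.
  have b1 z : `|g n z - Ex (Q n) (g n)| <= A + A.
    rewrite (le_trans (ler_normB _ _))// lerD//; apply: Ex_norm_le => //; exact: hg.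
  have b2 z : `|(g n z - Ex (Q n) (g n)) ^+ 2| <= (A + A) ^+ 2.
    by rewrite normrX lerXn2r// nnegrE addr_ge0// ltW.
  have m1 : measurable_fun setT (fun z => g n z - Ex (Q n) (g n)).
    by apply: measurable_funB => //; exact: L1_meas (hg _ n0).
  have l2 : L1 (Q n) (fun z => (g n z - Ex (Q n) (g n)) ^+ 2).
    by apply: (L1_bd _ _ b2); exact: measurable_funX.
  split=> //; first exact: (L1_bd _ m1 b1).
    by rewrite ExB ?Ex_cst ?subrr//; [exact: hg|exact: L1_cst].
  by rewrite (le_trans (ler_norm _))// Ex_norm_le.
have N2 : oft S (e / 2) (fun n =>
    [set w | avg w (fun z => `|h2 n z|) + Ex (Q n) (fun z => `|h2 n z|) <= c / 2]).
  near=> n; have n0 : (0 < n)%N by near: n; exact: nbhs_infty_gt.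
  have [hfn hA] := h _ n0.
  have [l1 E1] := Ex_avg n0 (L1_norm (hh _ n0)).
  have hl : L1 (S n) (fun w => avg w (fun z => `|h2 n z|) + Ex (Q n) (fun z => `|h2 n z|)).
    by apply: L1D => //; exact: L1_cst.
  have := @big_Ex_le _ _ _ (S n) _ (c * e / 4) (c / 2) hl _ _ c2.
  rewrite (_ : c * e / 4 / (c / 2) = e / 2); last by field; rewrite gt_eqF.
  apply.
    by move=> w; rewrite addr_ge0 ?avg_ge0// Ex_ge0.
  rewrite ExD// ?Ex_cst ?E1; last exact: L1_cst.
  by rewrite (_ : c * e / 4 = c * e / 8 + c * e / 8) ?lerD//; field.
apply: (@oftS _ _ _ _ _ (fun n => [set w |
  `|avg w (fun z => g n z - Ex (Q n) (g n))| <= c / 2 /\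
  avg w (fun z => `|h2 n z|) + Ex (Q n) (fun z => `|h2 n z|) <= c / 2])).
  by apply: (oft2h (N1 _ c2 _ e2) N2) => n w /= ? ?; split.
near=> n; have n0 : (0 < n)%N by near: n; exact: nbhs_infty_gt.
have [hfn _] := h _ n0; move=> w /= [h3 h4].
have E1 : avg w (f n) - Ex (Q n) (f n) =
    avg w (fun z => g n z - Ex (Q n) (g n)) + (avg w (h2 n) - Ex (Q n) (h2 n)).
  rewrite avgB avg_cst// /g avgB ExB//; last exact: hh.
  ring.
rewrite E1 (le_trans (ler_normD _ _))// (_ : c = c / 2 + c / 2); last by lra.
rewrite lerD// (le_trans (ler_normB _ _))// (le_trans _ h4)// lerD ?avg_norm//.
exact/Ex_norm/hh.
Unshelve. all: by end_near. Qed.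

End averages.

(** * The central limit theorem *)

Section taylor.
Context {R : realType}.
Implicit Types (x y h v : R).

(** One integration by the mean value theorem. The constant is carried over unchanged instead of
    being divided by n + 1, which makes the bound easy to iterate into Taylor remainders. *)
Lemma mvt_pow_bound (g g1 : R -> R) (C : R) n v :
  (forall h, is_derive h 1 g (g1 h)) -> g 0 = 0 -> 0 <= C ->
  (forall h, `|h| <= `|v| -> `|g1 h| <= C * `|h| ^+ n) ->
  `|g v| <= C * `|v| ^+ n.+1.
Proof.
move=> dg g0 C0 g1C.
have cg : continuous g by move=> h; apply: differentiable_continuous; apply/derivable1_diffP; case: (dg h).
have H c : `|c| <= `|v| -> g v = g1 c * v -> `|g v| <= C * `|v| ^+ n.+1.
  move=> cv ->; rewrite normrM exprSr mulrA ler_wpM2r// (le_trans (g1C _ cv))//.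
  by rewrite ler_wpM2l// lerXn2r// nnegrE.
have [v0|v0] := leP 0 v.
  have [c cv] := MVT_segment v0 (fun x _ => dg x) (@continuous_subspaceT _ _ _ _ cg).
  rewrite g0 !subr0; apply: H; move: cv; rewrite in_itv/= => /andP[c0 cv].
  by rewrite !ger0_norm.
have [c cv] := MVT_segment (ltW v0) (fun x _ => dg x) (@continuous_subspaceT _ _ _ _ cg).
rewrite g0 sub0r sub0r mulrN => /oppr_inj; apply: H; move: cv; rewrite in_itv/= => /andP[cv c0].
by rewrite !ler0_norm ?lerN2// ltW.
Qed.

Lemma is_derive1B (f g : R -> R) x a b : is_derive x 1 f a -> is_derive x 1 g b ->
  is_derive x 1 (fun y => f y - g y) (a - b).
Proof. exact: is_deriveB. Qed.

Lemma is_derive_monomial (a : R) n x :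
  is_derive x 1 (fun y => a * y ^+ n.+1) (a * (n.+1%:R * x ^+ n)).
Proof.
have := is_deriveZ a (is_deriveX n.+1 (is_derive_id x (1 : R))).
rewrite (_ : a \*: id ^+ n.+1 = (fun y => a * y ^+ n.+1)); last first.
  by apply/funext => y; rewrite exprfctE.
by move/is_derive_eq; apply; rewrite /GRing.scale/= mulr1.
Qed.

Definition exp_sum n v : R := \sum_(k < n) v ^+ k / k`!%:R.

Lemma is_derive_exp_sum n v : is_derive v 1 (exp_sum n.+1) (exp_sum n v).
Proof.
elim: n => [|n ih].
  rewrite /exp_sum big_ord0 (_ : (fun v => _) = cst 1); first exact: is_derive_cst.
  by apply/funext => x; rewrite big_ord_recl big_ord0 addr0 expr0 fact0 invr1 mulr1.
have -> : exp_sum n.+2 = (fun x => exp_sum n.+1 x + n.+1`!%:R^-1 * x ^+ n.+1).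
  by apply/funext => x; rewrite /exp_sum big_ord_recr/= [X in _ + X]mulrC.
rewrite [exp_sum n.+1 v]/exp_sum big_ord_recr/=.
apply: is_deriveD.
have := is_derive_monomial n.+1`!%:R^-1 n v; move/is_derive_eq; apply.
by rewrite factS natrM invfM mulrACA mulVf ?pnatr_eq0// mul1r mulrC.
Qed.

Lemma expR_taylor n v : `|expR v - exp_sum n v| <= expR `|v| * `|v| ^+ n.
Proof.
(* The radius [a] is frozen before the induction, so that one constant exp(a) serves on the whole
   segment at every order. *)
suff H a : 0 <= a -> forall v, `|v| <= a -> `|expR v - exp_sum n v| <= expR a * `|v| ^+ n.
  by apply: H => //; exact: normr_ge0.
move=> a0; elim: n => [|n ih] {}v va.
  rewrite /exp_sum big_ord0 subr0 expr0 mulr1 ger0_norm ?expR_ge0// ler_expR.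
  by rewrite (le_trans (ler_norm _)).
apply: (@mvt_pow_bound (fun v => expR v - exp_sum n.+1 v) (fun v => expR v - exp_sum n v)).
- move=> h; apply: is_derive1B; exact: is_derive_exp_sum.
- rewrite expR0 /exp_sum big_ord_recl/= expr0 fact0 divr1 big1 ?addr0 ?subrr// => i _.
  by rewrite exprS mul0r mul0r.
- exact: expR_ge0.
- by move=> h hv; apply: ih; exact: le_trans va.
Qed.

(** The inequality |v| / 3 <= exp(|v| / 3), cubed. *)
Lemma cube_le_expR v : `|v| ^+ 3 <= 27 * (expR v + expR (- v)).
Proof.
have h : `|v| ^+ 3 <= 27 * expR `|v|.
  have -> : `|v| = 3%:R * (`|v| / 3) by field.
  rewrite expRM_natl exprMn -natrX ler_pM2l// lerXn2r// ?nnegrE ?expR_ge0 ?divr_ge0//.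
  by rewrite (le_trans _ (expR_ge1Dx _))// lerDr.
apply: (le_trans h); rewrite ler_pM2l//.
by case: (ler0P v) => _; rewrite ?lerDr ?lerDl expR_ge0.
Qed.

(** The better of two bounds on a second-order Taylor remainder: the cube makes small summands
    negligible, and the square is all that a finite variance affords for large ones. *)
Definition rem h : R := Num.min (h ^+ 2) (`|h| ^+ 3).

Lemma rem_ge0 h : 0 <= rem h.
Proof. by rewrite le_min sqr_ge0 exprn_ge0. Qed.

Lemma measurable_rem : measurable_fun setT rem.
Proof.
by apply: measurable_minr; apply: measurable_funX => //; apply: measurableT_comp.
Qed.

(** Only what the replacement argument consumes is recorded, namely bounds and an expansion rather
    than derivatives. In this form the class is stable under averaging over shifts, by linearity of
    the integral. *)
Definition smooth2 (M : R) (f f1 f2 : R -> R) :=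
  [/\ measurable_fun setT f, measurable_fun setT f1, measurable_fun setT f2,
      forall x, [/\ `|f x| <= M, `|f1 x| <= M & `|f2 x| <= M] &
      forall x h, `|f (x + h) - f x - f1 x * h - f2 x * h ^+ 2 / 2| <= M * rem h].

(** The cubic bound is Taylor's theorem. In the quadratic bound the term f2 x h^2 / 2 has no
    counterpart and is paid for separately, whence the factor 2. *)
Lemma smooth2_of_derivs (M : R) (f f1 f2 f3 : R -> R) :
  (forall x, is_derive x 1 f (f1 x)) -> (forall x, is_derive x 1 f1 (f2 x)) ->
  (forall x, is_derive x 1 f2 (f3 x)) ->
  (forall x, [/\ `|f x| <= M, `|f1 x| <= M, `|f2 x| <= M & `|f3 x| <= M]) ->
  smooth2 (2 * M) f f1 f2.
Proof.
move=> d0 d1 d2 bd.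
have M0 : 0 <= M by have [h _ _ _] := bd 0; exact: le_trans h.
have mc (g g1 : R -> R) : (forall x, is_derive x 1 g (g1 x)) -> measurable_fun setT g.
  move=> dg; apply: continuous_measurable_fun => x.
  by apply: differentiable_continuous; apply/derivable1_diffP; case: (dg x).
split; [exact: mc d0|exact: mc d1|exact: mc d2| |].
  move=> x; have [h0 h1 h2 _] := bd x.
  by split; rewrite (le_trans _ (_ : M <= 2 * M))//; lra.
move=> x h.
have shift (g g1 : R -> R) : (forall x, is_derive x 1 g (g1 x)) ->
    forall h, is_derive h 1 (fun h => g (x + h)) (g1 (x + h)).
  move=> dg k; have := @is_derive1_comp R g (fun h => x + h) k (g1 (x + k)) 1.
  rewrite mulr1; apply => //.
  have := is_deriveD (is_derive_cst x k 1) (is_derive_id k 1); rewrite add0r.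
  exact.
have lin (a : R) : forall k : R, is_derive k 1 (fun h => a * h) a.
  move=> k; have := is_deriveZ a (is_derive_id k (1 : R)); rewrite /GRing.scale/= mulr1.
  exact.
have quad (a : R) : forall k : R, is_derive k 1 (fun h => a * h ^+ 2 / 2) (a * k).
  move=> k; have := is_derive_monomial (a / 2) 1 k.
  rewrite (_ : (fun y => a / 2 * y ^+ 2) = (fun h => a * h ^+ 2 / 2)); last first.
    by apply/funext => z; ring.
  by move/is_derive_eq; apply; rewrite expr1; field.
have r3 : `|f (x + h) - f x - f1 x * h - f2 x * h ^+ 2 / 2| <= M * `|h| ^+ 3.
  apply: (@mvt_pow_bound (fun h => f (x + h) - f x - f1 x * h - f2 x * h ^+ 2 / 2)
    (fun h => f1 (x + h) - f1 x - f2 x * h) M 2) => //.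
  - move=> k; apply: (is_derive1B _ (quad _ _)).
    apply: (is_derive1B _ (lin _ _)).
    have := is_derive1B (shift _ _ d0 k) (is_derive_cst (f x) k 1); rewrite subr0; exact.
  - by rewrite addr0 subrr expr0n/= !mulr0 mul0r !subr0.
  move=> k _; apply: (@mvt_pow_bound (fun h => f1 (x + h) - f1 x - f2 x * h)
    (fun h => f2 (x + h) - f2 x) M 1) => //.
  - move=> k'; apply: (is_derive1B _ (lin _ _)).
    have := is_derive1B (shift _ _ d1 k') (is_derive_cst (f1 x) k' 1); rewrite subr0; exact.
  - by rewrite addr0 subrr mulr0 subr0.
  move=> k' _; apply: (@mvt_pow_bound (fun h => f2 (x + h) - f2 x)
    (fun h => f3 (x + h)) M 0) => //.
  - move=> l; have := is_derive1B (shift _ _ d2 l) (is_derive_cst (f2 x) l 1).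
    by rewrite subr0; exact.
  - by rewrite addr0 subrr.
  by move=> l _; rewrite expr0 mulr1; case: (bd (x + l)).
have r2 : `|f (x + h) - f x - f1 x * h| <= M * `|h| ^+ 2.
  apply: (@mvt_pow_bound (fun h => f (x + h) - f x - f1 x * h)
    (fun h => f1 (x + h) - f1 x) M 1) => //.
  - move=> k; apply: (is_derive1B _ (lin _ _)).
    have := is_derive1B (shift _ _ d0 k) (is_derive_cst (f x) k 1); rewrite subr0; exact.
  - by rewrite addr0 subrr mulr0 subr0.
  move=> k _; apply: (@mvt_pow_bound (fun h => f1 (x + h) - f1 x)
    (fun h => f2 (x + h)) M 0) => //.
  - move=> l; have := is_derive1B (shift _ _ d1 l) (is_derive_cst (f1 x) l 1).
    by rewrite subr0; exact.
  - by rewrite addr0 subrr.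
  by move=> l _; rewrite expr0 mulr1; case: (bd (x + l)).
rewrite /rem; case: (leP (h ^+ 2) (`|h| ^+ 3)) => _; last first.
  by rewrite (le_trans r3)// -mulrA ler_peMl ?ler1n// mulr_ge0// exprn_ge0.
rewrite (le_trans (ler_normB _ _))// (_ : 2 * M * h ^+ 2 = M * h ^+ 2 + M * h ^+ 2);
  last by ring.
apply: lerD.
  by rewrite (le_trans r2)// real_normK// num_real.
have h2 : 0 <= h ^+ 2 / 2 by rewrite divr_ge0 ?sqr_ge0.
rewrite -mulrA normrM (ger0_norm h2).
have [_ _ f2M _] := bd x; apply: ler_pM => //.
by have := sqr_ge0 h; lra.
Qed.

(** The decreasing logistic function: rescaled, it is a smooth stand-in for the indicator of a left
    half-line, and its derivatives are polynomials in itself. *)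
Definition logistic v : R := (1 + expR v)^-1.

Lemma logistic_bounds v : 0 < logistic v < 1.
Proof.
have e0 := expR_gt0 v; rewrite /logistic invr_gt0 addr_gt0//=.
by rewrite invf_lt1 ?addr_gt0// ltrDl.
Qed.

Lemma is_derive_logistic v : is_derive v 1 logistic (- (logistic v * (1 - logistic v))).
Proof.
have e0 := expR_gt0 v; have e1 : 1 + expR v != 0 by rewrite gt_eqF// addr_gt0.
have d1 : is_derive v 1 (fun v => 1 + expR v) (expR v).
  have := is_deriveD (is_derive_cst (1 : R) v 1) (is_derive_expR v); rewrite add0r; exact.
have := @is_deriveV R (fun v => 1 + expR v) v (expR v) 1 e1 d1.
move/is_derive_eq; apply.
by rewrite /GRing.scale/= /logistic; field.
Qed.

Lemma smooth2_logistic : smooth2 (2 * 6) logistic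
  (fun v => - (logistic v * (1 - logistic v)))
  (fun v => logistic v * (1 - logistic v) * (1 - 2 * logistic v)).
Proof.
have dl := is_derive_logistic.
have d1ml v : is_derive v 1 (fun v => 1 - logistic v) (logistic v * (1 - logistic v)).
  by have := is_derive1B (is_derive_cst (1 : R) v 1) (dl v); rewrite sub0r opprK; exact.
have d12l v : is_derive v 1 (fun v => 1 - 2 * logistic v) (2 * (logistic v * (1 - logistic v))).
  have := is_derive1B (is_derive_cst (1 : R) v 1) (is_deriveZ 2 (dl v)).
  by rewrite sub0r scalerN opprK; exact.
have dp v : is_derive v 1 (fun v => logistic v * (1 - logistic v))
    (- (logistic v * (1 - logistic v) * (1 - 2 * logistic v))).
  have := is_deriveM (dl v) (d1ml v); move/is_derive_eq; apply.
  by rewrite /GRing.scale/=; ring.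
have dnp v : is_derive v 1 (fun v => - (logistic v * (1 - logistic v)))
    (logistic v * (1 - logistic v) * (1 - 2 * logistic v)).
  by have := is_deriveN (dp v); rewrite opprK; exact.
have d3 v : is_derive v 1 (fun v => logistic v * (1 - logistic v) * (1 - 2 * logistic v))
    (logistic v * (1 - logistic v) *
     (2 * (logistic v * (1 - logistic v)) - (1 - 2 * logistic v) ^+ 2)).
  have := is_deriveM (dp v) (d12l v); move/is_derive_eq; apply.
  by rewrite /GRing.scale/=; ring.
(* With s in (0, 1) the function and its three derivatives are bounded by 3; the constant 6 is
   merely ample. *)
apply: (smooth2_of_derivs dl dnp d3).
move=> v; have /andP[] := logistic_bounds v; set s := logistic v => s0 s1.
have q0 : 0 <= s * (1 - s) by rewrite mulr_ge0//; lra.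
have q1 : s * (1 - s) <= 1 by nra.
have p0 : `|s * (1 - s)| <= 1 by rewrite ger0_norm.
have b1 : `|1 - 2 * s| <= 1 by rewrite ler_norml; apply/andP; split; lra.
split.
- by rewrite gtr0_norm//; lra.
- by rewrite normrN (le_trans p0)//; lra.
- by rewrite normrM (@le_trans _ _ (1 * 1))// ?ler_pM//; lra.
- rewrite normrM (@le_trans _ _ (1 * 3))// ?ler_pM//; last by lra.
  rewrite (le_trans (ler_normB _ _))// (_ : 3 = 2 + 1) ?lerD//; last by lra.
    by rewrite normrM ger0_norm// ler_piMr.
  by rewrite normrX exprn_ile1.
Qed.

(** Each order of differentiation costs a factor k >= 1, at most k^3 up to the third-order
    remainder. *)
Lemma smooth2_affine (M k a : R) f f1 f2 : 1 <= k -> smooth2 M f f1 f2 ->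
  smooth2 (M * k ^+ 3) (fun x => f (k * (x - a))) (fun x => k * f1 (k * (x - a)))
    (fun x => k ^+ 2 * f2 (k * (x - a))).
Proof.
move=> k1 [m0 m1 m2 bd tay]; have k0 : 0 <= k by exact: le_trans k1.
have M0 : 0 <= M by have [h _ _] := bd 0; exact: le_trans h.
have mk : measurable_fun setT (fun x : R => k * (x - a)).
  by apply: measurable_funM => //; apply: measurable_funB.
have kk : k <= k ^+ 3 by rewrite -[leLHS]expr1 ler_weXn2l.
have kk2 : k ^+ 2 <= k ^+ 3 by rewrite ler_weXn2l.
have k31 : 1 <= k ^+ 3 by exact: le_trans kk.
have mono c : 0 <= c -> c <= k ^+ 3 -> forall y, `|y| <= M -> `|c * y| <= M * k ^+ 3.
  by move=> c0 ck y yM; rewrite normrM ger0_norm// mulrC ler_pM.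
split.
- exact: measurableT_comp.
- by apply: measurable_funM => //; exact: measurableT_comp.
- by apply: measurable_funM => //; exact: measurableT_comp.
- move=> x; have [h0 h1 h2] := bd (k * (x - a)); split.
  + by rewrite -[X in `|X|]mul1r; exact: mono.
  + exact: mono.
  + by apply: mono => //; exact: exprn_ge0.
move=> x h; have := tay (k * (x - a)) (k * h).
rewrite (_ : k * (x - a) + k * h = k * (x + h - a)); last by ring.
rewrite (_ : _ - f1 _ * (k * h) = f (k * (x + h - a)) - f (k * (x - a)) - k * f1 (k * (x - a)) * h); last by ring.
rewrite (_ : f2 _ * (k * h) ^+ 2 = k ^+ 2 * f2 (k * (x - a)) * h ^+ 2); last by ring.
move=> /le_trans; apply; rewrite -mulrA ler_wpM2l//.
rewrite /rem normrM (ger0_norm k0) !exprMn; case: (leP (h ^+ 2)) => _; rewrite ge_min.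
  by rewrite ler_wpM2r ?sqr_ge0.
by rewrite lexx orbT.
Qed.

End taylor.

(** * Moments, densities and convolution of centred normal laws *)

Section gaussian.
Context {R : realType}.
Implicit Types (s t x z : R).
Notation mu := (@lebesgue_measure R).
Notation N s := (normal_prob (0 : R) s : probability (measurableTypeR R) R).
Notation phi := (normal_pdf (0 : R)).

(** The Radon-Nikodym derivative of the normal law agrees almost everywhere with the density, since
    both have the same integral over every measurable set. *)
Lemma ge0_integral_normal s (f : R -> \bar R) : measurable_fun setT f ->
  (forall x, 0 <= f x)%E -> (\int[N s]_x f x = \int[mu]_x (f x * (phi s x)%:E))%E.
Proof.
move=> mf f0; have dom := @normal_prob_dominates R 0 s.
rewrite -(Radon_Nikodym_SigmaFinite.change_of_variables dom)//.
apply: ae_eq_integral => //.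
- apply: emeasurable_funM => //; apply: (measurable_int mu).
  exact: Radon_Nikodym_SigmaFinite.f_integrable.
- by apply: emeasurable_funM => //; apply/measurable_EFinP; exact: measurable_normal_pdf.
- apply: ae_eqe_mul2l => /=.
  apply: integral_ae_eq => //=.
  + exact: Radon_Nikodym_SigmaFinite.f_integrable.
  + by apply/measurable_EFinP; exact: measurable_normal_pdf.
  + by move=> E _ mE; rewrite -Radon_Nikodym_SigmaFinite.f_integral.
Qed.

(** Completing the square: tilting N(0, s^2) by exp(t z) moves its mean to t s^2. *)
Lemma normal_pdf_expR s t z : s != 0 ->
  expR (t * z) * phi s z = expR (t ^+ 2 * s ^+ 2 / 2) * normal_pdf (t * s ^+ 2) s z.
Proof.
move=> s0; rewrite !normal_pdfE// /normal_fun mulrCA [RHS]mulrCA; congr (_ * _).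
by rewrite -!expRD; congr expR; field.
Qed.

Lemma Ex_normal_expR s t : s != 0 -> L1 (N s) (fun z => expR (t * z)) /\
  Ex (N s) (fun z => expR (t * z)) = expR (t ^+ 2 * s ^+ 2 / 2).
Proof.
move=> s0.
have mf : measurable_fun setT (fun z : R => expR (t * z)) by apply: measurableT_comp.
have H : (\int[N s]_z (expR (t * z))%:E = (expR (t ^+ 2 * s ^+ 2 / 2))%:E)%E.
  rewrite ge0_integral_normal; [|exact/measurable_EFinP|by move=> z; rewrite lee_fin expR_ge0].
  under eq_integral do rewrite -EFinM normal_pdf_expR// EFinM.
  rewrite ge0_integralZl//=.
  - by rewrite integral_normal_pdf mule1.
  - by apply/measurable_EFinP; exact: measurable_normal_pdf.
  - by move=> z _; rewrite lee_fin normal_pdf_ge0.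
have [hL _] : L1 (N s) (fun z => expR (t * z)) /\
    Ex (N s) (fun z => expR (t * z)) <= expR (t ^+ 2 * s ^+ 2 / 2).
  by apply: L1_ge0 => //; rewrite H.
by split=> //; apply: EFin_inj; rewrite -Ex_fin.
Qed.

Lemma expR_norm_le x : expR `|x| <= expR x + expR (- x).
Proof. by case: (ler0P x) => _; rewrite ?lerDr ?lerDl expR_ge0. Qed.

(** For n <= 3 one has |z|^n <= 28 exp(|z|), by cubing |z| / 3 <= exp(|z| / 3), so two exponential
    moments dominate. *)
Lemma L1_normal_poly s n (c : R) : s != 0 -> (n <= 3)%N -> 0 <= c ->
  L1 (N s) (fun z => `|z| ^+ n * expR (c * `|z|)).
Proof.
move=> s0 n3 c0; have c1 : 0 <= c + 1 by lra.
have hL : L1 (N s) (fun z => 28 * (expR ((c + 1) * z) + expR (- (c + 1) * z))).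
  apply: L1Z; apply: L1D; [have [] // := Ex_normal_expR (c + 1) s0|].
  by have [] := Ex_normal_expR (- (c + 1)) s0.
apply: L1_le hL => [|z].
  apply: measurable_funM; first by apply: measurable_funX; exact: normr_measurable.
  apply: measurableT_comp => //; apply: measurable_funM => //; exact: normr_measurable.
rewrite ger0_norm ?mulr_ge0 ?expR_ge0 ?exprn_ge0//.
have zn : `|z| ^+ n <= 28 * expR `|z|.
  have [z1|/ltW z1] := leP `|z| 1.
    rewrite (@le_trans _ _ 1)// ?exprn_ile1//.
    apply: (@le_trans _ _ (expR `|z|)); last by rewrite ler_peMl ?expR_ge0// ler1n.
    by rewrite (le_trans _ (expR_ge1Dx _))// lerDl.
  rewrite (@le_trans _ _ (`|z| ^+ 3)) ?ler_weXn2l//.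
  have -> : `|z| = 3%:R * (`|z| / 3) by field.
  rewrite expRM_natl exprMn -natrX ler_pM// ?exprn_ge0 ?divr_ge0//; first by rewrite ler_nat.
  rewrite lerXn2r// ?nnegrE ?expR_ge0 ?divr_ge0//.
  by rewrite (le_trans _ (expR_ge1Dx _))// lerDr.
apply: (@le_trans _ _ (28 * expR `|z| * expR (c * `|z|))).
  by rewrite ler_wpM2r// expR_ge0.
rewrite -mulrA ler_pM2l// -expRD (_ : `|z| + c * `|z| = `|(c + 1) * z|); last first.
  by rewrite normrM ger0_norm//; ring.
by rewrite (le_trans (expR_norm_le _))// mulNr.
Qed.

Lemma L1_normal_id s : s != 0 -> L1 (N s) id.
Proof.
move=> s0; apply: (L1_le _ _ (L1_normal_poly (n := 1) s0 isT (lexx 0))) => // z.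
by rewrite mul0r expR0 mulr1 expr1.
Qed.

Lemma L1_normal_sqr s : s != 0 -> L1 (N s) (fun z => z ^+ 2).
Proof.
move=> s0; apply: (L1_le _ _ (L1_normal_poly (n := 2) s0 isT (lexx 0))) => // z.
by rewrite mul0r expR0 mulr1 normrX.
Qed.

(** Identifies a Taylor coefficient: once the leading power of t is divided out, what remains is
    linear in t. *)
Lemma small_linear_eq0 (a K : R) : (forall t, 0 < t -> t <= 1 -> `|a| <= K * t) -> a = 0.
Proof.
move=> h; apply/eqP; rewrite -normr_eq0; apply: contraT => a0.
have ap : 0 < `|a| by rewrite lt_def a0 normr_ge0.
have K1 : `|a| <= K by rewrite -[K]mulr1 h.
have K0 : 0 < K by exact: lt_le_trans K1.
have t0 : 0 < `|a| / (2 * K) by rewrite divr_gt0// mulr_gt0.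
have t1 : `|a| / (2 * K) <= 1 by rewrite ler_pdivrMr ?mulr_gt0// mul1r; lra.
have := h _ t0 t1; rewrite (_ : K * (`|a| / (2 * K)) = `|a| / 2); last by field; rewrite gt_eqF.
by lra.
Qed.

Lemma exp_sum1 (v : R) : exp_sum 1 v = 1.
Proof. by rewrite /exp_sum big_ord_recr big_ord0 /= expr0 fact0 add0r divr1. Qed.

Lemma exp_sum2 (v : R) : exp_sum 2 v = 1 + v.
Proof.
by rewrite /exp_sum big_ord_recr -/(exp_sum 1 v) exp_sum1/= expr1 (_ : 1`! = 1%N)// divr1.
Qed.

Lemma exp_sum3 (v : R) : exp_sum 3 v = 1 + v + v ^+ 2 / 2.
Proof. by rewrite /exp_sum big_ord_recr -/(exp_sum 2 v) exp_sum2/= (_ : 2`! = 2%N). Qed.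

(** Compares the first-order expansions in t of both sides of E exp(t Z) = exp(t^2 s^2 / 2). For t
    <= 1 the factor exp(|t z|) is below exp(|z|), so the remainders are constants times t^2. *)
Lemma Ex_normal_id s : s != 0 -> Ex (N s) id = 0.
Proof.
move=> s0; pose K := Ex (N s) (fun z => `|z| ^+ 2 * expR (1 * `|z|)).
apply: (@small_linear_eq0 _ (K + s ^+ 2 * expR (s ^+ 2))) => t t0 t1.
have [hE EE] := Ex_normal_expR t s0.
have hid := L1_normal_id s0.
have hK := L1_normal_poly (n := 2) s0 isT ler01.
have s20 : 0 <= s ^+ 2 by exact: sqr_ge0.
have h1 : `|Ex (N s) (fun z => expR (t * z) - (1 + t * z))| <= t ^+ 2 * K.
  have hl : L1 (N s) (fun z => expR (t * z) - (1 + t * z)).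
    by apply: L1B => //; apply: L1D; [exact: L1_cst|exact: L1Z].
  rewrite (le_trans (Ex_norm hl))// -ExZ//; apply: Ex_le; [exact: L1_norm|exact: L1Z|].
  move=> z; have := expR_taylor 2 (t * z).
  rewrite exp_sum2 => /le_trans; apply.
  rewrite normrM (gtr0_norm t0) exprMn mulrC -mulrA ler_pM2l ?exprn_gt0//.
  by rewrite ler_wpM2l ?exprn_ge0// ler_expR mul1r ler_piMl.
have h2 : `|expR (t ^+ 2 * s ^+ 2 / 2) - 1| <= t ^+ 2 * (s ^+ 2 * expR (s ^+ 2)).
  have := expR_taylor 1 (t ^+ 2 * s ^+ 2 / 2).
  rewrite exp_sum1 expr1 => /le_trans; apply.
  have t21 : t ^+ 2 <= 1 by rewrite exprn_ile1// ltW.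
  have u0 : 0 <= t ^+ 2 * s ^+ 2 / 2 by rewrite divr_ge0// mulr_ge0// exprn_ge0// ltW.
  have us : t ^+ 2 * s ^+ 2 / 2 <= s ^+ 2.
    have : 0 <= (2 - t ^+ 2) * s ^+ 2 by rewrite mulr_ge0//; lra.
    lra.
  rewrite ger0_norm// mulrC mulrA; apply: ler_pM; rewrite ?expR_ge0 ?ler_expR//.
  by rewrite ler_pdivrMr// ler_peMr ?ler1n// mulr_ge0// exprn_ge0// ltW.
move: h1; rewrite ExB//; last by apply: L1D; [exact: L1_cst|exact: L1Z].
rewrite ExD ?ExZ ?Ex_cst ?EE//; [|exact: L1_cst|exact: L1Z].
set m := Ex _ _ => h1.
have : `|t * m| <= t ^+ 2 * (K + s ^+ 2 * expR (s ^+ 2)).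
  rewrite (_ : t * m = (expR (t ^+ 2 * s ^+ 2 / 2) - 1)
     - (expR (t ^+ 2 * s ^+ 2 / 2) - (1 + t * m))); last by ring.
  by rewrite (le_trans (ler_normB _ _))// mulrDr addrC lerD.
by rewrite normrM gtr0_norm// expr2 -mulrA ler_pM2l// mulrC.
Qed.

(** The same comparison one order further, now with the mean known to vanish; dividing by t^2 / 2
    puts the factor 2 into the constant. *)
Lemma Ex_normal_sqr s : s != 0 -> Ex (N s) (fun z => z ^+ 2) = s ^+ 2.
Proof.
move=> s0; pose K := Ex (N s) (fun z => `|z| ^+ 3 * expR (1 * `|z|)).
apply/eqP; rewrite -subr_eq0; apply/eqP.
apply: (@small_linear_eq0 _ (2 * (K + s ^+ 4 * expR (s ^+ 2)))) => t t0 t1.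
have [hE EE] := Ex_normal_expR t s0.
have hid := L1_normal_id s0.
have hsq := L1_normal_sqr s0.
have hK := L1_normal_poly (n := 3) s0 isT ler01.
have s20 : 0 <= s ^+ 2 by exact: sqr_ge0.
have hq : L1 (N s) (fun z => t ^+ 2 / 2 * z ^+ 2) by exact: L1Z.
have hlin : L1 (N s) (fun z => 1 + t * z) by apply: L1D; [exact: L1_cst|exact: L1Z].
have h1 : `|Ex (N s) (fun z => expR (t * z) - (1 + t * z + t ^+ 2 / 2 * z ^+ 2))| <= t ^+ 3 * K.
  have hl : L1 (N s) (fun z => expR (t * z) - (1 + t * z + t ^+ 2 / 2 * z ^+ 2)).
    by apply: L1B => //; apply: L1D.
  rewrite (le_trans (Ex_norm hl))// -ExZ//; apply: Ex_le; [exact: L1_norm|exact: L1Z|].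
  move=> z; have := expR_taylor 3 (t * z).
  rewrite exp_sum3 (_ : (t * z) ^+ 2 / 2 = t ^+ 2 / 2 * z ^+ 2); last by field.
  move=> /le_trans; apply.
  rewrite normrM (gtr0_norm t0) exprMn mulrC -mulrA ler_pM2l ?exprn_gt0//.
  by rewrite ler_wpM2l ?exprn_ge0// ler_expR mul1r ler_piMl.
have h2 : `|expR (t ^+ 2 * s ^+ 2 / 2) - (1 + t ^+ 2 * s ^+ 2 / 2)|
    <= t ^+ 3 * (s ^+ 4 * expR (s ^+ 2)).
  have := expR_taylor 2 (t ^+ 2 * s ^+ 2 / 2).
  rewrite exp_sum2 => /le_trans; apply.
  have t21 : t ^+ 2 <= 1 by rewrite exprn_ile1// ltW.
  have u0 : 0 <= t ^+ 2 * s ^+ 2 / 2 by rewrite divr_ge0// mulr_ge0// exprn_ge0// ltW.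
  have us : t ^+ 2 * s ^+ 2 / 2 <= s ^+ 2.
    have : 0 <= (2 - t ^+ 2) * s ^+ 2 by rewrite mulr_ge0//; lra.
    lra.
  rewrite ger0_norm// mulrC mulrA; apply: ler_pM; rewrite ?expR_ge0 ?ler_expR ?exprn_ge0//.
  rewrite (_ : (t ^+ 2 * s ^+ 2 / 2) ^+ 2 = t ^+ 3 * s ^+ 4 * (t / 4)); last by field.
  have s4 : 0 <= s ^+ 4.
    by rewrite -[4%N]/(2 + 2)%N exprD mulr_ge0.
  have t3 : 0 <= t ^+ 3 by rewrite exprn_ge0// ltW.
  by apply: ler_piMr; [exact: mulr_ge0|lra].
move: h1; rewrite ExB//; last by apply: L1D.
rewrite ExD// ExD ?ExZ ?Ex_cst ?EE//; [|exact: L1_cst|exact: L1Z].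
rewrite (Ex_normal_id s0) mulr0 addr0; set m := Ex _ _ => h1.
have : `|t ^+ 2 / 2 * (m - s ^+ 2)| <= t ^+ 3 * (K + s ^+ 4 * expR (s ^+ 2)).
  rewrite (_ : t ^+ 2 / 2 * (m - s ^+ 2) =
     (expR (t ^+ 2 * s ^+ 2 / 2) - (1 + t ^+ 2 * s ^+ 2 / 2))
     - (expR (t ^+ 2 * s ^+ 2 / 2) - (1 + t ^+ 2 / 2 * m))); last by field.
  by rewrite (le_trans (ler_normB _ _))// mulrDr addrC lerD.
have t2 : 0 < t ^+ 2 / 2 by rewrite divr_gt0// exprn_gt0.
rewrite normrM (gtr0_norm t2) (_ : t ^+ 3 * _ =
  t ^+ 2 / 2 * (2 * (K + s ^+ 4 * expR (s ^+ 2)) * t)); last by field.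
by rewrite ler_pM2l.
Qed.

(** [cube_le_expR] at z / s, together with the generating function at 1 / s and -1 / s, gives the
    constant 27 * 2 * exp(1/2). *)
Lemma Ex_normal_cube s : 0 < s -> L1 (N s) (fun z => `|z| ^+ 3) /\
  Ex (N s) (fun z => `|z| ^+ 3) <= 54 * expR (1 / 2) * s ^+ 3.
Proof.
move=> s0; have sn0 : s != 0 by rewrite gt_eqF.
have h3 : L1 (N s) (fun z => `|z| ^+ 3).
  apply: (L1_le _ _ (L1_normal_poly (n := 3) sn0 isT (lexx 0))) => //.
    by apply: measurable_funX; exact: normr_measurable.
  by move=> z; rewrite mul0r expR0 mulr1 ger0_norm ?exprn_ge0.
split=> //.
have [l1 E1] := Ex_normal_expR s^-1 sn0; have [l2 E2] := Ex_normal_expR (- s^-1) sn0.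
have hh : L1 (N s) (fun z => s ^+ 3 * (27 * (expR (s^-1 * z) + expR (- s^-1 * z)))).
  by do 2 apply: L1Z; exact: L1D.
apply: (@le_trans _ _ (Ex (N s) (fun z => s ^+ 3 * (27 * (expR (s^-1 * z) + expR (- s^-1 * z)))))).
  apply: Ex_le => // z; have := cube_le_expR (s^-1 * z).
  rewrite normrM gtr0_norm ?invr_gt0// exprMn exprVn mulNr.
  by move=> h; rewrite -ler_pdivrMl ?exprn_gt0.
rewrite ExZ; last by apply: L1Z; exact: L1D.
rewrite ExZ; last exact: L1D.
rewrite ExD// E1 E2 sqrrN exprVn mulVf ?expf_eq0//.
by rewrite le_eqVlt; apply/orP; left; apply/eqP; ring.
Qed.

(** Two factorisations of one joint density: y ~ N(0, s^2) with x given y ~ N(y, t^2), against x ~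
    N(0, r^2) with y given x normal about its regression x s^2 / r^2. *)
Lemma normal_pdf_conv s t x y : 0 < s -> 0 < t ->
  let r := Num.sqrt (s ^+ 2 + t ^+ 2) in
  phi s y * normal_pdf y t x = phi r x * normal_pdf (x * s ^+ 2 / r ^+ 2) (s * t / r) y.
Proof.
move=> s0 t0 r.
have st0 : 0 < s ^+ 2 + t ^+ 2 by rewrite addr_gt0// exprn_gt0.
have r0 : 0 < r by rewrite sqrtr_gt0.
have r2 : r ^+ 2 = s ^+ 2 + t ^+ 2 by rewrite sqr_sqrtr// ltW.
have q0 : 0 < s * t / r by rewrite divr_gt0// mulr_gt0.
rewrite !normal_pdfE ?gt_eqF//.
rewrite mulrACA [RHS]mulrACA; congr (_ * _).
  have pos (a : R) : 0 <= a ^+ 2 * pi *+ 2.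
    by rewrite mulrn_wge0// mulr_ge0 ?sqr_ge0 ?pi_ge0.
  have key : (s ^+ 2 * pi *+ 2) * (t ^+ 2 * pi *+ 2) =
      (r ^+ 2 * pi *+ 2) * ((s * t / r) ^+ 2 * pi *+ 2).
    rewrite !mulr2n; move: (pi : R) => p.
    have rn : r != 0 by rewrite gt_eqF.
    clear -rn; field; exact: rn.
  by rewrite /normal_peak -!invfM -(sqrtrM _ (pos s)) -(sqrtrM _ (pos r)) key.
rewrite /normal_fun -!expRD subr0.
have -> // : - (y ^+ 2) / (s ^+ 2 *+ 2) + - (x - y) ^+ 2 / (t ^+ 2 *+ 2) =
   - (x ^+ 2) / (r ^+ 2 *+ 2) +
   - (y - x * s ^+ 2 / r ^+ 2) ^+ 2 / ((s * t / r) ^+ 2 *+ 2).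
  have sn : s != 0 by rewrite gt_eqF.
  have tn : t != 0 by rewrite gt_eqF.
  have rn : s ^+ 2 + t ^+ 2 != 0 by rewrite gt_eqF.
  rewrite !mulr2n expr_div_n r2; clear -sn tn rn.
  by field; rewrite -!mulr2n !mulrn_eq0 !expf_eq0/= mulf_eq0 (negbTE sn) (negbTE tn) (negbTE rn).
by rewrite subr0.
Qed.

Definition gauss_avg s (f : R -> R) x : R := Ex (N s) (fun z => f (x + z)).

Lemma measurable_gauss_avg s (f : R -> R) (M : R) : measurable_fun setT f -> (forall x, `|f x| <= M) ->
  measurable_fun setT (gauss_avg s f).
Proof.
move=> mf fM.
(* Adding [M] makes the integrand nonnegative, so Tonelli's theorem provides measurability in x. *)
pose F := fun xz : R * R => (f (xz.1 + xz.2) + M)%:E.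
have mF : measurable_fun setT F.
  apply/measurable_EFinP; apply: measurable_funD => //.
  by apply: (measurableT_comp mf); exact: measurable_funD.
have F0 xz : (0 <= F xz)%E.
  by rewrite lee_fin -lerBlDr sub0r; have := fM (xz.1 + xz.2); rewrite ler_norml => /andP[].
have mG := @measurable_fun_fubini_tonelli_F _ _ _ _ R (N s) F mF F0.
have hf x : L1 (N s) (fun z => f (x + z)).
  by apply: (L1_bd (N s) _ (fun z => fM (x + z))); apply: (measurableT_comp mf); exact: measurable_funD.
have E : EFin \o (fun x => gauss_avg s f x + M) = fubini_F (N s) F.
  apply/funext => x /=; rewrite /fubini_F /F /gauss_avg /= -[M](Ex_cst (N s)) -ExD//; last exact: L1_cst.
  by rewrite -Ex_fin ?Ex_cst//; apply: L1D => //; exact: L1_cst.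
have mM : measurable_fun setT (fun x => gauss_avg s f x + M).
  by apply/measurable_EFinP; rewrite E.
rewrite (_ : gauss_avg s f = fun x => (gauss_avg s f x + M) - M).
  exact: measurable_funB.
by apply/funext => x; rewrite addrK.
Qed.

(** After a change of variable the two densities are exchanged by [normal_pdf_conv]; the conditional
    density of the first shift given the total then integrates to 1. *)
Lemma gauss_avg_comp s t (f : R -> R) : 0 < s -> 0 < t -> continuous f -> (forall x, 0 <= f x <= 1) ->
  gauss_avg s (gauss_avg t f) = gauss_avg (Num.sqrt (s ^+ 2 + t ^+ 2)) f.
Proof.
move=> s0 t0 cf f01; set r := Num.sqrt _.
have mf : measurable_fun setT f by exact: continuous_measurable_fun.
have fM x : `|f x| <= 1 by have /andP[? ?] := f01 x; rewrite ger0_norm.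
have f0 x : 0 <= f x by have /andP[] := f01 x.
have r0 : 0 < r by rewrite sqrtr_gt0 addr_gt0// exprn_gt0.
have mfx x : measurable_fun setT (fun z => f (x + z)).
  by apply: (measurableT_comp mf); exact: measurable_funD.
have hfx u x : L1 (N u) (fun z => f (x + z)) by apply: (L1_bd (N u) (mfx x) (fun z => fM (x + z))).
have gE u x : (gauss_avg u f x)%:E = (\int[mu]_z (f (x + z) * phi u z)%:E)%E.
  rewrite /gauss_avg -Ex_fin// ge0_integral_normal//.
  - exact/measurable_EFinP.
  - by move=> z; rewrite lee_fin.
have shiftE x y : (gauss_avg t f (x + y))%:E = (\int[mu]_z (f (x + z) * normal_pdf y t z)%:E)%E.
  rewrite gE (@increasing_ge0_integration_by_substitutionT R (fun z : R => z + y)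
    (fun z => f (x + z) * normal_pdf y t z)).
  - apply: eq_integral => z _; congr EFin.
    transitivity (f (x + (z + y)) * normal_pdf y t (z + y) *
      ((fun z => z + y)^`()%classic : R -> R) z); last by [].
    have -> : ((fun z => z + y)^`()%classic : R -> R) = cst 1.
      by apply/funext => u; rewrite derive1E deriveD// derive_id derive_cst addr0.
    rewrite /= mulr1; congr (f _ * _); first by ring.
    by rewrite !normal_pdfE ?gt_eqF// /normal_fun subr0 addrK.
  - by move=> a b ab; rewrite ltrD2r.
  - have -> : ((fun z => z + y)^`()%classic : R -> R) = cst 1.
      by apply/funext => u; rewrite derive1E deriveD// derive_id derive_cst addr0.
    by move=> u; exact: cvg_cst.
  - have -> : ((fun z => z + y)^`()%classic : R -> R) = cst 1.
      by apply/funext => u; rewrite derive1E deriveD// derive_id derive_cst addr0.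
    exact: is_cvg_cst.
  - have -> : ((fun z => z + y)^`()%classic : R -> R) = cst 1.
      by apply/funext => u; rewrite derive1E deriveD// derive_id derive_cst addr0.
    exact: is_cvg_cst.
  - by move=> u; apply: derivableD.
  - exact: cvg_addrr_Ny.
  - exact: cvg_addrr.
  - move=> u; apply: cvgM.
      by apply: continuous_comp; [apply: cvgD; [exact: cvg_cst|exact: cvg_id]|exact: cf].
    by apply: continuous_normal_pdf; rewrite gt_eqF.
  - by move=> u; rewrite mulr_ge0 ?normal_pdf_ge0.
apply/funext => x; apply: EFin_inj.
have mT : measurable_fun setT (fun z => gauss_avg t f (x + z)).
  by apply: (measurableT_comp (measurable_gauss_avg t mf fM)); exact: measurable_funD.
have T0 y : 0 <= gauss_avg t f y by apply: Ex_ge0.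
have T1 y : `|gauss_avg t f y| <= 1 by exact: (Ex_norm_le (hfx t y) (fun z => fM (y + z))).
have lT : L1 (N s) (fun z => gauss_avg t f (x + z)) by exact: (L1_bd (N s) mT (fun y => T1 (x + y))).
transitivity (\int[N s]_z (gauss_avg t f (x + z))%:E)%E; first exact: esym (Ex_fin lT).
rewrite ge0_integral_normal; [|exact/measurable_EFinP|by move=> y; rewrite lee_fin].
transitivity (\int[mu]_y \int[mu]_z (f (x + z) * (phi s y * normal_pdf y t z))%:E)%E.
  apply: eq_integral => y _; rewrite shiftE -ge0_integralZr//.
  - by apply: eq_integral => z _; rewrite -EFinM; congr EFin; ring.
  - by apply/measurable_EFinP; apply: measurable_funM; [exact: mfx|exact: measurable_normal_pdf].
  - by move=> z _; rewrite lee_fin mulr_ge0 ?normal_pdf_ge0.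
  - by rewrite lee_fin normal_pdf_ge0.
have mpdf2 : measurable_fun setT (fun yz : R * R => normal_pdf yz.1 t yz.2).
  rewrite (_ : (fun yz : R * R => normal_pdf yz.1 t yz.2) = (fun yz => phi t (yz.2 - yz.1))).
    by apply: measurableT_comp; [exact: measurable_normal_pdf|exact: measurable_funB].
  by apply/funext => yz; rewrite !normal_pdfE ?gt_eqF// /normal_fun subr0.
rewrite (@fubini_tonelli _ _ _ _ R mu mu (fun yz : R * R =>
   (f (x + yz.2) * (phi s yz.1 * normal_pdf yz.1 t yz.2))%:E)); last 2 first.
- apply/measurable_EFinP; apply: measurable_funM; first by apply: (measurableT_comp (mfx x)).
  apply: measurable_funM => //.
  by apply: measurableT_comp; [exact: measurable_normal_pdf|].
- by move=> yz; rewrite lee_fin !mulr_ge0 ?normal_pdf_ge0.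
rewrite gE; apply: eq_integral => z _ /=.
transitivity (\int[mu]_y ((f (x + z) * phi r z)%:E * (normal_pdf (z * s ^+ 2 / r ^+ 2) (s * t / r) y)%:E))%E.
  apply: eq_integral => y _; rewrite -EFinM; congr EFin.
  by rewrite (normal_pdf_conv _ _ s0 t0) mulrA.
rewrite ge0_integralZl//.
- by rewrite integral_normal_pdf mule1.
- by apply/measurable_EFinP; exact: measurable_normal_pdf.
- by move=> y _; rewrite lee_fin normal_pdf_ge0.
- by rewrite lee_fin mulr_ge0 ?normal_pdf_ge0.
Qed.

End gaussian.

(** * Replacement of observations by normal smoothing *)

Section lindeberg.
Context {R : realType}.
Notation N s := (normal_prob (0 : R) s : probability (measurableTypeR R) R).

Lemma smooth2_gauss_avg (s M : R) (f f1 f2 : R -> R) : smooth2 M f f1 f2 ->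
  smooth2 M (gauss_avg s f) (gauss_avg s f1) (gauss_avg s f2).
Proof.
move=> [m0 m1 m2 bd tay].
have b0 x : `|f x| <= M by case: (bd x).
have b1 x : `|f1 x| <= M by case: (bd x).
have b2 x : `|f2 x| <= M by case: (bd x).
have lg (g : R -> R) x : measurable_fun setT g -> (forall x, `|g x| <= M) ->
    L1 (N s) (fun z => g (x + z)).
  move=> mg gM; apply: (L1_bd (N s) _ (fun z => gM (x + z))).
  by apply: (measurableT_comp mg); exact: measurable_funD.
split.
- exact: measurable_gauss_avg m0 b0.
- exact: measurable_gauss_avg m1 b1.
- exact: measurable_gauss_avg m2 b2.
- move=> x; split.
  + exact: (Ex_norm_le (lg _ x m0 b0) (fun z => b0 (x + z))).
  + exact: (Ex_norm_le (lg _ x m1 b1) (fun z => b1 (x + z))).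
  + exact: (Ex_norm_le (lg _ x m2 b2) (fun z => b2 (x + z))).
move=> x h; have l0 y := lg _ y m0 b0; have l1 := lg _ x m1 b1; have l2 := lg _ x m2 b2.
have E : gauss_avg s f (x + h) - gauss_avg s f x - gauss_avg s f1 x * h -
    gauss_avg s f2 x * h ^+ 2 / 2 =
    Ex (N s) (fun z => f (x + h + z) - f (x + z) - h * f1 (x + z) - h ^+ 2 / 2 * f2 (x + z)).
  rewrite ExB; [|by apply: L1B; [exact: L1B|exact: L1Z]|exact: L1Z].
  rewrite ExB; [|exact: L1B|exact: L1Z].
  by rewrite ExB// !ExZ// /gauss_avg; ring.
rewrite E; apply: Ex_norm_le.
  by apply: L1B; [apply: L1B; [exact: L1B|exact: L1Z]|exact: L1Z].
move=> z; have := tay (x + z) h; rewrite (_ : x + z + h = x + h + z); last by ring.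
by rewrite (mulrC (f1 _)) (_ : f2 (x + z) * h ^+ 2 / 2 = h ^+ 2 / 2 * f2 (x + z))//; ring.
Qed.

Lemma L1_rem d (T : measurableType d) (P : probability T R) (xi : T -> R) :
  measurable_fun setT xi -> L1 P (fun z => xi z ^+ 2) -> L1 P (fun z => rem (xi z)).
Proof.
move=> mx; apply: L1_le; first exact: (measurableT_comp measurable_rem).
by move=> z; rewrite ger0_norm ?rem_ge0// /rem ge_min lexx.
Qed.

(** A zero mean removes the first-order term, and the comparison value depends on the law of [xi]
    only through its variance. Two such laws with equal variance are thus interchangeable up to
    remainders. *)
Lemma smooth2_one_step d (T : measurableType d) (P : probability T R) (xi : T -> R)
    (M : R) f f1 f2 x : smooth2 M f f1 f2 -> L1 P xi -> L1 P (fun z => xi z ^+ 2) ->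
  Ex P xi = 0 ->
  `|Ex P (fun z => f (x + xi z)) - f x - f2 x * Ex P (fun z => xi z ^+ 2) / 2|
     <= M * Ex P (fun z => rem (xi z)).
Proof.
move=> [m0 m1 m2 bd tay] hx hx2 x0.
have mx := L1_meas hx.
have l0 : L1 P (fun z => f (x + xi z)).
  apply: (@L1_bd _ _ _ _ _ M); last by move=> z; case: (bd (x + xi z)).
  by apply: (measurableT_comp m0); exact: measurable_funD.
have lr := L1_rem mx hx2.
pose g z := f (x + xi z) - f x - f1 x * xi z - f2 x / 2 * xi z ^+ 2.
have lc : L1 P (fun=> f x) by exact: L1_cst.
have lg : L1 P g.
  by apply: L1B; [apply: L1B; [exact: L1B|exact: L1Z]|exact: L1Z].
have -> : Ex P (fun z => f (x + xi z)) - f x - f2 x * Ex P (fun z => xi z ^+ 2) / 2 = Ex P g.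
  rewrite /g ExB; [|by apply: L1B; [exact: L1B|exact: L1Z]|exact: L1Z].
  rewrite ExB; [|exact: L1B|exact: L1Z].
  by rewrite ExB// Ex_cst !ExZ// x0; ring.
rewrite (le_trans (Ex_norm lg))// -ExZ//; apply: Ex_le; [exact: L1_norm|exact: L1Z|].
by move=> z; have := tay x (xi z); rewrite /g (_ : f2 x * xi z ^+ 2 / 2 = f2 x / 2 * xi z ^+ 2)//; ring.
Qed.

Section swap.
Context {d : measure_display} {O : measurableType d}.
Variables (Q : probability O R) (n : nat) (S : probability (n.-tuple O) R).
Hypothesis S_iid : iid Q S.
Variables (xi : O -> R) (s : R).
Hypotheses (hx : L1 Q xi) (hx2 : L1 Q (fun z => xi z ^+ 2)) (x0 : Ex Q xi = 0).
Hypotheses (s0 : s != 0) (xs : Ex Q (fun z => xi z ^+ 2) = s ^+ 2).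

(** [iter k (gauss_avg s) f x] stands for the expectation with k normal summands. The induction
    generalises over the test function: the normal that replaces an observation is absorbed into
    [gauss_avg s f], which stays in the class with the same [M]. *)
Lemma lindeberg_swap k (M : R) f f1 f2 x : (k <= n)%N -> smooth2 M f f1 f2 ->
  `|Ex S (fun w => f (x + \sum_(i < n | (i < k)%N) xi (tnth w i))) -
    iter k (gauss_avg s) f x|
  <= k%:R * (M * Ex Q (fun z => rem (xi z)) + M * Ex (N s) (fun z => rem z)).
Proof.
elim: k M f f1 f2 x => [|k ih] M f f1 f2 x kn sf.
  rewrite /= mul0r (_ : (fun w => _) = cst (f x)) ?Ex_cst ?subrr ?normr0//.
  by apply/funext => w; rewrite big_pred0// addr0.
pose i0 := Ordinal kn; set err := (X in _ * X).
pose sk k (w : n.-tuple O) := \sum_(i < n | (i < k)%N) xi (tnth w i).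
have [m0 _ _ bd _] := sf.
have fM y : `|f y| <= M by case: (bd y).
have msk j : measurable_fun setT (sk j).
  apply: measurable_fun_sum => i _; apply: measurableT_comp; last exact: measurable_tnth.
  exact: L1_meas hx.
have skS w z : sk k.+1 (upd i0 (z, w)) = sk k w + xi z.
  rewrite /sk (bigD1 i0)/=; last by rewrite ltnS.
  rewrite tnth_upd_eq addrC; congr (_ + _); apply: eq_big => [i|i /andP[_ ii0]].
    by rewrite ltnS [RHS]ltn_neqAle andbC.
  by rewrite tnth_upd_neq.
have lF : L1 S (fun w => f (x + sk k.+1 w)).
  apply: (L1_bd S _ (fun w => fM _)).
  by apply: (measurableT_comp m0); exact: measurable_funD.
have lz y : L1 Q (fun z => f (y + xi z)).
  apply: (L1_bd Q _ (fun w => fM _)).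
  by apply: (measurableT_comp m0); apply: measurable_funD => //; exact: L1_meas hx.
have [|lH EH] := @Ex_resample _ _ _ Q n S S_iid i0 (fun w => f (x + sk k.+1 w))
    (fun w => Ex Q (fun z => f (x + sk k w + xi z))) lF.
  by move=> w; rewrite -Ex_fin//; apply: eq_integral => z _; rewrite skS addrA.
have stf := smooth2_gauss_avg s sf.
have step y : `|Ex Q (fun z => f (y + xi z)) - gauss_avg s f y| <= err.
  have h1 := smooth2_one_step y sf hx hx2 x0.
  have h2 := smooth2_one_step y sf (L1_normal_id s0) (L1_normal_sqr s0) (Ex_normal_id s0).
  rewrite Ex_normal_sqr// -xs -/(gauss_avg s f y) in h2.
  rewrite (_ : _ - _ = (Ex Q (fun z => f (y + xi z)) - f y - f2 y * Ex Q (fun z => xi z ^+ 2) / 2)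
    - (gauss_avg s f y - f y - f2 y * Ex Q (fun z => xi z ^+ 2) / 2)); last by ring.
  by rewrite (le_trans (ler_normB _ _))// lerD.
have [mt _ _ bt _] := stf.
have lT : L1 S (fun w => gauss_avg s f (x + sk k w)).
  apply: (@L1_bd _ _ _ _ _ M); last by move=> w; case: (bt (x + sk k w)).
  by apply: (measurableT_comp mt); exact: measurable_funD.
rewrite -/(sk k.+1) EH iterSr.
rewrite (_ : _ - _ = (Ex S (fun w => Ex Q (fun z => f (x + sk k w + xi z)))
    - Ex S (fun w => gauss_avg s f (x + sk k w)))
    + (Ex S (fun w => gauss_avg s f (x + sk k w)) - iter k (gauss_avg s) (gauss_avg s f) x));
  last by ring.
rewrite (le_trans (ler_normD _ _))// -natr1 mulrDl mul1r addrC lerD//.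
  exact: (ih M _ _ _ x (ltnW kn) stf).
rewrite -ExB//; apply: Ex_norm_le; first exact: L1B.
by move=> w; exact: step.
Qed.

End swap.

Let sqrt_step (s m : R) : 0 < s -> 0 < m -> 0 < Num.sqrt m * s /\
  Num.sqrt (s ^+ 2 + (Num.sqrt m * s) ^+ 2) = Num.sqrt (m + 1) * s.
Proof.
move=> s0 m0; split; first by rewrite mulr_gt0// sqrtr_gt0.
have -> : s ^+ 2 + (Num.sqrt m * s) ^+ 2 = (m + 1) * s ^+ 2.
  by rewrite (exprMn _ (Num.sqrt m)) sqr_sqrtr ?ltW//; ring.
by rewrite sqrtrM ?sqrtr_sqr ?gtr0_norm// addr_ge0// ltW.
Qed.

Lemma iter_gauss_avg (s : R) k (f : R -> R) : 0 < s -> continuous f ->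
  (forall x, 0 <= f x <= 1) ->
  (0 < k)%N -> iter k (gauss_avg s) f = gauss_avg (Num.sqrt k%:R * s) f.
Proof.
case: k => [_ _ _ //|k s0 cf f01 _]; elim: k => [|k ih]; first by rewrite /= sqrtr1 mul1r.
have [u0 E] := sqrt_step s0 (ltr0Sn R k).
have Ec := gauss_avg_comp s0 u0 cf f01; move: ih; clear cf f01 u0 => ih.
rewrite E natr1 in Ec; rewrite iterS ih; exact: Ec.
Qed.

End lindeberg.

(** * The limit for smooth test functions *)

Section clt.
Context {R : realType} {d : nat -> measure_display} {O : forall n, measurableType (d n)}.
Variables (Q : forall n, probability (O n) R) (S : forall n, probability (n.-tuple (O n)) R).
Hypothesis S_iid : forall n, (0 < n)%N -> iid (Q n) (S n).
Variable zeta : forall n, O n -> R.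
Hypothesis zetaP : forall n, (0 < n)%N -> [/\ L1 (Q n) (zeta (n := n)),
  Ex (Q n) (zeta (n := n)) = 0 & Ex (Q n) (fun z => zeta z ^+ 2) = 1].
Hypothesis zeta_ui : unif_int Q (fun n z => zeta z ^+ 2).
Notation N s := (normal_prob (0 : R) s : probability (measurableTypeR R) R).

Let W n (w : n.-tuple (O n)) := Num.sqrt n%:R * avg w (zeta (n := n)).

(** With r = n^(-1/2): where zeta^2 > A the quadratic branch sums to the excess of zeta^2, and
    elsewhere the cubic branch gains a factor sqrt(A) r. *)
Lemma lindeberg_cond e : 0 < e -> \forall n \near \oo,
  n%:R * Ex (Q n) (fun z => rem ((Num.sqrt n%:R)^-1 * zeta z)) <= e.
Proof.
move=> e0; have e2 : 0 < e / 2 by rewrite divr_gt0.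
have [A A0 hA] := zeta_ui e2.
have := @invn_sqrt_cvg R => /cvgrPdist_le.
have eA : 0 < e / 2 / (Num.sqrt A + 1) by rewrite !divr_gt0// ltr_wpDl ?sqrtr_ge0.
move=> /(_ _ eA); apply: filterS2 (nbhs_infty_gt 0) => n n0.
rewrite sub0r normrN; set r := (Num.sqrt n%:R)^-1.
have nR : (0 : R) < n%:R by rewrite ltr0n.
have r0 : 0 < r by rewrite invr_gt0 sqrtr_gt0.
have nr2 : n%:R * r ^+ 2 = 1 by rewrite exprVn sqr_sqrtr ?ltW// divff// gt_eqF.
rewrite gtr0_norm// => rA.
have [hl2 hE] := hA _ n0; have [hz z0 z1] := zetaP n0.
have mz := L1_meas hz.
have hex : L1 (Q n) (fun z => `|excess A (fun z : O n => zeta z ^+ 2) z|).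
  apply: L1_norm; apply: (L1_le _ _ (L1_norm hl2)); last exact: excess_le.
  by apply: measurable_excess; exact: measurable_funX.
have hr2 : L1 (Q n) (fun z => (r * zeta z) ^+ 2).
  by under eq_fun do rewrite exprMn; exact: L1Z.
have hrem : L1 (Q n) (fun z => rem (r * zeta z)).
  by apply: L1_rem => //; exact: measurable_funM.
rewrite -ExZ//.
apply: (@le_trans _ _ (Ex (Q n) (fun z => `|excess A (fun z : O n => zeta z ^+ 2) z|
    + (Num.sqrt A * r) * zeta z ^+ 2))).
  apply: Ex_le; [exact: L1Z|by apply: L1D => //; exact: L1Z|].
  move=> z; rewrite /excess (ger0_norm (sqr_ge0 _)); case: ltP => [Az|zA].
    rewrite ger0_norm ?sqr_ge0//.
    apply: (@le_trans _ _ (zeta z ^+ 2)); last first.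
      rewrite lerDl; apply: mulr_ge0; last exact: sqr_ge0.
      by apply: mulr_ge0; [exact: sqrtr_ge0|exact: ltW].
    apply: (@le_trans _ _ (n%:R * (r * zeta z) ^+ 2)).
      by rewrite ler_pM2l// /rem ge_min lexx.
    by rewrite exprMn mulrA nr2 mul1r.
  rewrite normr0 add0r.
  apply: (@le_trans _ _ (n%:R * `|r * zeta z| ^+ 3)).
    by rewrite ler_pM2l// /rem ge_min lexx orbT.
  rewrite normrM gtr0_norm// (_ : n%:R * _ = (n%:R * r ^+ 2) * r * `|zeta z| * `|zeta z| ^+ 2); last by ring.
  rewrite nr2 mul1r real_normK ?num_real// ler_wpM2r ?sqr_ge0// mulrC ler_wpM2r ?(ltW r0)//.
  by rewrite -sqrtr_sqr ler_wsqrtr.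
rewrite ExD//; last exact: L1Z.
rewrite ExZ// z1 mulr1 (_ : e = e / 2 + e / 2); last by lra.
rewrite lerD//; apply: (@le_trans _ _ ((Num.sqrt A + 1) * r)).
  by rewrite ler_wpM2r ?(ltW r0)// lerDl.
by rewrite mulrC -ler_pdivlMr// ltr_wpDl ?sqrtr_ge0.
Qed.

(** The observations contribute the Lindeberg sum; the n normal summands contribute n r^3 = r up to
    a constant, by their third absolute moments. *)
Lemma clt_smooth (M : R) f f1 f2 : smooth2 M f f1 f2 -> continuous f ->
  (forall x, 0 <= f x <= 1) -> forall e, 0 < e ->
  \forall n \near \oo, `|Ex (S n) (fun w => f (W w)) - Ex (N 1) f| <= e.
Proof.
move=> sf cf f01 e e0.
have M0 : 0 <= M by have [_ _ _ /(_ 0) [h _ _] _] := sf; exact: le_trans h.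
have M1 : 0 < M + 1 by lra.
have eM : 0 < e / 2 / (M + 1) by rewrite !divr_gt0.
pose K : R := 54 * expR (1 / 2).
have K0 : 0 < K by rewrite mulr_gt0 ?expR_gt0.
have eK : 0 < e / 2 / ((M + 1) * K) by rewrite !divr_gt0// mulr_gt0.
have := @invn_sqrt_cvg R => /cvgrPdist_le.
move=> /(_ _ eK); apply: filterS3 (nbhs_infty_gt 0) (lindeberg_cond eM) => n n0 hrem.
rewrite sub0r normrN; set r := (Num.sqrt n%:R)^-1.
have nR : (0 : R) < n%:R by rewrite ltr0n.
have r0 : 0 < r by rewrite invr_gt0 sqrtr_gt0.
have nr2 : n%:R * r ^+ 2 = 1 by rewrite exprVn sqr_sqrtr ?ltW// divff// gt_eqF.
have nr1 : Num.sqrt n%:R * r = 1 by rewrite divff// gt_eqF// sqrtr_gt0.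
rewrite gtr0_norm// => rK.
have [hz z0 z1] := zetaP n0.
have [A _ /(_ _ n0) [hz2 _]] := zeta_ui (@ltr01 R).
have hr2 : L1 (Q n) (fun z => (r * zeta z) ^+ 2).
  by under eq_fun do rewrite exprMn; exact: L1Z.
have E2 : Ex (Q n) (fun z => (r * zeta z) ^+ 2) = r ^+ 2.
  rewrite (_ : (fun z => _) = (fun z => r ^+ 2 * zeta z ^+ 2)).
    by rewrite ExZ// z1 mulr1.
  by apply/funext => z; rewrite exprMn.
have E1 : Ex (Q n) (fun z => r * zeta z) = 0 by rewrite ExZ// z0 mulr0.
have rn0 : r != 0 by rewrite gt_eqF.
have := lindeberg_swap (S_iid n0) (L1Z r hz) hr2 E1 rn0 E2 0 (leqnn n) sf.
have -> : (fun w : n.-tuple (O n) => f (0 + \sum_(i < n | (i < n)%N) r * zeta (tnth w i))) =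
    (fun w => f (W w)).
  apply/funext => w; congr f; rewrite add0r /W /avg (eq_bigl xpredT); last by move=> i; rewrite ltn_ord.
  have ninv : n%:R^-1 = r ^+ 2 by rewrite exprVn sqr_sqrtr ?ltW.
  by rewrite -mulr_sumr ninv expr2 !mulrA nr1 mul1r.
have -> : iter n (gauss_avg r) f 0 = Ex (N 1) f.
  rewrite (iter_gauss_avg r0 cf f01 n0) nr1 /gauss_avg.
  by congr Ex; apply/funext => z; rewrite add0r.
move=> /le_trans; apply.
rewrite mulrDr (_ : e = e / 2 + e / 2); last by lra.
apply: lerD.
  rewrite mulrCA; apply: (@le_trans _ _ (M * (e / 2 / (M + 1)))); first by rewrite ler_wpM2l.
  rewrite mulrA ler_pdivrMr// mulrC; apply: ler_wpM2l; first by rewrite ltW// divr_gt0.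
  by lra.
have [l3 E3] := Ex_normal_cube r0.
have remle : Ex (N r) (fun z => rem z) <= K * r ^+ 3.
  apply: (le_trans _ E3); apply: Ex_le => //.
    by apply: (@L1_rem _ _ _ (N r) id) => //; exact: L1_normal_sqr.
  by move=> z; rewrite /rem ge_min lexx orbT.
apply: (@le_trans _ _ (n%:R * (M * (K * r ^+ 3)))).
  by rewrite ler_pM2l// ler_wpM2l.
rewrite (_ : n%:R * _ = (n%:R * r ^+ 2) * (M * K * r)); last by ring.
rewrite nr2 mul1r; apply: (@le_trans _ _ ((M + 1) * K * r)).
  by rewrite ler_wpM2r ?(ltW r0)// ler_wpM2r ?(ltW K0)//; lra.
by rewrite mulrC -ler_pdivlMr// mulr_gt0.
Qed.

End clt.

(** * From smooth test functions to distribution functions *)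

Section clt_distribution.
Context {R : realType}.
Notation N s := (normal_prob (0 : R) s : probability (measurableTypeR R) R).

Lemma Ex_indic d (T : measurableType d) (P : probability T R) (A : set T) : measurable A ->
  L1 P (\1_A) /\ Ex P (\1_A) = fine (P A).
Proof.
move=> mA; split; first exact: integrable_indic.
by rewrite /Ex /Rintegral integral_indic// setIT.
Qed.

Lemma logistic_anti : {homo @logistic R : x y / x <= y >-> y <= x}.
Proof.
move=> x y xy; rewrite /logistic lef_pV2 ?posrE ?addr_gt0 ?expR_gt0//.
by rewrite lerD2l ler_expR.
Qed.

Lemma logistic_tail (x : R) : logistic x <= expR (- x) /\ 1 - logistic x <= expR x.
Proof.
have e0 := expR_gt0 x; split.
  by rewrite /logistic expRN lef_pV2 ?posrE ?addr_gt0// lerDr.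
rewrite /logistic (_ : 1 - _ = expR x / (1 + expR x)); last by field; rewrite gt_eqF// addr_gt0.
by rewrite ler_pdivrMr ?addr_gt0// ler_peMr ?(ltW e0)// lerDl ltW.
Qed.

(** At distance at least eta from b, the rescaled logistic function is within exp(-k eta) of the
    indicator of Y <= b. *)
Lemma logistic_sandwich d (T : measurableType d) (P : probability T R) (Y : T -> R)
    (b eta k : R) : measurable_fun setT Y -> 0 <= eta -> 0 <= k ->
  fine (P [set w | Y w <= b - eta]) - expR (- (k * eta)) <=
    Ex P (fun w => logistic (k * (Y w - b))) <=
  fine (P [set w | Y w <= b + eta]) + expR (- (k * eta)).
Proof.
move=> mY eta0 k0; have lb := @logistic_bounds R.
have ml : measurable_fun setT (@logistic R).
  apply: continuous_measurable_fun => x; apply: differentiable_continuous.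
  by apply/derivable1_diffP; case: (is_derive_logistic x).
have mf : measurable_fun setT (fun w => logistic (k * (Y w - b))).
  by apply: (measurableT_comp ml); apply: measurable_funM => //; exact: measurable_funB.
have lf : L1 P (fun w => logistic (k * (Y w - b))).
  by apply: (@L1_bd _ _ _ _ _ 1) => // w; have /andP[h1 h2] := lb (k * (Y w - b));
    rewrite gtr0_norm// ltW.
have mA c : measurable [set w | Y w <= c] by apply: (measurable_setle mY).
apply/andP; split.
  have [l1 <-] := Ex_indic P (mA (b - eta)).
  rewrite -[X in _ - X](Ex_cst P) -ExB//; last exact: L1_cst.
  apply: Ex_le => //; first by apply: L1B => //; exact: L1_cst.
  move=> w; rewrite indicE; case: (boolP (w \in _)) => [|_]; last first.
    rewrite sub0r; have /andP[h1 _] := lb (k * (Y w - b)).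
    by rewrite (le_trans _ (ltW h1))// oppr_le0 expR_ge0.
  rewrite inE/= => Yb; have [_ h] := logistic_tail (- (k * eta)).
  apply: (@le_trans _ _ (logistic (- (k * eta)))); first by lra.
  by apply: logistic_anti; rewrite -mulrN ler_wpM2l//; lra.
have [l1 <-] := Ex_indic P (mA (b + eta)).
rewrite -[X in _ + X](Ex_cst P) -ExD//; last exact: L1_cst.
apply: Ex_le => //; first by apply: L1D => //; exact: L1_cst.
move=> w; rewrite indicE; case: (boolP (w \in _)) => [_|].
  by have /andP[_ h1] := lb (k * (Y w - b)); rewrite (le_trans (ltW h1))// lerDl expR_ge0.
rewrite notin_setE/= => /negP; rewrite -ltNge => Yb; rewrite add0r.
have [h _] := logistic_tail (k * eta); apply: le_trans h.
by apply: logistic_anti; rewrite ler_wpM2l//; lra.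
Qed.

(** The peak 1 / sqrt(2 pi) of the density is below 1. *)
Lemma Phi_lipschitz (a h : R) : 0 <= h -> Phi (a + h) <= Phi a + h.
Proof.
move=> h0; rewrite /Phi -lerBlDl -lee_fin EFinB.
have s0 : (1 : R) != 0 by rewrite oner_neq0.
have fin A : measurable A -> (N 1 A \is a fin_num) by move=> mA; exact: fin_num_measure.
rewrite !fineK ?fin//.
have -> : `]-oo, a + h]%classic = `]-oo, a]%classic `|` `]a, a + h]%classic.
  apply/seteqP; split => x /=; rewrite !in_itv/=.
    by move=> xah; have [xa|ax] := leP x a; [left|right].
  by move=> [xa|/andP[]//]; rewrite (le_trans xa)// lerDl.
have := @measureU _ _ _ (N 1) `]-oo, a]%classic `]a, a + h]%classic.
move=> ->//; last first.
  apply/seteqP; split => // x /= []; rewrite !in_itv/= => xa /andP[ax _].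
  by have := lt_le_trans ax xa; rewrite ltxx.
rewrite addeAC subee ?fin// add0e /normal_prob.
apply: (@le_trans _ _ (\int[lebesgue_measure]_(x in `]a, (a + h)%R]) cst 1%E x)%E).
  apply: ge0_le_integral => //.
  - by move=> x _; rewrite lee_fin normal_pdf_ge0.
  - by apply/measurable_EFinP; apply: measurable_funTS; exact: measurable_normal_pdf.
  - move=> x _; rewrite /= lee_fin (le_trans (normal_pdf_ub _ _ s0))//.
    rewrite /normal_peak expr1n mul1r invf_le1; last first.
      by rewrite sqrtr_gt0 mulrn_wgt0// pi_gt0.
    rewrite -[leLHS](@sqrtr1 R) ler_wsqrtr//.
    by have := pi_ge2 R; rewrite mulr2n => ?; lra.
rewrite integral_cst//= mul1e lebesgue_measure_itv/= lte_fin.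
case: ifPn => _; last by rewrite lee_fin.
by rewrite lee_fin; lra.
Qed.

Context {d : nat -> measure_display} {O : forall n, measurableType (d n)}.
Variables (Q : forall n, probability (O n) R) (S : forall n, probability (n.-tuple (O n)) R).
Hypothesis S_iid : forall n, (0 < n)%N -> iid (Q n) (S n).
Variable zeta : forall n, O n -> R.
Hypothesis zetaP : forall n, (0 < n)%N -> [/\ L1 (Q n) (zeta (n := n)),
  Ex (Q n) (zeta (n := n)) = 0 & Ex (Q n) (fun z => zeta z ^+ 2) = 1].
Hypothesis zeta_ui : unif_int Q (fun n z => zeta z ^+ 2).

Lemma clt (a e : R) : 0 < e -> \forall n \near \oo,
  `|fine (S n [set w | Num.sqrt n%:R * avg w (zeta (n := n)) <= a]) - Phi a| <= e.
Proof.
(* Each side loses at most 5 eta: one from the smooth limit theorem, two from the two sandwiches,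
   two from moving the point by 2 eta. *)
move=> e0; pose eta := e / 8; have eta0 : 0 < eta by rewrite divr_gt0.
(* This makes k eta >= 1 / eta, hence exp(-k eta) <= eta; the maximum with 1 is what
   [smooth2_affine] asks for. *)
pose k := Num.max 1 (eta^-1 / eta).
have k1 : 1 <= k by rewrite le_max lexx.
have k0 : 0 <= k by exact: le_trans k1.
have kd : expR (- (k * eta)) <= eta.
  have h : eta^-1 <= k * eta by rewrite -ler_pdivrMr// le_max lexx orbT.
  rewrite expRN -[leRHS]invrK lef_pV2 ?posrE ?expR_gt0 ?invr_gt0//.
  by rewrite (le_trans h)// (le_trans _ (expR_ge1Dx _))// lerDr.
have sm b := smooth2_affine b k1 (@smooth2_logistic R).
have cf b : continuous (fun x : R => logistic (k * (x - b))).
  move=> x; apply: (@continuous_comp R R R (fun x => k * (x - b)) logistic); last first.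
    apply: differentiable_continuous; apply/derivable1_diffP.
    by case: (is_derive_logistic (k * (x - b))).
  by apply: cvgM; [exact: cvg_cst|apply: cvgB; [exact: cvg_id|exact: cvg_cst]].
have f01 b (x : R) : 0 <= logistic (k * (x - b)) <= 1.
  by have /andP[h1 h2] := logistic_bounds (k * (x - b)); rewrite !ltW.
have cs b := clt_smooth S_iid zetaP zeta_ui (sm b) (cf b) (f01 b) eta0.
apply: filterS3 (nbhs_infty_gt 0) (cs (a + eta)) (cs (a - eta)) => n n0 {cs}.
have [hz _ _] := zetaP n0.
pose W := fun w : n.-tuple (O n) => Num.sqrt n%:R * avg w (zeta (n := n)).
have mW : measurable_fun setT W.
  by apply: measurable_funM => //; apply: measurable_avg; exact: L1_meas hz.
have eta0' := ltW eta0.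
have /andP[u1 _] := logistic_sandwich (S n) (a + eta) mW eta0' k0.
have /andP[_ u2] := @logistic_sandwich _ _ (N 1) id (a + eta) _ k (@measurable_id _ _ _) eta0' k0.
have /andP[_ l1] := logistic_sandwich (S n) (a - eta) mW eta0' k0.
have /andP[l2 _] := @logistic_sandwich _ _ (N 1) id (a - eta) _ k (@measurable_id _ _ _) eta0' k0.
move=> /ler_normlP[_ cu] /ler_normlP[cl _].
have PhiE c : fine (N 1 [set x : R | x <= c]) = Phi c.
  by rewrite /Phi; congr (fine (_ _)); apply/seteqP; split => x /=; rewrite in_itv.
rewrite PhiE in u2; rewrite PhiE in l2.
rewrite addrK in u1; rewrite subrK in l1.
have p1 : Phi (a + eta + eta) <= Phi a + (eta + eta).
  by rewrite -addrA; apply: Phi_lipschitz; rewrite addr_ge0.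
have p2 : Phi a <= Phi (a - eta - eta) + (eta + eta).
  have := @Phi_lipschitz (a - eta - eta) (eta + eta).
  rewrite (_ : a - eta - eta + (eta + eta) = a); last by ring.
  by apply; rewrite addr_ge0.
have e8 : e = 8 * eta by rewrite /eta; field.
move: e8 kd u1 u2 l1 l2 cu cl p1 p2; clear.
move: (expR _) (fine _) (Ex (S n) _) (Ex (N 1) _) (Ex (S n) _) (Ex (N 1) _) (Phi _) (Phi a) (Phi _).
rewrite -/eta; move: (eta) => h D x u1 v1 u2 v2 y1 y y2 *.
by rewrite ler_norml; apply/andP; split; lra.
Qed.

End clt_distribution.

(** * Conditional expectations and the population *)

Section conditional_expectation.
Import HBNNSimple.
Context {R : realType} {d d' : measure_display} {Z : measurableType d} {V : measurableType d'}.
Variable P : probability Z R.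
Implicit Types (D W : Z -> R) (g h : V -> R).

Lemma integral_setE (B : set Z) (f : Z -> R) : measurable B -> L1 P f ->
  (\int[P]_(z in B) (f z)%:E = (Ex P (fun z => \1_B z * f z))%:E)%E.
Proof.
move=> mB hf; rewrite -Ex_fin; last first.
  apply: (@L1_mul_bd _ _ _ _ _ _ 1) => // z; rewrite indicE.
  by case: (_ \in _); rewrite ?normr1 ?normr0.
rewrite integral_mkcond; apply: eq_integral => z _.
by rewrite patchE indicE; case: (_ \in _); rewrite ?mul1r ?mul0r.
Qed.

(** From indicators to simple functions by linearity, then to nonnegative [h] by dominated
    convergence with the limit product itself as dominating function. Positive and negative parts
    are separated beforehand. *)
Lemma orthogonal_mul (v : Z -> V) D h : measurable_fun setT v -> L1 P D ->
  (forall A : set V, measurable A -> Ex P (fun z => \1_A (v z) * D z) = 0) ->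
  measurable_fun setT h -> L1 P (fun z => h (v z) * D z) ->
  Ex P (fun z => h (v z) * D z) = 0.
Proof.
move=> mv hD D0.
wlog h0 : h / forall x, 0 <= h x.
  move=> H mh hhD.
  have mpos : measurable_fun setT (fun x => Num.max (h x) 0) by exact: measurable_maxr.
  have mneg : measurable_fun setT (fun x => Num.max (- h x) 0).
    by apply: measurable_maxr => //; exact: measurable_funN.
  have mD := L1_meas hD.
  have lpos : L1 P (fun z => Num.max (h (v z)) 0 * D z).
    apply: (L1_le _ _ (L1_norm hhD)).
      by apply: measurable_funM => //; exact: (measurableT_comp mpos).
    move=> z; rewrite !normrM ler_wpM2r//; case: (leP (h (v z)) 0) => //.
    by rewrite normr0.
  have lneg : L1 P (fun z => Num.max (- h (v z)) 0 * D z).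
    apply: (L1_le _ _ (L1_norm hhD)).
      by apply: measurable_funM => //; exact: (measurableT_comp mneg).
    move=> z; rewrite !normrM ler_wpM2r//; case: (leP (- h (v z)) 0) => //.
      by rewrite normr0.
    by rewrite normrN.
  have -> : (fun z => h (v z) * D z) =
    (fun z => Num.max (h (v z)) 0 * D z - Num.max (- h (v z)) 0 * D z).
    apply/funext => z; rewrite -mulrBl; congr (_ * _).
    case: (leP (h (v z)) 0) => h1.
      by rewrite max_l ?oppr_ge0// sub0r opprK.
    by rewrite max_r ?subr0// oppr_le0 ltW.
  rewrite ExB// (H (fun x => Num.max (h x) 0)) ?(H (fun x => Num.max (- h x) 0)) ?subr0//.
    by move=> x; rewrite le_max lexx orbT.
  by move=> x; rewrite le_max lexx orbT.
move=> mh hhD; have mD := L1_meas hD.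
have mEh : measurable_fun setT (EFin \o h) by apply/measurable_EFinP.
pose f := nnsfun_approx measurableT mEh.
have fcvg x : f n x @[n --> \oo] --> h x.
  have := @cvg_nnsfun_approx _ _ _ _ measurableT (EFin \o h) mEh (fun x _ => h0 x) x I.
  exact: fine_cvg.
have f_le n x : f n x <= h x.
  rewrite -(cvg_lim _ (fcvg x))//; apply: nondecreasing_cvgn_le.
    by move=> m k mk; exact/lefP/nd_nnsfun_approx.
  by apply/cvg_ex; exists (h x); exact: fcvg.
have f_ge0 n x : 0 <= f n x by [].
have mfD n : measurable_fun setT (fun z => f n (v z) * D z).
  by apply: measurable_funM => //; apply: measurableT_comp.
have fn0 n : Ex P (fun z => f n (v z) * D z) = 0.
  have -> : (fun z => f n (v z) * D z) =
      (fun z => \sum_(y <- finmap.enum_fset (fset_set (range (f n))))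
         y * (\1_(f n @^-1` [set y]) (v z) * D z)).
    apply/funext => z; rewrite {1}(fimfunE (f n)) fsbig_finite//= mulr_suml.
    by apply: eq_bigr => y _; rewrite mulrA.
  have l1 y : L1 P (fun z => \1_(f n @^-1` [set y]) (v z) * D z).
    apply: (@L1_mul_bd _ _ _ _ _ _ 1) => //.
      by apply: measurableT_comp => //; apply: measurable_indic.
    by move=> z; rewrite indicE; case: (_ \in _); rewrite ?normr1 ?normr0.
  rewrite Ex_sum; last by move=> y _; exact: L1Z.
  by rewrite big1// => y _; rewrite ExZ// D0 ?mulr0.
have lfn n : L1 P (fun z => f n (v z) * D z).
  apply: (L1_le (mfD n) _ (L1_norm hhD)) => z; rewrite !normrM ler_wpM2r//.
  by rewrite !ger0_norm.
have H : (\int[P]_z (f n (v z) * D z)%:E)%E @[n --> \oo] --> (\int[P]_z (h (v z) * D z)%:E)%E.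
  have m1 n : measurable_fun setT (fun z => (f n (v z) * D z)%:E).
    by apply/measurable_EFinP; exact: mfD.
  have m2 : measurable_fun setT (fun z => (h (v z) * D z)%:E).
    by apply/measurable_EFinP; exact: L1_meas hhD.
  have c1 : {ae P, forall z, setT z ->
      (f n (v z) * D z)%:E @[n --> \oo] --> (h (v z) * D z)%:E}.
    apply: aeW => z _; apply: cvg_EFin; first by apply: nearW.
    by apply: cvgM; [exact: fcvg|exact: cvg_cst].
  have c2 : {ae P, forall z n, setT z ->
      (`|(f n (v z) * D z)%:E| <= `|h (v z) * D z|%:E)%E}.
    apply: aeW => z n _; rewrite lee_fin !normrM ler_wpM2r//.
    by rewrite !ger0_norm.
  have [_ _] := dominated_convergence measurableT m1 m2 c1 (L1_norm hhD) c2.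
  exact.
have H0 : (fun n => \int[P]_z (f n (v z) * D z)%:E)%E = cst 0%E.
  by apply/funext => n; rewrite Ex_fin// fn0.
rewrite H0 in H.
have E : (\int[P]_z (h (v z) * D z)%:E = 0)%E by rewrite -(cvg_lim _ H)// lim_cst.
by apply: EFin_inj; rewrite -Ex_fin.
Qed.

(** The test-function form of a conditional expectation; [h] may be unbounded as long as its product
    with the error is integrable. *)
Lemma condE_ortho (v : Z -> V) W g : measurable_fun setT v -> is_condE P v W g ->
  [/\ L1 P W, measurable_fun setT g, L1 P (fun z => g (v z)) &
   forall h, measurable_fun setT h -> L1 P (fun z => h (v z) * (W z - g (v z))) ->
     Ex P (fun z => h (v z) * (W z - g (v z))) = 0].
Proof.
move=> mv [hW mg hg EA]; split=> // h mh hh.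
apply: (orthogonal_mul mv) => //; first exact: L1B.
move=> A mA.
have mvA : measurable (v @^-1` A) by rewrite -[X in measurable X]setTI; exact: mv.
have := EA A mA; rewrite !integral_setE// => -[E].
have l1 (f : Z -> R) : L1 P f -> L1 P (fun z => \1_(v @^-1` A) z * f z).
  move=> hf; apply: (@L1_mul_bd _ _ _ _ _ _ 1) => // z; rewrite indicE.
  by case: (_ \in _); rewrite ?normr1 ?normr0.
have -> : (fun z => \1_A (v z) * (W z - g (v z))) =
    (fun z => \1_(v @^-1` A) z * W z - \1_(v @^-1` A) z * g (v z)).
  apply/funext => z; rewrite mulrBr !indicE.
  have -> // : (z \in v @^-1` A) = (v z \in A).
  by apply/idP/idP; rewrite !inE.
by rewrite ExB ?E ?subrr//; exact: l1.
Qed.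

Lemma condE_bd (v : Z -> V) W g h (K : R) : measurable_fun setT v -> is_condE P v W g ->
  measurable_fun setT h -> (forall x, `|h x| <= K) ->
  [/\ L1 P (fun z => h (v z) * W z), L1 P (fun z => h (v z) * g (v z)) &
   Ex P (fun z => h (v z) * W z) = Ex P (fun z => h (v z) * g (v z))].
Proof.
move=> mv /(condE_ortho mv) [hW mg hg ortho] mh hK.
have mhv : measurable_fun setT (fun z => h (v z)) by exact: measurableT_comp.
have l1 (f : Z -> R) : L1 P f -> L1 P (fun z => h (v z) * f z).
  by move=> hf; apply: (L1_mul_bd mhv (fun z => hK (v z)) hf).
split; [exact: l1|exact: l1|].
apply/eqP; rewrite -subr_eq0 -ExB; [|exact: l1|exact: l1].
rewrite -(ortho h mh); last by apply: l1; exact: L1B.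
by apply/eqP; congr Ex; apply/funext => z; rewrite mulrBr.
Qed.

End conditional_expectation.

Lemma measurable_fun_ord d (U : measurableType d) n (f : 'I_n.+1 -> U) :
  measurable_fun setT f.
Proof. by []. Qed.

(** * The law of one observation *)

Section observed_law.
Context {R : realType} {T : nat} {d : measure_display} {X : measurableType d}.
Local Notation Z := (latent R T X).
Local Notation O := (observed R T X).

Lemma measurable_lX : measurable_fun setT (lX : Z -> X).
Proof. exact: measurable_snd. Qed.

Lemma measurable_lD : measurable_fun setT (lD : Z -> 'I_T.+1).
Proof. exact: (measurableT_comp measurable_snd measurable_fst). Qed.

Lemma measurable_lDX : measurable_fun setT (fun z : Z => (lD z, lX z)).
Proof. by apply: measurable_fun_pair; [exact: measurable_lD|exact: measurable_lX]. Qed.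

Lemma measurable_lY t : measurable_fun setT (lY t : Z -> R).
Proof.
apply: (measurableT_comp (measurable_tnth t)).
exact: (measurableT_comp measurable_fst measurable_fst).
Qed.

Lemma measurable_obsY : measurable_fun setT (obsY : Z -> R).
Proof.
apply: measurable_fun_sum => t _; apply: measurable_funM; last exact: measurable_lY.
by apply: (measurableT_comp (measurable_fun_ord (fun s : 'I_T.+1 => (s == t)%:R : R))); exact: measurable_lD.
Qed.

Lemma measurable_obs : measurable_fun setT (obs : Z -> O).
Proof.
apply: measurable_fun_pair; last exact: measurable_lX.
by apply: measurable_fun_pair; [exact: measurable_obsY|exact: measurable_lD].
Qed.

HB.instance Definition _ := isMeasurableFun.Build _ _ _ _ (obs : Z -> O) measurable_obs.

(** With this law as [Q], the predicate [iid_sample] unfolds to [iid]. *)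
Definition law n (P : dgp R T X n) : probability O R := distribution (pop P) obs.

Lemma measurable_od : measurable_fun setT (od : O -> 'I_T.+1).
Proof. exact: (measurableT_comp measurable_snd measurable_fst). Qed.

Lemma measurable_ox : measurable_fun setT (ox : O -> X).
Proof. exact: measurable_snd. Qed.

Lemma measurable_oy : measurable_fun setT (oy : O -> R).
Proof. exact: (measurableT_comp measurable_fst measurable_fst). Qed.

Lemma measurable_odx : measurable_fun setT (fun o : O => (od o, ox o)).
Proof. by apply: measurable_fun_pair; [exact: measurable_od|exact: measurable_ox]. Qed.

Lemma measurable_dummy t : measurable_fun setT (fun o : O => (od o == t)%:R : R).
Proof.
by apply: (measurableT_comp (measurable_fun_ord (fun s : 'I_T.+1 => (s == t)%:R : R))); exact: measurable_od.
Qed.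

Lemma measurable_ldummy t : measurable_fun setT (fun z : Z => (lD z == t)%:R : R).
Proof.
by apply: (measurableT_comp (measurable_fun_ord (fun s : 'I_T.+1 => (s == t)%:R : R))); exact: measurable_lD.
Qed.

Lemma obsYE (z : Z) : obsY z = lY (lD z) z.
Proof.
rewrite /obsY (bigD1 (lD z))//= eqxx mul1r big1 ?addr0// => t tz.
by rewrite eq_sym (negbTE tz) mul0r.
Qed.

Variables (n : nat) (P : dgp R T X n).

Lemma Ex_law (f : O -> R) : measurable_fun setT f -> L1 (pop P) (f \o obs) ->
  L1 (law P) f /\ Ex (law P) f = Ex (pop P) (f \o obs).
Proof.
move=> mf hf.
have mEf : measurable_fun setT (EFin \o f) by apply/measurable_EFinP.
have hl : L1 (law P) f.
  exact: (@integrable_pushforward _ _ _ _ R obs measurable_obs (pop P) setT (EFin \o f) mEf hf measurableT).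
split=> //; apply: EFin_inj; rewrite -!Ex_fin//.
exact: (@integral_pushforward _ _ _ _ R obs measurable_obs (pop P) setT (EFin \o f) mEf hf measurableT).
Qed.

Lemma ae_law (A : set O) : measurable A -> {ae pop P, forall z, A (obs z)} -> {ae law P, forall o, A o}.
Proof.
move=> mA [N [mN PN AN]].
exists (~` A); split; [exact: measurableC| |by []].
apply/eqP; rewrite -measure_le0 -PN -[leLHS]/(pop P (obs @^-1` (~` A))).
apply: le_measure; rewrite ?inE//.
  by rewrite -[X in measurable X]setTI; apply: measurable_obs => //; exact: measurableC.
Qed.

End observed_law.

(** * What identification and the moment conditions say about one population *)

Section population.
Context {R : realType} {T : nat} {d : measure_display} {X : measurableType d}.
Local Notation Z := (latent R T X).
Local Notation O := (observed R T X).
Variables (n : nat) (P : dgp R T X n) (ps mu : 'I_T.+1 -> X -> R).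
Hypothesis nuis : is_nuisance P ps mu.
Local Notation Pp := (pop P).
Let mX := @measurable_lX R T d X.
Let mDX := @measurable_lDX R T d X.

Lemma measurable_ps t : measurable_fun setT (ps t).
Proof. by have [/(_ t) [] ] := nuis. Qed.

Lemma measurable_mu2 : measurable_fun setT (fun dx : 'I_T.+1 * X => mu dx.1 dx.2).
Proof. by have [_ []] := nuis. Qed.

Lemma measurable_mu t : measurable_fun setT (mu t).
Proof. exact: (measurableT_comp measurable_mu2 (measurable_pair1 t)). Qed.

Lemma measurable_resid : measurable_fun setT (resid mu : O -> R).
Proof.
apply: measurable_funB; first exact: measurable_oy.
exact: (measurableT_comp measurable_mu2 measurable_odx).
Qed.

Lemma condE_ps (h : X -> R) (K : R) t : measurable_fun setT h -> (forall x, `|h x| <= K) ->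
  [/\ L1 Pp (fun z => h (lX z) * (lD z == t)%:R), L1 Pp (fun z => h (lX z) * ps t (lX z)) &
   Ex Pp (fun z => h (lX z) * (lD z == t)%:R) = Ex Pp (fun z => h (lX z) * ps t (lX z))].
Proof. by move=> mh hK; have [/(_ t) ct _] := nuis; exact: (condE_bd mX ct mh hK). Qed.

(* [x / (1 + x ^ 2)] is a bounded multiplier that turns an integrable random variable
   into a bounded nonnegative one with the same zeros. *)
Let k (x : R) := x / (1 + x ^+ 2).

Let k_den (x : R) : 0 < 1 + x ^+ 2.
Proof. by rewrite ltr_wpDr// sqr_ge0. Qed.

Let k_bound x : `|k x| <= 1.
Proof.
rewrite /k normrM normfV (gtr0_norm (k_den x)) ler_pdivrMr// mul1r.
have := sqr_ge0 (`|x| - 1); rewrite -(real_normK (num_real x)) sqrrB1 => h.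
by have := normr_ge0 x; lra.
Qed.

Let kx_bound x : 0 <= k x * x <= 1.
Proof.
rewrite /k mulrAC -expr2 divr_ge0 ?sqr_ge0 ?(ltW (k_den x))//=.
by rewrite ler_pdivrMr// mul1r lerDr.
Qed.

Let kx_eq0 x : k x * x = 0 -> x = 0.
Proof.
rewrite /k mulrAC -expr2 => /eqP; rewrite mulf_eq0 expf_eq0/= invr_eq0.
by rewrite (gt_eqF (k_den x)) orbF => /eqP.
Qed.

Let measurable_k (V : measurableType d) (f : V -> R) : measurable_fun setT f ->
  measurable_fun setT (fun x => k (f x)).
Proof.
move=> mf; apply: measurable_funM => //.
have ci : measurable_fun setT (fun x : R => (1 + x ^+ 2)^-1).
  apply: continuous_measurable_fun => x; apply: cvgV; first by rewrite gt_eqF.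
  apply: cvgD; [exact: cvg_cst|exact: exprn_continuous].
exact: (measurableT_comp ci).
Qed.

(** The scores are versions chosen level by level, so the identity is only almost sure. Testing the
    defect [D] against the bounded weight [k (D x)] gives a nonnegative variable with vanishing
    expectation. *)
Lemma sum_ps1 : {ae Pp, forall z, \sum_t ps t (lX z) = 1}.
Proof.
pose D x := \sum_t ps t x - 1.
have mD : measurable_fun setT D.
  by apply: measurable_funB => //; apply: measurable_fun_sum => t _; exact: measurable_ps.
have mk := measurable_k mD.
have mq : measurable_fun setT (fun x => k (D x) * D x) by exact: measurable_funM.
have q0 x : 0 <= k (D x) * D x by have /andP[] := kx_bound (D x).
have lq : L1 Pp (fun z => k (D (lX z)) * D (lX z)).
  apply: (@L1_bd _ _ _ _ _ 1); first exact: (measurableT_comp mq mX).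
  by move=> z; rewrite ger0_norm//; have /andP[] := kx_bound (D (lX z)).
have cp t := condE_ps t mk (fun x => k_bound (D x)).
have l1 : L1 Pp (fun z => k (D (lX z))).
  by apply: (@L1_bd _ _ _ _ _ 1) => //; exact: (measurableT_comp mk mX).
have E0 : Ex Pp (fun z => k (D (lX z)) * D (lX z)) = 0.
  have -> : (fun z : Z => k (D (lX z)) * D (lX z)) =
    (fun z : Z => \sum_t k (D (lX z)) * ps t (lX z) - k (D (lX z))) :> (Z -> R).
    by apply/funext => z; rewrite {2}/D mulrBr mulr1 mulr_sumr.
  rewrite ExB//; last by apply: L1_sum => t _; have [] := cp t.
  rewrite Ex_sum; last by move=> t _; have [] := cp t.
  under eq_bigr => t _. 
    have [_ _ <-] := cp t; over.
  rewrite -Ex_sum; last by move=> t _; have [] := cp t.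
  apply/eqP; rewrite subr_eq0; apply/eqP; congr Ex; apply/funext => z.
  rewrite -mulr_sumr (bigD1 (lD z))//= eqxx big1 ?addr0 ?mulr1// => t.
  by rewrite eq_sym => /negbTE ->.
have := Ex_eq0_ae lq (fun z => q0 (lX z)) E0.
by apply: filterS => z /kx_eq0 /eqP; rewrite subr_eq0 => /eqP.
Qed.

Variable pmin : R.
Hypotheses (pmin0 : 0 < pmin) (overlap : forall t, {ae Pp, forall z, pmin <= ps t (lX z)}).

Lemma ps_bounds_pop : {ae Pp, forall z, (forall t, pmin <= ps t (lX z) <= 1) /\
  \sum_t ps t (lX z) = 1}.
Proof.
have ov : {ae Pp, forall z, forall t, pmin <= ps t (lX z)}.
  exact: filter_forall overlap.
apply: filterS2 ov sum_ps1 => z h s1; split=> // t; rewrite h/= -s1 (bigD1 t)//= lerDl.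
by apply: sumr_ge0 => s _; rewrite (le_trans _ (h s))// ltW.
Qed.

Hypothesis indep : mean_independence P.

(** The regression [mu t] is pinned down only where the treatment equals t, whereas [g] concerns all
    of X. There Y = Y(t), so the tested difference times the indicator of level t integrates to 0;
    the score replaces the indicator, and overlap bounds it below by [pmin]. *)
Lemma mu_version t : exists2 g : X -> R, is_condE Pp lX (lY t) g &
  {ae Pp, forall z, mu t (lX z) = g (lX z)}.
Proof.
have [g [h [cg ch hg]]] := indep t.
exists g => //.
have [_ cmu] := nuis.
have mg : measurable_fun setT g by case: cg.
pose D x := mu t x - g x.
have mD : measurable_fun setT D by apply: measurable_funB => //; exact: measurable_mu.
have mk := measurable_k mD.
pose hh (dx : 'I_T.+1 * X) := (dx.1 == t)%:R * k (D dx.2).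
have mhh : measurable_fun setT hh.
  apply: measurable_funM; last exact: (measurableT_comp mk measurable_snd).
  exact: (measurableT_comp (measurable_fun_ord (fun s : 'I_T.+1 => (s == t)%:R : R)) measurable_fst).
have hh1 dx : `|hh dx| <= 1.
  by rewrite /hh; case: eqP => _; rewrite ?mul1r ?mul0r ?normr0 ?k_bound.
have [lW lh Eh] := condE_bd mDX ch mhh hh1.
have [lW' lmu Emu] := condE_bd mDX cmu mhh hh1.
have EW : (fun z : Z => hh (lD z, lX z) * obsY z) = (fun z => hh (lD z, lX z) * lY t z) :> (Z -> R).
  by apply/funext => z; rewrite /hh/=; case: eqP => [<-|]; rewrite ?obsYE// !mul0r.
have mgX : measurable_fun setT (fun z : Z => hh (lD z, lX z) * g (lX z)).
  by apply: measurable_funM; [exact: (measurableT_comp mhh mDX)|exact: (measurableT_comp mg mX)].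
have [lg Eg] : L1 Pp (fun z => hh (lD z, lX z) * g (lX z)) /\
    Ex Pp (fun z => hh (lD z, lX z) * h (lD z, lX z)) = Ex Pp (fun z => hh (lD z, lX z) * g (lX z)).
  by apply: Ex_ae => //; apply: filterS hg => z ->.
have mq : measurable_fun setT (fun x => k (D x) * D x) by exact: measurable_funM.
have q1 x : `|k (D x) * D x| <= 1 by have /andP[q0 ?] := kx_bound (D x); rewrite ger0_norm.
have [lqd lqp Eq] := condE_ps t mq q1.
have Ed0 : Ex Pp (fun z => k (D (lX z)) * D (lX z) * (lD z == t)%:R) = 0.
  rewrite (_ : (fun z => _) = (fun z : Z => hh (lD z, lX z) * mu (lD z) (lX z) -
      hh (lD z, lX z) * g (lX z)) :> (Z -> R)).
    by rewrite ExB// -Emu EW Eh Eg subrr.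
  apply/funext => z; rewrite -mulrBr /hh/=; case: eqP => [->|_].
    by rewrite mul1r mulr1.
  by rewrite !mul0r mulr0.
have lq : L1 Pp (fun z => k (D (lX z)) * D (lX z)).
  exact: (L1_bd Pp (measurableT_comp mq mX) (fun z => q1 (lX z))).
have q0 x : 0 <= k (D x) * D x by have /andP[] := kx_bound (D x).
have Eq0 : Ex Pp (fun z => k (D (lX z)) * D (lX z)) = 0.
  apply/eqP; rewrite eq_le; apply/andP; split; last by apply: Ex_ge0 => z; exact: q0.
  rewrite -(pmulr_rle0 _ pmin0) -ExZ// -Ed0 Eq; apply: Ex_le_ae => //; first exact: L1Z.
  by apply: filterS (overlap t) => z pz; rewrite mulrC ler_wpM2l.
have := Ex_eq0_ae lq (fun z => q0 (lX z)) Eq0.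
by apply: filterS => z /kx_eq0 /eqP; rewrite subr_eq0 => /eqP.
Qed.

(** The tower property for the version of E[Y(t) | X] with which [mu_version] identifies [mu t]. *)
Lemma Ex_law_mu t : L1 (law P) (fun o => mu t (ox o)) /\
  Ex (law P) (fun o => mu t (ox o)) = fine ('E_Pp[lY t])%E.
Proof.
have [g [lY1 mg lg Eg] hg] := mu_version t.
have mmu := measurable_mu t.
have [l1 E1] : L1 Pp (fun z => mu t (lX z)) /\ Ex Pp (fun z => g (lX z)) = Ex Pp (fun z => mu t (lX z)).
  apply: Ex_ae => //; first exact: (measurableT_comp mmu mX).
  by apply: filterS hg => z ->.
have [|l2 E2] := @Ex_law _ _ _ _ n P (fun o => mu t (ox o)) _ l1.
  exact: (measurableT_comp mmu measurable_ox).
split=> //; rewrite E2 unlock; apply: EFin_inj.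
have -> : (fun o => mu t (ox o)) \o obs = (fun z : Z => mu t (lX z)) by [].
rewrite -E1 fineK; last exact: integrable_fin_num.
rewrite -Ex_fin//; have := Eg setT measurableT.
by rewrite preimage_setT => ->.
Qed.

Lemma Ex_law_resid (h : 'I_T.+1 * X -> R) : measurable_fun setT h ->
  L1 (law P) (fun o => h (od o, ox o) * resid mu o) ->
  Ex (law P) (fun o => h (od o, ox o) * resid mu o) = 0.
Proof.
move=> mh hl; have [_ cmu] := nuis.
have [_ _ _ ortho] := condE_ortho mDX cmu.
have mf : measurable_fun setT (fun o : O => h (od o, ox o) * resid mu o).
  by apply: measurable_funM; [exact: (measurableT_comp mh measurable_odx)|exact: measurable_resid].
have lP : L1 Pp ((fun o : O => h (od o, ox o) * resid mu o) \o obs).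
  apply/integrableP; split; first by apply/measurable_EFinP; exact: (measurableT_comp mf measurable_obs).
  have /integrableP[_] := hl; rewrite ge0_integral_pushforward//.
  by apply: measurableT_comp => //; apply/measurable_EFinP.
by have [_ ->] := Ex_law mf lP; exact: ortho.
Qed.

Lemma resid_obs (z : Z) : resid mu (obs z) = lU mu (lD z) z.
Proof. by rewrite /resid /oy /od /ox /= obsYE. Qed.

Variable B4 : R.
Hypothesis moment4 : forall t, exists2 g : X -> R,
  is_condE Pp lX (fun z => `|lU mu t z| ^+ 4) g & {ae Pp, forall z, g (lX z) <= B4}.

Lemma measurable_lU t : measurable_fun setT (lU mu t : Z -> R).
Proof.
apply: measurable_funB; first exact: measurable_lY.
exact: (measurableT_comp (measurable_mu t) mX).
Qed.

Lemma Ex_lU4 (h : X -> R) (K : R) t : measurable_fun setT h -> (forall x, 0 <= h x <= K) ->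
  L1 Pp (fun z => h (lX z) * `|lU mu t z| ^+ 4) /\
  Ex Pp (fun z => h (lX z) * `|lU mu t z| ^+ 4) <= B4 * Ex Pp (fun z => h (lX z)).
Proof.
move=> mh hK; have [g cg gB] := moment4 t.
have h0 x : 0 <= h x by have /andP[] := hK x.
have hK' x : `|h x| <= K by have /andP[? ?] := hK x; rewrite ger0_norm.
have [l4 lg ->] := condE_bd mX cg mh hK'.
have lh : L1 Pp (fun z => h (lX z)).
  exact: (L1_bd Pp (measurableT_comp mh mX) (fun z => hK' (lX z))).
split=> //; rewrite -ExZ//; apply: Ex_le_ae => //; first exact: L1Z.
by apply: filterS gB => z gz; rewrite mulrC ler_wpM2r.
Qed.

(** The observed residual is one of the potential ones, so its fourth power is below the sum of
    theirs; hence the factor T + 1. *)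
Lemma L1_resid_obs4 : L1 Pp (fun z => resid mu (obs z) ^+ 4) /\
  Ex Pp (fun z => resid mu (obs z) ^+ 4) <= T.+1%:R * B4.
Proof.
have m1 : measurable_fun setT (fun _ : X => (1 : R)) by exact: measurable_cst.
have l4 t := @Ex_lU4 (fun=> 1) 1 t m1 (fun=> introT andP (conj ler01 (lexx 1))).
have le4 z : resid mu (obs z) ^+ 4 <= \sum_t 1 * `|lU mu t z| ^+ 4.
  rewrite resid_obs (bigD1 (lD z))//= mul1r -normrX ger0_norm; last first.
    by rewrite -[4%N]/(2 * 2)%N exprM sqr_ge0.
  by rewrite lerDl; apply: sumr_ge0 => t _; rewrite mul1r exprn_ge0.
have r0 z : 0 <= resid mu (obs z) ^+ 4 by rewrite -[4%N]/(2 * 2)%N exprM sqr_ge0.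
have ls : L1 Pp (fun z => \sum_t 1 * `|lU mu t z| ^+ 4).
  by apply: L1_sum => t _; have [] := l4 t.
have lr : L1 Pp (fun z => resid mu (obs z) ^+ 4).
  apply: (L1_le _ _ ls).
    by apply: measurable_funX; exact: (measurableT_comp measurable_resid measurable_obs).
  by move=> z; rewrite ger0_norm.
split=> //; apply: (le_trans (Ex_le lr ls le4)).
rewrite Ex_sum; last by move=> t _; have [] := l4 t.
rewrite -[X in X%:R * _](card_ord T.+1) mulr_natl -sumr_const; apply: ler_sum => t _.
by have [_] := l4 t; rewrite Ex_cst mulr1.
Qed.

Lemma Ex_law_resid4 : L1 (law P) (fun o => resid mu o ^+ 4) /\
  Ex (law P) (fun o => resid mu o ^+ 4) <= T.+1%:R * B4.
Proof.
have [l4 E4] := L1_resid_obs4.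
have m4 : measurable_fun setT (fun o : O => resid mu o ^+ 4).
  by apply: measurable_funX; exact: measurable_resid.
by have [l ->] := Ex_law m4 l4.
Qed.

Lemma sqr_le_quart (x : R) : x ^+ 2 <= 1 + x ^+ 4.
Proof.
rewrite -[4%N]/(2 * 2)%N exprM; have := sqr_ge0 (x ^+ 2 - 1); rewrite sqrrB1 => h.
by have := sqr_ge0 (x ^+ 2); have := sqr_ge0 x; lra.
Qed.

Lemma L1_law_resid2 : L1 (law P) (fun o => resid mu o ^+ 2).
Proof.
have [l4 _] := Ex_law_resid4.
apply: (@L1_le _ _ _ _ _ (fun o => 1 + resid mu o ^+ 4)).
- by apply: measurable_funX; exact: measurable_resid.
- by move=> o; rewrite ger0_norm ?sqr_ge0// sqr_le_quart.
- by apply: L1D => //; exact: L1_cst.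
Qed.

Lemma L1_law_resid : L1 (law P) (resid mu : O -> R).
Proof.
apply: (@L1_le _ _ _ _ _ (fun o => 1 + resid mu o ^+ 2)).
- exact: measurable_resid.
- move=> o; have := sqr_ge0 (`|resid mu o| - 1); rewrite sqrrB1 real_normK ?num_real//.
  by have := sqr_ge0 (resid mu o); lra.
- by apply: L1D; [exact: L1_cst|exact: L1_law_resid2].
Qed.

(** Moments are controlled given X, while the weight depends on (D, X). Summing over all potential
    residuals, with u^2 <= 1 + u^4, removes D; overlap brings it back through E h(t, X) <=
    E[h(t, X) 1{D = t}] / pmin. *)
Lemma Ex_law_resid2_weighted (h : 'I_T.+1 * X -> R) (K : R) : measurable_fun setT h ->
  (forall dx, 0 <= h dx <= K) ->
  Ex (law P) (fun o => h (od o, ox o) * resid mu o ^+ 2)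
    <= (1 + B4) / pmin * Ex (law P) (fun o => h (od o, ox o)).
Proof.
move=> mh hK.
have h0 dx : 0 <= h dx by have /andP[] := hK dx.
have hK' dx : `|h dx| <= K by have /andP[? ?] := hK dx; rewrite ger0_norm.
have K0 : 0 <= K by have /andP[h1 h2] := hK (ord0, point); exact: le_trans h2.
have mho : measurable_fun setT (fun o : O => h (od o, ox o)) by exact: (measurableT_comp mh measurable_odx).
have mht t : measurable_fun setT (fun x => h (t, x)) by exact: (measurableT_comp mh (measurable_pair1 t)).
have mhz : measurable_fun setT (fun z : Z => h (lD z, lX z)) by exact: (measurableT_comp mh mDX).
have [_ ->] : L1 (law P) (fun o => h (od o, ox o)) /\
    Ex (law P) (fun o => h (od o, ox o)) = Ex Pp (fun z => h (lD z, lX z)).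
  by apply: Ex_law => //; exact: (L1_bd Pp mhz (fun z => hK' (lD z, lX z))).
have mhu : measurable_fun setT (fun o : O => h (od o, ox o) * resid mu o ^+ 2).
  by apply: measurable_funM => //; apply: measurable_funX; exact: measurable_resid.
have mU t := measurable_lU t.
have lUt t := @Ex_lU4 _ K t (mht t) (fun x => hK (t, x)).
have lht t : L1 Pp (fun z => h (t, lX z)).
  exact: (L1_bd Pp (measurableT_comp (mht t) mX) (fun z => hK' (t, lX z))).
have ltt t : L1 Pp (fun z => h (t, lX z) + h (t, lX z) * `|lU mu t z| ^+ 4).
  by apply: L1D => //; have [] := lUt t.
have lsum : L1 Pp (fun z => \sum_t (h (t, lX z) + h (t, lX z) * `|lU mu t z| ^+ 4)).
  by apply: L1_sum.
have le_sum z : h (lD z, lX z) * resid mu (obs z) ^+ 2 <=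
    \sum_t (h (t, lX z) + h (t, lX z) * `|lU mu t z| ^+ 4).
  rewrite resid_obs (bigD1 (lD z))//= -[leLHS]addr0 lerD//.
    rewrite -{2}[h _]mulr1 -mulrDr ler_wpM2l// (le_trans (sqr_le_quart _))//.
    by rewrite -normrX ger0_norm// -[4%N]/(2 * 2)%N exprM sqr_ge0.
  by apply: sumr_ge0 => t _; rewrite addr_ge0// mulr_ge0// exprn_ge0.
have lhu : L1 Pp (fun z => h (lD z, lX z) * resid mu (obs z) ^+ 2).
  apply: (L1_le (measurableT_comp mhu measurable_obs) _ lsum) => z.
  by rewrite /= ger0_norm ?le_sum// mulr_ge0// sqr_ge0.
have [_ ->] := Ex_law mhu lhu.
apply: (le_trans (Ex_le lhu lsum le_sum)).
rewrite Ex_sum//.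
have ct t := condE_ps t (mht t) (fun x => hK' (t, x)).
have ld t : L1 Pp (fun z => h (t, lX z) * (lD z == t)%:R) by have [] := ct t.
have -> : (fun z : Z => h (lD z, lX z)) = (fun z => \sum_t h (t, lX z) * (lD z == t)%:R) :> (Z -> R).
  apply/funext => z; rewrite (bigD1 (lD z))//= eqxx mulr1 big1 ?addr0// => t.
  by rewrite eq_sym => /negbTE ->; rewrite mulr0.
rewrite Ex_sum// mulr_sumr; apply: ler_sum => t _.
have [l4 E4] := lUt t.
rewrite ExD//; apply: (le_trans (_ : _ <= (1 + B4) * Ex Pp (fun z => h (t, lX z)))).
  by rewrite mulrDl mul1r lerD2l.
have B40 : 0 <= 1 + B4.
  have [_ h4] := L1_resid_obs4; have : 0 <= T.+1%:R * B4.
    by apply: le_trans h4; apply: Ex_ge0 => z; rewrite -[4%N]/(2 * 2)%N exprM sqr_ge0.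
  by rewrite pmulr_rge0// => ?; rewrite addr_ge0.
rewrite -mulrA ler_wpM2l// mulrC ler_pdivlMr// mulrC -ExZ//.
have [_ lp ->] := ct t; apply: Ex_le_ae => //; first exact: L1Z.
by apply: filterS (overlap t) => z pz; rewrite mulrC ler_wpM2l.
Qed.

(** A bounded regressor lets the lower bound pass from the weight xf^2 to the constant weight; 1 +
    b^2 replaces b^2 so that the division is safe. *)
Lemma Ex_law_dummy_resid2 t (xf : X -> R) (b c : R) : measurable_fun setT xf ->
  {ae Pp, forall z, `|xf (lX z)| <= b} -> 0 < c ->
  (c%:E <= 'E_Pp[(fun z =>
       (lD z == t)%:R * (xf (lX z) ^+ 2 * lU mu t z ^+ 2))%R])%E ->
  c / (1 + b ^+ 2) <= Ex (law P) (fun o => (od o == t)%:R * resid mu o ^+ 2).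
Proof.
move=> mx xb c0 cE.
have md : measurable_fun setT (fun o : O => (od o == t)%:R * resid mu o ^+ 2).
  apply: measurable_funM; first exact: measurable_dummy.
  by apply: measurable_funX; exact: measurable_resid.
have [l4 _] := L1_resid_obs4.
have ld : L1 Pp (fun z => (lD z == t)%:R * resid mu (obs z) ^+ 2).
  apply: (@L1_le _ _ _ _ _ (fun z => 1 + resid mu (obs z) ^+ 4)).
  - exact: (measurableT_comp md measurable_obs).
  - move=> z; rewrite ger0_norm; last by apply: mulr_ge0; [exact: ler0n|exact: sqr_ge0].
    apply: le_trans (sqr_le_quart _); apply: ler_piMl; first exact: sqr_ge0.
    by case: eqP.
  - exact: (L1D (L1_cst Pp 1) l4).
have [_ ->] := Ex_law md ld.
have -> : (fun o => (od o == t)%:R * resid mu o ^+ 2) \o obs =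
  (fun z : Z => (lD z == t)%:R * resid mu (obs z) ^+ 2) by [].
have b0 : 0 < 1 + b ^+ 2 by rewrite ltr_wpDr// sqr_ge0.
rewrite ler_pdivrMr// mulrC -ExZ// -lee_fin -Ex_fin; last exact: L1Z.
apply: (le_trans cE); rewrite unlock.
apply: ae_ge0_le_integral => //.
- move=> z _; rewrite lee_fin; apply: mulr_ge0; first exact: ler0n.
  by apply: mulr_ge0; exact: sqr_ge0.
- apply/measurable_EFinP; apply: measurable_funM; first exact: measurable_ldummy.
  apply: measurable_funM; apply: measurable_funX; last exact: measurable_lU.
  exact: (measurableT_comp mx mX).
- move=> z _; rewrite lee_fin; apply: mulr_ge0; first exact: ltW.
  by apply: mulr_ge0; [exact: ler0n|exact: sqr_ge0].
- by apply/measurable_EFinP; apply: L1_meas; exact: (L1Z (1 + b ^+ 2) ld).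
- apply: filterS xb => z xz _; rewrite lee_fin resid_obs.
  case: eqP => [->|_]; last by rewrite !mul0r mulr0.
  rewrite !mul1r ler_wpM2r ?sqr_ge0//.
  rewrite -(real_normK (num_real (xf _))) (@le_trans _ _ (b ^+ 2))// ?lerDr//.
  by rewrite lerXn2r// nnegrE (le_trans _ xz).
Qed.

Lemma Ex_law_mu_mu (r B : R) t t' : 0 < r ->
  ('E_Pp[(fun z => `|mu t (lX z) * mu t' (lX z)| `^ (1 + r))%R] <= B%:E)%E ->
  L1 (law P) (fun o => `|mu t (ox o) * mu t' (ox o)| `^ (1 + r)) /\
  Ex (law P) (fun o => `|mu t (ox o) * mu t' (ox o)| `^ (1 + r)) <= B.
Proof.
move=> r0; rewrite unlock => EB.
have mm : measurable_fun setT (fun o : O => `|mu t (ox o) * mu t' (ox o)| `^ (1 + r)).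
  apply: (measurableT_comp (measurable_powR _)); apply: measurableT_comp => //.
  apply: measurable_funM; exact: (measurableT_comp (measurable_mu _) measurable_ox).
have [l E] := @L1_ge0 _ _ _ Pp _ B (measurableT_comp mm measurable_obs) (fun z => powR_ge0 _ _) EB.
by have [? ->] := Ex_law mm l.
Qed.

End population.

(** * Uniform integrability *)

Section uniform_integrability.
Context {R : realType} {d : nat -> measure_display} {O : forall n, measurableType (d n)}.
Variable Q : forall n, probability (O n) R.
Implicit Types f g h : forall n, O n -> R.

Lemma excess_mono A n (f g : O n -> R) z : `|f z| <= `|g z| ->
  `|excess A f z| <= `|excess A g z|.
Proof.
rewrite /excess => fg; case: ltP => Af; last by rewrite normr0.
by rewrite (lt_le_trans Af fg).
Qed.

Lemma L1_excess A n (f : O n -> R) : L1 (Q n) f -> L1 (Q n) (fun z => `|excess A f z|).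
Proof.
move=> hf; apply: L1_norm; apply: (L1_le _ _ (L1_norm hf)); last exact: excess_le.
by apply: measurable_excess; exact: L1_meas hf.
Qed.

Lemma unif_int_dom f g : (forall n, (0 < n)%N -> measurable_fun setT (f n)) ->
  (forall n z, (0 < n)%N -> `|f n z| <= `|g n z|) -> unif_int Q g -> unif_int Q f.
Proof.
move=> mf fg ug e e0; have [A A0 hA] := ug _ e0; exists A => // n n0.
have [hg gA] := hA _ n0.
have hf : L1 (Q n) (f n).
  by apply: (L1_le (mf _ n0) _ (L1_norm hg)) => z; exact: fg.
split=> //; apply: le_trans gA; apply: Ex_le; [exact: L1_excess|exact: L1_excess|].
by move=> z; apply: excess_mono; exact: fg.
Qed.

Lemma unif_intD f g : unif_int Q f -> unif_int Q g ->
  unif_int Q (fun n z => `|f n z| + `|g n z|).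
Proof.
move=> uf ug e e0; have e4 : 0 < e / 4 by rewrite divr_gt0.
have [A A0 hA] := uf _ e4; have [B B0 hB] := ug _ e4.
pose C := Num.max A B; have CA : A <= C by rewrite le_max lexx.
have CB : B <= C by rewrite le_max lexx orbT.
have C0 : 0 < C by exact: lt_le_trans CA.
(* If the sum of two nonnegative numbers exceeds 2 C, the larger one exceeds C and the sum is at
   most twice the larger. *)
exists (2 * C); first by rewrite mulr_gt0.
move=> n n0; have [lf fA] := hA _ n0; have [lg gB] := hB _ n0.
have lfg : L1 (Q n) (fun z => `|f n z| + `|g n z|) by apply: L1D; exact: L1_norm.
split=> //.
have lh : L1 (Q n) (fun z => 2 * `|excess A (f n) z| + 2 * `|excess B (g n) z|).
  by apply: L1D; apply: L1Z; exact: L1_excess.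
apply: (@le_trans _ _ (Ex (Q n) (fun z => 2 * `|excess A (f n) z| + 2 * `|excess B (g n) z|))).
  apply: Ex_le => //; first exact: L1_excess.
  move=> z; rewrite /excess (ger0_norm (addr_ge0 (normr_ge0 _) (normr_ge0 _))).
  case: ltP => [h2|_]; last by rewrite normr0 addr_ge0// mulr_ge0.
  rewrite (ger0_norm (addr_ge0 (normr_ge0 _) (normr_ge0 _))).
  have a0 := normr_ge0 (f n z); have b0 := normr_ge0 (g n z).
  case: (ltP A) => hf; case: (ltP B) => hg; rewrite ?normr0; lra.
rewrite ExD; [|by apply: L1Z; exact: L1_excess|by apply: L1Z; exact: L1_excess].
rewrite !ExZ; [lra|exact: L1_excess|exact: L1_excess].
Qed.

Lemma unif_int_scale (K : R) f : unif_int Q f -> unif_int Q (fun n z => K * f n z).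
Proof.
move=> uf e e0; pose L := `|K| + 1; have L0 : 0 < L by rewrite ltr_wpDl.
have eL : 0 < e / L by rewrite divr_gt0.
have [A A0 hA] := uf _ eL; exists (L * A); first by rewrite mulr_gt0.
move=> n n0; have [lf fA] := hA _ n0; split; first exact: L1Z.
apply: (@le_trans _ _ (Ex (Q n) (fun z => L * `|excess A (f n) z|))); last first.
  by rewrite ExZ ?[L * _]mulrC -?ler_pdivlMr//; exact: L1_excess.
apply: Ex_le; [by apply: L1_excess; exact: L1Z|by apply: L1Z; exact: L1_excess|].
move=> z; rewrite /excess normrM.
have KL : `|K| <= L by rewrite lerDl.
case: ltP => h; last by rewrite normr0 mulr_ge0// ltW.
have fz : L * A < L * `|f n z| by rewrite (lt_le_trans h)// ler_wpM2r.
by move: fz; rewrite ltr_pM2l// => ->; rewrite normrM ler_wpM2r.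
Qed.

Lemma unif_int_cst (K : R) : unif_int Q (fun n z => K).
Proof.
move=> e e0; exists (`|K| + 1); first by rewrite ltr_wpDl.
move=> n n0; split; first exact: L1_cst.
rewrite /excess ltNge lerDl ler01/= (_ : (fun=> _) = cst 0) ?Ex_cst ?ltW//.
by apply/funext => z; rewrite normr0.
Qed.

Lemma unif_int_sum I (s : seq I) (F : I -> forall n, O n -> R) :
  (forall i, unif_int Q (F i)) -> unif_int Q (fun n z => \sum_(i <- s) `|F i n z|).
Proof.
move=> uF; elim: s => [|i s ih].
  have := unif_int_cst 0; apply: unif_int_dom.
    by move=> n n0; apply: measurable_fun_sum => j _; apply: measurableT_comp => //;
      have [A _ /(_ _ n0) [h _]] := uF j _ (@ltr01 R); exact: L1_meas h.
  by move=> n z _; rewrite big_nil.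
apply: unif_int_dom (unif_intD (uF i) ih).
  by move=> n n0; apply: measurable_fun_sum => j _; apply: measurableT_comp => //;
    have [A _ /(_ _ n0) [h _]] := uF j _ (@ltr01 R); exact: L1_meas h.
move=> n z _; rewrite big_cons [leRHS]ger0_norm; last by rewrite addr_ge0.
by rewrite (le_trans (ler_normD _ _))// normr_id.
Qed.

Lemma unif_int_sqr (C : R) f : (forall n, (0 < n)%N -> [/\ measurable_fun setT (f n),
    L1 (Q n) (fun z => f n z ^+ 2) & Ex (Q n) (fun z => f n z ^+ 2) <= C]) ->
  unif_int Q f.
Proof.
move=> h e e0; pose D := `|C| + 1; have D0 : 0 < D by rewrite ltr_wpDl.
exists (D / e); first by rewrite divr_gt0.
move=> n n0; have [mf l2 E2] := h _ n0.
have lf : L1 (Q n) (f n).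
  apply: (@L1_le _ _ _ _ _ (fun z => 1 + f n z ^+ 2)) => //.
    move=> z; have := sqr_ge0 (`|f n z| - 1); rewrite sqrrB1 real_normK ?num_real//.
    by have := sqr_ge0 (f n z); lra.
  by apply: L1D => //; exact: L1_cst.
split=> //; apply: (@le_trans _ _ (Ex (Q n) (fun z => e / D * f n z ^+ 2))).
  apply: Ex_le; [exact: L1_excess|exact: L1Z|].
  move=> z; rewrite /excess; case: ltP => hz; last first.
    by rewrite normr0 mulr_ge0 ?sqr_ge0// divr_ge0// ltW.
  rewrite -(real_normK (num_real (f n z))) expr2 mulrA ler_peMl//.
  by rewrite mulrAC ler_pdivlMr// mul1r mulrC -ler_pdivrMr// ltW.
rewrite ExZ// mulrAC ler_pdivrMr// ler_wpM2l ?(ltW e0)// (le_trans E2)//.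
by rewrite (le_trans (ler_norm _))// lerDl.
Qed.

Lemma unif_int_powR (r B : R) f : 0 < r -> (forall n, (0 < n)%N ->
    [/\ measurable_fun setT (f n), L1 (Q n) (fun z => `|f n z| `^ (1 + r)) &
     Ex (Q n) (fun z => `|f n z| `^ (1 + r)) <= B]) ->
  unif_int Q f.
Proof.
move=> r0 h e e0; pose D := `|B| + 1; have D0 : 0 < D by rewrite ltr_wpDl.
have De : 0 < D / e by rewrite divr_gt0.
(* Chosen so that A^r = D / e; above this level |f| <= A^(-r) |f|^(1 + r). *)
pose A := (D / e) `^ r^-1.
have A0 : 0 < A by rewrite powR_gt0.
have Ar : A `^ r = D / e by rewrite -powRrM mulVf ?powRr1 ?ltW// gt_eqF.
exists A => // n n0; have [mf lp Ep] := h _ n0.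
have le1 z : `|f n z| <= 1 + `|f n z| `^ (1 + r).
  have [f1|/ltW f1] := leP `|f n z| 1; first by rewrite (le_trans f1)// lerDl powR_ge0.
  rewrite (@le_trans _ _ (`|f n z| `^ (1 + r)))// ?lerDr//.
  by rewrite -[leLHS]powRr1// ler_powR// lerDl ltW.
have lf : L1 (Q n) (f n).
  by apply: (L1_le mf le1); apply: L1D => //; exact: L1_cst.
split=> //; apply: (@le_trans _ _ (Ex (Q n) (fun z => e / D * `|f n z| `^ (1 + r)))).
  apply: Ex_le; [exact: L1_excess|exact: L1Z|].
  move=> z; rewrite /excess; case: ltP => hz; last first.
    by rewrite normr0 mulr_ge0 ?powR_ge0// divr_ge0// ltW.
  rewrite powRD; last by rewrite gt_eqF// addr_gt0.
  rewrite powRr1// mulrCA ler_peMr//.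
  rewrite -invf_div ler_pdivlMl// mulr1 -Ar.
  by rewrite ge0_ler_powR ?nnegrE ?(ltW r0) ?(ltW A0)// ltW.
rewrite ExZ// mulrAC ler_pdivrMr// ler_wpM2l ?(ltW e0)// (le_trans Ep)//.
by rewrite (le_trans (ler_norm _))// lerDl.
Qed.

End uniform_integrability.

(** * Smooth functions of a vector *)

Section vector_functions.
Context {R : realType} {k : nat}.
Local Notation vec := 'cV[R]_k.+1.
Implicit Types (x y v : vec) (e : R).

Lemma cV_ballP x y e : 0 < e -> (forall t, `|x t 0 - y t 0| < e) <-> ball x e y.
Proof.
move=> e0; split; first by move=> h; split=> // i j; rewrite ord1; exact: h.
by move=> [_ h] t; exact: h.
Qed.

Lemma measurable_forall d (Om : measurableType d) (I : finType) (A : I -> set Om) :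
  (forall i, measurable (A i)) -> measurable [set w | forall i, A i w].
Proof.
move=> mA; rewrite [X in measurable X](_ : _ = \big[setI/setT]_(i : I) A i).
  by apply: bigsetI_measurable.
rewrite -bigcap_seq/=; apply/seteqP; split => w /=; first by move=> h i _; exact: h.
by move=> h i; apply: (h i); rewrite /= mem_index_enum.
Qed.

(** The preimage of an open set is a countable union over the rational boxes that the set contains,
    and each box only constrains coordinates. *)
Lemma measurable_cV_comp d (Om : measurableType d) (m : Om -> vec) (g : vec -> R) :
  continuous g -> (forall t, measurable_fun setT (fun w => m w t 0)) ->
  measurable_fun setT (fun w => g (m w)).
Proof.
move=> cg mm.
have mU (U : set vec) : open U -> measurable (m @^-1` U).
  move=> oU.
  pose box (q : 'cV[rat]_k.+1) (r : nat) : set vec :=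
    [set y | forall t, `|ratr (q t 0) - y t 0| < r.+1%:R^-1].
  pose F (j : nat) : set Om := if unpickle j is Some qr then
    (if `[< box qr.1 qr.2 `<=` U >] then m @^-1` box qr.1 qr.2 else set0) else set0.
  have -> : m @^-1` U = \bigcup_j F j.
    apply/seteqP; split => w /=; last first.
      move=> [j _]; rewrite /F; case: unpickle => // -[q r]/=.
      by case: asboolP => // qU /qU.
    move=> Uw; have /nbhs_ballP[e /= e0 eU] : nbhs (m w) U by exact: open_nbhs_nbhs.
    (* A box of this radius about a rational point equally close to [m w] contains [m w] and stays
       within distance e of it. *)
    have [r r0] : exists r : nat, r.+1%:R^-1 < e / 2.
      by have := @near_infty_natSinv_lt R (PosNum (divr_gt0 e0 (ltr0n _ 2))) => -[r _ /(_ r (leqnn r))/= h]; exists r.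
    have rp : (0 : R) < r.+1%:R^-1 by rewrite invr_gt0.
    have qx t : {q : rat | `|ratr q - m w t 0| < r.+1%:R^-1}.
      apply: cid; have ab : m w t 0 - r.+1%:R^-1 < m w t 0 + r.+1%:R^-1.
        by rewrite ltrBlDr -addrA ltrDl addr_gt0.
      have [q] := rat_in_itvoo ab; rewrite in_itv/= => /andP[h1 h2]; exists q.
      by rewrite ltr_distl; apply/andP; split.
    exists (pickle ((\col_t sval (qx t) : 'cV[rat]_k.+1), r)) => //.
    rewrite /F pickleK/=; case: asboolP => [_|]; first by move=> t; rewrite mxE; case: (qx t).
    case; move=> y h; apply: eU; apply/cV_ballP => // t.
    have := h t; rewrite mxE; case: (qx t) => q /= hq hy.
    rewrite (_ : m w t 0 - y t 0 = (ratr q - y t 0) - (ratr q - m w t 0)); last by ring.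
    rewrite (le_lt_trans (ler_normB _ _))// (lt_trans (ltrD hy hq))//.
    by rewrite (_ : e = e / 2 + e / 2) ?ltrD//; field.
  apply: bigcupT_measurable => j; rewrite /F; case: unpickle => // -[q r]/=.
  case: asboolP => // _.
  apply: (@measurable_forall _ _ _ (fun t => [set w | `|ratr (q t 0) - m w t 0| < r.+1%:R^-1])) => t.
  apply: measurable_setlt => //; apply: measurableT_comp => //; exact: measurable_funB.
apply: (measurability _ (RGenOpens.measurableE R)).
move=> _ [_ [a [b ->] <-]]; apply: measurableI => //.
by apply: (mU (g @^-1` `]a, b[%classic)); move/continuousP : cg; apply; exact: interval_open.
Qed.

Lemma compact_box (K : R) : compact [set x : vec | forall t, `|x t 0| <= K].
Proof.
have -> : [set x : vec | forall t, `|x t 0| <= K] =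
    trmx @` [set v : 'rV[R]_k.+1 | forall i, `[- K, K]%classic (v ord0 i)].
  apply/seteqP; split => x /=.
    move=> h; exists (x^T); last by rewrite trmxK.
    by move=> i; rewrite mxE/= in_itv/= -ler_norml; exact: h.
  by move=> [v h <-] t; rewrite mxE; have := h t; rewrite /= in_itv/= -ler_norml.
apply: continuous_compact; last first.
  apply: (@rV_compact _ _ (fun=> `[- K, K]%classic)) => i; exact: segment_compact.
apply: continuous_subspaceT => v A [B nB BA]; exists (fun i j => B j i).
  by move=> i j; have := nB j i; rewrite mxE.
by move=> u hu; apply: BA => i j; rewrite mxE; exact: hu.
Qed.

(** Only [x] is confined to the compact set: [y] will be the estimator, which need not lie in it. *)
Lemma uniform_continuity_on_compact (A : set vec) (f : vec -> R) : compact A -> continuous f ->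
  forall e, 0 < e -> exists2 de, 0 < de & forall x y, A x ->
    (forall t, `|x t 0 - y t 0| < de) -> `|f x - f y| < e.
Proof.
move=> /compact_near_coveringP cA cf e e0.
pose Pr (de : R) (x : vec) := forall y, (forall t, `|x t 0 - y t 0| < de) -> `|f x - f y| < e.
have H : \forall de \near 0^'+, A `<=` Pr de.
  apply: cA => x Ax.
  have e2 : 0 < e / 2 by rewrite divr_gt0.
  have : \forall y \near x, `|f x - f y| < e / 2.
    by move/cvgrPdist_lt : (cf x) => /(_ _ e2).
  move=> /nbhs_ballP[r /= r0 hr].
  have r2 : 0 < r / 2 by rewrite divr_gt0.
  near=> x' de => y hy.
  have h1 : ball x (r / 2) x' by near: x'; exact: nbhsx_ballx.
  have dr : de < r / 2 by near: de; exact: nbhs_right_lt.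
  have h2 : ball x r y.
    apply/cV_ballP => // t; rewrite (_ : x t 0 - y t 0 = (x t 0 - x' t 0) + (x' t 0 - y t 0)); last by ring.
    rewrite (le_lt_trans (ler_normD _ _))//.
    have g1 := (cV_ballP x x' r2).2 h1 t; have g2 := hy t.
    by rewrite (lt_trans (ltrD g1 g2))// -ltrBrDl (lt_le_trans dr)//; lra.
  have h3 : ball x r x'.
    by apply: le_ball h1; lra.
  have /= := hr _ h2; have /= := hr _ h3 => g1 g2.
  rewrite (_ : f x' - f y = (f x - f y) - (f x - f x')); last by ring.
  by rewrite (le_lt_trans (ler_normB _ _))//; lra.
have [de [de0 h]] : exists de : R, 0 < de /\ A `<=` Pr de.
  have : \forall de \near 0^'+, 0 < de /\ A `<=` Pr de.
    by near=> de; split; [near: de; exact: nbhs_right_gt|near: de].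
  exact: filter_ex.
by exists de => // x y Ax; exact: h.
Unshelve. all: by end_near. Qed.

Lemma bounded_on_box (K : R) (f : vec -> R) : continuous f ->
  exists B, forall x, (forall t, `|x t 0| <= K) -> `|f x| <= B.
Proof.
move=> cf; have : compact (f @` [set x : vec | forall t, `|x t 0| <= K]).
  apply: continuous_compact; [exact: continuous_subspaceT|exact: compact_box].
move=> /compact_bounded [M [_ hM]]; exists (M + 1) => x hx.
by apply: (hM (M + 1)); [rewrite ltrDl|exists x].
Qed.

Lemma partial_derive_sum (G : vec -> R) x v : differentiable G x ->
  'D_v G x = \sum_t v t 0 * partial t G x.
Proof.
move=> dG; rewrite deriveE// {1}(_ : v = \sum_t v t 0 *: delta_mx t 0).
  rewrite linear_sum; apply: eq_bigr => t _; rewrite linearZ/=.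
  by rewrite /partial deriveE.
rewrite [LHS]matrix_sum_delta; apply: eq_bigr => i _.
by rewrite big_ord1.
Qed.

Lemma is_derive_line (G : vec -> R) x v (s : R) : (forall y, differentiable G y) ->
  is_derive s 1 (fun s => G (x + s *: v)) ('D_v G (x + s *: v)).
Proof.
move=> dG; have dv : derivable G (x + s *: v) v by exact: diff_derivable.
have E : (fun h : R => h^-1 *: (((fun s => G (x + s *: v)) \o shift s) (h *: 1) - G (x + s *: v))) =
    (fun h : R => h^-1 *: ((G \o shift (x + s *: v)) (h *: v) - G (x + s *: v))).
  apply/funext => h /=; congr (_ *: (G _ - _)).
  by rewrite [_ *: (1 : R)]mulr1 scalerDl addrCA.
by split; rewrite /derivable /derive E.
Qed.

(** Uniformity over a box of base points is what a moving target requires, since the mean vector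
    changes with n and only its boundedness is known. *)
Lemma gradient_increment (G : vec -> R) (K e : R) : (forall y, differentiable G y) ->
  (forall t, continuous (partial t G)) -> 0 < e ->
  exists2 de, 0 < de & forall x y, (forall t, `|x t 0| <= K) ->
    (forall t, `|x t 0 - y t 0| < de) ->
    `|G y - G x - \sum_t partial t G x * (y t 0 - x t 0)| <= e * \sum_t `|y t 0 - x t 0| /\
    forall t, `|partial t G x - partial t G y| <= e.
Proof.
move=> dG cG e0.
have [de de0 hde] : exists2 de, 0 < de & forall t x y, (forall s, `|x s 0| <= K) ->
    (forall s, `|x s 0 - y s 0| < de) -> `|partial t G x - partial t G y| < e.
  have cK : compact [set x : vec | forall t, `|x t 0| <= K] by exact: compact_box.
  have h t := @uniform_continuity_on_compact _ (partial t G) cK (cG t) e e0.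
  pose D t := sval (cid2 (h t)).
  have D0 t : 0 < D t by rewrite /D; case: cid2.
  have DP t : forall x y, (forall s, `|x s 0| <= K) -> (forall s, `|x s 0 - y s 0| < D t) ->
      `|partial t G x - partial t G y| < e.
    by rewrite /D; case: cid2.
  pose m := \big[Num.min/1]_t D t.
  exists m.
    by rewrite /m; elim/big_ind : _ => // [a b a0 b0]; rewrite lt_min a0.
  move=> t x y hx hxy; apply: (DP t x y hx) => s; apply: lt_le_trans (hxy s) _.
  by rewrite /m (bigD1 t)//= ge_min lexx.
exists de => // x y hx hxy; split; last by move=> t; apply: ltW; exact: hde.
pose v := y - x.
have h1 (s : R) : s \in `]0, 1[ -> is_derive s 1 (fun s => G (x + s *: v)) ('D_v G (x + s *: v)).
  by move=> _; exact: is_derive_line.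
have h2 : {within `[(0 : R), 1], continuous (fun s => G (x + s *: v))}.
  apply: continuous_subspaceT => s; apply: differentiable_continuous.
  by apply/derivable1_diffP; case: (is_derive_line x v s dG).
have [c c01] := MVT ltr01 h1 h2.
rewrite scale1r scale0r addr0 subr0 mulr1 (_ : x + v = y); last by rewrite addrC subrK.
move=> ->; rewrite partial_derive_sum// (_ : (_ - _) =
  \sum_t (y t 0 - x t 0) * (partial t G (x + c *: v) - partial t G x)); last first.
  by rewrite -sumrB; apply: eq_bigr => t _; rewrite !mxE; ring.
rewrite (le_trans (ler_norm_sum _ _ _))// mulr_sumr; apply: ler_sum => t _.
rewrite normrM mulrC ler_wpM2r// distrC ltW// hde// => s.
rewrite !mxE opprD addrA subrr add0r normrN normrM.
move: c01; rewrite in_itv/= => /andP[c0 c1].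
rewrite gtr0_norm// (le_lt_trans _ (hxy s))// distrC.
by rewrite -[leRHS]mul1r distrC ler_wpM2r// ltW.
Qed.

End vector_functions.

(** * Coverage *)

Lemma coverage_arith (R : realType) (eta e al p1 p p2 f1 f f2 : R) : eta <= e / 8 ->
  p1 <= p + eta -> p <= p2 + eta ->
  f1 - (2 * p1 - 1) <= 2 * (e / 8) -> - (f2 - (2 * p2 - 1)) <= 2 * (e / 8) ->
  f <= f1 + e / 8 -> f2 <= f + e / 8 -> p = 1 - al / 2 -> `|f - (1 - al)| <= e.
Proof. by move=> *; rewrite ler_norml; apply/andP; split; lra. Qed.

(** For x >= 0 compare s with sqrt x + s in the factorisation of x - s^2. Negative [x], with root 0
    by convention, are included, so the variance estimate needs no proof of sign. *)
Lemma sqrt_sub_sqr (R : realType) (x s : R) : 0 < s -> `|Num.sqrt x - s| * s <= `|x - s ^+ 2|.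
Proof.
move=> s0; have [x0|x0] := leP 0 x; last first.
  by rewrite ltr0_sqrtr// sub0r normrN gtr0_norm// ltr0_norm; have := sqr_ge0 s; nra.
rewrite -{2}(sqr_sqrtr x0) subr_sqr normrM ler_wpM2l// ger0_norm ?lerDr ?sqrtr_ge0//.
by rewrite addr_ge0 ?sqrtr_ge0// ltW.
Qed.

Section coverage.
Context {R : realType} {d : nat -> measure_display} {O : forall n, measurableType (d n)}.
Variables (Q : forall n, probability (O n) R) (S : forall n, probability (n.-tuple (O n)) R).
Hypothesis S_iid : forall n, (0 < n)%N -> iid (Q n) (S n).
Variable zeta : forall n, O n -> R.
Hypothesis zetaP : forall n, (0 < n)%N -> [/\ L1 (Q n) (zeta (n := n)),
  Ex (Q n) (zeta (n := n)) = 0 & Ex (Q n) (fun z => zeta z ^+ 2) = 1].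
Hypothesis zeta_ui : unif_int Q (fun n z => zeta z ^+ 2).
Let W n (w : n.-tuple (O n)) := Num.sqrt n%:R * avg w (zeta (n := n)).

Let measurable_W n : (0 < n)%N -> measurable_fun setT (@W n).
Proof.
by move=> /zetaP[hz _ _]; apply: measurable_funM => //; apply: measurable_avg; exact: L1_meas hz.
Qed.

(** The limit theorem for -zeta. With both [W] and [- W] at hand, the two-sided limit 2 Phi(a) - 1
    comes without the symmetry of [Phi]. *)
Let clt_ge (a e : R) : 0 < e -> \forall n \near \oo,
  `|fine (S n [set w | - W w <= a]) - Phi a| <= e.
Proof.
move=> e0.
have zP n : (0 < n)%N -> [/\ L1 (Q n) (fun z => - zeta (n := n) z),
    Ex (Q n) (fun z => - zeta (n := n) z) = 0 & Ex (Q n) (fun z => (- zeta (n := n) z) ^+ 2) = 1].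
  move=> /zetaP[z1 z2 z3]; split; [exact: L1N|by rewrite ExN// z2 oppr0|].
  by rewrite -[RHS]z3; congr Ex; apply/funext => z; rewrite sqrrN.
have zu : unif_int Q (fun n z => (- zeta (n := n) z) ^+ 2).
  move=> c c0; have [A A0 h] := zeta_ui c0; exists A => // n n0.
  rewrite (_ : (fun z => (- zeta (n := n) z) ^+ 2) = (fun z => zeta z ^+ 2) :> (O n -> R)); last first.
    by apply/funext => z; rewrite sqrrN.
  exact: h.
have := @clt _ _ _ Q S S_iid (fun n z => - zeta (n := n) z) zP zu a e e0.
apply: filterS => n; congr (`|fine (S n _) - _| <= _).
apply/seteqP; split => w /=; rewrite /W (_ : avg w (fun z => - zeta z) = - avg w (zeta (n := n))) ?mulrN//;
by rewrite /avg sumrN mulrN.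
Qed.

Lemma Phi_mono : {homo (@Phi R) : x y / x <= y}.
Proof.
move=> x y xy; rewrite /Phi fine_le ?fin_num_measure//.
apply: le_measure; rewrite ?inE//; apply: subset_itvl.
by rewrite bnd_simp.
Qed.

Let two_sided (a e : R) : 0 <= a -> 0 < e -> \forall n \near \oo,
  `|fine (S n [set w | `|W w| <= a]) - (2 * Phi a - 1)| <= 2 * e.
Proof.
move=> a0 e0; apply: filterS3 (nbhs_infty_gt 0) (clt S_iid zetaP zeta_ui a e0) (clt_ge a e0) => n n0.
have mW := measurable_W n0.
pose A := [set w | @W n w <= a]; pose B := [set w | - @W n w <= a].
have mA : measurable A by apply: measurable_setle.
have mB : measurable B by apply: measurable_setle => //; exact: measurableT_comp.
rewrite -/(W _) -/A -/B.
have -> : [set w | `|@W n w| <= a] = A `\` ~` B.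
  rewrite setDE setCK; apply/seteqP; split => w /=; rewrite /A /B /= ler_norml.
    by move=> /andP[h1 h2]; split => //; rewrite lerNl.
  by move=> [h1 h2]; rewrite h1 andbT lerNl.
have BA : ~` B `<=` A by move=> w /= /negP; rewrite /B /A /= -ltNge; lra.
have : fine (S n (A `\` ~` B)) = fine (S n A) + fine (S n B) - 1.
  have [fA fB] : (S n A \is a fin_num) /\ (S n B \is a fin_num) by rewrite !fin_num_measure.
  rewrite measureD//; last 2 first.
  - exact: measurableC.
  - by rewrite ltey_eq fA.
  have PC : fine (S n (~` B)) = 1 - fine (S n B).
    by rewrite (@probability_setC _ _ _ (S n) B mB) fineB.
  rewrite setIidr// fineB//; last by rewrite fin_num_measure//; exact: measurableC.
  by rewrite PC; lra.
move=> -> /ler_normlP[h1 h2] /ler_normlP[h3 h4].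
by rewrite ler_norml; apply/andP; split; lra.
Qed.

(** The events W <= -e and -W <= -e are disjoint, and both probabilities are close to Phi(-e); so
    the limit theorem itself yields the bound by one half. It makes the critical value positive. *)
Let Phi0_le : Phi (0 : R) <= 1 / 2.
Proof.
suff h e : 0 < e -> Phi (0 : R) <= 1 / 2 + 2 * e.
  rewrite leNgt; apply/negP => lt; have := h ((Phi (0 : R) - 1 / 2) / 4).
  by rewrite divr_gt0 ?subr_gt0// => /(_ isT); lra.
move=> e0.
have [n [n0 [h1 h2]]] := filter_ex (filterI (nbhs_infty_gt 0)
  (filterI (clt S_iid zetaP zeta_ui (- e) e0) (clt_ge (- e) e0))).
have mW := measurable_W n0.
pose A := [set w | @W n w <= - e]; pose B := [set w | - @W n w <= - e].
have mA : measurable A by apply: measurable_setle.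
have mB : measurable B by apply: measurable_setle => //; exact: measurableT_comp.
rewrite -/(W _) -/A in h1; rewrite -/B in h2.
have [fA fB] : (S n A \is a fin_num) /\ (S n B \is a fin_num) by rewrite !fin_num_measure.
have AB : fine (S n A) + fine (S n B) <= 1.
  have : (S n (A `|` B) <= 1)%E by apply: probability_le1; exact: measurableU.
  rewrite -lee_fin EFinD !fineK// (@measureU _ _ _ (S n))//.
  apply/seteqP; split => // w []; rewrite /A /B /= => h3 h4.
  have : e <= 0 by lra.
  by rewrite leNgt e0.
have := @Phi_lipschitz R (- e) e (ltW e0); rewrite addNr.
move: h1 h2 => /ler_normlP[h1 _] /ler_normlP[h2 _]; lra.
Qed.

Variables (D V : forall n, n.-tuple (O n) -> R) (sigma : nat -> R) (s0 : R).
Hypothesis s0_gt0 : 0 < s0.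
Hypothesis sigma_ge : forall n, (0 < n)%N -> s0 <= sigma n.
Hypothesis measurable_D : forall n, (0 < n)%N -> measurable_fun setT (D (n := n)).
Hypothesis measurable_V : forall n, (0 < n)%N -> measurable_fun setT (V (n := n)).
Hypothesis D_approx : negl S (fun n w => D w - sigma n * W w).
Hypothesis V_approx : negl S (fun n w => V w - sigma n ^+ 2).

(* Both inclusions {|W| <= c - eta} <= {|D| <= c sqrt V} <= {|W| <= c + eta} hold off an event of
   small probability. *)
Lemma coverage (alpha c e : R) : 0 < alpha < 1 -> Phi c = 1 - alpha / 2 -> 0 < e ->
  \forall n \near \oo,
    `|fine (S n [set w | `|D w| <= c * Num.sqrt (V w)]) - (1 - alpha)| <= e.
Proof.
move=> /andP[al0 al1] Phic e0.
have c0 : 0 < c.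
  rewrite ltNge; apply/negP => /Phi_mono; rewrite Phic => h.
  by have := le_trans h Phi0_le; lra.
pose eta := Num.min (c / 2) (e / 8).
have eta0 : 0 < eta by rewrite lt_min !divr_gt0.
have eta_e : eta <= e / 8 by rewrite ge_min lexx orbT.
have eta_c : eta <= c / 2 by rewrite ge_min lexx.
have e8 : 0 < e / 8 by rewrite divr_gt0.
(* Calibrated to de (1 + c) <= eta sigma: one [de] for the error of [D], and c times [de] for that
   of the root of [V]. *)
pose de := eta * s0 / (1 + c).
have c1 : 0 < 1 + c by rewrite addr_gt0.
have de0 : 0 < de by rewrite !(mulr_gt0, divr_gt0, invr_gt0).
have ds0 : 0 < de * s0 by rewrite mulr_gt0.
have e16 : 0 < e / 16 by rewrite divr_gt0.
have a1 : 0 <= c + eta by rewrite addr_ge0// ltW.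
have a2 : 0 <= c - eta by lra.
near=> n; have n0 : (0 < n)%N by near: n; exact: nbhs_infty_gt.
have bigE : big (S n) (e / 16 + e / 16) ([set w | `|D w - sigma n * W w| <= de] `&`
    [set w | `|V w - sigma n ^+ 2| <= de * s0]).
  apply: bigI; near: n; [exact: D_approx|exact: V_approx].
have : `|fine (S n [set w | `|W w| <= c + eta]) - (2 * Phi (c + eta) - 1)| <= 2 * (e / 8).
  by near: n; exact: two_sided.
have : `|fine (S n [set w | `|W w| <= c - eta]) - (2 * Phi (c - eta) - 1)| <= 2 * (e / 8).
  by near: n; exact: two_sided.
set A2 := [set w | _ <= c - eta]; set A1 := [set w | _ <= c + eta].
set E := [set w | _ <= c * _] => t2 t1.
have mW := measurable_W n0; have mD := measurable_D n0; have mV := measurable_V n0.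
have mnW : measurable_fun setT (fun w => `|@W n w|) by exact: measurableT_comp.
have mA1 : measurable A1 by exact: measurable_setle.
have mA2 : measurable A2 by exact: measurable_setle.
have mE : measurable E.
  apply: measurable_setle; first exact: measurableT_comp.
  by apply: measurable_funM => //; apply: measurableT_comp => //; apply: continuous_measurable_fun; exact: sqrt_continuous.
have key (w : n.-tuple (O n)) : `|D w - sigma n * W w| <= de -> `|V w - sigma n ^+ 2| <= de * s0 ->
    `| `|D w| - c * Num.sqrt (V w) - sigma n * (`|W w| - c)| <= eta * sigma n.
  have sn := sigma_ge n0; have sp : 0 < sigma n by exact: lt_le_trans sn.
  move=> h1 h2; have h3 : `|Num.sqrt (V w) - sigma n| <= de.
    rewrite -(ler_pM2r sp) (le_trans (sqrt_sub_sqr _ sp))// (le_trans h2)//.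
    by rewrite ler_wpM2l// ltW.
  have h4 : `| `|D w| - sigma n * `|W w| | <= de.
    by rewrite -[sigma n]gtr0_norm// -normrM (le_trans (ler_dist_dist _ _)).
  have h5 : de * (1 + c) <= eta * sigma n.
    by rewrite /de divfK ?gt_eqF// ler_wpM2l// ltW.
  rewrite (_ : _ - _ - _ = (`|D w| - sigma n * `|W w|) - c * (Num.sqrt (V w) - sigma n)); last by ring.
  rewrite (le_trans (ler_normB _ _))// (le_trans _ h5)// [de * (1 + c)]mulrDr mulr1 lerD//.
  by rewrite normrM (gtr0_norm c0) mulrC ler_wpM2r// ltW.
have p1 : (S n E <= S n A1 + (e / 8)%:E)%E.
  apply: (big_prob_le mE mA1 (bigS _ (@subset_refl _ _) bigE)); first by lra.
  move=> w [/= h1 h2] hE; have sp : 0 < sigma n by exact: lt_le_trans (sigma_ge n0).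
  have /ler_normlP[k1 _] := key w h1 h2; rewrite /A1 /= -(ler_pM2l sp).
  by move: hE k1; rewrite /E /=; move: (Num.sqrt _) `|D w| `|W w| => x y z; nra.
have p2 : (S n A2 <= S n E + (e / 8)%:E)%E.
  apply: (big_prob_le mA2 mE (bigS _ (@subset_refl _ _) bigE)); first by lra.
  move=> w [/= h1 h2] hA; have sp : 0 < sigma n by exact: lt_le_trans (sigma_ge n0).
  have /ler_normlP[_ k1] := key w h1 h2; rewrite /E /=.
  have hA' : sigma n * `|W w| <= sigma n * (c - eta) by rewrite ler_pM2l.
  by move: hA' k1; move: (Num.sqrt _) `|D w| `|W w| => x y z; nra.
have [fA1 [fA2 fE]] : (S n A1 \is a fin_num) /\ (S n A2 \is a fin_num) /\ (S n E \is a fin_num).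
  by rewrite !fin_num_measure.
move: p1 p2; rewrite -(fineK fA1) -(fineK fA2) -(fineK fE) -!EFinD !lee_fin => p1 p2.
have l1 : Phi (c + eta) <= Phi c + eta by apply: Phi_lipschitz; exact: ltW.
have l2 : Phi c <= Phi (c - eta) + eta.
  by have := @Phi_lipschitz R (c - eta) eta (ltW eta0); rewrite subrK.
move: t1 t2 => /ler_normlP[_ t1] /ler_normlP[t2 _].
exact: (coverage_arith eta_e l1 l2 t1 t2 p1 p2 Phic).
Unshelve. all: by end_near. Qed.

End coverage.

(** * The doubly robust estimator *)

Lemma measurable_invr (R : realType) : measurable_fun setT (@GRing.inv R).
Proof.
have oN : open [set x : R | x != 0] by exact: open_neq.
have mN := open_measurable oN; have -> : setT = [set (0 : R)] `|` [set x : R | x != 0].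
  by apply/seteqP; split=> // x _ /=; have [->|x0] := eqVneq x 0; [left|right].
apply/measurable_funU => //; split; first exact: measurable_fun_set1.
apply: open_continuous_measurable_fun => // x; rewrite inE => x0.
by apply: cvgV => //; exact: cvg_id.
Qed.

Lemma sqr_sum_le (R : realType) n (f : 'I_n -> R) :
  (\sum_i f i) ^+ 2 <= n%:R * \sum_i f i ^+ 2.
Proof.
rewrite expr2 mulr_suml (@le_trans _ _ (\sum_i \sum_j (f i ^+ 2 / 2 + f j ^+ 2 / 2)))//.
  apply: ler_sum => i _; rewrite mulr_sumr; apply: ler_sum => j _.
  by move: (f i) (f j) => x y; have := sqr_ge0 (x - y); nra.
rewrite (eq_bigr (fun i => n%:R * (f i ^+ 2 / 2) + (\sum_j f j ^+ 2) / 2)); last first.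
  by move=> i _; rewrite big_split/= sumr_const card_ord -mulr_suml mulr_natl.
rewrite big_split/= sumr_const card_ord -(mulr_natl (_ / 2)) -mulr_sumr -mulr_suml.
by rewrite -mulrDr -splitr.
Qed.

(** In use, a and b are the inverses of the fitted and true scores, x their distance before
    inversion, u the residual and dl the outcome error. Using one bound of each kind, (a - b)^2 <= K
    L x stays linear in x, so that x u^2 can be averaged with fourth moments of u. *)
Lemma within_arith (R : realType) (K L a b x u dl ci : R) : 0 < K -> 0 < L ->
  `|a - b| <= K * x -> `|a - b| <= L -> a <= ci -> 0 < a ->
  ((u - dl) * a - u * b) ^+ 2 <= 2 * (K * L + ci ^+ 2) * (x * u ^+ 2 + dl ^+ 2).
Proof.
move=> K0 L0 d1 d2 aci a0.
have x0 : 0 <= x by rewrite -(pmulr_rge0 _ K0) (le_trans _ d1).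
have h1 : (a - b) ^+ 2 <= K * L * x.
  by rewrite -real_normK ?num_real// expr2 mulrAC ler_pM.
have h2 : a ^+ 2 <= ci ^+ 2 by rewrite lerXn2r// ?nnegrE ?ltW// (lt_le_trans a0).
have h3 : ((u - dl) * a - u * b) ^+ 2 <= 2 * (u ^+ 2 * (a - b) ^+ 2 + dl ^+ 2 * a ^+ 2).
  by have := sqr_ge0 (u * (a - b) + dl * a); nra.
rewrite (le_trans h3)// -mulrA ler_wpM2l//.
have h4 : u ^+ 2 * (a - b) ^+ 2 <= u ^+ 2 * (K * L * x) by rewrite ler_wpM2l ?sqr_ge0.
have h5 : dl ^+ 2 * a ^+ 2 <= dl ^+ 2 * ci ^+ 2 by rewrite ler_wpM2l ?sqr_ge0.
have h6 : 0 <= K * L * dl ^+ 2 by rewrite mulr_ge0 ?sqr_ge0// mulr_ge0// ltW.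
have h7 : 0 <= ci ^+ 2 * (x * u ^+ 2) by rewrite mulr_ge0 ?sqr_ge0// mulr_ge0 ?sqr_ge0.
rewrite (le_trans (lerD h4 h5))// mulrDl !mulrDr.
rewrite (_ : u ^+ 2 * (K * L * x) = K * L * (x * u ^+ 2)); last by ring.
by rewrite (mulrC (dl ^+ 2)); lra.
Qed.

Lemma Ex_sqr_comb (R : realType) d (O : measurableType d) (Q : probability O R) k
  (F : 'I_k -> O -> R) (g : 'I_k -> R) : (forall t t', L1 Q (fun o => F t o * F t' o)) ->
  Ex Q (fun o => (\sum_t g t * F t o) ^+ 2) =
  \sum_t \sum_t' g t * g t' * Ex Q (fun o => F t o * F t' o).
Proof.
move=> hF.
rewrite (_ : (fun o => _) = (fun o => \sum_t \sum_t' g t * g t' * (F t o * F t' o))); last first.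
  apply/funext => o; rewrite expr2 mulr_suml; apply: eq_bigr => t _.
  by rewrite mulr_sumr; apply: eq_bigr => t' _; ring.
rewrite Ex_sum; last by move=> t _; apply: L1_sum => t' _; exact: L1Z.
apply: eq_bigr => t _; rewrite Ex_sum; last by move=> t' _; exact: L1Z.
by apply: eq_bigr => t' _; rewrite ExZ.
Qed.

Section averaged_products.
Context {R : realType} {d : nat -> measure_display} {O : forall n, measurableType (d n)}.
Variable S : forall n, probability (n.-tuple (O n)) R.
Implicit Types (a b f g : forall n, n.-tuple (O n) -> O n -> R).

Lemma negl_avgM f g : negl S (fun n w => avg w (fun z => f n w z ^+ 2)) ->
  tight S (fun n w => avg w (fun z => g n w z ^+ 2)) ->
  negl S (fun n w => avg w (fun z => f n w z * g n w z)).
Proof.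
move=> nf tg; apply: (negl_le0 (neglM (negl_sqrt nf) (tight_sqrt tg))) => n w.
by rewrite [leRHS]ger0_norm ?mulr_ge0 ?sqrtr_ge0//; exact: cauchy_schwarz_avg.
Qed.

Lemma negl_avg_prod a a' b b' :
  negl S (fun n w => avg w (fun z => (b n w z - a n w z) ^+ 2)) ->
  negl S (fun n w => avg w (fun z => (b' n w z - a' n w z) ^+ 2)) ->
  tight S (fun n w => avg w (fun z => a n w z ^+ 2)) ->
  tight S (fun n w => avg w (fun z => a' n w z ^+ 2)) ->
  negl S (fun n w => avg w (fun z => b n w z * b' n w z) - avg w (fun z => a n w z * a' n w z)).
Proof.
move=> nd nd' ta ta'.
have n1 := negl_avgM (f := fun n w z => b n w z - a n w z) (g := fun n w z => b' n w z - a' n w z)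
  nd (negl_tight nd').
have n2 := negl_avgM (f := fun n w z => b n w z - a n w z) nd ta'.
have n3 := negl_avgM (f := fun n w z => b' n w z - a' n w z) nd' ta.
apply: (negl_eq (neglD (neglD n1 n2) n3)) => n w.
by rewrite -avgB -!avgD; apply: eq_avg => i; ring.
Qed.

End averaged_products.

Section aipw.
Context {R : realType} {T : nat} {d : nat -> measure_display} {X : forall n, measurableType (d n)}.
Local Notation O n := (observed R T (X n)).
Local Notation avgO := (@avg R _ (fun n => O n) _).
Variables (Q : forall n, probability (O n) R) (S : forall n, probability (n.-tuple (O n)) R).
Hypothesis S_iid : forall n, (0 < n)%N -> iid (Q n) (S n).
Variables (q mu : forall n, 'I_T.+1 -> X n -> R).
Variables (ph mh : forall n, n.-tuple (O n) -> 'I_T.+1 -> X n -> R).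
Variables (pmin cmin C4 : R).
Hypothesis pmin_gt0 : 0 < pmin.
Hypothesis q_ge : forall n t x, pmin <= q (n := n) t x.
Hypothesis q_le1 : forall n t x, q (n := n) t x <= 1.
Hypothesis mq : forall n t, (0 < n)%N -> measurable_fun setT (q (n := n) t).
Hypothesis mmu : forall n t, (0 < n)%N -> measurable_fun setT (mu (n := n) t).
Hypothesis mresid : forall n, (0 < n)%N -> measurable_fun setT (resid (mu (n := n)) : O n -> R).
Hypothesis resid4 : forall n, (0 < n)%N -> L1 (Q n) (fun o => resid (mu (n := n)) o ^+ 4) /\
  Ex (Q n) (fun o => resid (mu (n := n)) o ^+ 4) <= C4.
Hypothesis resid0 : forall n (h : 'I_T.+1 * X n -> R), (0 < n)%N -> measurable_fun setT h ->
  L1 (Q n) (fun o => h (od o, ox o) * resid (mu (n := n)) o) ->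
  Ex (Q n) (fun o => h (od o, ox o) * resid (mu (n := n)) o) = 0.
Hypothesis resid2_ge : forall n t, (0 < n)%N ->
  cmin <= Ex (Q n) (fun o => (od o == t)%:R * resid (mu (n := n)) o ^+ 2).
Hypothesis mu2_ui : forall t, unif_int Q (fun n o => mu (n := n) t (ox o) ^+ 2).

Let M n t := Ex (Q n) (fun o => mu (n := n) t (ox o)).
Let dum n (t : 'I_T.+1) (o : O n) : R := (od o == t)%:R.
(** The influence function [psi] is the inverse-weighted residual [A] plus the centred regression
    [B]; they generate the within and between parts of the variance. *)
Let A t n (o : O n) := dum t o * resid (mu (n := n)) o / q (n := n) t (ox o).
Let B t n (o : O n) := mu (n := n) t (ox o) - M n t.
Let psi t n (o : O n) := A t o + B t o.

Let dum_bd n t (o : O n) : `|dum t o| <= 1.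
Proof. by rewrite /dum; case: (_ == _); rewrite ?normr1// normr0. Qed.

Let q_gt0 n t x : 0 < q (n := n) t x.
Proof. exact: lt_le_trans (q_ge t x). Qed.

Let qi_bd n t x : `|(q (n := n) t x)^-1| <= pmin^-1.
Proof. by rewrite gtr0_norm ?invr_gt0// lef_pV2// posrE. Qed.

Let mqi0 n t : (0 < n)%N -> measurable_fun setT (fun x => (q (n := n) t x)^-1).
Proof.
by move=> n0; apply: (measurableT_comp (@measurable_invr R)); exact: mq.
Qed.

Let mqi n t : (0 < n)%N -> measurable_fun setT (fun o : O n => (q (n := n) t (ox o))^-1).
Proof. by move=> n0; apply: (measurableT_comp (mqi0 t n0)); exact: measurable_ox. Qed.

Let mweight n t : (0 < n)%N ->
  measurable_fun setT (fun dx : 'I_T.+1 * X n => (dx.1 == t)%:R / q (n := n) t dx.2).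
Proof.
move=> n0; apply: measurable_funM; last exact: (measurableT_comp (mqi0 t n0)).
by apply: (@measurableT_comp _ _ _ _ _ _ (fun a : 'I_T.+1 => (a == t)%:R : R)) => //; exact: measurable_fun_ord.
Qed.

Let mA t n : (0 < n)%N -> measurable_fun setT (A t (n := n)).
Proof.
move=> n0; apply: measurable_funM; last exact: mqi.
by apply: measurable_funM; [exact: measurable_dummy|exact: mresid].
Qed.

Let mB t n : (0 < n)%N -> measurable_fun setT (B t (n := n)).
Proof.
move=> n0; apply: measurable_funB; last exact: measurable_cst.
by apply: measurableT_comp; [exact: mmu|exact: measurable_ox].
Qed.

Let r2_ui : unif_int Q (fun n o => resid (mu (n := n)) o ^+ 2).
Proof.
apply: (unif_int_sqr (C := C4)) => n n0; have [h1 h2] := resid4 n0.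
have E : (fun z : O n => (resid (mu (n := n)) z ^+ 2) ^+ 2) = (fun z => resid (mu (n := n)) z ^+ 4).
  by apply/funext => z; rewrite -exprM.
split; rewrite ?E//; apply: measurable_funX; exact: mresid.
Qed.

Let mmuo n t : (0 < n)%N -> measurable_fun setT (fun o : O n => mu (n := n) t (ox o)).
Proof. by move=> n0; apply: measurableT_comp; [exact: mmu|exact: measurable_ox]. Qed.

Let L1_mu n t : (0 < n)%N -> L1 (Q n) (fun o => mu (n := n) t (ox o)).
Proof.
move=> n0; have [C /(_ _ n0) [h _]] := unif_int_bound (mu2_ui t).
apply: (L1_le (mmuo t n0) _ (L1D (L1_cst _ 1) h)) => o.
by have := norm_mul_le_sqr 1 (mu (n := n) t (ox o)); rewrite mul1r expr1n.
Qed.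

Lemma mean_bounded : exists C, forall n t, (0 < n)%N -> `|M n t| <= C.
Proof.
have h t : exists C, forall n, (0 < n)%N -> `|M n t| <= C.
  have [C hC] := unif_int_bound (mu2_ui t); exists (1 + C) => n n0; have [h1 h2] := hC _ n0.
  rewrite /M (le_trans (Ex_norm (L1_mu t n0)))//.
  apply: (@le_trans _ _ (Ex (Q n) (fun o => 1 + mu (n := n) t (ox o) ^+ 2))).
    apply: Ex_le; [exact/L1_norm/L1_mu|by apply: L1D => //; exact: L1_cst|].
    move=> o; have := norm_mul_le_sqr 1 (mu (n := n) t (ox o)).
    by rewrite mul1r expr1n.
  rewrite ExD ?Ex_cst//; last exact: L1_cst.
  by rewrite lerD2l (le_trans (ler_norm _))// (le_trans (Ex_norm h1)).
pose C t := sval (cid (h t)).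
exists (\sum_t `|C t|) => n t n0; rewrite (bigD1 t)//= (@le_trans _ _ (C t))//.
  by rewrite /C; case: cid => c /= ->.
by rewrite (le_trans (ler_norm _))// lerDl sumr_ge0.
Qed.

Let B2_ui t : unif_int Q (fun n o => B t o ^+ 2).
Proof.
have [C hC] := mean_bounded.
have h := unif_intD (unif_int_scale 2 (mu2_ui t)) (unif_int_cst Q (2 * C ^+ 2)).
apply: (unif_int_dom _ _ h).
  by move=> n n0; apply: measurable_funX; exact: mB.
have nn (x : R) : 0 <= 2 * x ^+ 2 by apply: mulr_ge0; rewrite ?sqr_ge0.
move=> n z n0; rewrite (ger0_norm (sqr_ge0 _)) [leRHS]ger0_norm ?addr_ge0//.
rewrite !(ger0_norm (nn _)) /B.
have /ler_normlP[h1 h2] := hC n t n0.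
move: (mu _ _) (M n t) h1 h2 => x m h1 h2.
have m2 : m ^+ 2 <= C ^+ 2 by nra.
by have := sqr_ge0 (x + m); nra.
Qed.

Let A2_ui t : unif_int Q (fun n o => A t o ^+ 2).
Proof.
apply: (unif_int_dom _ _ (unif_int_scale (pmin^-1 ^+ 2) r2_ui)).
  by move=> n n0; apply: measurable_funX; exact: mA.
move=> n z n0; rewrite -exprMn !(ger0_norm (sqr_ge0 _)).
rewrite -[leLHS]real_normK ?num_real// -[leRHS]real_normK ?num_real//.
rewrite lerXn2r ?nnegrE//= /A !normrM.
rewrite mulrC [`|pmin^-1|]gtr0_norm ?invr_gt0// ler_pM//.
by rewrite -[leRHS]mul1r ler_wpM2r.
Qed.

Let L1A2 t n : (0 < n)%N -> L1 (Q n) (fun o => A t o ^+ 2).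
Proof. by move=> n0; have [C /(_ _ n0) []] := unif_int_bound (A2_ui t). Qed.

Let L1B2 t n : (0 < n)%N -> L1 (Q n) (fun o => B t o ^+ 2).
Proof. by move=> n0; have [C /(_ _ n0) []] := unif_int_bound (B2_ui t). Qed.

Let L1_sq n (f : O n -> R) : measurable_fun setT f -> L1 (Q n) (fun o => f o ^+ 2) -> L1 (Q n) f.
Proof.
move=> mf hf; apply: (L1_le mf _ (L1D (L1_cst _ 1) hf)) => o.
by have := norm_mul_le_sqr 1 (f o); rewrite mul1r expr1n.
Qed.

Let L1_prod n (f g : O n -> R) : measurable_fun setT f -> measurable_fun setT g ->
  L1 (Q n) (fun o => f o ^+ 2) -> L1 (Q n) (fun o => g o ^+ 2) -> L1 (Q n) (fun o => f o * g o).
Proof.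
move=> mf mg hf hg; apply: (L1_le _ _ (L1D hf hg)); first exact: measurable_funM.
by move=> o; exact: norm_mul_le_sqr.
Qed.

Let Ex_A t n : (0 < n)%N -> Ex (Q n) (A t (n := n)) = 0.
Proof.
move=> n0; have E : A t (n := n) = (fun o => ((od o, ox o).1 == t)%:R / q (n := n) t (od o, ox o).2 * resid (mu (n := n)) o).
  by apply/funext => o; rewrite /A /dum/= mulrAC.
rewrite E; apply: (resid0 (h := fun dx : 'I_T.+1 * X n => (dx.1 == t)%:R / q (n := n) t dx.2) n0); last first.
  by rewrite -E; apply: L1_sq; [exact: mA|exact: L1A2].
exact: mweight.
Qed.

Let Ex_AB t t' n : (0 < n)%N -> Ex (Q n) (fun o => A t o * B t' o) = 0.
Proof.
move=> n0.
have E : (fun o : O n => A t o * B t' o) = (fun o => ((od o, ox o).1 == t)%:R / q (n := n) t (od o, ox o).2 *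
     (mu (n := n) t' (od o, ox o).2 - M n t') * resid (mu (n := n)) o).
  by apply/funext => o; rewrite /A /B /dum/=; ring.
rewrite E; apply: (resid0 (h := fun dx : 'I_T.+1 * X n => (dx.1 == t)%:R / q (n := n) t dx.2 * (mu (n := n) t' dx.2 - M n t')) n0); last first.
  by rewrite -E; apply: L1_prod; [exact: mA|exact: mB|exact: L1A2|exact: L1B2].
apply: measurable_funM; last first.
  by apply: measurable_funB => //; apply: measurableT_comp => //; exact: mmu.
exact: mweight.
Qed.

Let Ex_B t n : (0 < n)%N -> Ex (Q n) (B t (n := n)) = 0.
Proof.
move=> n0; rewrite /B ExB; [by rewrite Ex_cst subrr|exact: L1_mu|exact: L1_cst].
Qed.

Let A_disjoint t t' n (o : O n) : t != t' -> A t o * A t' o = 0.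
Proof.
move=> tt'; rewrite /A /dum; case: eqP => [->|]; last by rewrite !mul0r.
by rewrite (negbTE tt') !(mul0r, mulr0).
Qed.

Definition asymp_var n t t' : R := (t == t')%:R * Ex (Q n) (fun o => A t o ^+ 2) +
  Ex (Q n) (fun o => B t o * B t' o).

Definition influence (g : 'I_T.+1 -> R) n (o : O n) : R := \sum_t g t * psi t o.

Let mpsi t n : (0 < n)%N -> measurable_fun setT (psi t (n := n)).
Proof. by move=> n0; apply: measurable_funD; [exact: mA|exact: mB]. Qed.

(** [A t] is orthogonal to every [B t'], residuals being centred given (D, X), and the products of
    [A] at distinct levels vanish. The variance is a diagonal part plus the second moment of the
    combined [B]; the diagonal part alone supplies the lower bound. *)
Lemma influence_facts (g : nat -> 'I_T.+1 -> R) (K : R) : (forall n t, `|g n t| <= K) ->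
  [/\ forall n, (0 < n)%N -> L1 (Q n) (influence (g n) (n := n)),
      forall n, (0 < n)%N -> Ex (Q n) (influence (g n) (n := n)) = 0,
      unif_int Q (fun n o => influence (g n) o ^+ 2) &
      forall n, (0 < n)%N -> Ex (Q n) (fun o => influence (g n) o ^+ 2) =
         \sum_t \sum_t' g n t * g n t' * asymp_var n t t' /\
         cmin * (\sum_t g n t ^+ 2) <= Ex (Q n) (fun o => influence (g n) o ^+ 2)].
Proof.
move=> gK.
have L1p t n : (0 < n)%N -> L1 (Q n) (psi t (n := n)).
  by move=> n0; apply: L1D; apply: L1_sq; [exact: mA|exact: L1A2|exact: mB|exact: L1B2].
have mi n : (0 < n)%N -> measurable_fun setT (influence (g n) (n := n)).
  by move=> n0; apply: measurable_fun_sum => t _; apply: measurable_funM => //; exact: mpsi.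
split.
- by move=> n n0; apply: L1_sum => t _; apply: L1Z; exact: L1p.
- move=> n n0; rewrite /influence Ex_sum; last by move=> t _; apply: L1Z; exact: L1p.
  rewrite big1// => t _; rewrite ExZ; last exact: L1p.
  rewrite /psi ExD ?Ex_A ?Ex_B ?addr0 ?mulr0//; apply: L1_sq; [exact: mA|exact: L1A2|exact: mB|exact: L1B2].
- have u := unif_int_scale (2 * T.+1%:R * K ^+ 2)
    (unif_intD (unif_int_sum (index_enum _) A2_ui) (unif_int_sum (index_enum _) B2_ui)).
  apply: (unif_int_dom _ _ u); first by move=> n n0; apply: measurable_funX; exact: mi.
  move=> n o n0; rewrite ger0_norm ?sqr_ge0// (le_trans _ (ler_norm _))//.
  have sq (x : R) : `|x ^+ 2| = x ^+ 2 by rewrite ger0_norm ?sqr_ge0.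
  rewrite [X in _ * (X + _)]ger0_norm ?sumr_ge0// [X in _ * (_ + X)]ger0_norm ?sumr_ge0//.
  rewrite -big_split/=.
  rewrite (le_trans (sqr_sum_le _))//.
  rewrite (_ : 2 * T.+1%:R * K ^+ 2 * _ = T.+1%:R * (2 * K ^+ 2 * \sum_i (`|A i o ^+ 2| + `|B i o ^+ 2|))); last by ring.
  rewrite ler_wpM2l ?ler0n//.
  rewrite !mulr_sumr; apply: ler_sum => t _; rewrite !sq exprMn.
  rewrite (_ : 2 * K ^+ 2 * _ = K ^+ 2 * (2 * (A t o ^+ 2 + B t o ^+ 2))); last by ring.
  have g2 : g n t ^+ 2 <= K ^+ 2.
    by rewrite -[leLHS]real_normK ?num_real// lerXn2r// ?nnegrE// (le_trans _ (gK n t)).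
  apply: ler_pM; rewrite ?sqr_ge0// /psi.
  by move: (A t o) (B t o) => x y; have := sqr_ge0 (x - y); nra.
- move=> n n0.
  have LAA t t' : L1 (Q n) (fun o => A t o * A t' o) by apply: L1_prod; [exact: mA|exact: mA|exact: L1A2|exact: L1A2].
  have LAB t t' : L1 (Q n) (fun o => A t o * B t' o) by apply: L1_prod; [exact: mA|exact: mB|exact: L1A2|exact: L1B2].
  have LBB t t' : L1 (Q n) (fun o => B t o * B t' o) by apply: L1_prod; [exact: mB|exact: mB|exact: L1B2|exact: L1B2].
  have Epsi t t' : (fun o => psi t o * psi t' o) =
      (fun o : O n => A t o * A t' o + (A t o * B t' o + A t' o * B t o) + B t o * B t' o).
    by apply/funext => o; rewrite /psi; ring.
  have LAB2 t t' : L1 (Q n) (fun o => A t o * B t' o + A t' o * B t o) by exact: L1D.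
  have E : Ex (Q n) (fun o => influence (g n) o ^+ 2) = \sum_t \sum_t' g n t * g n t' * asymp_var n t t'.
    rewrite /influence Ex_sqr_comb; last first.
      by move=> t t'; rewrite Epsi; apply: L1D => //; exact: L1D.
    apply: eq_bigr => t _; apply: eq_bigr => t' _; rewrite Epsi; congr (_ * _).
    rewrite ExD//; last exact: L1D.
    rewrite ExD// ExD// !Ex_AB// !addr0 /asymp_var; congr (_ + _).
    have [<-|tt'] := eqVneq t t'; first by rewrite mul1r; congr Ex; apply/funext => o; rewrite expr2.
    rewrite mul0r (_ : (fun o => _) = (fun=> 0)) ?Ex_cst//.
    by apply/funext => o; exact: A_disjoint.
  split=> //; rewrite E /asymp_var.
  have -> : \sum_t \sum_t' g n t * g n t' * ((t == t')%:R * Ex (Q n) (fun o => A t o ^+ 2) +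
      Ex (Q n) (fun o => B t o * B t' o)) =
    \sum_t g n t ^+ 2 * Ex (Q n) (fun o => A t o ^+ 2) +
    Ex (Q n) (fun o => (\sum_t g n t * B t o) ^+ 2).
    rewrite (Ex_sqr_comb _ LBB) -big_split/=; apply: eq_bigr => t _.
    under eq_bigr do rewrite mulrDr.
    rewrite big_split/=; congr (_ + _).
    rewrite (bigD1 t)//= eqxx mul1r big1 ?addr0 ?expr2// => t'; rewrite eq_sym => /negbTE ->.
    by rewrite mul0r mulr0.
  rewrite -[leLHS]addr0 lerD//; last by apply: Ex_ge0 => o; exact: sqr_ge0.
  rewrite mulr_sumr; apply: ler_sum => t _; rewrite mulrC ler_wpM2l ?sqr_ge0//.
  (* As q <= 1, dividing the residual by q can only increase its second moment. *)
  rewrite (le_trans (resid2_ge t n0))//; apply: Ex_le; last 1 first.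
  + move=> o; rewrite /A /dum; case: eqP => _; last by rewrite !mul0r expr0n.
    rewrite !mul1r exprMn ler_peMr ?sqr_ge0// exprVn.
    rewrite invf_ge1 ?exprn_gt0//; apply: exprn_ile1 => //; exact: ltW.
  + apply: (L1_mul_bd (K := 1)) => //; [exact: measurable_dummy|exact: dum_bd|].
    have [C /(_ _ n0) [h _]] := unif_int_bound r2_ui; exact: h.
  + exact: L1A2.
Qed.

Variable Mvec : forall n : nat, 'cV[R]_T.+1.
Hypothesis MvecE : forall n t, (0 < n)%N -> Mvec n t 0 = M n t.
Hypothesis overlap : forall e, 0 < e -> exists2 c, 0 < c &
  oft S e (fun n => [set w | forall i, c <= ph w (od (tnth w i)) (ox (tnth w i))]).
Let dp t n (w : n.-tuple (O n)) (o : O n) := ph w t (ox o) - q (n := n) t (ox o).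
Let dm t n (w : n.-tuple (O n)) (o : O n) := mh w t (ox o) - mu (n := n) t (ox o).
Let msep t n (w : n.-tuple (O n)) := avgO w (fun o => dp t w o ^+ 2).
Let msem t n (w : n.-tuple (O n)) := avgO w (fun o => dm t w o ^+ 2).
Hypothesis msep_negl : forall t, negl S (msep t).
Hypothesis msem_negl : forall t, negl S (msem t).
Hypothesis prod_negl : forall t,
  negl S (fun n w => Num.sqrt n%:R * (Num.sqrt (msem t w) * Num.sqrt (msep t w))).
Hypothesis balance_negl : forall t, negl S (fun n w => Num.sqrt n%:R *
  avgO w (fun o => dm t w o * (1 - (od o == t)%:R / q (n := n) t (ox o)))).
Hypothesis score_negl : forall t, negl S (fun n w => Num.sqrt n%:R *
  avgO w (fun o => (od o == t)%:R * resid (mu (n := n)) o * ((ph w t (ox o))^-1 - (q (n := n) t (ox o))^-1))).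

Let rem3 t n (w : n.-tuple (O n)) (o : O n) :=
  dm t w o * (dum t o * ((q (n := n) t (ox o))^-1 - (ph w t (ox o))^-1)).

Let inv_diff (x y c : R) : 0 < c -> c <= x -> pmin <= y -> `|x^-1 - y^-1| <= (c * pmin)^-1 * `|x - y|.
Proof.
move=> c0 cx py; have x0 : 0 < x by exact: lt_le_trans cx.
have y0 : 0 < y by exact: lt_le_trans py.
have -> : x^-1 - y^-1 = (x * y)^-1 * (y - x) by field; rewrite !gt_eqF.
rewrite normrM [`|y - x|]distrC ler_wpM2r// gtr0_norm ?invr_gt0 ?mulr_gt0//.
by rewrite lef_pV2 ?posrE ?mulr_gt0// ler_pM// ltW.
Qed.

(** The indicator confines the inverse score to observations at level t, exactly where the overlap
    event bounds it; the error of the inverse is then at most a constant times that of the score. *)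
Let rem3_negl t : negl S (fun n w => Num.sqrt n%:R * avgO w (rem3 t w)).
Proof.
apply: (negl_dom (prod_negl t)) => e e0; have [c c0 hc] := overlap e0.
exists (c * pmin)^-1; apply: (oftS hc); near=> n; move=> w /= h.
rewrite !(normrM (Num.sqrt _)) [leRHS]mulrCA ler_wpM2l// !(ger0_norm (sqrtr_ge0 _)).
rewrite (le_trans (avg_norm _ _))//.
apply: (@le_trans _ _ (avgO w (fun o => (c * pmin)^-1 * (`|dm t w o| * `|dp t w o|)))).
  apply: avg_le => i; rewrite /rem3 normrM mulrCA ler_wpM2l//.
  rewrite /dum; case: eqP => [E|_]; last first.
    by rewrite mul0r normr0 mulr_ge0// invr_ge0 mulr_ge0// ltW.
  by rewrite mul1r distrC inv_diff// -E.
rewrite avgZ ler_wpM2l ?invr_ge0 ?mulr_ge0 ?(ltW c0) ?(ltW pmin_gt0)//.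
rewrite (le_trans (ler_norm _))// (le_trans (cauchy_schwarz_avg _ _ _))//.
by rewrite ler_pM ?sqrtr_ge0// ler_wsqrtr//; apply: avg_le => i; rewrite real_normK ?num_real.
Unshelve. all: by end_near. Qed.

(** An exact identity, checked separately at d = t and d <> t: the score, balance and product
    remainders add up to the error with no linearisation. *)
Lemma aipw_expansion t : negl S (fun n w =>
  Num.sqrt n%:R * (muhat_vec (ph w) (mh w) w t 0 - Mvec n t 0) - Num.sqrt n%:R * avgO w (psi t (n := n))).
Proof.
apply: (negl_eqn (neglD (neglD (score_negl t) (balance_negl t)) (rem3_negl t))) => n w n0.
rewrite -mulrBr -2!(mulrDr (Num.sqrt _)); congr (_ * _); rewrite -!avgD mxE MvecE// -[En w _]/(avgO w _) -[X in _ - X - _](@avg_cst R _ (fun n => O n) n w _ n0).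
rewrite -!avgB; apply: eq_avg => i; rewrite /psi /A /B /rem3 /dm /dum.
case: eqP => [E|_]; last by rewrite !mul0r; ring.
by rewrite /resid E; ring.
Qed.

Lemma muhat_tight t : tight S (fun n w =>
  Num.sqrt n%:R * (muhat_vec (ph w) (mh w) w t 0 - Mvec n t 0)).
Proof.
have h : tight S (fun n w => Num.sqrt n%:R * avgO w (psi t (n := n))).
  have [C hC] := unif_int_bound (unif_intD (unif_int_scale 2 (A2_ui t)) (unif_int_scale 2 (B2_ui t))).
  apply: (tight_sqrtn_avg S_iid (C := C)) => n n0; have [h1 h2] := hC _ n0.
  have lA := L1_sq (mA t n0) (L1A2 t n0); have lB := L1_sq (mB t n0) (L1B2 t n0).
  have le o : psi t (n := n) o ^+ 2 <= `| `|2 * A t o ^+ 2| + `|2 * B t o ^+ 2| |.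
    rewrite (le_trans _ (ler_norm _))// (le_trans _ (lerD (ler_norm _) (ler_norm _)))// /psi.
    by move: (A t o) (B t o) => x y; have := sqr_ge0 (x - y); nra.
  have l2 : L1 (Q n) (fun z => psi t (n := n) z ^+ 2).
    apply: (L1_le _ _ (L1_norm h1)); first by apply: measurable_funX; exact: mpsi.
    by move=> o; rewrite ger0_norm ?sqr_ge0.
  split=> //; first exact: L1D.
    by rewrite ExD// Ex_A// Ex_B// addr0.
  by apply: le_trans h2; apply: Ex_le => //; exact: L1_norm.
by apply: (tight_le0 (tightD (negl_tight (aipw_expansion t)) h)) => n w; rewrite subrK.
Qed.

Lemma muhat_consistent t : negl S (fun n w => muhat_vec (ph w) (mh w) w t 0 - Mvec n t 0).
Proof. exact: negl_of_tight_sqrtn (muhat_tight t). Qed.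

Let tight_A2 t : tight S (fun n w => avgO w (fun o => A t o ^+ 2)).
Proof.
have [C hC] := unif_int_bound (A2_ui t).
exact: (tight_avg S_iid (f := fun n o => A t o ^+ 2) (C := C)).
Qed.

Let tight_B2 t : tight S (fun n w => avgO w (fun o => B t o ^+ 2)).
Proof.
have [C hC] := unif_int_bound (B2_ui t).
exact: (tight_avg S_iid (f := fun n o => B t o ^+ 2) (C := C)).
Qed.

Let within t n (w : n.-tuple (O n)) (o : O n) := dum t o * (oy o - mh w t (ox o)) / ph w t (ox o).

(** The term |ph - q| u^2 has small average by Cauchy-Schwarz, from the mean-square error of the
    score and the fourth moment of u. *)
Let within_approx t : negl S (fun n w => avgO w (fun o => (within t w o - A t o) ^+ 2)).
Proof.
have t4 : tight S (fun n w => avgO w (fun o => (resid (mu (n := n)) o ^+ 2) ^+ 2)).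
  apply: (tight_avg S_iid (f := fun n o => (resid (mu (n := n)) o ^+ 2) ^+ 2) (C := C4)) => n n0.
  have [h1 h2] := resid4 n0.
  rewrite (_ : (fun z : O n => `|(resid (mu (n := n)) z ^+ 2) ^+ 2|) = (fun z => resid (mu (n := n)) z ^+ 4)).
    by rewrite (_ : (fun z : O n => _ ^+ 2) = (fun z => resid (mu (n := n)) z ^+ 4))//; apply/funext => z; rewrite -exprM.
  by apply/funext => z; rewrite ger0_norm ?sqr_ge0// -exprM.
have n1' : negl S (fun n w => avgO w (fun o => `|dp t w o| * resid (mu (n := n)) o ^+ 2)).
  apply: negl_avgM t4; apply: (negl_eq (msep_negl t)) => n w.
  by apply: eq_avg => i; rewrite real_normK ?num_real.
apply: (negl_dom (neglD n1' (msem_negl t))) => e e0; have [c c0 hc] := overlap e0.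
pose K := (c * pmin)^-1; have K0 : 0 < K by rewrite invr_gt0 mulr_gt0.
pose L := c^-1 + pmin^-1; have L0 : 0 < L by rewrite addr_gt0 ?invr_gt0.
exists (2 * (K * L + c^-1 ^+ 2)); apply: (oftS hc); near=> n; move=> w /= h.
rewrite -avgD ger0_norm; last by apply: avg_ge0 => i; exact: sqr_ge0.
rewrite ger0_norm; last first.
  by apply: avg_ge0 => i; apply: addr_ge0; [apply: mulr_ge0|]; rewrite ?sqr_ge0.
rewrite -avgZ; apply: avg_le => i; rewrite /within /A /dum; case: eqP => [E|_]; last first.
  rewrite !mul0r subrr expr0n/=; apply: mulr_ge0.
    by apply: mulr_ge0 => //; apply: addr_ge0; [apply: mulr_ge0; exact: ltW|exact: sqr_ge0].
  by apply: addr_ge0; [apply: mulr_ge0|]; rewrite ?sqr_ge0.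
have cp : c <= ph w t (ox (tnth w i)) by rewrite -E.
have d1 := inv_diff c0 cp (q_ge t (ox (tnth w i))).
have p0 : 0 < ph w t (ox (tnth w i)) by exact: lt_le_trans cp.
have ic : (ph w t (ox (tnth w i)))^-1 <= c^-1 by rewrite lef_pV2 ?posrE.
have d2 : `|(ph w t (ox (tnth w i)))^-1 - (q (n := n) t (ox (tnth w i)))^-1| <= L.
  by rewrite (le_trans (ler_normB _ _))// lerD// gtr0_norm ?invr_gt0// lef_pV2 ?posrE.
rewrite !mul1r /dp -/K in d1 *; rewrite (_ : oy _ - _ = resid (mu (n := n)) (tnth w i) - dm t w (tnth w i)); last first.
  by rewrite /resid /dm E; ring.
have i0 : 0 < (ph w t (ox (tnth w i)))^-1 by rewrite invr_gt0.
move: d1 d2 ic i0; rewrite -/K; set a := (ph _ _ _)^-1; set b := (q _ _)^-1.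
set x := `|ph _ _ _ - _|; set u := resid _ _; set dl := dm _ _ _; set ci := c^-1.
move=> d1 d2 ic i0.
exact: within_arith.
Unshelve. all: by end_near. Qed.

Let between_approx t : negl S (fun n w => avgO w (fun o =>
  ((mh w t (ox o) - muhat_vec (ph w) (mh w) w t 0) - B t o) ^+ 2)).
Proof.
have n2 := neglZ 2 (neglM (muhat_consistent t) (negl_tight (muhat_consistent t))).
apply: (negl_le (neglD (neglZ 2 (msem_negl t)) n2)); apply: whp_near; near=> n; move=> w /=.
have n0 : (0 < n)%N by near: n; exact: nbhs_infty_gt.
rewrite ger0_norm; last by apply: avg_ge0 => i; exact: sqr_ge0.
rewrite (le_trans _ (ler_norm _))// -[X in _ + X](@avg_cst R _ (fun n => O n) n w _ n0) -avgZ -avgD.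
apply: avg_le => i; rewrite /B -MvecE// /dm.
move: (mh _ _ _) (mu _ _) (muhat_vec _ _ _ _ _) (Mvec n t 0) => x y z m.
by have := sqr_ge0 ((x - y) + (z - m)); nra.
Unshelve. all: by end_near. Qed.

(** Mean-square closeness of the summands reduces both parts to averages of products of [A] and of
    [B], to which the law of large numbers applies. *)
Lemma Vhat_consistent t t' :
  negl S (fun n w => Vhat (ph w) (mh w) w t t' - asymp_var n t t').
Proof.
have w1 : negl S (fun n w => VhatW (ph w) (mh w) w t - Ex (Q n) (fun o => A t o ^+ 2)).
  have h := negl_avg_prod (a := fun n w => A t (n := n)) (a' := fun n w => A t (n := n))
    (within_approx t) (within_approx t) (tight_A2 t) (tight_A2 t).
  apply: (negl_eq (neglD h (lln S_iid (A2_ui t)))) => n w.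
  rewrite -[in LHS](_ : avgO w (fun z => within t w z * within t w z) = VhatW (ph w) (mh w) w t).
    have -> : avgO w (fun z => A t z * A t z) = avgO w (fun z => A t z ^+ 2).
      by apply: eq_avg => i; rewrite expr2.
    by rewrite addrA subrK.
  apply: eq_avg => i; rewrite -expr2 /within exprMn exprVn; congr (_ / _).
  by rewrite exprMn; congr (_ * _); rewrite /dum; case: (_ == _); rewrite ?expr1n ?expr0n.
have w2 : negl S (fun n w => VhatB (ph w) (mh w) w t t' - Ex (Q n) (fun o => B t o * B t' o)).
  have h := negl_avg_prod (a := fun n w => B t (n := n)) (a' := fun n w => B t' (n := n))
    (between_approx t) (between_approx t') (tight_B2 t) (tight_B2 t').
  have ui : unif_int Q (fun n o => B t o * B t' o).
    apply: (unif_int_dom _ _ (unif_intD (B2_ui t) (B2_ui t'))).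
      by move=> n n0; apply: measurable_funM; exact: mB.
    move=> n z n0; rewrite (le_trans (norm_mul_le_sqr _ _))// (le_trans _ (ler_norm _))//.
    by rewrite lerD// ler_norm.
  apply: (negl_eq (neglD h (lln S_iid ui))) => n w.
  by rewrite /VhatB addrA subrK.
apply: (negl_eq (neglD (neglZ (t == t')%:R w1) w2)) => n w.
by rewrite mxE /asymp_var; ring.
Qed.


Variables (G : 'cV[R]_T.+1 -> R) (kappa : R).
Hypothesis dG : forall x, differentiable G x.
Hypothesis cG : forall t, continuous (partial t G).
Hypothesis cmin_gt0 : 0 < cmin.
Hypothesis kappa_gt0 : 0 < kappa.
Hypothesis grad_ge : \forall n \near \oo, kappa <= norm2 (grad G (Mvec n)).
Hypothesis mph : forall n t, (0 < n)%N ->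
  measurable_fun setT (fun wx : n.-tuple (O n) * X n => ph wx.1 t wx.2).
Hypothesis mmh : forall n t, (0 < n)%N ->
  measurable_fun setT (fun wx : n.-tuple (O n) * X n => mh wx.1 t wx.2).

Let mhat n (w : n.-tuple (O n)) := muhat_vec (ph w) (mh w) w.
Let dl t n (w : n.-tuple (O n)) := mhat w t 0 - Mvec n t 0.
Let g n t := partial t G (Mvec n).

Let Mvec_bounded : exists C, forall n, (0 < n)%N -> forall t, `|Mvec n t 0| <= C.
Proof. by have [C hC] := mean_bounded; exists C => n n0 t; rewrite MvecE// hC. Qed.

Let g_bounded : exists C, forall n t, (0 < n)%N -> `|g n t| <= C.
Proof.
have [C hC] := Mvec_bounded.
pose B0 t := sval (cid (bounded_on_box C (@cG t))).
exists (\sum_t `|B0 t|) => n t n0; rewrite (bigD1 t)//= (@le_trans _ _ (B0 t))//.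
  by rewrite /B0; case: cid => c /= hc; apply: hc; exact: hC.
by rewrite (le_trans (ler_norm _))// lerDl sumr_ge0.
Qed.

Let approxM (Z Z' : forall n, n.-tuple (O n) -> R) (z z' : nat -> R) (K K' : R) :
  negl S (fun n w => Z n w - z n) -> negl S (fun n w => Z' n w - z' n) ->
  (forall n, (0 < n)%N -> `|z n| <= K) -> (forall n, (0 < n)%N -> `|z' n| <= K') ->
  negl S (fun n w => Z n w * Z' n w - z n * z' n).
Proof.
move=> h h' b b'; have t1 := tight_bd S b; have t2 := tight_bd S b'.
apply: (negl_eq (neglD (neglD (neglM h (negl_tight h')) (neglM h t2)) (neglM h' t1))) => n w.
by ring.
Qed.

Let dl_small de : 0 < de -> whp S (fun n => [set w | (0 < n)%N /\ forall t, `|Mvec n t 0 - mhat w t 0| < de]).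
Proof.
move=> de0; have d2 : 0 < de / 2 by rewrite divr_gt0.
have h := whp_all (fun t => muhat_consistent t d2).
have h0 : whp S (fun n => [set w | (0 < n)%N]).
  by apply: whp_near; near=> n; move=> w /=; near: n; exact: nbhs_infty_gt.
apply: (whp2 h0 h) => n w /= n0 hw; split=> // t.
by rewrite distrC (le_lt_trans (hw t))//; lra.
Unshelve. all: by end_near. Qed.

Let partial_approx t : negl S (fun n w => partial t G (mhat w) - g n t).
Proof.
move=> c c0; have [C hC] := Mvec_bounded.
have [de de0 hde] := gradient_increment C dG cG c0.
apply: (whpS (dl_small de0)); near=> n; move=> w /= [n0 hw].
have [_ h] := hde _ _ (hC _ n0) hw; rewrite distrC; exact: h.
Unshelve. all: by end_near. Qed.

Let sqrt_dl t n (w : n.-tuple (O n)) := Num.sqrt n%:R * dl t w.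

(** The expansion error is an arbitrarily small multiple of the distance to the means, and root n
    times that distance is tight. *)
Let delta_method : negl S (fun n w => Num.sqrt n%:R * (G (mhat w) - G (Mvec n)) -
  \sum_t g n t * sqrt_dl t w).
Proof.
move=> c c0 e e0; have [C hC] := Mvec_bounded.
have tt : tight S (fun n w => \sum_t `|sqrt_dl t w|).
  by apply: tight_sum => t; apply: (tight_le0 (muhat_tight t)) => n w; rewrite normr_id.
have e2 : 0 < e / 2 by rewrite divr_gt0.
have [K hK] := tt _ e2; pose L := `|K| + 1; have L0 : 0 < L by rewrite ltr_wpDl.
have c1 : 0 < c / L by rewrite divr_gt0.
have [de de0 hde] := gradient_increment C dG cG c1.
apply: (oft_whp e0 hK (dl_small de0)) => n w /= hs [n0 hw].
have [h _] := hde _ _ (hC _ n0) hw.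
rewrite (_ : _ - _ = Num.sqrt n%:R * (G (mhat w) - G (Mvec n) -
    \sum_t partial t G (Mvec n) * (mhat w t 0 - Mvec n t 0))); last first.
  by rewrite [RHS]mulrBr mulr_sumr; congr (_ - _); apply: eq_bigr => t _; rewrite mulrCA.
rewrite normrM (ger0_norm (sqrtr_ge0 _)) (le_trans (ler_wpM2l (sqrtr_ge0 _) h))//.
apply: (@le_trans _ _ (c / L * L)); last by rewrite divfK// gt_eqF.
rewrite mulrCA ler_wpM2l ?(ltW c1)// mulr_sumr.
apply: (@le_trans _ _ `|\sum_t `|sqrt_dl t w| |).
  rewrite [leRHS]ger0_norm ?sumr_ge0//; apply: ler_sum => t _.
  by rewrite normrM (ger0_norm (sqrtr_ge0 _)).
by rewrite (le_trans hs)// (le_trans (ler_norm K))// lerDl.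
Qed.

(** The gradient is known to be long only for large n. At the other indices kappa times a unit
    vector takes its place, so that the standardisation is well defined for every n. *)
Let gt n t : R := if (0 < n)%N && (kappa <= norm2 (grad G (Mvec n))) then g n t
  else (t == ord0)%:R * kappa.

Let gt_ev : \forall n \near \oo, forall t, gt n t = g n t.
Proof.
by apply: filterS2 (nbhs_infty_gt 0) grad_ge => n n0 h t; rewrite /gt n0 h.
Qed.

Let gt_bounded : exists C, forall n t, `|gt n t| <= C.
Proof.
have [C hC] := g_bounded; exists (`|C| + kappa) => n t; rewrite /gt; case: ifPn => [/andP[n0 _]|_].
  by rewrite (le_trans (hC n t n0))// (le_trans (ler_norm C))// lerDl ltW.
rewrite normrM (gtr0_norm kappa_gt0) (@le_trans _ _ kappa) ?lerDr//.
by case: (_ == _); rewrite /= ?normr1 ?normr0 ?mul1r ?mul0r// ltW.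
Qed.

Let gt_ge n : kappa ^+ 2 <= \sum_t gt n t ^+ 2.
Proof.
have [/andP[n0 h]|/negbTE nh] := boolP ((0 < n)%N && (kappa <= norm2 (grad G (Mvec n)))); last first.
  rewrite (eq_bigr (fun t : 'I_T.+1 => ((t == ord0)%:R * kappa) ^+ 2)); last by move=> t _; rewrite /gt nh.
  by rewrite (bigD1 ord0)//= mul1r lerDl sumr_ge0// => t _; rewrite sqr_ge0.
rewrite (eq_bigr (fun t => g n t ^+ 2)); last by move=> t _; rewrite /gt n0 h.
have s0 : 0 <= \sum_t g n t ^+ 2 by rewrite sumr_ge0// => t _; rewrite sqr_ge0.
rewrite -[leRHS](sqr_sqrtr s0) lerXn2r ?nnegrE ?sqrtr_ge0 ?(ltW kappa_gt0)//.
apply: (le_trans h); rewrite /norm2 le_eqVlt; apply/orP; left; apply/eqP; congr (Num.sqrt _).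
by apply: eq_bigr => t _; rewrite mxE.
Qed.

Let v n := Ex (Q n) (fun o => influence (gt n) o ^+ 2).
(** The value at n = 0 is a placeholder that keeps [sigma] positive everywhere. *)
Let sigma n := if (0 < n)%N then Num.sqrt (v n) else Num.sqrt (cmin * kappa ^+ 2).
Let zeta n (o : O n) := (sigma n)^-1 * influence (gt n) o.

Let s0_gt0 : 0 < Num.sqrt (cmin * kappa ^+ 2).
Proof. by rewrite sqrtr_gt0 mulr_gt0// exprn_gt0. Qed.

Let v_ge n : (0 < n)%N -> cmin * kappa ^+ 2 <= v n.
Proof.
move=> n0; have [C hC] := gt_bounded; have [_ _ _ /(_ _ n0) [_ h]] := influence_facts hC.
by rewrite (le_trans _ h)// ler_pM2l// gt_ge.
Qed.

Let sigma_ge n : (0 < n)%N -> Num.sqrt (cmin * kappa ^+ 2) <= sigma n.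
Proof. by move=> n0; rewrite /sigma n0 ler_wsqrtr// v_ge. Qed.

Let sigma_gt0 n : 0 < sigma n.
Proof. by rewrite /sigma; case: ifPn => // n0; rewrite (lt_le_trans s0_gt0)// ler_wsqrtr// v_ge. Qed.

Let sigma_sqr n : (0 < n)%N -> sigma n ^+ 2 = v n.
Proof.
move=> n0; rewrite /sigma n0 sqr_sqrtr// (le_trans _ (v_ge n0))//.
by rewrite mulr_ge0 ?sqr_ge0// ltW.
Qed.

Let zetaP n : (0 < n)%N -> [/\ L1 (Q n) (zeta (n := n)), Ex (Q n) (zeta (n := n)) = 0 &
  Ex (Q n) (fun o => zeta (n := n) o ^+ 2) = 1].
Proof.
move=> n0; have [C hC] := gt_bounded; have [h1 h2 h3 _] := influence_facts hC.
split; first by apply: L1Z; exact: h1.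
  by rewrite /zeta ExZ ?h2 ?mulr0//; exact: h1.
have [D /(_ _ n0) [l2 _]] := unif_int_bound h3.
rewrite (_ : (fun o => _) = (fun o => (sigma n)^-1 ^+ 2 * influence (gt n) o ^+ 2)); last first.
  by apply/funext => o; rewrite -exprMn.
by rewrite ExZ// exprVn sigma_sqr// mulVf// gt_eqF// (lt_le_trans _ (v_ge n0))// mulr_gt0// exprn_gt0.
Qed.

Let zeta_ui : unif_int Q (fun n o => zeta (n := n) o ^+ 2).
Proof.
have [C hC] := gt_bounded; have [h1 _ h3 _] := influence_facts hC.
pose s := Num.sqrt (cmin * kappa ^+ 2).
apply: (unif_int_dom _ _ (unif_int_scale (s^-1 ^+ 2) h3)).
  by move=> n n0; apply: measurable_funX; apply: measurable_funM => //; apply: L1_meas (h1 _ n0).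
move=> n o n0; rewrite /zeta -!exprMn !(ger0_norm (sqr_ge0 _)) !exprMn ler_wpM2r ?sqr_ge0//.
rewrite lerXn2r ?nnegrE ?invr_ge0 ?sqrtr_ge0 ?(ltW (sigma_gt0 n))//.
by rewrite lef_pV2 ?posrE ?sigma_gt0// sigma_ge.
Qed.

Let Dn n (w : n.-tuple (O n)) := Num.sqrt n%:R * (G (mhat w) - G (Mvec n)).
Let Vn n (w : n.-tuple (O n)) :=
  ((grad G (mhat w))^T *m Vhat (ph w) (mh w) w *m grad G (mhat w)) 0 0.

Let D_approx : negl S (fun n w => Dn w - sigma n * (Num.sqrt n%:R * avgO w (zeta (n := n)))).
Proof.
have [C hC] := g_bounded.
have h2 : negl S (fun n w => \sum_t (sqrt_dl t w - Num.sqrt n%:R * avgO w (psi t (n := n))) * g n t).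
  apply: negl_sum => t; apply: neglM; first exact: aipw_expansion.
  by apply: (@tight_bd _ _ _ _ _ C) => n n0; exact: hC.
apply: (negl_le (neglD delta_method h2)); apply: whp_near; near=> n; move=> w /=.
have gE : forall t, gt n t = g n t by near: n; exact: gt_ev.
rewrite (_ : Dn w - _ = Num.sqrt n%:R * (G (mhat w) - G (Mvec n)) - \sum_t g n t * sqrt_dl t w +
  \sum_t (sqrt_dl t w - Num.sqrt n%:R * avgO w (psi t (n := n))) * g n t)//.
rewrite -addrA; congr (_ + _); rewrite /zeta (avgZ w (sigma n)^-1 (influence (gt n) (n := n))).
have sc (a b : R) : sigma n * (a * ((sigma n)^-1 * b)) = a * b by field; rewrite gt_eqF.
rewrite sc.
rewrite (_ : influence _ (n := n) = (fun o => \sum_t g n t * psi t o)); last first.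
  by apply/funext => o; apply: eq_bigr => t _; rewrite gE.
rewrite avg_sum mulr_sumr -!sumrN -big_split/=; apply: eq_bigr => t _.
by rewrite avgZ; ring.
Unshelve. all: by end_near. Qed.

Let V_approx : negl S (fun n w => Vn w - sigma n ^+ 2).
Proof.
have [C hC] := g_bounded; have [C' hC'] := gt_bounded.
have vb t t' : exists K, forall n, (0 < n)%N -> `|asymp_var n t t'| <= K.
  have [K1 h1] := unif_int_bound (A2_ui t).
  have [K2 h2] := unif_int_bound (unif_intD (B2_ui t) (B2_ui t')).
  exists (K1 + K2) => n n0; have [l1 k1] := h1 _ n0; have [l2 k2] := h2 _ n0.
  rewrite (le_trans (ler_normD _ _))// lerD//.
    rewrite normrM (le_trans _ k1)// -[leRHS]mul1r ler_pM//; last exact: Ex_norm.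
    by case: (_ == _); rewrite ?normr1 ?normr0.
  have lBB : L1 (Q n) (fun o => B t o * B t' o).
    by apply: L1_prod; [exact: mB|exact: mB|exact: L1B2|exact: L1B2].
  rewrite (le_trans (Ex_norm lBB))// (le_trans _ k2)//.
  apply: Ex_le; [exact: L1_norm|exact: L1_norm|move=> o].
  rewrite (le_trans (norm_mul_le_sqr _ _))// (le_trans _ (ler_norm _))//.
  by rewrite lerD// ler_norm.
have h : negl S (fun n w => \sum_t' \sum_t
    (partial t G (mhat w) * Vhat (ph w) (mh w) w t t' * partial t' G (mhat w) -
     g n t * asymp_var n t t' * g n t')).
  apply: negl_sum => t'; apply: negl_sum => t; have [K hK] := vb t t'.
  apply: (approxM (K := C * K) (K' := C)); [|exact: partial_approx| |by move=> n; exact: hC].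
    by apply: approxM; [exact: partial_approx|exact: Vhat_consistent|by move=> n; exact: hC|exact: hK].
  by move=> n n0; rewrite normrM ler_pM ?hC ?hK.
apply: (negl_le h); apply: whp_near; near=> n; move=> w /=.
have n0 : (0 < n)%N by near: n; exact: nbhs_infty_gt.
have gE : forall t, gt n t = g n t by near: n; exact: gt_ev.
rewrite sigma_sqr// /v; have [_ _ _ /(_ _ n0) [-> _]] := influence_facts hC'.
rewrite (_ : Vn w - _ = \sum_t' \sum_t
    (partial t G (mhat w) * Vhat (ph w) (mh w) w t t' * partial t' G (mhat w) -
     g n t * asymp_var n t t' * g n t'))//.
rewrite [X in _ - X]exchange_big/= /Vn mxE -sumrB; apply: eq_bigr => t' _.
rewrite mxE mulr_suml -sumrB; apply: eq_bigr => t _; rewrite !mxE !gE.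
by congr (_ - _); ring.
Unshelve. all: by end_near. Qed.

Let mhw (f : forall n, n.-tuple (O n) -> 'I_T.+1 -> X n -> R) n t i : (0 < n)%N ->
  measurable_fun setT (fun wx : n.-tuple (O n) * X n => f n wx.1 t wx.2) ->
  measurable_fun setT (fun w : n.-tuple (O n) => f n w t (ox (tnth w i))).
Proof.
move=> n0 mf; have h : measurable_fun setT (fun w : n.-tuple (O n) => (w, ox (tnth w i))).
  apply: measurable_fun_pair => //; apply: measurableT_comp; first exact: measurable_ox.
  exact: measurable_tnth.
exact: (measurableT_comp mf h).
Qed.

Let mtn n i (f : O n -> R) : measurable_fun setT f ->
  measurable_fun setT (fun w : n.-tuple (O n) => f (tnth w i)).
Proof. by move=> mf; apply: measurableT_comp => //; exact: measurable_tnth. Qed.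

Let mmhat n t : (0 < n)%N -> measurable_fun setT (fun w : n.-tuple (O n) => mhat w t 0).
Proof.
move=> n0; rewrite (_ : (fun w => _) = (fun w : n.-tuple (O n) => n%:R^-1 * \sum_(i < n)
    ((od (tnth w i) == t)%:R * (oy (tnth w i) - mh w t (ox (tnth w i))) / ph w t (ox (tnth w i))
      + mh w t (ox (tnth w i))))); last by apply/funext => w; rewrite /mhat mxE.
apply: measurable_funM => //; apply: measurable_fun_sum => i _.
have m1 := mhw i n0 (mmh t n0); have m2 := mhw i n0 (mph t n0).
apply: measurable_funD => //; apply: measurable_funM.
  apply: measurable_funM; first exact: (mtn i (@measurable_dummy R T _ (X n) t)).
  by apply: measurable_funB => //; exact: (mtn i (@measurable_oy R T _ (X n))).
exact: measurableT_comp (@measurable_invr R) m2.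
Qed.

Let mVhat n t t' : (0 < n)%N ->
  measurable_fun setT (fun w : n.-tuple (O n) => Vhat (ph w) (mh w) w t t').
Proof.
move=> n0; rewrite (_ : (fun w => _) = (fun w => (t == t')%:R * VhatW (ph w) (mh w) w t +
   VhatB (ph w) (mh w) w t t')); last by apply/funext => w; rewrite mxE.
apply: measurable_funD; last first.
  apply: measurable_funM => //; apply: measurable_fun_sum => i _.
  by apply: measurable_funM; apply: measurable_funB; [exact: mhw (mmh _ n0)|exact: mmhat|exact: mhw (mmh _ n0)|exact: mmhat].
apply: measurable_funM => //; apply: measurable_funM => //; apply: measurable_fun_sum => i _.
have m1 := mhw i n0 (mmh t n0); have m2 := mhw i n0 (mph t n0).
apply: measurable_funM.
  apply: measurable_funM; first exact: (mtn i (@measurable_dummy R T _ (X n) t)).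
  by apply: measurable_funX; apply: measurable_funB => //; exact: (mtn i (@measurable_oy R T _ (X n))).
by apply: (measurableT_comp (@measurable_invr R)); exact: measurable_funX.
Qed.

Lemma coverage_aipw (alpha c e : R) : 0 < alpha < 1 -> Phi c = 1 - alpha / 2 -> 0 < e ->
  \forall n \near \oo, `|fine (S n [set w | G (Mvec n) \in
    conf_interval G c (ph (n := n) w) (mh w) w]) - (1 - alpha)| <= e.
Proof.
move=> al hc e0.
have mGm n : (0 < n)%N -> measurable_fun setT (fun w : n.-tuple (O n) => G (mhat w)).
  move=> n0; apply: measurable_cV_comp; last by move=> t; exact: mmhat.
  by move=> x; exact: differentiable_continuous.
have mpm n t : (0 < n)%N -> measurable_fun setT (fun w : n.-tuple (O n) => partial t G (mhat w)).
  by move=> n0; apply: measurable_cV_comp => // t'; exact: mmhat.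
have mD n : (0 < n)%N -> measurable_fun setT (Dn (n := n)).
  by move=> n0; apply: measurable_funM => //; apply: measurable_funB => //; exact: mGm.
have mV n : (0 < n)%N -> measurable_fun setT (Vn (n := n)).
  move=> n0; rewrite (_ : Vn (n := n) = (fun w => \sum_t' (\sum_t
      partial t G (mhat w) * Vhat (ph w) (mh w) w t t') * partial t' G (mhat w))).
    apply: measurable_fun_sum => t' _; apply: measurable_funM; last exact: mpm.
    by apply: measurable_fun_sum => t _; apply: measurable_funM; [exact: mpm|exact: mVhat].
  apply/funext => w; rewrite /Vn mxE; apply: eq_bigr => t' _; rewrite !mxE; congr (_ * _).
  by apply: eq_bigr => t _; rewrite !mxE.
apply: filterS2 (nbhs_infty_gt 0) (@coverage _ _ _ _ _ S_iid zeta zetaP zeta_ui Dn Vn sigma _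
  s0_gt0 sigma_ge mD mV D_approx V_approx alpha c e al hc e0) => n n0.
congr (`|fine (S n _) - _| <= _); apply/seteqP.
have sn : 0 < Num.sqrt (n%:R : R) by rewrite sqrtr_gt0 ltr0n.
(* Membership becomes |Dn| <= c sqrt(Vn) after multiplying by root n; the root of Vn / n splits
   because 1 / n >= 0, whatever the sign of Vn. *)
have E (w : n.-tuple (O n)) : (`|Dn w| <= c * Num.sqrt (Vn w)) =
    (G (Mvec n) \in conf_interval G c (ph (n := n) w) (mh w) w).
  rewrite mem_setE in_itv/= -/(mhat w) -/(Vn w) [Vn w / _]mulrC sqrtrM ?invr_ge0//.
  rewrite sqrtrV// [_^-1 * _]mulrC mulrA -ler_distl distrC ler_pdivlMr//.
  by rewrite /Dn normrM gtr0_norm// mulrC.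
by split=> w /=; rewrite E.
Qed.

End aipw.

(** * Scores fitted from the treatment data *)

(** Gives a score its bounds at every point rather than almost everywhere, and leaves it unchanged
    where they already hold. *)
Definition clip (R : realType) (a x : R) := Num.max a (Num.min 1 x).

Lemma clip_ge (R : realType) (a x : R) : a <= clip a x.
Proof. by rewrite /clip le_max lexx. Qed.

Lemma clip_le1 (R : realType) (a x : R) : a <= 1 -> clip a x <= 1.
Proof. by move=> a1; rewrite /clip ge_max a1 ge_min lexx. Qed.

Lemma clip_id (R : realType) (a x : R) : a <= x <= 1 -> clip a x = x.
Proof. by move=> /andP[ax x1]; rewrite /clip min_r// max_r. Qed.

Lemma measurable_clip (R : realType) d (T : measurableType d) (a : R) (f : T -> R) :
  measurable_fun setT f -> measurable_fun setT (fun z => clip a (f z)).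
Proof. by move=> mf; apply: measurable_maxr => //; exact: measurable_minr. Qed.

Lemma measurable_at_level (R : realType) (T : nat) d (W : measurableType d) (a : W -> 'I_T.+1)
    (f : 'I_T.+1 -> W -> R) :
  measurable_fun setT a -> (forall t, measurable_fun setT (f t)) ->
  measurable_fun setT (fun v => f (a v) v).
Proof.
move=> ma mf; rewrite (_ : (fun v => _) = (fun v => \sum_t (a v == t)%:R * f t v)).
  apply: measurable_fun_sum => t _; apply: measurable_funM => //.
  by apply: (measurableT_comp (@measurable_fun_ord _ _ T (fun s => (s == t)%:R : R)) ma).
apply/funext => v; rewrite (bigD1 (a v))//= eqxx mul1r big1 ?addr0// => t.
by rewrite eq_sym => /negbTE ->; rewrite mul0r.
Qed.

Section treatment.
Context {R : realType} {T : nat} {d : measure_display} {X : measurableType d} {n : nat}.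
Local Notation O := (observed R T X).
Local Notation DX := ('I_T.+1 * X)%type.

Lemma measurable_treatment_data :
  measurable_fun setT (@treatment_data R T d X n : n.-tuple O -> n.-tuple DX).
Proof.
apply/measurable_fun_tnthP => i; rewrite (_ : _ \o _ = (fun w => (od (tnth w i), ox (tnth w i)))).
  exact: (measurableT_comp measurable_odx (measurable_tnth i)).
by apply/funext => w /=; rewrite tnth_mktuple.
Qed.

Lemma treatment_data_upd i o (w : n.-tuple O) :
  treatment_data (upd i (o, w)) = upd i ((od o, ox o), treatment_data w).
Proof. by apply: eq_from_tnth => j; rewrite !tnth_mktuple; case: eqP. Qed.

Lemma measurable_fitted (ph : n.-tuple DX -> 'I_T.+1 -> X -> R) t i :
  measurable_fun setT (fun vx : n.-tuple DX * X => ph vx.1 t vx.2) ->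
  measurable_fun setT (fun v : n.-tuple DX => ph v t (tnth v i).2).
Proof.
move=> mf; have h : measurable_fun setT (fun v : n.-tuple DX => (v, (tnth v i).2)).
  apply: measurable_fun_pair => //; apply: measurableT_comp => //; exact: measurable_tnth.
exact: (measurableT_comp mf h).
Qed.

End treatment.

Section score_from_treatment_data.
Context {R : realType} {T : nat} {d : nat -> measure_display} {X : forall n, measurableType (d n)}.
Local Notation O n := (observed R T (X n)).
Local Notation DX n := ('I_T.+1 * X n)%type.
Local Notation avgO := (@avg R _ (fun n => O n) _).
Variables (Q : forall n, probability (O n) R) (S : forall n, probability (n.-tuple (O n)) R).
Hypothesis S_iid : forall n, (0 < n)%N -> iid (Q n) (S n).
Variables (q mu : forall n, 'I_T.+1 -> X n -> R).
Variables (pt : forall n, n.-tuple (DX n) -> 'I_T.+1 -> X n -> R).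
Variables (pmin C2 : R).
Hypothesis pmin_gt0 : 0 < pmin.
Hypothesis q_ge : forall n t x, pmin <= q (n := n) t x.
Hypothesis mq : forall n t, (0 < n)%N -> measurable_fun setT (q (n := n) t).
Hypothesis mpt : forall n t, (0 < n)%N ->
  measurable_fun setT (fun wx : n.-tuple (DX n) * X n => pt wx.1 t wx.2).
Hypothesis resid1 : forall n, (0 < n)%N -> L1 (Q n) (resid (mu (n := n))).
Hypothesis resid2 : forall n, (0 < n)%N -> L1 (Q n) (fun o => resid (mu (n := n)) o ^+ 2).
Hypothesis resid0 : forall n (h : DX n -> R), (0 < n)%N -> measurable_fun setT h ->
  L1 (Q n) (fun o => h (od o, ox o) * resid (mu (n := n)) o) ->
  Ex (Q n) (fun o => h (od o, ox o) * resid (mu (n := n)) o) = 0.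
Hypothesis resid2w : forall n (h : DX n -> R) (K : R), (0 < n)%N -> measurable_fun setT h ->
  (forall dx, 0 <= h dx <= K) ->
  Ex (Q n) (fun o => h (od o, ox o) * resid (mu (n := n)) o ^+ 2)
    <= C2 * Ex (Q n) (fun o => h (od o, ox o)).
Hypothesis C2_ge0 : 0 <= C2.
Let ph n (w : n.-tuple (O n)) := pt (treatment_data w).
Hypothesis overlap : forall e, 0 < e -> exists2 c, 0 < c &
  oft S e (fun n => [set w | forall i, c <= ph w (od (tnth w i)) (ox (tnth w i))]).
Hypothesis msep_negl : forall t,
  negl S (fun n w => avgO w (fun o => (ph w t (ox o) - q (n := n) t (ox o)) ^+ 2)).

Let good n t c de : set (n.-tuple (DX n)) := [set v |
  (forall i, c <= pt v (tnth v i).1 (tnth v i).2) /\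
  n%:R^-1 * (\sum_(i < n) (pt v t (tnth v i).2 - q (n := n) t (tnth v i).2) ^+ 2) <= de].

(** The indicator of the good event depends on the treatment data alone. It therefore bounds the
    weights without disturbing the centring of the residuals given them. *)
Let bt n t c de (i : 'I_n) (v : n.-tuple (DX n)) : R :=
  \1_(good t c de) v * (((tnth v i).1 == t)%:R *
    ((pt v t (tnth v i).2)^-1 - (q (n := n) t (tnth v i).2)^-1)).

Let mqt n t i : (0 < n)%N -> measurable_fun setT (fun v : n.-tuple (DX n) => q (n := n) t (tnth v i).2).
Proof.
move=> n0; apply: (measurableT_comp (mq t n0)); apply: measurableT_comp => //; exact: measurable_tnth.
Qed.

Let mdt n i : measurable_fun setT (fun v : n.-tuple (DX n) => (tnth v i).1).
Proof. apply: measurableT_comp => //; exact: measurable_tnth. Qed.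

Let mgood n t c de : (0 < n)%N -> measurable (@good n t c de).
Proof.
move=> n0; apply: measurableI.
  apply: measurable_forall => i; apply: measurable_setle => //.
  apply: (@measurable_at_level R T _ _ (fun v => (tnth v i).1) (fun t (v : n.-tuple (DX n)) => pt v t (tnth v i).2)).
    exact: mdt.
  by move=> s; apply: measurable_fitted; exact: mpt.
apply: measurable_setle => //; apply: measurable_funM => //; apply: measurable_fun_sum => i _.
apply: measurable_funX; apply: measurable_funB; last exact: mqt.
by apply: measurable_fitted; exact: mpt.
Qed.

Let mbt n t c de i : (0 < n)%N -> measurable_fun setT (@bt n t c de i).
Proof.
move=> n0; apply: measurable_funM; first by apply: measurable_indic; exact: mgood.
apply: measurable_funM.
  exact: (measurableT_comp (@measurable_fun_ord _ _ T (fun s => (s == t)%:R : R)) (mdt i)).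
apply: measurable_funB; apply: (measurableT_comp (@measurable_invr R)); last exact: mqt.
by apply: measurable_fitted; exact: mpt.
Qed.

Let bt_bd n t c de i v : 0 < c -> `|@bt n t c de i v| <= c^-1 + pmin^-1.
Proof.
move=> c0; have cp : 0 < c^-1 + pmin^-1 by rewrite addr_gt0 ?invr_gt0.
rewrite /bt indicE; case: (boolP (v \in _)) => [|_]; last by rewrite mul0r normr0 ltW.
rewrite inE => -[/(_ i) h _]; case: eqP h => [->|_] h; last by rewrite mul0r mulr0 normr0 ltW.
rewrite !mul1r (le_trans (ler_normB _ _))// !gtr0_norm ?invr_gt0 ?(lt_le_trans c0 h)//; last first.
  exact: lt_le_trans (q_ge _ _).
by rewrite lerD// lef_pV2 ?posrE ?(lt_le_trans c0 h)// (lt_le_trans pmin_gt0).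
Qed.

Let bt_sum n t c de v : 0 < c -> 0 <= de -> (0 < n)%N ->
  \sum_(i < n) @bt n t c de i v ^+ 2 <= ((c * pmin)^-1) ^+ 2 * (n%:R * de).
Proof.
move=> c0 de0 n0; have K0 : 0 <= ((c * pmin)^-1) ^+ 2 by exact: sqr_ge0.
have [gv|gv] := boolP (v \in good t c de); last first.
  rewrite big1; first by apply: mulr_ge0 => //; apply: mulr_ge0; rewrite ?ler0n.
  by move=> i _; rewrite /bt indicE (negbTE gv) mul0r expr0n.
move: (gv); rewrite inE => -[h1 h2].
apply: (@le_trans _ _ (((c * pmin)^-1) ^+ 2 *
    \sum_(i < n) (pt v t (tnth v i).2 - q (n := n) t (tnth v i).2) ^+ 2)); last first.
  by rewrite ler_wpM2l// -ler_pdivrMl ?ltr0n.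
rewrite mulr_sumr; apply: ler_sum => i _; rewrite /bt indicE gv mul1r.
have := h1 i; case: eqP => [->|_] h; last by rewrite mul0r expr0n mulr_ge0 ?sqr_ge0.
rewrite mul1r -exprMn.
have p0 : 0 < pt v t (tnth v i).2 by exact: lt_le_trans h.
have q0 : 0 < q (n := n) t (tnth v i).2 by exact: lt_le_trans (q_ge _ _).
have qg := q_ge t (tnth v i).2.
move: (pt _ _ _) (q _ _) p0 q0 qg h => x y x0 y0 qg h.
have -> : x^-1 - y^-1 = (x * y)^-1 * (y - x) by field; rewrite !gt_eqF.
rewrite !exprMn -(sqrrN (y - x)) opprB ler_wpM2r ?sqr_ge0//.
apply: lerXn2r; rewrite ?nnegrE ?invr_ge0; [by apply: mulr_ge0; exact: ltW|by apply: mulr_ge0; exact: ltW|].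
by rewrite lef_pV2 ?posrE ?mulr_gt0// ler_pM// ltW.
Qed.

Lemma score_negl_treatment_data t : negl S (fun n w => Num.sqrt n%:R *
  avgO w (fun o => (od o == t)%:R * resid (mu (n := n)) o * ((ph w t (ox o))^-1 - (q (n := n) t (ox o))^-1))).
Proof.
move=> c c0 e e0; have e2 : 0 < e / 2 by rewrite divr_gt0.
have [b b0 hb] := overlap e2.
pose K := ((b * pmin)^-1) ^+ 2.
have K0 : 0 <= K by exact: sqr_ge0.
(* Makes C2 K de at most e c^2 / 4, so that Markov's inequality at c^2 costs e / 4; the added 1
   avoids a zero denominator. *)
pose de := (e / 4 * c ^+ 2) / (C2 * K + 1).
have CK0 := mulr_ge0 C2_ge0 K0; have CK : 0 < C2 * K + 1 by exact: ltr_wpDl.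
have de0 : 0 < de by rewrite divr_gt0 ?mulr_gt0 ?exprn_gt0 ?divr_gt0.
have e4 : 0 < e / 4 by rewrite divr_gt0.
pose B n i (w : n.-tuple (O n)) := @bt n t b de i (treatment_data w).
pose F n (w : n.-tuple (O n)) := n%:R^-1 * (\sum_(i < n) B n i w * resid (mu (n := n)) (tnth w i)) ^+ 2.
have hF n : (0 < n)%N -> L1 (S n) (F n) /\ Ex (S n) (F n) <= e / 4 * c ^+ 2.
  move=> n0.
  have mB i : measurable_fun setT (B n i).
    by apply: (measurableT_comp (mbt t b de i n0)); exact: measurable_treatment_data.
  have mh i j w : measurable_fun setT (fun dx : DX n => @bt n t b de j (upd i (dx, treatment_data w))).
    by apply: (measurableT_comp (mbt t b de j n0)); exact: measurable_updl.
  have bB i w : `|B n i w| <= b^-1 + pmin^-1 by exact: bt_bd.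
  have [||l E] := weighted_second_moment (C := C2) (S_iid n0) (resid1 n0) (resid2 n0) mB bB.
  (* A fresh observation i enters the treatment data only through its (d, x). Both weights become
     functions of (d, x), against which the residual is orthogonal. *)
  - move=> i j w ij; under eq_fun do rewrite /B treatment_data_upd.
    apply: (resid0 (h := fun dx => bt t b de i (upd i (dx, treatment_data w)) * bt t b de j (upd i (dx, treatment_data w))) n0).
      by apply: measurable_funM; exact: mh.
    apply: (L1_mul_bd (K := (b^-1 + pmin^-1) ^+ 2)) (resid1 n0).
      by apply: (measurableT_comp (f := fun dx => bt t b de i (upd i (dx, treatment_data w)) * bt t b de j (upd i (dx, treatment_data w))) _ measurable_odx); apply: measurable_funM; exact: mh.
    by move=> o; rewrite normrM expr2 ler_pM// bt_bd.
  - move=> i w; under eq_fun do rewrite /B treatment_data_upd.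
    under [in leRHS]eq_fun do rewrite /B treatment_data_upd.
    apply: (resid2w (h := fun dx => bt t b de i (upd i (dx, treatment_data w)) ^+ 2) (K := (b^-1 + pmin^-1) ^+ 2) n0).
      by apply: measurable_funX; exact: mh.
    move=> dx; rewrite sqr_ge0/= -[leLHS]real_normK ?num_real// lerXn2r ?nnegrE ?bt_bd//.
    by rewrite addr_ge0 ?invr_ge0 ?ltW.
  split; first exact: L1Z.
  rewrite /F ExZ// -ler_pdivlMl ?invr_gt0 ?ltr0n// invrK (le_trans E)//.
  have EB : Ex (S n) (fun w => \sum_(i < n) B n i w ^+ 2) <= K * (n%:R * de).
    rewrite -[leRHS](Ex_cst (S n)); apply: Ex_le; [|exact: L1_cst|].
      apply: (L1_bd _ (K := K * (n%:R * de))).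
        by apply: measurable_fun_sum => i _; apply: measurable_funX.
      move=> w; rewrite ger0_norm; last by apply: sumr_ge0 => i _; exact: sqr_ge0.
      by apply: bt_sum => //; exact: ltW.
    by move=> w; apply: bt_sum => //; exact: ltW.
  rewrite (le_trans (ler_wpM2l C2_ge0 EB))// mulrA mulrCA ler_wpM2l ?ler0n//.
  have r1 : C2 * K / (C2 * K + 1) <= 1 by rewrite ler_pdivrMr// mul1r lerDl.
  rewrite (_ : C2 * K * de = C2 * K / (C2 * K + 1) * (e / 4 * c ^+ 2)); last by rewrite /de; ring.
  by rewrite ler_piMl// mulr_ge0 ?sqr_ge0// ltW.
have c2 : 0 < c ^+ 2 by rewrite exprn_gt0.
have hE : oft S (e / 4) (fun n => [set w | F n w <= c ^+ 2]).
  apply: filterS (nbhs_infty_gt 0) => n n0; have [l E] := hF n n0.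
  have F0 w : 0 <= F n w by rewrite /F mulr_ge0 ?invr_ge0 ?ler0n ?sqr_ge0.
  by apply: bigS (big_Ex_le l F0 E c2) => //; rewrite mulfK// gt_eqF.
have hM := msep_negl t de0 e4.
have h2 : oft S (e / 2) (fun n => [set w | F n w <= c ^+ 2 /\
    `|avgO w (fun o => (ph w t (ox o) - q (n := n) t (ox o)) ^+ 2)| <= de]).
  apply: (@oft2h _ _ _ S (e / 2) _ _ _ _ _ (fun n w h1 h2 => conj h1 h2)).
    by rewrite (_ : e / 2 / 2 = e / 4)//; field.
  by rewrite (_ : e / 2 / 2 = e / 4)//; field.
apply: filterS2 (nbhs_infty_gt 0) (filterI hb h2) => n n0 [k1 k2].
apply: (bigS _ _ (bigI k1 k2)); first by lra.
move=> w [/= g1 [g2 g3]].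
have gd : treatment_data w \in good t b de.
  rewrite inE; split; first by move=> i; rewrite tnth_mktuple; exact: g1.
  apply: le_trans g3; rewrite (le_trans _ (ler_norm _))//.
  by rewrite /avg ler_wpM2l ?invr_ge0 ?ler0n//; apply: ler_sum => i _; rewrite tnth_mktuple.
rewrite -(@ler_pXn2r _ 2) ?nnegrE ?(ltW c0)// real_normK ?num_real//.
rewrite (le_trans _ g2)// /F exprMn sqr_sqrtr ?ler0n// /avg exprMn.
have nr (x : R) : n%:R * (n%:R^-1 ^+ 2 * x) = n%:R^-1 * x by field; rewrite pnatr_eq0 -lt0n.
rewrite nr.
rewrite ler_wpM2l ?invr_ge0 ?ler0n// le_eqVlt; apply/orP; left; apply/eqP; congr (_ ^+ 2).
apply: eq_bigr => i _; rewrite /B /bt indicE gd mul1r tnth_mktuple /=.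
by rewrite mulrAC.
Qed.

End score_from_treatment_data.

(** * Scores fitted on random supports *)

Section tensor.
Context {R : realType} {d : nat -> measure_display} {O : forall n, measurableType (d n)}.
Variables (n p : nat) (x : 'I_p -> O n -> R) (B : R).
Hypothesis B_ge1 : 1 <= B.
Hypothesis mx : forall j, measurable_fun setT (x j).
Hypothesis xB : forall j z, `|x j z| <= B.

(** Ordered index tuples with repetition: there are p^k of them, and the k-th power of a sum expands
    over them with unit coefficients. *)
Definition tens k (J : {ffun 'I_k -> 'I_p}) (z : O n) : R := \prod_i x (J i) z.

Lemma measurable_tens k (J : {ffun 'I_k -> 'I_p}) : measurable_fun setT (tens J).
Proof. by apply: measurable_fun_prodr => i _; exact: mx. Qed.

Lemma tens_bd k (J : {ffun 'I_k -> 'I_p}) z : `|tens J z| <= B ^+ k.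
Proof.
rewrite /tens normr_prod -[k in leRHS]card_ord -prodr_const.
by apply: ler_prod => i _; rewrite normr_ge0 xB.
Qed.

Lemma pow_sum k (a : 'I_p -> R) :
  (\sum_j a j) ^+ k = \sum_(J : {ffun 'I_k -> 'I_p}) \prod_i a (J i).
Proof. by rewrite -[k in LHS]card_ord -prodr_const bigA_distr_bigA. Qed.

(** The partial sums obey s -> y (1 + s), and s <= 2 y <= 1 gives y (1 + s) <= 2 y. *)
Lemma sum_pow_le (y : R) m : 0 <= y -> y <= 1 / 2 -> \sum_(i < m) y ^+ i.+1 <= 2 * y.
Proof.
move=> y0 y1; elim: m => [|m ih]; first by rewrite big_ord0; lra.
rewrite big_ord_recl expr1 (eq_bigr (fun i : 'I_m => y * y ^+ i.+1)); last first.
  by move=> i _; rewrite -exprS.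
rewrite -mulr_sumr; move: (\sum_(i < m) _) ih => s ih.
have := ler_wpM2l y0 ih; nra.
Qed.

(* The averages on the left of the hypothesis do not involve [th], which may depend on the
   sample. *)
Lemma avg_exp_bound (w : n.-tuple (O n)) (f : O n -> R) (th : 'I_p -> R) (D : R) : (0 < n)%N ->
  0 <= D -> B * (\sum_j `|th j|) <= 1 / 2 ->
  (forall (k : 'I_n) (J : {ffun 'I_k -> 'I_p}), (0 < k)%N ->
     `|avg w (fun z => f z * tens J z)| <= D * k%:R * B ^+ k) ->
  `|avg w (fun z => f z * (expR (\sum_j x j z * th j) - 1))| <=
    2 * D * (B * \sum_j `|th j|) +
    expR 1 * (1 / 2) ^+ n * avg w (fun z => `|f z|).
Proof.
move=> n0 D0; set tau := \sum_j `|th j|; set y := B * tau => y12 H.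
have tau0 : 0 <= tau by exact: sumr_ge0.
have y0 : 0 <= y by rewrite mulr_ge0// (le_trans ler01).
pose v z := \sum_j x j z * th j.
have vy z : `|v z| <= y.
  rewrite (le_trans (ler_norm_sum _ _ _))// /y /tau mulr_sumr; apply: ler_sum => j _.
  by rewrite normrM ler_wpM2r.
(* Expansion to order n leaves a tail below e 2^(-n), which root n cannot inflate. A fixed order
   would leave a power of |theta|_1, and the assumed rate is too slow to make that o(n^(-1/2)). *)
rewrite (_ : avg w _ = avg w (fun z => f z * (exp_sum n (v z) - 1)) +
    avg w (fun z => f z * (expR (v z) - exp_sum n (v z)))); last first.
  by rewrite -avgD; apply: eq_avg => i; rewrite /v; ring.
rewrite (le_trans (ler_normD _ _))// lerD//; last first.
  rewrite (le_trans (avg_norm _ _))// -avgZ; apply: avg_le => i.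
  rewrite normrM mulrC ler_wpM2r// (le_trans (expR_taylor _ _))// ler_pM ?expR_ge0//.
    by rewrite ler_expR (le_trans (vy _))//; lra.
  by rewrite lerXn2r ?nnegrE// ?divr_ge0// (le_trans (vy _)).
have Hk (k : 'I_n) : (0 < k)%N -> `|avg w (fun z => f z * v z ^+ k)| <= D * k%:R * y ^+ k.
  move=> k0.
  have -> : avg w (fun z => f z * v z ^+ k) =
      \sum_(J : {ffun 'I_k -> 'I_p}) (\prod_i th (J i)) * avg w (fun z => f z * tens J z).
    under [in RHS]eq_bigr do rewrite -avgZ.
    rewrite -avg_sum; apply: eq_avg => i; rewrite /v pow_sum mulr_sumr; apply: eq_bigr => J _.
    by rewrite big_split/= /tens; ring.
  rewrite (le_trans (ler_norm_sum _ _ _))//.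
  rewrite /y exprMn /tau pow_sum !mulr_sumr; apply: ler_sum => J _.
  by rewrite normrM normr_prod mulrC mulrA ler_wpM2r ?prodr_ge0// H.
have -> : avg w (fun z => f z * (exp_sum n (v z) - 1)) =
    \sum_(k < n | (0 < k)%N) k`!%:R^-1 * avg w (fun z => f z * v z ^+ k).
  rewrite big_mkcond/=.
  rewrite (eq_bigr (fun k : 'I_n => avg w (fun z => if (0 < k)%N then k`!%:R^-1 * (f z * v z ^+ k) else 0))); last first.
    by move=> k _; case: ifP => _; [rewrite avgZ|rewrite avg_cst].
  rewrite -avg_sum; apply: eq_avg => i; rewrite -big_mkcond/= /exp_sum.
  rewrite (bigD1 (Ordinal n0))//= expr0 fact0 divr1 addrAC subrr add0r mulr_sumr.
  apply: eq_big => k; first by rewrite -(inj_eq val_inj)/= lt0n.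
  by move=> _; ring.
rewrite (le_trans (ler_norm_sum _ _ _))//.
apply: (@le_trans _ _ (\sum_(k < n | (0 < k)%N) D * y ^+ k)).
  apply: ler_sum => k k0; rewrite normrM gtr0_norm ?invr_gt0 ?ltr0n ?fact_gt0//.
  rewrite ler_pdivrMl ?ltr0n ?fact_gt0// (le_trans (Hk k k0))// mulrCA mulrA ler_wpM2r ?exprn_ge0//.
  (* Here k <= k! absorbs the factor k of the assumed bound. *)
  rewrite ler_wpM2l// ler_nat; case: (k : nat) k0 => // m _.
  by rewrite factS leq_pmulr// fact_gt0.
rewrite -mulr_sumr -mulrA mulrCA ler_wpM2l//.
rewrite -(big_mkord (fun k => (0 < k)%N) (fun k => y ^+ k)).
case: (n) n0 => // m _; rewrite big_mkcond big_nat_recl//= add0r big_mkord.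
exact: sum_pow_le.
Qed.

End tensor.

Section tensor_tail.
Context {R : realType} {d : nat -> measure_display} {O : forall n, measurableType (d n)}.
Variables (n p : nat) (x : 'I_p -> O n -> R) (B : R).
Hypothesis B_ge1 : 1 <= B.
Hypothesis mx : forall j, measurable_fun setT (x j).
Hypothesis xB : forall j z, `|x j z| <= B.
Variables (Q : probability (O n) R) (S : probability (n.-tuple (O n)) R).
Hypothesis S_iid : iid Q S.
Variables (f : O n -> R) (H b s l L : R).
Hypothesis n_gt0 : (0 < n)%N.
Hypothesis mf : measurable_fun setT f.
Hypothesis fH : forall z, `|f z| <= H.
Hypothesis f2 : Ex Q (fun z => f z ^+ 2) <= s.
Hypothesis fb : forall k (J : {ffun 'I_k -> 'I_p}), `|Ex Q (fun z => f z * tens x J z)| <= b / n%:R * B ^+ k.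
Hypothesis L_ge1 : 1 <= L.
Hypothesis s_ge0 : 0 <= s.
Hypothesis b_ge0 : 0 <= b.
Hypothesis lE : l = Num.sqrt (L / n%:R).
Hypothesis l_le1 : l <= 1.
Hypothesis lH : l * H <= 1 / 2.
(** The Chernoff exponent is at least A k L - b L - 2 s L, and 3 k >= k + 2 for k >= 1, so (k + 2) L
    remains. With L the logarithm of max(p, n), k of these L pay for the p^k monomials and the other
    two for the n degrees. *)
Let A := 3 + b + 2 * s.

Let tail_one (sg : R) k (J : {ffun 'I_k -> 'I_p}) : `|sg| = 1 -> (0 < k)%N ->
  (S [set w | (A * k%:R * Num.sqrt (n%:R * L) < \sum_(i < n) sg * (f (tnth w i) * tens x J (tnth w i) / B ^+ k))%R]
    <= (expR (- ((k + 2)%:R * L)))%:E)%E.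
Proof.
move=> sg1 k0.
have nR : 0 < n%:R :> R by rewrite ltr0n.
have L0 : 0 < L by exact: lt_le_trans L_ge1.
have l0 : 0 < l by rewrite lE sqrtr_gt0 divr_gt0.
have Bk : 0 < B ^+ k by rewrite exprn_gt0// (lt_le_trans ltr01).
have mF : measurable_fun setT (fun z => sg * (f z * tens x J z / B ^+ k)).
  apply: measurable_funM => //; apply: measurable_funM => //; apply: measurable_funM => //.
  exact: measurable_tens.
have Ff z : `|sg * (f z * tens x J z / B ^+ k)| <= `|f z|.
  rewrite normrM sg1 mul1r !normrM normfV (gtr0_norm Bk) ler_pdivrMr// ler_wpM2l//.
  exact: tens_bd.
have hf : L1 Q f by exact: (L1_bd Q mf fH).
have hf2 : L1 Q (fun z => f z ^+ 2).
  apply: (L1_bd Q (K := H ^+ 2)); first exact: measurable_funX.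
  by move=> z; rewrite normrX lerXn2r ?nnegrE// (le_trans (normr_ge0 (f z))).
have hF2 : L1 Q (fun z => (sg * (f z * tens x J z / B ^+ k)) ^+ 2).
  apply: (L1_le _ _ hf2); first exact: measurable_funX.
  by move=> z; rewrite normrX -[leRHS]real_normK ?num_real// lerXn2r ?nnegrE.
have hfT : L1 Q (fun z => f z * tens x J z).
  rewrite (_ : (fun z => _) = (fun z => tens x J z * f z)); last by apply/funext => z; rewrite mulrC.
  by apply: (L1_mul_bd (K := B ^+ k)) => //; [exact: measurable_tens|move=> z; exact: tens_bd].
have c1 z : `|l * (sg * (f z * tens x J z / B ^+ k))| <= 1 / 2.
  rewrite normrM (gtr0_norm l0) (le_trans _ lH)// ler_wpM2l ?(ltW l0)//.
  by rewrite (le_trans (Ff z)).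
have c2 : `|Ex Q (fun z => sg * (f z * tens x J z / B ^+ k))| <= b / n%:R.
  rewrite (_ : (fun z => _) = (fun z => (sg / B ^+ k) * (f z * tens x J z))); last first.
    by apply/funext => z; ring.
  rewrite ExZ// !normrM sg1 mul1r normfV (gtr0_norm Bk) mulrC ler_pdivrMr//; exact: fb.
have c3 : Ex Q (fun z => (sg * (f z * tens x J z / B ^+ k)) ^+ 2) <= s.
  apply: le_trans f2; apply: Ex_le => // z.
  by rewrite -[leLHS]real_normK ?num_real// -[leRHS]real_normK ?num_real// lerXn2r ?nnegrE.
apply: (le_trans (iid_tail S_iid (A * k%:R * Num.sqrt (n%:R * L)) mF l0 c1 c2 c3)).
rewrite lee_fin ler_expR.
have e1 : l * (A * k%:R * Num.sqrt (n%:R * L)) = A * k%:R * L.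
  rewrite lE mulrCA -sqrtrM ?divr_ge0 ?(ltW L0) ?(ltW nR)//; congr (_ * _).
  rewrite (_ : L / n%:R * (n%:R * L) = L ^+ 2); last by field; rewrite gt_eqF.
  by rewrite sqrtr_sqr gtr0_norm.
have e2 : n%:R * l ^+ 2 = L.
  by rewrite lE sqr_sqrtr ?divr_ge0 ?(ltW L0) ?(ltW nR)// mulrC divfK// gt_eqF.
rewrite e1 mulrDr (_ : n%:R * (l * (b / n%:R)) = l * b); last by field; rewrite gt_eqF.
rewrite (_ : n%:R * (2 * l ^+ 2 * s) = 2 * (n%:R * l ^+ 2) * s); last by ring.
rewrite e2 natrD.
have k1 : 1 <= k%:R :> R by rewrite ler1n.
have lb : l * b <= b by rewrite ler_piMl.
have bL : b <= b * L by rewrite ler_peMr.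
rewrite /A; move: (k%:R : R) k1 => K k1.
have h1 : (3 + b + 2 * s) * K * L >= (K + 2 + b + 2 * s) * L.
  rewrite ler_wpM2r ?(ltW L0)//.
  have : 0 <= (b + 2 * s) * (K - 1) by rewrite mulr_ge0 ?subr_ge0// addr_ge0// mulr_ge0.
  by nra.
by rewrite -subr_ge0; nra.
Qed.

Lemma tensor_tail k (J : {ffun 'I_k -> 'I_p}) : (0 < k)%N ->
  big S (2 * expR (- ((k + 2)%:R * L)))
    [set w | `|avg w (fun z => f z * tens x J z)| <= A * Num.sqrt (L / n%:R) * k%:R * B ^+ k].
Proof.
move=> k0; have nR : 0 < n%:R :> R by rewrite ltr0n.
have L0 : 0 < L by exact: lt_le_trans L_ge1.
have Bk : 0 < B ^+ k by rewrite exprn_gt0// (lt_le_trans ltr01).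
have mE (sg : R) : measurable [set w : n.-tuple (O n) |
    (A * k%:R * Num.sqrt (n%:R * L) < \sum_(i < n) sg * (f (tnth w i) * tens x J (tnth w i) / B ^+ k))%R].
  apply: measurable_setlt => //; apply: measurable_fun_sum => i _; apply: measurable_funM => //.
  apply: measurable_funM => //; apply: measurable_funM.
    by apply: measurableT_comp => //; exact: measurable_tnth.
  by apply: (measurableT_comp (measurable_tens mx J)); exact: measurable_tnth.
have n1 : `|1 : R| = 1 by rewrite normr1.
have n2 : `|-1 : R| = 1 by rewrite normrN1.
have h1 := big_setC (mE 1) (tail_one J n1 k0).
have h2 := big_setC (mE (-1)) (tail_one J n2 k0).
apply: bigS (bigI h1 h2); first by move: (expR _) => y; lra.
move=> w [/= /negP g1 /negP g2]; move: g1 g2; rewrite -!leNgt => g1 g2.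
have q1 : `|\sum_(i < n) f (tnth w i) * tens x J (tnth w i) / B ^+ k| <= A * k%:R * Num.sqrt (n%:R * L).
  rewrite ler_norml; apply/andP; split.
    by rewrite lerNl; move: g2; under eq_bigr do rewrite mulN1r; rewrite sumrN.
  by move: g1; under eq_bigr do rewrite mul1r.
rewrite /avg normrM gtr0_norm ?invr_gt0// ler_pdivrMl//.
move: q1; rewrite -mulr_suml normrM normfV (gtr0_norm Bk) ler_pdivrMr// => /le_trans; apply.
have -> : Num.sqrt (n%:R * L) = n%:R * Num.sqrt (L / n%:R).
  rewrite -[X in X * Num.sqrt (L / _)](gtr0_norm nR) -sqrtr_sqr -sqrtrM ?sqr_ge0//.
  by congr Num.sqrt; field; rewrite gt_eqF.
by rewrite le_eqVlt; apply/orP; left; apply/eqP; ring.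
Qed.

End tensor_tail.

Lemma big_forall (R : realType) d (W : measurableType d) (P : probability W R) (I : finType)
  (e : R) (A : I -> set W) : (forall i, big P e (A i)) -> 0 <= e ->
  big P (#|I|%:R * e) [set w | forall i, A i w].
Proof.
move=> hA e0.
have H (s : seq I) : big P ((size s)%:R * e) [set w | forall i, i \in s -> A i w].
  elim: s => [|i s ih].
    by exists set0 => //; split => //=; rewrite measure0 lee_fin mul0r.
  apply: (bigS _ _ (bigI (hA i) ih)); first by rewrite /= -natr1 mulrDl mul1r addrC.
  by move=> w [h1 h2] j; rewrite inE => /predU1P[->//|]; exact: h2.
apply: bigS (H (enum I)); first by rewrite cardE.
by move=> w h i; apply: h; rewrite mem_enum.
Qed.

(** * Growth of the logarithmic dimension against the cube root of n *)

Section log_rate.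
Context {R : realType}.
Variable p : nat -> nat.
Hypothesis p_rate : ln (p n)%:R / (n%:R `^ 3^-1) @[n --> \oo] --> (0 : R).
Definition log_dim n : R := ln (maxn (p n) n)%:R.

Lemma cube_root_cube n : ((n%:R : R) `^ 3^-1) ^+ 3 = n%:R.
Proof. by rewrite -powR_mulrn ?powR_ge0// -powRrM mulVf// powRr1. Qed.

Lemma cube_root_ge (K : R) : \forall n \near \oo, K <= n%:R `^ 3^-1.
Proof.
near=> n; have [K0|K0] := ltP K 0; first by rewrite (le_trans (ltW K0))// powR_ge0.
rewrite -(@ler_pXn2r _ 3) ?nnegrE ?powR_ge0// cube_root_cube.
by near: n; exact: nbhs_infty_ger.
Unshelve. all: by end_near. Qed.

Lemma log_dim_ge1 : \forall n \near \oo, 1 <= log_dim n.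
Proof.
near=> n; have n0 : (0 < n)%N by near: n; exact: nbhs_infty_gt.
have h : expR 1 <= n%:R :> R by near: n; exact: nbhs_infty_ger.
rewrite /log_dim -[leLHS]expRK ler_ln ?posrE ?expR_gt0//; last first.
  by rewrite ltr0n leq_max n0 orbT.
by rewrite (le_trans h)// ler_nat leq_maxr.
Unshelve. all: by end_near. Qed.

(** The constant 1/4 is what l tau <= 1/2 requires, because (l tau)^2 = L / tau when tau^3 = n. *)
Lemma log_dim_le : \forall n \near \oo, log_dim n <= 1 / 4 * n%:R `^ 3^-1.
Proof.
near=> n; have n0 : (0 < n)%N by near: n; exact: nbhs_infty_gt.
have t0 : 0 < (n%:R : R) `^ 3^-1 by rewrite powR_gt0// ltr0n.
have h1 : ln (p n)%:R / (n%:R `^ 3^-1) <= 1 / 4 :> R.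
  rewrite (le_trans (ler_norm _))//; near: n.
  have q : (0 : R) < 1 / 4 by rewrite divr_gt0.
  move/cvgrPdist_le : p_rate => /(_ _ q); apply: filterS => n.
  by rewrite sub0r normrN.
(* 576 = 24^2: with t = n^(1/3), ln n = 6 ln(sqrt t) <= 6 sqrt t, which is at most t / 4 once sqrt t
   >= 24. *)
have h2 : (576 : R) <= n%:R `^ 3^-1 by near: n; exact: cube_root_ge.
rewrite /log_dim; case: (leqP (p n) n) => pn; last first.
  by rewrite -ler_pdivrMr.
have -> : ln n%:R = 6 * ln (Num.sqrt (n%:R `^ 3^-1)) :> R.
  rewrite -[in LHS](cube_root_cube n) -[in LHS](sqr_sqrtr (ltW t0)) -exprM lnXn ?sqrtr_gt0//.
  by rewrite (mulr_natl _ 6).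
move: (n%:R `^ 3^-1) t0 h2 => t t0 h2.
have st : 24 <= Num.sqrt t.
  rewrite -(@ler_pXn2r _ 2) ?nnegrE ?sqrtr_ge0// sqr_sqrtr ?(ltW t0)//.
  by rewrite (le_trans _ h2)//; lra.
have s0 : 0 < Num.sqrt t by rewrite sqrtr_gt0.
have ls : ln (Num.sqrt t) <= Num.sqrt t.
  have := @le_ln1Dx R (Num.sqrt t - 1); rewrite (_ : 1 + (Num.sqrt t - 1) = Num.sqrt t) => [/(_ _)|]; last by ring.
  by move=> h; rewrite (le_trans (h _)) ?gerBl//; lra.
rewrite -[in leRHS](sqr_sqrtr (ltW t0)); move: (Num.sqrt t) (ln (Num.sqrt t)) ls st s0 => s a ls st s0.
by rewrite expr2; nra.
Unshelve. all: by end_near. Qed.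

End log_rate.

(** * Averages of residuals against exponential perturbations with random coefficients *)

Section exponential_perturbation.
Context {R : realType} {d : nat -> measure_display} {O : forall n, measurableType (d n)}.
Variables (Q : forall n, probability (O n) R) (S : forall n, probability (n.-tuple (O n)) R).
Hypothesis S_iid : forall n, (0 < n)%N -> iid (Q n) (S n).
Variables (p : nat -> nat) (x : forall n, 'I_(p n) -> O n -> R) (B C4 : R).
Hypothesis B_ge1 : 1 <= B.
Hypothesis mx : forall n j, (0 < n)%N -> measurable_fun setT (x (n := n) j).
Hypothesis xB : forall n j z, `|x (n := n) j z| <= B.
Hypothesis p_rate : ln (p n)%:R / (n%:R `^ 3^-1) @[n --> \oo] --> (0 : R).
Variable f : forall n, O n -> R.
Hypothesis mf : forall n, (0 < n)%N -> measurable_fun setT (f (n := n)).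
Hypothesis C4_ge0 : 0 <= C4.
Hypothesis f4 : forall n, (0 < n)%N -> L1 (Q n) (fun z => f z ^+ 4) /\ Ex (Q n) (fun z => f z ^+ 4) <= C4.
Hypothesis f0 : forall n k (J : {ffun 'I_k -> 'I_(p n)}), (0 < n)%N ->
  Ex (Q n) (fun z => f z * tens (x (n := n)) J z) = 0.
Variable th : forall n, n.-tuple (O n) -> 'I_(p n) -> R.
Let L := log_dim p (R := R).
Let tau n : R := n%:R `^ 3^-1.
Let nrm n (w : n.-tuple (O n)) := \sum_j `|th w j|.
Hypothesis th_small : negl S (fun n w => Num.sqrt (L n) * nrm w).

Let ftr n (z : O n) := f z - excess (tau n) (f (n := n)) z.

Let L1f n : (0 < n)%N -> L1 (Q n) (f (n := n)).
Proof.
move=> n0; have [l _] := f4 n0.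
apply: (L1_le (mf n0) _ (L1D (L1_cst _ 2) l)) => z.
have -> : f z ^+ 4 = `|f z| ^+ 4 by rewrite -normrX ger0_norm// (exprM _ 2 2) sqr_ge0.
by move: `|f z| (normr_ge0 (f z)) => y y0; have := sqr_ge0 (y - 1); have := sqr_ge0 (y ^+ 2 - 1); nra.
Qed.

Let A : R := 3 + C4 + 2 * (1 + C4).

Let good n : set (n.-tuple (O n)) := [set w | forall (k : 'I_n) (J : {ffun 'I_k -> 'I_(p n)}),
  (0 < k)%N -> `|avg w (fun z => ftr z * tens (x (n := n)) J z)| <= A * Num.sqrt (L n / n%:R) * k%:R * B ^+ k].

(** With M = max(p, n), the failure probabilities sum to at most 2 p^k M^(-(k + 2)) <= 2 M^(-2) over
    the monomials of degree k, and to at most 2 n M^(-2) <= 2 / n over the degrees. *)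
Let whp_good : whp S good.
Proof.
move=> e e0; near=> n.
have n0 : (0 < n)%N by near: n; exact: nbhs_infty_gt.
have nR : 0 < n%:R :> R by rewrite ltr0n.
have Lge1 : 1 <= L n by near: n; exact: log_dim_ge1.
have Lt : L n <= 1 / 4 * tau n by near: n; exact: log_dim_le.
have t1 : 1 <= tau n by near: n; exact: cube_root_ge.
have t3 : tau n ^+ 3 = n%:R by exact: cube_root_cube.
have t0 : 0 < tau n by exact: lt_le_trans t1.
have mtr : measurable_fun setT (ftr (n := n)).
  by apply: measurable_funB; [exact: mf|apply: measurable_excess; exact: mf].
have trt z : `|ftr (n := n) z| <= tau n by apply: sub_excess_le; exact: ltW.
have trf z : `|ftr (n := n) z| <= `|f z|.
  by rewrite /ftr /excess; case: ifP => _; rewrite ?subrr ?normr0// subr0.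
have [l4 E4] := f4 n0.
have tr2 : Ex (Q n) (fun z => ftr z ^+ 2) <= 1 + C4.
  apply: (@le_trans _ _ (Ex (Q n) (fun z => 1 + f z ^+ 4))).
    apply: Ex_le; [|by apply: L1D => //; exact: L1_cst|].
      apply: (L1_bd _ (K := tau n ^+ 2)); first exact: measurable_funX.
      by move=> z; rewrite normrX lerXn2r ?nnegrE// ltW.
    move=> z; rewrite (le_trans _ (sqr_le_quart (f z)))//.
    by rewrite -[leLHS]real_normK ?num_real// -[leRHS]real_normK ?num_real// lerXn2r ?nnegrE.
  by rewrite ExD ?Ex_cst ?lerD2l//; exact: L1_cst.
(* [f] is orthogonal to every monomial, so the bias is that of the discarded part, where |f| <= f^4
   / tau^3 = f^4 / n. *)
have trb k (J : {ffun 'I_k -> 'I_(p n)}) :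
    `|Ex (Q n) (fun z => ftr z * tens (x (n := n)) J z)| <= C4 / n%:R * B ^+ k.
  have mT := measurable_tens (fun j => mx j n0) J.
  have bT z : `|tens (x (n := n)) J z| <= B ^+ k by exact: tens_bd.
  have lf : L1 (Q n) (fun z => f z * tens (x (n := n)) J z).
    rewrite (_ : (fun z => _) = (fun z => tens (x (n := n)) J z * f z)); last by apply/funext => z; rewrite mulrC.
    by apply: (L1_mul_bd mT bT); exact: L1f.
  have le : L1 (Q n) (fun z => excess (tau n) (f (n := n)) z * tens (x (n := n)) J z).
    rewrite (_ : (fun z => _) = (fun z => tens (x (n := n)) J z * excess (tau n) (f (n := n)) z)); last by apply/funext => z; rewrite mulrC.
    apply: (L1_mul_bd mT bT); apply: (L1_le _ _ (L1_norm (L1f n0))).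
      by apply: measurable_excess; exact: mf.
    by move=> z; exact: excess_le.
  rewrite (_ : (fun z => _) = (fun z => f z * tens (x (n := n)) J z - excess (tau n) (f (n := n)) z * tens (x (n := n)) J z)); last first.
    by apply/funext => z; rewrite /ftr mulrBl.
  rewrite ExB// f0// sub0r normrN (le_trans (Ex_norm le))//.
  apply: (@le_trans _ _ (Ex (Q n) (fun z => (B ^+ k / n%:R) * f z ^+ 4))).
    apply: Ex_le; [exact: L1_norm|exact: L1Z|move=> z].
    rewrite normrM mulrC -mulrA ler_pM//.
    have -> : f z ^+ 4 = `|f z| ^+ 4 by rewrite -normrX ger0_norm// (exprM _ 2 2) sqr_ge0.
    rewrite ler_pdivlMl// -t3 /excess; case: ltP => [h|_]; last by rewrite normr0 mulr0 exprn_ge0.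
    rewrite [leRHS]exprSr ler_wpM2r// lerXn2r ?nnegrE ?(ltW t0)//; exact: ltW.
  rewrite ExZ// [leRHS]mulrC mulrA -[leLHS]mulrAC ler_wpM2r ?invr_ge0 ?(ltW nR)//.
  by rewrite ler_wpM2l// exprn_ge0// (le_trans ler01).
have Ln : L n / n%:R <= 1.
  rewrite ler_pdivrMr// mul1r -t3 (le_trans Lt)//.
  move: (tau n) t1 => t t1; have t2 : 1 <= t ^+ 2 by exact: exprn_ege1.
  by rewrite exprS; nra.
have L0 : 0 < L n by exact: lt_le_trans Lge1.
pose l := Num.sqrt (L n / n%:R).
have l1 : l <= 1 by rewrite -[leRHS]sqrtr1 ler_wsqrtr.
have lt : l * tau n <= 1 / 2.
  rewrite -[tau n]gtr0_norm// -sqrtr_sqr -sqrtrM ?divr_ge0 ?(ltW L0) ?(ltW nR)//.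
  rewrite (_ : L n / n%:R * tau n ^+ 2 = L n / tau n); last first.
    by rewrite -t3; field; rewrite gt_eqF.
  rewrite -[leRHS]gtr0_norm ?divr_gt0// -sqrtr_sqr ler_wsqrtr// ler_pdivrMr//.
  by rewrite (le_trans Lt)// ler_wpM2r ?(ltW t0)//; lra.
have C41 : 0 <= 1 + C4 by rewrite addr_ge0.
have tt k (J : {ffun 'I_k -> 'I_(p n)}) : (0 < k)%N -> _ :=
  @tensor_tail R d O n (p n) (x (n := n)) B B_ge1 (fun j => mx j n0) (@xB n) (Q n) (S n) (S_iid n0)
   (ftr (n := n)) (tau n) C4 (1 + C4) l (L n) n0 mtr trt tr2 trb Lge1 C41 C4_ge0 erefl l1 lt k J.
pose M : R := (maxn (p n) n)%:R.
have M0 : 0 < M by rewrite /M ltr0n leq_max n0 orbT.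
have LM : expR (L n) = M by rewrite /L /log_dim lnK// posrE.
have eM k : expR (- ((k + 2)%:R * L n)) = (M ^+ (k + 2))^-1 by rewrite expRN expRM_natl LM.
have bk (k : 'I_n) : big (S n) (2 * (M ^+ 2)^-1) [set w | forall J : {ffun 'I_k -> 'I_(p n)},
    (0 < k)%N -> `|avg w (fun z => ftr z * tens (x (n := n)) J z)| <= A * Num.sqrt (L n / n%:R) * k%:R * B ^+ k].
  have M2 : 0 <= 2 * (M ^+ (k + 2))^-1 by rewrite mulr_ge0// invr_ge0 exprn_ge0// ltW.
  have hb (J : {ffun 'I_k -> 'I_(p n)}) : big (S n) (2 * (M ^+ (k + 2))^-1) [set w | (0 < k)%N ->
      `|avg w (fun z => ftr z * tens (x (n := n)) J z)| <= A * Num.sqrt (L n / n%:R) * k%:R * B ^+ k].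
    have [k0|k0] := posnP k; last first.
      by have := tt k J k0; rewrite eM; apply: bigS => // w h _.
    by exists set0 => //; rewrite measure0 lee_fin; split=> // w _; rewrite /= k0.
  apply: (bigS _ _ (big_forall hb M2)) => //.
  rewrite card_ffun !card_ord mulrCA ler_wpM2l// natrX exprD invfM mulrA ler_piMl ?invr_ge0 ?exprn_ge0 ?(ltW M0)//.
  rewrite ler_pdivrMr ?exprn_gt0// mul1r lerXn2r ?nnegrE ?ler0n ?(ltW M0)//.
  by rewrite ler_nat leq_maxl.
have M22 : 0 <= 2 * (M ^+ 2)^-1 by rewrite mulr_ge0// invr_ge0 exprn_ge0// ltW.
apply: (bigS _ _ (big_forall bk M22)) => //.
have nM : n%:R <= M by rewrite ler_nat leq_maxr.
rewrite card_ord (@le_trans _ _ (2 / n%:R))//.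
  rewrite mulrCA ler_wpM2l// ler_pdivrMr ?exprn_gt0// ler_pdivlMl//.
  by rewrite -expr2 lerXn2r ?nnegrE ?(ltW nR) ?(ltW M0).
rewrite ler_pdivrMr// mulrC -ler_pdivrMr//.
by near: n; exact: nbhs_infty_ger.
Unshelve. all: by end_near. Qed.

Let avg4_tight : tight S (fun n w => avg w (fun z => f (n := n) z ^+ 4)).
Proof.
apply: (tight_avg S_iid (f := fun n z => f (n := n) z ^+ 4) (C := C4)) => n n0.
have [h1 h2] := f4 n0; split=> //.
rewrite (_ : (fun z => `| f z ^+ 4|) = (fun z => f z ^+ 4))//.
by apply/funext => z; rewrite ger0_norm// (exprM _ 2 2) sqr_ge0.
Qed.

(** If the average of f^4 is at most K, each f^4 is at most K n, and this is below tau^4 = n tau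
    once tau >= K; truncation is then invisible on the sample. *)
Let whp_trunc : whp S (fun n => [set w | forall i, f (tnth w i) = ftr (n := n) (tnth w i)]).
Proof.
move=> e e0; have [K hK] := avg4_tight e0.
apply: (oftS hK); near=> n; move=> w /= h i.
have n0 : (0 < n)%N by near: n; exact: nbhs_infty_gt.
have Kt : K <= tau n by near: n; exact: cube_root_ge.
have t0 : 0 < tau n by rewrite powR_gt0// ltr0n.
have t3 : tau n ^+ 3 = n%:R by exact: cube_root_cube.
rewrite /ftr /excess ifF ?subr0//; apply/negbTE; rewrite -leNgt.
rewrite -(@ler_pXn2r _ 4) ?nnegrE ?(ltW t0)//.
have q (z : O n) : 0 <= f z ^+ 4 by rewrite (exprM _ 2 2) sqr_ge0.
rewrite -normrX ger0_norm// [tau n ^+ 4]exprSr t3 mulrC.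
have := le_trans (le_trans (ler_norm _) h) Kt; rewrite /avg ler_pdivrMl ?ltr0n// mulrC.
by apply: le_trans; rewrite (bigD1 i)//= lerDl sumr_ge0.
Unshelve. all: by end_near. Qed.

(** Root n turns the main term into 2 A B sqrt(L) |theta|_1, negligible by the assumed rate, and the
    Taylor tail is controlled by sqrt(n) 2^(-n) <= 1 / sqrt(n). *)
Lemma exp_perturbation_negl : negl S (fun n w => Num.sqrt n%:R *
  avg w (fun z => f z * (expR (\sum_j x j z * th w j) - 1))).
Proof.
have t1 : tight S (fun n w => avg w (fun z => `|f (n := n) z|)).
  have [C hC] : exists C, forall n, (0 < n)%N -> Ex (Q n) (fun z => `|f (n := n) z|) <= C.
    exists (2 + C4) => n n0; have [h1 h2] := f4 n0.
    apply: (@le_trans _ _ (Ex (Q n) (fun z => 2 + f z ^+ 4))); last first.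
      by rewrite ExD ?Ex_cst ?lerD2l//; exact: L1_cst.
    apply: Ex_le; [exact/L1_norm/L1f|by apply: L1D => //; exact: L1_cst|move=> z].
    have -> : f z ^+ 4 = `|f z| ^+ 4 by rewrite -normrX ger0_norm// (exprM _ 2 2) sqr_ge0.
    by move: `|f z| (normr_ge0 (f z)) => y y0; have := sqr_ge0 (y - 1); have := sqr_ge0 (y ^+ 2 - 1); nra.
  apply: (tight_avg S_iid (f := fun n z => `|f (n := n) z|) (C := C)) => n n0.
  split; first exact/L1_norm/L1f.
  rewrite (_ : (fun z => `| `|f z| |) = (fun z => `|f z|)); first exact: hC.
  by apply/funext => z; rewrite normr_id.
have n1 := neglZ (2 * A * B) th_small.
have n2 := neglM (negl_cvg S (@invn_sqrt_cvg R)) (tightM (tight_cst S (expR 1)) t1).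
have B0 : 0 < B by exact: lt_le_trans B_ge1.
have A0 : 0 <= A by rewrite /A !addr_ge0// mulr_ge0// addr_ge0.
have half : 0 < 1 / 2 / B by rewrite divr_gt0// divr_gt0.
apply: (negl_le (neglD n1 n2)).
apply: (whp2 (whp2 whp_good whp_trunc (fun n w h1 h2 => conj h1 h2))
  (whp2 (th_small half) (whp_near S (A := fun n => [set w | (0 < n)%N /\ 1 <= L n]) _)
     (fun n w h1 h2 => conj h1 h2))).
  by near=> n; move=> w; split; near: n; [exact: nbhs_infty_gt|exact: log_dim_ge1].
move=> n w [g1 g2] [/= g3 [n0 L1]].
have nR : 0 < n%:R :> R by rewrite ltr0n.
have L0 : 0 <= L n by exact: le_trans L1.
have N0 : 0 <= nrm w by exact: sumr_ge0.
have sL : 1 <= Num.sqrt (L n) by rewrite -[leLHS]sqrtr1 ler_wsqrtr.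
have y12 : B * nrm w <= 1 / 2.
  rewrite mulrC -ler_pdivlMr// (le_trans _ g3)// (le_trans _ (ler_norm _))//.
  by rewrite ler_peMl.
have D0 : 0 <= A * Num.sqrt (L n / n%:R) by rewrite mulr_ge0 ?sqrtr_ge0.
have H (k : 'I_n) (J : {ffun 'I_k -> 'I_(p n)}) : (0 < k)%N ->
    `|avg w (fun z => f z * tens (x (n := n)) J z)| <= A * Num.sqrt (L n / n%:R) * k%:R * B ^+ k.
  move=> k0; rewrite (_ : avg w _ = avg w (fun z => ftr z * tens (x (n := n)) J z)); last first.
    by apply: eq_avg => i; rewrite g2.
  exact: g1.
have E := avg_exp_bound B_ge1 (@xB n) n0 D0 y12 H.
rewrite normrM (ger0_norm (sqrtr_ge0 _)) (le_trans (ler_wpM2l (sqrtr_ge0 _) E))//.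
rewrite (le_trans _ (ler_norm _))// mulrDr lerD//.
  rewrite le_eqVlt; apply/orP; left; apply/eqP.
  have -> : Num.sqrt (L n) = Num.sqrt n%:R * Num.sqrt (L n / n%:R).
    by rewrite -sqrtrM ?ler0n// mulrC divfK// gt_eqF.
  by rewrite -/(nrm w); ring.
have a0 : 0 <= avg w (fun z => `|f z|) by exact: avg_ge0.
rewrite -[expR 1 * _ * _]mulrA mulrCA [leRHS]mulrCA ler_wpM2l ?expR_ge0// mulrA ler_wpM2r//.
have sn : 0 < Num.sqrt (n%:R : R) by rewrite sqrtr_gt0.
rewrite -[leRHS]mul1r ler_pdivlMr// mulrAC -expr2 sqr_sqrtr ?(ltW nR)//.
rewrite expr_div_n expr1n mul1r ler_pdivrMr ?exprn_gt0// mul1r -natrX ler_nat.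
by rewrite ltnW// ltn_expl.
Unshelve. all: by end_near. Qed.

End exponential_perturbation.

Section almost_sure_samples.
Context {R : realType} {d : measure_display} {O : measurableType d}.
Variables (Q : probability O R) (n : nat) (S : probability (n.-tuple O) R).
Hypothesis S_iid : iid Q S.

Lemma ae_sample (A : set O) : {ae Q, forall o, A o} -> {ae S, forall w, forall i, A (tnth w i)}.
Proof.
move=> [N [mN QN AN]]; apply: filter_forall => i.
exists [set w | N (tnth w i)]; split.
- rewrite -[X in measurable X]setTI; exact: (measurable_tnth i measurableT mN).
- by rewrite (prob_tnth S_iid).
- by move=> w /= h; apply: AN.
Qed.

(* Otherwise a whole sample would violate the bound with positive probability. *)
Lemma ae_of_sample_bound (f : O -> R) (b : R) : (0 < n)%N -> measurable_fun setT f ->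
  {ae S, forall w, Num.sqrt (n%:R^-1 * \sum_(i < n) f (tnth w i) ^+ 2) <= b} ->
  {ae Q, forall o, `|f o| <= b}.
Proof.
move=> n0 mf [N [mN SN AN]].
pose A := [set o | b < `|f o|].
have mA : measurable A by apply: measurable_setlt => //; exact: measurableT_comp.
suff A0 : Q A = 0%E.
  by exists A; split => // o /= /negP; rewrite -ltNge.
apply/eqP; rewrite eq_le measure_ge0 andbT leNgt; apply/negP => A_gt0.
have : S [set w | forall i, A (tnth w i)] = (\prod_(i < n) Q A)%E by exact: S_iid.
have : (0 < \prod_(i < n) Q A)%E by elim/big_ind : _ => //; exact: mule_gt0.
move=> /[swap] <-; apply/negP; rewrite -leNgt -SN; apply: le_measure; rewrite ?inE//.
  exact: (measurable_cylinder (fun=> mA)).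
move=> w /= h; apply: AN => /=; apply/negP; rewrite -ltNge.
have [b0|b0] := ltP b 0; first by rewrite (lt_le_trans b0)// sqrtr_ge0.
rewrite -[ltLHS]ger0_norm// -sqrtr_sqr ltr_sqrt; last first.
  rewrite mulr_gt0 ?invr_gt0 ?ltr0n//; case: n w n0 h => // m w _ h.
  rewrite big_ord_recl ltr_pwDl ?sumr_ge0// => [|i _]; last exact: sqr_ge0.
  by rewrite lt_def sqr_ge0 sqrf_eq0 andbT -normr_gt0 (le_lt_trans b0 (h ord0)).
rewrite ltr_pdivlMl ?ltr0n// mulr_natl -[n in ltLHS]card_ord -sumr_const.
apply: ltr_sum; first by apply/hasP; exists (Ordinal n0); rewrite ?mem_index_enum.
move=> i _; rewrite -[ltRHS]real_normK ?num_real// ltrXn2r ?nnegrE//.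
exact: h.
Qed.

End almost_sure_samples.

(** * Algebra of the multinomial logit *)

Section multinomial_logit.
Context {R : realType} {T : nat}.
Implicit Types (m : 'I_T -> R) (t : 'I_T.+1).

(** The base level receives index 0, so that all levels are treated alike. *)
Definition level m t : R := if unlift ord0 t is Some r then m r else 0.

Lemma sum_expR_level m : \sum_s expR (level m s) = 1 + \sum_(r < T) expR (m r).
Proof.
rewrite big_ord_recl /level unlift_none expR0; congr (_ + _).
by apply: eq_bigr => r _; rewrite liftK.
Qed.

Lemma logitE m t : logit m t = expR (level m t) / \sum_s expR (level m s).
Proof.
by rewrite sum_expR_level /logit /level; case: (unlift _ _) => // ; rewrite expR0.
Qed.

Lemma logit_gt0 m t : 0 < logit m t.
Proof.
rewrite logitE divr_gt0 ?expR_gt0// (bigD1 t)//= ltr_pwDl ?expR_gt0//.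
by apply: sumr_ge0 => s _; exact: expR_ge0.
Qed.

Lemma logitV m t : (logit m t)^-1 = \sum_s expR (level m s - level m t).
Proof.
rewrite logitE invf_div mulr_suml; apply: eq_bigr => s _.
by rewrite expRD expRN.
Qed.

Lemma sum_logit m : \sum_t logit m t = 1.
Proof.
under eq_bigr do rewrite logitE.
rewrite -mulr_suml divff// sum_expR_level gt_eqF// ltr_pwDl//.
by apply: sumr_ge0 => s _; exact: expR_ge0.
Qed.

Definition level_vec p (g : 'I_T -> 'cV[R]_p) t : 'cV[R]_p :=
  if unlift ord0 t is Some r then g r else 0.

Lemma level_dot p (v : 'cV[R]_p) (g : 'I_T -> 'cV[R]_p) t :
  level (fun r => dot v (g r)) t = dot v (level_vec g t).
Proof.
rewrite /level /level_vec; case: (unlift _ _) => // .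
by rewrite /dot big1// => j _; rewrite mxE mulr0.
Qed.

End multinomial_logit.

(** * Overlap and the score remainder for fitted logit scores *)

Section logit_score.
Context {R : realType} {T : nat} {d : nat -> measure_display} {X : forall n, measurableType (d n)}.
Local Notation O n := (observed R T (X n)).
Local Notation avgO := (@avg R _ (fun n => O n) _).
Variables (Q : forall n, probability (O n) R) (S : forall n, probability (n.-tuple (O n)) R).
Hypothesis S_iid : forall n, (0 < n)%N -> iid (Q n) (S n).
Variables (q mu : forall n, 'I_T.+1 -> X n -> R).
Variables (ph : forall n, n.-tuple (O n) -> 'I_T.+1 -> X n -> R).
Variables (p : nat -> nat) (XD : forall n, X n -> 'cV[R]_(p n)).
Variables (gs : forall n, 'I_T -> 'cV[R]_(p n)).
Variables (gh : forall n, n.-tuple (O n) -> 'I_T -> 'cV[R]_(p n)).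
Variables (pmin B C2 C4 : R) (bnd : nat -> R).
Hypothesis pmin_gt0 : 0 < pmin.
Hypothesis B_ge1 : 1 <= B.
Hypothesis C2_ge0 : 0 <= C2.
Hypothesis C4_ge0 : 0 <= C4.
Hypothesis q_ge : forall n t x, pmin <= q (n := n) t x.
Hypothesis mq : forall n t, (0 < n)%N -> measurable_fun setT (q (n := n) t).
Hypothesis mXD : forall n j, measurable_fun setT (fun x => XD (n := n) x j 0).
Hypothesis resid4 : forall n, (0 < n)%N -> L1 (Q n) (fun o => resid (mu (n := n)) o ^+ 4) /\
  Ex (Q n) (fun o => resid (mu (n := n)) o ^+ 4) <= C4.
Hypothesis resid1 : forall n, (0 < n)%N -> L1 (Q n) (resid (mu (n := n))).
Hypothesis resid2 : forall n, (0 < n)%N -> L1 (Q n) (fun o => resid (mu (n := n)) o ^+ 2).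
Hypothesis resid0 : forall n (h : 'I_T.+1 * X n -> R), (0 < n)%N -> measurable_fun setT h ->
  L1 (Q n) (fun o => h (od o, ox o) * resid (mu (n := n)) o) ->
  Ex (Q n) (fun o => h (od o, ox o) * resid (mu (n := n)) o) = 0.
Hypothesis resid2w : forall n (h : 'I_T.+1 * X n -> R) (K : R), (0 < n)%N -> measurable_fun setT h ->
  (forall dx, 0 <= h dx <= K) ->
  Ex (Q n) (fun o => h (od o, ox o) * resid (mu (n := n)) o ^+ 2)
    <= C2 * Ex (Q n) (fun o => h (od o, ox o)).
Hypothesis p_rate : ln (p n)%:R / (n%:R `^ 3^-1) @[n --> \oo] --> (0 : R).
Let Ls n t (x : X n) := logit (fun r => dot (XD x) (gs n r)) t.
Hypothesis XD_ae : forall n, (0 < n)%N -> {ae Q n, forall o, forall j, `|XD (ox o) j 0| <= B}.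
Hypothesis Ls_ae : forall n, (0 < n)%N ->
  {ae Q n, forall o, forall t, `|Ls t (ox o) - q (n := n) t (ox o)| <= bnd n}.
Hypothesis bnd0 : bnd n @[n --> \oo] --> (0 : R).
Hypothesis fit : forall n (w : n.-tuple (O n)) t i, (0 < n)%N ->
  ph w t (ox (tnth w i)) = logit (fun r => dot (XD (ox (tnth w i))) (gh w r)) t.
Hypothesis gh_rate : forall r, negl S (fun n w =>
  Num.sqrt (log_dim p (R := R) n) * norm1 (gh w r - gs n r)).

(** The perturbation of the log ratio of levels s and t: 1 / phat_t is the sum over s of the ratio
    at the target coefficients times exp(x' th). *)
Let th (s t : 'I_T.+1) n (w : n.-tuple (O n)) (j : 'I_(p n)) : R :=
  (level_vec (gh w) s - level_vec (gs n) s - (level_vec (gh w) t - level_vec (gs n) t)) j 0.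

Let level_rate t : negl S (fun n w => Num.sqrt (log_dim p (R := R) n) *
  norm1 (level_vec (gh w) t - level_vec (gs n) t)).
Proof.
rewrite /level_vec; case: (unlift _ _) => [r|]; first exact: gh_rate.
apply: (negl_eq (negl0 S)) => n w.
by rewrite /norm1 big1 ?mulr0// => j _; rewrite !mxE subr0 normr0.
Qed.

Let th_rate s t : negl S (fun n w => Num.sqrt (log_dim p (R := R) n) * \sum_j `|th s t w j|).
Proof.
apply: (negl_le0 (neglD (level_rate s) (level_rate t))) => n w.
rewrite -mulrDr !normrM ler_wpM2l// ger0_norm ?sumr_ge0// (le_trans _ (ler_norm _))//.
rewrite /norm1 -big_split/=; apply: ler_sum => j _.
by rewrite /th !mxE (le_trans (ler_normB _ _)).
Qed.

(** Regressors clipped to [-B, B], since the tensor bounds are needed at every point. *)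
Let xc n j (x : X n) : R := Num.max (- B) (Num.min B (XD x j 0)).

Let B0 : 0 < B. Proof. exact: lt_le_trans B_ge1. Qed.

Let xc_bd n j x : `|xc (n := n) j x| <= B.
Proof.
rewrite /xc ler_norml le_max lexx/= ge_max ge_min lexx andbT.
by have := B0; lra.
Qed.

Let mxc n j : measurable_fun setT (xc (n := n) j).
Proof. by apply: measurable_maxr => //; apply: measurable_minr => //; exact: mXD. Qed.

Let sure n : set (n.-tuple (O n)) := [set w | [/\ (0 < n)%N,
  forall i j, xc j (ox (tnth w i)) = XD (ox (tnth w i)) j 0,
  forall i t, `|Ls t (ox (tnth w i)) - q (n := n) t (ox (tnth w i))| <= bnd n &
  `|bnd n| <= pmin / 2]].

Let whp_sure : whp S sure.
Proof.
have p2 : 0 < pmin / 2 by rewrite divr_gt0.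
apply: whp_ae; near=> n; have n0 : (0 < n)%N by near: n; exact: nbhs_infty_gt.
have b2 : `|bnd n| <= pmin / 2.
  near: n; move/cvgrPdist_le : bnd0 => /(_ _ p2); apply: filterS => n.
  by rewrite sub0r normrN.
apply: filterS2 (ae_sample (S_iid n0) (XD_ae n0)) (ae_sample (S_iid n0) (Ls_ae n0)) => w h1 h2.
split=> // i j; have := h1 i j; rewrite /xc ler_norml => /andP[k1 k2].
by rewrite min_r// max_r.
Unshelve. all: by end_near. Qed.

Let Ls_ge n (w : n.-tuple (O n)) t i : sure w -> pmin / 2 <= Ls t (ox (tnth w i)).
Proof.
move=> [_ _ /(_ i t) h b]; have := q_ge t (ox (tnth w i)).
move: h => /ler_normlP[h _]; have := ler_norm (bnd n); move: (Ls _ _) (q _ _) h b => x y; lra.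
Qed.

Let phV n (w : n.-tuple (O n)) t i : sure w -> (ph w t (ox (tnth w i)))^-1 =
  \sum_s expR (level (fun r => dot (XD (ox (tnth w i))) (gs n r)) s -
               level (fun r => dot (XD (ox (tnth w i))) (gs n r)) t) *
         expR (\sum_j xc j (ox (tnth w i)) * th s t w j).
Proof.
move=> [n0 hx _ _]; rewrite fit// logitV; apply: eq_bigr => s _.
rewrite -expRD; congr expR; rewrite !level_dot /dot -!sumrB -big_split/=.
by apply: eq_bigr => j _; rewrite hx /th !mxE; ring.
Qed.

(** In this regime overlap of the fitted scores is a consequence: once B |th|_1 <= 1, each
    exponential changes by at most a factor e, so 1 / phat <= e / Ls <= 2 e / pmin. *)
Lemma logit_overlap e : 0 < e -> exists2 c, 0 < c &
  oft S e (fun n => [set w | forall i, c <= ph w (od (tnth w i)) (ox (tnth w i))]).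
Proof.
move=> e0; exists (pmin / 2 / expR 1); first by rewrite !divr_gt0 ?expR_gt0.
have iB : 0 < B^-1 by rewrite invr_gt0.
have small : whp S (fun n => [set w | forall s t, \sum_j `|th s t w j| <= B^-1]).
  apply: whp_all => s; apply: whp_all => t.
  apply: (whp2 (th_rate s t iB) (whp_near S (A := fun n => [set w | 1 <= log_dim p (R := R) n]) _)).
    by near=> n; move=> w /=; near: n; exact: log_dim_ge1.
  move=> n w /= h L1; rewrite (le_trans _ h)// normrM (ger0_norm (sqrtr_ge0 _)).
  rewrite [X in _ * X]ger0_norm ?sumr_ge0// ler_peMl ?sumr_ge0//.
  by rewrite -[leLHS]sqrtr1 ler_wsqrtr.
apply: (whp2 whp_sure small _ e0) => n w hs hw i /=.
have Lg := Ls_ge (od (tnth w i)) i hs; have p2 : 0 < pmin / 2 by rewrite divr_gt0.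
have [n0 _ _ _] := hs.
have p0 : 0 < ph w (od (tnth w i)) (ox (tnth w i)) by rewrite fit// logit_gt0.
rewrite -lef_pV2 ?posrE ?divr_gt0 ?expR_gt0// phV// invf_div.
apply: (@le_trans _ _ ((Ls (od (tnth w i)) (ox (tnth w i)))^-1 * expR 1)).
  rewrite /Ls logitV mulr_suml; apply: ler_sum => s _.
  rewrite ler_wpM2l ?expR_ge0// ler_expR.
  rewrite (le_trans (ler_norm _))// (le_trans (ler_norm_sum _ _ _))//.
  apply: (@le_trans _ _ (\sum_j B * `|th s (od (tnth w i)) w j|)).
    by apply: ler_sum => j _; rewrite normrM ler_wpM2r.
  by rewrite -mulr_sumr -ler_pdivlMl// mulr1.
by rewrite mulrC ler_wpM2l ?expR_ge0// lef_pV2 ?posrE// (lt_le_trans p2).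
Unshelve. all: by end_near. Qed.

Variable t : 'I_T.+1.
Let Ms n s (x : X n) := level (fun r => dot (XD x) (gs n r)) s.
(** [rs], [bn] and [Lc] are clipped so that the ratios stay below 2 / pmin and the target logit
    within [bn] of [q] at every point; on the event [sure] the clipping changes nothing at the
    sample points. *)
Let rs s n (x : X n) : R := Num.min (2 / pmin) (expR (Ms s x - Ms t x)).
Let bn n : R := Num.min `|bnd n| (pmin / 2).
Let Lc n (x : X n) : R := Num.max (q (n := n) t x - bn n) (Num.min (q (n := n) t x + bn n) (Ls t x)).
Let hc n (x : X n) : R := (Lc x)^-1 - (q (n := n) t x)^-1.
Let u n (o : O n) := resid (mu (n := n)) o.
Let fs s n (o : O n) : R := (od o == t)%:R * rs s (ox o) * u o.

Let mdotXD n (g : 'cV[R]_(p n)) : measurable_fun setT (fun x => dot (XD (n := n) x) g).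
Proof. by apply: measurable_fun_sum => j _; apply: measurable_funM => //; exact: mXD. Qed.

Let mMs n s : measurable_fun setT (Ms (n := n) s).
Proof. by rewrite /Ms /level; case: (unlift _ _) => // r; exact: mdotXD. Qed.

Let mLs n s : measurable_fun setT (Ls (n := n) s).
Proof.
rewrite (_ : Ls s = (fun x => (\sum_r expR (Ms r x - Ms s x))^-1)); last first.
  by apply/funext => x; rewrite -[LHS]invrK /Ls logitV.
apply: (measurableT_comp (@measurable_invr R)); apply: measurable_fun_sum => r _.
by apply: (measurableT_comp (@measurable_expR R)); apply: measurable_funB; exact: mMs.
Qed.

Let mrs n s : measurable_fun setT (rs s (n := n)).
Proof.
apply: measurable_minr => //; apply: (measurableT_comp (@measurable_expR R)).
by apply: measurable_funB; exact: mMs.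
Qed.

Let rs_bd n s x : `|rs s (n := n) x| <= 2 / pmin.
Proof. by rewrite ger0_norm /rs ?ge_min ?lexx// le_min expR_ge0 divr_ge0// ltW. Qed.

Let bn_ge0 n : 0 <= bn n.
Proof. by rewrite /bn le_min normr_ge0 divr_ge0// ltW. Qed.

Let Lc_near n x : `|Lc (n := n) x - q (n := n) t x| <= bn n.
Proof.
rewrite /Lc; have := bn_ge0 n; move: (bn n) (q _ _) (Ls _ _) => b y z b0.
rewrite ler_norml; apply/andP; split; first by rewrite lerBrDr addrC le_max lexx.
rewrite lerBlDr ge_max; apply/andP; split; first by lra.
by rewrite ge_min; apply/orP; left; lra.
Qed.

Let hc_bd n x : `|hc (n := n) x| <= 2 / pmin ^+ 2 * bn n.
Proof.
have h := Lc_near x; have qg := q_ge t x.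
have b2 : bn n <= pmin / 2 by rewrite /bn ge_min lexx orbT.
have Lg : pmin / 2 <= Lc (n := n) x.
  by move: h => /ler_normlP[h _]; move: (Lc x) (q _ _) h qg => y z; lra.
have p2 : 0 < pmin / 2 by rewrite divr_gt0.
have L0 := lt_le_trans p2 Lg; have q0 := lt_le_trans pmin_gt0 qg.
rewrite /hc; move: (Lc x) (q _ _) h L0 q0 Lg qg => y z h y0 z0 yg zg.
have -> : y^-1 - z^-1 = (y * z)^-1 * (z - y) by field; rewrite !gt_eqF.
rewrite normrM distrC ler_pM// gtr0_norm ?invr_gt0 ?mulr_gt0//.
rewrite (_ : 2 / pmin ^+ 2 = (pmin / 2 * pmin)^-1); last by field; rewrite gt_eqF.
by rewrite lef_pV2 ?posrE ?mulr_gt0// ler_pM// ltW.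
Qed.

Let mhc n : (0 < n)%N -> measurable_fun setT (hc (n := n)).
Proof.
move=> n0; apply: measurable_funB; apply: (measurableT_comp (@measurable_invr R)); last exact: mq.
apply: measurable_maxr; first by apply: measurable_funB => //; exact: mq.
by apply: measurable_minr; [apply: measurable_funD => //; exact: mq|exact: mLs].
Qed.

Let mlevel n : measurable_fun setT (fun dx : 'I_T.+1 * X n => (dx.1 == t)%:R : R).
Proof.
by apply: (@measurableT_comp _ _ _ _ _ _ (fun a : 'I_T.+1 => (a == t)%:R : R)) => //; exact: measurable_fun_ord.
Qed.

Let lev_bd (b : bool) : `|b%:R| <= 1 :> R.
Proof. by case: b; rewrite ?normr1 ?normr0. Qed.

(** The weights are nonrandom functions of (d, x), so the terms are centred with second moment of
    order bn^2, which vanishes. *)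
Let approx_negl : negl S (fun n w => Num.sqrt n%:R *
  avgO w (fun o => (od o == t)%:R * hc (ox o) * u o)).
Proof.
pose K n : R := 2 / pmin ^+ 2 * bn n.
have K0 n : 0 <= K n by rewrite mulr_ge0// divr_ge0// exprn_ge0// ltW.
apply: (negl_sqrtn_avg S_iid (f := fun n o => (od o == t)%:R * hc (ox o) * u o)
  (C := fun n => C2 * K n ^+ 2)); last first.
  have bb : `|bnd n| @[n --> \oo] --> (0 : R).
    apply/cvgrPdist_le => e e0; move/cvgrPdist_le : bnd0 => /(_ e e0); apply: filterS => n.
    by rewrite !sub0r !normrN normr_id.
  have bn0 : bn n @[n --> \oo] --> (0 : R).
    apply: (squeeze_cvgr _ (cvg_cst 0) bb); near=> n.
    by rewrite bn_ge0/= /bn ge_min lexx.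
  have Kc : K n @[n --> \oo] --> (0 : R).
    by rewrite -(mulr0 (2 / pmin ^+ 2)); apply: cvgM => //; exact: cvg_cst.
  rewrite -(mulr0 C2); apply: cvgM; first exact: cvg_cst.
  by rewrite -(mulr0 (0 : R)); exact: (cvgM Kc Kc).
move=> n n0.
have mh : measurable_fun setT (fun dx : 'I_T.+1 * X n => (dx.1 == t)%:R * hc dx.2).
  by apply: measurable_funM => //; apply: measurableT_comp => //; exact: mhc.
have mho : measurable_fun setT (fun o : O n => (od o == t)%:R * hc (ox o)).
  exact: (measurableT_comp mh (@measurable_odx R T _ (X n))).
have bh (b : bool) x : `|b%:R * hc (n := n) x| <= K n.
  by rewrite normrM -[leRHS]mul1r ler_pM// hc_bd.
have l1 : L1 (Q n) (fun o => (od o == t)%:R * hc (ox o) * u o).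
  by apply: (L1_mul_bd mho _ (resid1 n0)) => o; exact: bh.
have E2 : (fun o : O n => ((od o == t)%:R * hc (ox o) * u o) ^+ 2) =
    (fun o => ((od o == t)%:R * hc (ox o)) ^+ 2 * u o ^+ 2).
  by apply/funext => o; rewrite exprMn.
have bh2 (b : bool) x : 0 <= (b%:R * hc (n := n) x) ^+ 2 <= K n ^+ 2.
  by rewrite sqr_ge0/= -[leLHS]real_normK ?num_real// lerXn2r ?nnegrE ?bh.
split=> //.
- rewrite E2; apply: (L1_mul_bd (K := K n ^+ 2) _ _ (resid2 n0)); first exact: measurable_funX.
  by move=> o; have /andP[h1 h2] := bh2 (od o == t) (ox o); rewrite ger0_norm.
- exact: (resid0 (h := fun dx => (dx.1 == t)%:R * hc dx.2)).
- rewrite E2.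
  apply: (le_trans (resid2w (h := fun dx => ((dx.1 == t)%:R * hc dx.2) ^+ 2) (K := K n ^+ 2) n0 _ _)).
  + exact: measurable_funX.
  + by move=> dx; exact: bh2.
  rewrite ler_wpM2l// -[leRHS](Ex_cst (Q n)); apply: Ex_le; [|exact: L1_cst|].
    apply: (L1_bd _ (K := K n ^+ 2)); first exact: measurable_funX.
    by move=> o; have /andP[h1 h2] := bh2 (od o == t) (ox o); rewrite ger0_norm.
  by move=> o; have /andP[h1 h2] := bh2 (od o == t) (ox o).
Unshelve. all: by end_near. Qed.

Let perturb_negl s : negl S (fun n w => Num.sqrt n%:R *
  avgO w (fun o => fs s o * (expR (\sum_j xc j (ox o) * th s t w j) - 1))).
Proof.
pose K : R := 2 / pmin; have K0 : 0 <= K by rewrite divr_ge0// ltW.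
have mr n : measurable_fun setT (fun dx : 'I_T.+1 * X n => (dx.1 == t)%:R * rs s dx.2).
  by apply: measurable_funM => //; apply: measurableT_comp => //; exact: mrs.
have br n (b : bool) x : `|b%:R * rs s (n := n) x| <= K.
  by rewrite normrM -[leRHS]mul1r ler_pM// rs_bd.
have mro n : measurable_fun setT (fun o : O n => (od o == t)%:R * rs s (ox o)).
  exact: (measurableT_comp (mr n) (@measurable_odx R T _ (X n))).
have mfs n : (0 < n)%N -> measurable_fun setT (fs s (n := n)).
  by move=> n0; apply: measurable_funM => //; exact: L1_meas (resid1 n0).
apply: (@exp_perturbation_negl R _ (fun n => O n) Q S S_iid p (fun n j o => xc j (ox o)) B (K ^+ 4 * C4)
  B_ge1 _ _ p_rate (fs s) mfs _ _ _ (th s t)).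
- move=> n j n0; apply: measurableT_comp; [exact: mxc|exact: measurable_ox].
- by move=> n j o; exact: xc_bd.
- by rewrite mulr_ge0// exprn_ge0.
- move=> n n0; have [h1 h2] := resid4 n0.
  have E4 (o : O n) : fs s o ^+ 4 = ((od o == t)%:R * rs s (ox o)) ^+ 4 * u o ^+ 4 by rewrite -exprMn.
  have b4 (o : O n) : `|((od o == t)%:R * rs s (ox o)) ^+ 4| <= K ^+ 4.
    by rewrite normrX lerXn2r ?nnegrE ?br.
  have l4 : L1 (Q n) (fun o => fs s o ^+ 4).
    rewrite (_ : (fun o => _) = (fun o => ((od o == t)%:R * rs s (ox o)) ^+ 4 * u o ^+ 4)); last exact/funext.
    by apply: (L1_mul_bd _ b4 h1); exact: measurable_funX.
  split=> //; apply: (@le_trans _ _ (Ex (Q n) (fun o => K ^+ 4 * u o ^+ 4))).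
    apply: Ex_le => //; first exact: L1Z.
    move=> o; rewrite E4; apply: ler_wpM2r; first by rewrite (exprM _ 2 2); exact: sqr_ge0.
    exact: (le_trans (ler_norm _) (b4 o)).
  by rewrite ExZ// ler_wpM2l// exprn_ge0.
(* Indicator, clipped ratio and monomial together still form a bounded function of (d, x), to which
   the residual is orthogonal. *)
- move=> n k J n0.
  pose h (dx : 'I_T.+1 * X n) := (dx.1 == t)%:R * rs s dx.2 * \prod_i xc (J i) dx.2.
  have mT : measurable_fun setT (fun dx : 'I_T.+1 * X n => \prod_i xc (J i) dx.2).
    by apply: measurable_fun_prodr => i _; apply: measurableT_comp => //; exact: mxc.
  have E : (fun o : O n => fs s o * @tens R _ (fun n => O n) n (p n) (fun j o => xc j (ox o)) k J o) =
      (fun o => h (od o, ox o) * resid (mu (n := n)) o).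
    by apply/funext => o; rewrite /fs /tens /h /u/=; ring.
  have mh : measurable_fun setT h by exact: measurable_funM.
  rewrite E; apply: resid0 => //.
  apply: (L1_mul_bd (K := K * B ^+ k) _ _ (resid1 n0)).
    exact: (measurableT_comp mh (@measurable_odx R T _ (X n))).
  move=> o; rewrite normrM ler_pM// ?br//=.
  have := @tens_bd R _ (fun n => O n) n (p n) (fun j o => xc j (ox o)) B _ k J o.
  by apply => j z; exact: xc_bd.
- exact: th_rate.
Qed.

(** The target logit [Ls] is the intermediate point: 1 / Ls - 1 / q is the nonrandom approximation
    error, and 1 / phat - 1 / Ls is a sum of one exponential perturbation per level. *)
Lemma logit_score_negl : negl S (fun n w => Num.sqrt n%:R *
  avgO w (fun o => (od o == t)%:R * resid (mu (n := n)) o * ((ph w t (ox o))^-1 - (q (n := n) t (ox o))^-1))).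
Proof.
have h := negl_sum (index_enum _) perturb_negl.
apply: (negl_le (neglD approx_negl h)); apply: (whpS whp_sure); near=> n; move=> w hw /=.
rewrite (_ : avgO w _ = avgO w (fun o => (od o == t)%:R * hc (ox o) * u o) +
  \sum_s avgO w (fun o => fs s o * (expR (\sum_j xc j (ox o) * th s t w j) - 1))).
  by rewrite mulrDr mulr_sumr.
rewrite -avg_sum -avgD; apply: eq_avg => i.
have Lg := Ls_ge t i hw; have p2 : 0 < pmin / 2 by rewrite divr_gt0.
have [n0 hx hb b2] := hw.
have bE : bn n = `|bnd n| by rewrite /bn min_l.
have LE : Lc (ox (tnth w i)) = Ls t (ox (tnth w i)).
  have := le_trans (hb i t) (ler_norm _); rewrite /Lc bE => /ler_normlP[h1 h2].
  rewrite min_r; last by move: (Ls _ _) (q _ _) h1 h2 => *; lra.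
  by rewrite max_r//; move: (Ls _ _) (q _ _) h1 h2 => *; lra.
have rE s : rs s (ox (tnth w i)) = expR (Ms s (ox (tnth w i)) - Ms t (ox (tnth w i))).
  rewrite /rs min_r// (@le_trans _ _ ((Ls t (ox (tnth w i)))^-1))//.
    rewrite /Ls logitV (bigD1 s)//= lerDl; apply: sumr_ge0 => s' _; exact: expR_ge0.
  by rewrite -[2 / pmin]invf_div lef_pV2 ?posrE// (lt_le_trans p2).
rewrite phV// /hc LE /Ls logitV.
pose e s := expR (Ms s (ox (tnth w i)) - Ms t (ox (tnth w i))).
pose E s := expR (\sum_j xc j (ox (tnth w i)) * th s t w j).
have -> : \sum_s fs s (tnth w i) * (expR (\sum_j xc j (ox (tnth w i)) * th s t w j) - 1) =
    (od (tnth w i) == t)%:R * u (tnth w i) * (\sum_s e s * E s - \sum_s e s).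
  rewrite -sumrB mulr_sumr; apply: eq_bigr => s _; rewrite /fs rE -/(e s) -/(E s); ring.
have fin (a b x y z : R) : a * b * (x - z) = a * (y - z) * b + a * b * (x - y) by ring.
exact: fin.
Unshelve. all: by end_near. Qed.

End logit_score.

(** * From the conditions to coverage *)

Section convergence_in_probability.
Context {R : realType} {T : nat} {d : nat -> measure_display} {X : forall n, measurableType (d n)}.
Local Notation O n := (observed R T (X n)).
Variable P : forall n, dgp R T (X n) n.
Local Notation S := (fun n => smp (P n)).

Lemma oP_negl (Z : forall n, n.-tuple (O n) -> R) (a : nat -> R) :
  (forall n, (0 < n)%N -> measurable_fun setT (Z n)) -> (\forall n \near \oo, 0 < a n) ->
  oP P Z a -> negl S (fun n w => (a n)^-1 * Z n w).
Proof.
move=> mZ a0 h c c0 e e0.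
have /fine_cvgP[hfin hcv] := h c c0.
have ce : \forall n \near \oo, fine (S n [set w | c * a n < `|Z n w|]) <= e.
  move/cvgrPdist_le : hcv => /(_ e e0); apply: filterS => n /=.
  by rewrite sub0r normrN => /(le_trans (ler_norm _)).
near=> n; have n0 : (0 < n)%N by near: n; exact: nbhs_infty_gt.
have an : 0 < a n by near: n; exact: a0.
have mA : measurable [set w | c * a n < `|Z n w|].
  by apply: measurable_setlt => //; apply: measurableT_comp => //; exact: mZ.
apply: bigS (big_setC mA _); [exact: lexx| |].
  move=> w /= /negP; rewrite -leNgt normrM gtr0_norm ?invr_gt0// => hw.
  by rewrite ler_pdivrMl// mulrC.
rewrite -[leLHS]fineK ?fin_num_measure// lee_fin; near: n; exact: ce.
Unshelve. all: by end_near. Qed.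

Lemma oP_unif_negl (Z : forall n, 'I_T.+1 -> n.-tuple (O n) -> R) (a : nat -> R) :
  (forall n t, (0 < n)%N -> measurable_fun setT (Z n t)) -> (\forall n \near \oo, 0 < a n) ->
  oP_unif P Z a -> forall t, negl S (fun n w => (a n)^-1 * Z n t w).
Proof.
move=> mZ a0 h t.
have m1 n : (0 < n)%N -> measurable_fun setT (fun w => \big[Num.max/0]_(t < T.+1) `|Z n t w|).
  by move=> n0; apply: measurable_fun_bigmax => s _; apply: measurableT_comp => //; exact: mZ.
apply: (negl_le0 (oP_negl m1 a0 h)) => n w; rewrite !normrM ler_wpM2l//.
by rewrite (le_trans _ (ler_norm _))//; exact: (le_bigmax _ (fun t => `|Z n t w|)).
Qed.

End convergence_in_probability.

Section from_conditions.
Context {R : realType} {T : nat} {p : nat -> nat} {d : nat -> measure_display}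
  {X : forall n, measurableType (d n)}.
Local Notation O n := (observed R T (X n)).
Local Notation avgO := (@avg R _ (fun n => O n) _).
Variable p_ge1 : forall n, (0 < n)%N -> (1 <= p n)%N.
Variables (XD : forall n, X n -> 'cV[R]_(p n)) (FS : forall n, first_stage R T (p n) (X n) n).
Arguments XD : clear implicits.
Hypothesis mXD : forall n j, measurable_fun setT (fun x => XD n x j 0).
Variables (P : forall n, dgp R T (X n) n) (ps mu : forall n, 'I_T.+1 -> X n -> R).
Arguments ps : clear implicits.
Arguments mu : clear implicits.
Local Notation S := (fun n => smp (P n)).
Local Notation Q := (fun n => law (P n)).
Hypothesis nuis : forall n, (0 < n)%N -> is_nuisance (P n) (ps n) (mu n).
Hypothesis indep : forall n, (0 < n)%N -> mean_independence (P n).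
Variable pmin : R.
Hypothesis pmin_gt0 : 0 < pmin.
Hypothesis ps_ge : forall n, (0 < n)%N -> forall t, {ae pop (P n), forall z, pmin <= ps n t (lX z)}.
Hypothesis fsc : first_stage_conditions FS P ps mu.
Variables (Bx B4 cx r Bm : R).
Hypothesis XD_pop : forall n, (0 < n)%N -> {ae pop (P n), forall z, forall j, `|XD n (lX z) j 0| <= Bx}.
Hypothesis moment4 : forall n, (0 < n)%N -> forall t, exists2 g : X n -> R,
  is_condE (pop (P n)) lX (fun z => `|lU (mu n) t z| ^+ 4) g & {ae pop (P n), forall z, g (lX z) <= B4}.
Hypothesis B4_ge0 : 0 <= B4.
Hypothesis cx_gt0 : 0 < cx.
Hypothesis XU_ge : forall n, (0 < n)%N -> forall j t, (cx%:E <= 'E_(pop (P n))[(fun z =>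
  (lD z == t)%:R * (XD n (lX z) j 0 ^+ 2 * lU (mu n) t z ^+ 2))%R])%E.
Hypothesis r_gt0 : 0 < r.
Hypothesis mu_moment : forall n, (0 < n)%N -> forall t t', ('E_(pop (P n))[(fun z =>
  `|mu n t (lX z) * mu n t' (lX z)| `^ (1 + r))%R] <= Bm%:E)%E.
Hypothesis P_iid : forall n, (0 < n)%N -> iid_sample (P n).

(** The overlap bound on [ps] is only almost sure; the clipped score satisfies it everywhere and
    coincides with [ps] on almost every sample. *)
Let q n t x := clip pmin (ps n t x).
Arguments q : clear implicits.
Let ph n w t x := phat (FS n) w t x.
Let mh n w t x := muhat (FS n) w t x.

Let S_iid n : (0 < n)%N -> iid (law (P n)) (smp (P n)).
Proof. exact: P_iid. Qed.

Let ps_pop n (n0 : (0 < n)%N) := ps_bounds_pop (nuis n0) pmin_gt0 (ps_ge n0).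

Let pmin_le1 : pmin <= 1.
Proof.
(* An almost sure event is nonempty, and a single point of it, here at n = 1, suffices. *)
have [z [h _]] := big_gt0 ltr01 (big_ae (ps_pop (ltn0Sn 0))).
by have /andP[h1 h2] := h ord0; exact: le_trans h1 h2.
Qed.

Let mps n t : (0 < n)%N -> measurable_fun setT (ps n t).
Proof. by move=> n0; exact: measurable_ps (nuis n0) t. Qed.

Let mpso n t : (0 < n)%N -> measurable_fun setT (fun o : O n => ps n t (ox o)).
Proof. by move=> n0; apply: measurableT_comp; [exact: mps|exact: measurable_ox]. Qed.

Let mmu n t : (0 < n)%N -> measurable_fun setT (mu n t).
Proof. by move=> n0; exact: measurable_mu (nuis n0) t. Qed.

Let mq n t : (0 < n)%N -> measurable_fun setT (q n t).
Proof. by move=> n0; apply: measurable_clip; exact: mps. Qed.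

Let ps_law n : (0 < n)%N -> {ae law (P n), forall o,
  (forall t, q n t (ox o) = ps n t (ox o)) /\ \sum_t ps n t (ox o) = 1}.
Proof.
(* The equation is written as two inequalities because those give measurable sets directly. *)
move=> n0; pose A := [set o : O n | forall t, pmin <= ps n t (ox o) <= 1] `&`
  [set o : O n | \sum_t ps n t (ox o) <= 1] `&` [set o : O n | 1 <= \sum_t ps n t (ox o)].
have ms : measurable_fun setT (fun o : O n => \sum_t ps n t (ox o)).
  by apply: measurable_fun_sum => t _; exact: mpso.
have mA : measurable A.
  apply: measurableI; [apply: measurableI|]; [|exact: measurable_setle|exact: measurable_setle].
  apply: measurable_forall => t.
  rewrite [X in measurable X](_ : _ = [set o : O n | pmin <= ps n t (ox o)] `&` [set o : O n | ps n t (ox o) <= 1]).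
    by apply: measurableI; apply: measurable_setle => //; exact: mpso.
  by apply/seteqP; split => o /=; [move/andP|move=> h; apply/andP].
have : {ae law (P n), forall o, A o}.
  apply: (ae_law mA); apply: filterS (ps_pop n0) => z [h1 h2].
  by split; [split; [exact: h1|]|]; rewrite /= h2.
apply: filterS => o [[h1 h2] h3]; split.
  by move=> t; exact: clip_id (h1 t).
by apply/eqP; rewrite eq_le h2 h3.
Qed.

Let sure n : set (n.-tuple (O n)) := [set w | (0 < n)%N /\
  forall i t, q n t (ox (tnth w i)) = ps n t (ox (tnth w i))].

Let whp_sure : whp S sure.
Proof.
apply: whp_ae; near=> n; have n0 : (0 < n)%N by near: n; exact: nbhs_infty_gt.
by apply: filterS (ae_sample (S_iid n0) (ps_law n0)) => w h; split=> // i; case: (h i).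
Unshelve. all: by end_near. Qed.

Let mresid n : (0 < n)%N -> measurable_fun setT (resid (mu n) : O n -> R).
Proof. by move=> n0; exact: measurable_resid (nuis n0). Qed.

Let resid4 n : (0 < n)%N -> L1 (law (P n)) (fun o => resid (mu n) o ^+ 4) /\
  Ex (law (P n)) (fun o => resid (mu n) o ^+ 4) <= T.+1%:R * B4.
Proof. by move=> n0; exact: Ex_law_resid4 (nuis n0) _ (moment4 n0). Qed.

Let resid1 n : (0 < n)%N -> L1 (law (P n)) (resid (mu n)).
Proof. by move=> n0; exact: L1_law_resid (nuis n0) _ (moment4 n0). Qed.

Let resid2 n : (0 < n)%N -> L1 (law (P n)) (fun o => resid (mu n) o ^+ 2).
Proof. by move=> n0; exact: L1_law_resid2 (nuis n0) _ (moment4 n0). Qed.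

Let resid0 n (h : 'I_T.+1 * X n -> R) : (0 < n)%N -> measurable_fun setT h ->
  L1 (law (P n)) (fun o => h (od o, ox o) * resid (mu n) o) ->
  Ex (law (P n)) (fun o => h (od o, ox o) * resid (mu n) o) = 0.
Proof. by move=> n0; exact: Ex_law_resid (nuis n0) h. Qed.

Let resid2w n (h : 'I_T.+1 * X n -> R) (K : R) : (0 < n)%N -> measurable_fun setT h ->
  (forall dx, 0 <= h dx <= K) ->
  Ex (law (P n)) (fun o => h (od o, ox o) * resid (mu n) o ^+ 2)
    <= (1 + B4) / pmin * Ex (law (P n)) (fun o => h (od o, ox o)).
Proof.
move=> n0; exact: (Ex_law_resid2_weighted (nuis n0) pmin_gt0 (ps_ge n0) (moment4 n0)).
Qed.

Let resid2_ge n t : (0 < n)%N ->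
  cx / (1 + Bx ^+ 2) <= Ex (law (P n)) (fun o => (od o == t)%:R * resid (mu n) o ^+ 2).
Proof.
(* Any regressor would do; the first one exists because p n >= 1. *)
move=> n0; pose j := Ordinal (p_ge1 n0).
have hb : {ae pop (P n), forall z, `|(fun x => XD n x j 0) (lX z)| <= Bx}.
  by apply: filterS (XD_pop n0) => z; exact.
exact: (Ex_law_dummy_resid2 (t := t) (xf := fun x => XD n x j 0) (b := Bx) (c := cx) (nuis n0)
  (moment4 n0) (@mXD n j) hb cx_gt0 (XU_ge n0 j t)).
Qed.

Let mu2_ui t : unif_int Q (fun n o => mu n t (ox o) ^+ 2).
Proof.
apply: (unif_int_powR (r := r) (B := Bm)) => // n n0.
have [h1 h2] := Ex_law_mu_mu (nuis n0) r_gt0 (mu_moment n0 t t).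
split=> //; apply: measurable_funX; apply: measurableT_comp; [exact: mmu|exact: measurable_ox].
Qed.

Let MvecE n t : (0 < n)%N -> mean_vec (P n) t 0 = Ex (law (P n)) (fun o => mu n t (ox o)).
Proof.
move=> n0; rewrite mxE; have [_ ->] := Ex_law_mu (nuis n0) pmin_gt0 (ps_ge n0) (indep n0) t.
by [].
Qed.

Let mph n t : (0 < n)%N -> measurable_fun setT (fun wx : n.-tuple (O n) * X n => ph wx.1 t wx.2).
Proof. by move=> _; exact: phat_meas. Qed.

Let mmh n t : (0 < n)%N -> measurable_fun setT (fun wx : n.-tuple (O n) * X n => mh wx.1 t wx.2).
Proof. by move=> _; exact: muhat_meas. Qed.

Let mhw n (f : n.-tuple (O n) -> 'I_T.+1 -> X n -> R) t i :
  measurable_fun setT (fun wx : n.-tuple (O n) * X n => f wx.1 t wx.2) ->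
  measurable_fun setT (fun w : n.-tuple (O n) => f w t (ox (tnth w i))).
Proof.
move=> mf; have h : measurable_fun setT (fun w : n.-tuple (O n) => (w, ox (tnth w i))).
  apply: measurable_fun_pair => //; apply: measurableT_comp; first exact: measurable_ox.
  exact: measurable_tnth.
exact: (measurableT_comp mf h).
Qed.

Let mxi n (f : X n -> R) i : measurable_fun setT f ->
  measurable_fun setT (fun w : n.-tuple (O n) => f (ox (tnth w i))).
Proof.
move=> mf; have h : measurable_fun setT (fun w : n.-tuple (O n) => ox (tnth w i)).
  by apply: measurableT_comp; [exact: measurable_ox|exact: measurable_tnth].
exact: (measurableT_comp mf h).
Qed.

Let m_mse_p n t : (0 < n)%N -> measurable_fun setT (mse_p FS ps t (n := n)).
Proof.
move=> n0; apply: measurable_funM => //; apply: measurable_fun_sum => i _.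
apply: measurable_funX; apply: measurable_funB; first exact: mhw (mph t n0).
exact: mxi (mps t n0).
Qed.

Let m_mse_mu n t : (0 < n)%N -> measurable_fun setT (mse_mu FS mu t (n := n)).
Proof.
move=> n0; apply: measurable_funM => //; apply: measurable_fun_sum => i _.
apply: measurable_funX; apply: measurable_funB; first exact: mhw (mmh t n0).
exact: mxi (mmu t n0).
Qed.

Let one_gt0 : \forall n \near \oo, (0 : R) < (fun=> 1) (n : nat).
Proof. by near=> n. Unshelve. all: by end_near. Qed.

Let rootn_gt0 : \forall n \near \oo, (0 : R) < rootn n.
Proof.
near=> n; rewrite /rootn invr_gt0 sqrtr_gt0 ltr0n.
by near: n; exact: nbhs_infty_gt.
Unshelve. all: by end_near. Qed.

Let msepE n w t : sure w -> avgO w (fun o => (ph w t (ox o) - q n t (ox o)) ^+ 2) = mse_p FS ps t w.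
Proof. by move=> [_ h]; apply: eq_avg => i; rewrite h. Qed.

Let msep_negl t : negl S (fun n w => avgO w (fun o => (ph w t (ox o) - q n t (ox o)) ^+ 2)).
Proof.
have [h _ _ _] := fsc.
have := oP_unif_negl (Z := fun n t w => mse_p FS ps t w) m_mse_p one_gt0 h t.
move=> /negl_le; apply; apply: (whpS whp_sure); near=> n; move=> w hw /=.
by rewrite msepE// invr1 mul1r.
Unshelve. all: by end_near. Qed.

Let msem_negl t : negl S (fun n w => avgO w (fun o => (mh w t (ox o) - mu n t (ox o)) ^+ 2)).
Proof.
have [_ h _ _] := fsc.
have := oP_unif_negl (Z := fun n t w => mse_mu FS mu t w) m_mse_mu one_gt0 h t.
by move=> /negl_eq; apply => n w; rewrite invr1 mul1r.
Qed.

Let prod_negl t : negl S (fun n w => Num.sqrt n%:R *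
  (Num.sqrt (avgO w (fun o => (mh w t (ox o) - mu n t (ox o)) ^+ 2)) *
   Num.sqrt (avgO w (fun o => (ph w t (ox o) - q n t (ox o)) ^+ 2)))).
Proof.
have [_ _ h _] := fsc.
have mZ n t' : (0 < n)%N -> measurable_fun setT (fun w : n.-tuple (O n) =>
    Num.sqrt (mse_mu FS mu t' w) * Num.sqrt (mse_p FS ps t' w)).
  have ms : measurable_fun setT (@Num.sqrt R) by apply: continuous_measurable_fun; exact: sqrt_continuous.
  by move=> n0; apply: measurable_funM; apply: (measurableT_comp ms); [exact: m_mse_mu|exact: m_mse_p].
have := oP_unif_negl (Z := fun n t w => Num.sqrt (mse_mu FS mu t w) * Num.sqrt (mse_p FS ps t w))
  mZ rootn_gt0 h t.
move=> /negl_le; apply; apply: (whpS whp_sure); near=> n; move=> w hw /=.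
by rewrite msepE// /rootn invrK.
Unshelve. all: by end_near. Qed.

Let balance_negl t : negl S (fun n w => Num.sqrt n%:R *
  avgO w (fun o => (mh w t (ox o) - mu n t (ox o)) * (1 - (od o == t)%:R / q n t (ox o)))).
Proof.
have [_ _ _ h] := fsc.
have mZ n t' : (0 < n)%N -> measurable_fun setT (fun w : n.-tuple (O n) =>
    En w (fun o => (muhat (FS n) w t' (ox o) - mu n t' (ox o)) * (1 - (od o == t')%:R / ps n t' (ox o)))).
  move=> n0; apply: measurable_funM => //; apply: measurable_fun_sum => i _.
  apply: measurable_funM; apply: measurable_funB => //; [exact: mhw (mmh t' n0)|exact: mxi (mmu t' n0)|].
  apply: measurable_funM; last first.
    by apply: (measurableT_comp (@measurable_invr R)); exact: mxi (mps t' n0).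
  by apply: (measurableT_comp (@measurable_dummy R T _ (X n) t')); exact: measurable_tnth.
have := oP_unif_negl (Z := fun n t w => En w (fun o => (muhat (FS n) w t (ox o) - mu n t (ox o)) *
  (1 - (od o == t)%:R / ps n t (ox o)))) mZ rootn_gt0 h t.
move=> /negl_le; apply; apply: (whpS whp_sure); near=> n; move=> w [_ hw] /=.
rewrite /rootn invrK le_eqVlt; apply/orP; left; apply/eqP; congr (`|_ * _|).
by apply: eq_avg => i; rewrite hw.
Unshelve. all: by end_near. Qed.

(** The two facts that the regimes establish by different means; the rest of the argument is common
    to both. *)
Let well_behaved := (forall e, 0 < e -> exists2 c, 0 < c &
    oft S e (fun n => [set w | forall i, c <= ph w (od (tnth w i)) (ox (tnth w i))])) /\
  (forall t, negl S (fun n w => Num.sqrt n%:R * avgO w (fun o => (od o == t)%:R * resid (mu n) o *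
     ((ph w t (ox o))^-1 - (q n t (ox o))^-1)))).

Let C2_ge0 : 0 <= (1 + B4) / pmin.
Proof. by rewrite divr_ge0 ?addr_ge0// ltW. Qed.

Let regime1_well_behaved : no_additional_randomness FS -> fitted_overlap FS P -> well_behaved.
Proof.
move=> nar fo.
(* Dependence on the treatment data is given only for n >= 1; an arbitrary function fills index
   0. *)
have H n : exists pt : n.-tuple ('I_T.+1 * X n)%type -> 'I_T.+1 -> X n -> R, (0 < n)%N ->
    (forall t, measurable_fun setT (fun wx : n.-tuple ('I_T.+1 * X n)%type * X n => pt wx.1 t wx.2)) /\
    (forall w, phat (FS n) w = pt (treatment_data w)).
  have [->|n0] := posnP n; first by exists (fun _ _ _ => 0).
  by have [_ _ [pt h1 h2]] := nar n n0; exists pt.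
pose pt n := sval (cid (H n)).
have ptP n : (0 < n)%N ->
    (forall t, measurable_fun setT (fun wx : n.-tuple ('I_T.+1 * X n)%type * X n => pt n wx.1 t wx.2)) /\
    (forall w, phat (FS n) w = pt n (treatment_data w)).
  by rewrite /pt; case: cid.
have ov e : 0 < e -> exists2 c, 0 < c &
    oft S e (fun n => [set w | forall i, c <= ph w (od (tnth w i)) (ox (tnth w i))]).
  move=> e0; have [c c0 hc] := fo e e0; exists c => //.
  apply: filterS2 (nbhs_infty_gt 0) hc => n n0 hn.
  have mA : measurable [set w : n.-tuple (O n) | exists i, phat (FS n) w (od (tnth w i)) (ox (tnth w i)) < c].
    rewrite (_ : mkset _ = ~` [set w : n.-tuple (O n) | forall i, c <= phat (FS n) w (od (tnth w i)) (ox (tnth w i))]).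
      apply: measurableC; apply: measurable_forall => i; apply: measurable_setle => //.
      apply: (@measurable_at_level R T _ _ (fun w : n.-tuple (O n) => od (tnth w i)) (fun t w => phat (FS n) w t (ox (tnth w i)))).
        by apply: measurableT_comp; [exact: measurable_od|exact: measurable_tnth].
      by move=> t; exact: mhw (mph t n0).
    apply/seteqP; split => w /=; first by move=> [i hi] /(_ i); rewrite leNgt hi.
    by move=> /existsNP[i /negP]; rewrite -ltNge; exists i.
  apply: bigS (big_setC mA hn) => // w /= h i.
  by rewrite leNgt; apply/negP => hi; apply: h; exists i.
split=> // t.
have ov' e : 0 < e -> exists2 c, 0 < c &
    oft S e (fun n => [set w | forall i, c <= pt n (treatment_data w) (od (tnth w i)) (ox (tnth w i))]).
  move=> /ov[c c0 hc]; exists c => //; apply: (oftS hc); near=> n; move=> w /= h i.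
  have n0 : (0 < n)%N by near: n; exact: nbhs_infty_gt.
  by have [_ E] := ptP n n0; rewrite -E; exact: h.
have ms' t' : negl S (fun n w => avgO w (fun o => (pt n (treatment_data w) t' (ox o) - q n t' (ox o)) ^+ 2)).
  apply: (negl_eqn (msep_negl t')) => n w n0; have [_ E] := ptP n n0.
  by apply: eq_avg => i; rewrite /ph E.
have := score_negl_treatment_data (Q := Q) (S := S) S_iid (q := q) (mu := mu) (pt := pt) pmin_gt0 (fun n t x => clip_ge _ _) mq
  (fun n t n0 => (ptP n n0).1 t) resid1 resid2 resid0 resid2w C2_ge0 ov' ms' t.
move=> /negl_eqn; apply => n w n0; have [_ E] := ptP n n0.
by congr (_ * _); apply: eq_avg => i; rewrite /ph E.
Unshelve. all: by end_near. Qed.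

Let regime2_well_behaved XY gs bs gh bh : sparsity XD XY P ps mu gs bs ->
  parametric_fit XD XY FS gh bh -> union_conditions FS P ps mu gs bs gh bh -> well_behaved.
Proof.
move=> [BD [BY [bD [bY [_ _ _ spa [bD0 _]]]]]] pf [p_rate _ orate].
pose B := Num.max 1 Bx; have B1 : 1 <= B by rewrite le_max lexx.
(* Sparsity bounds the errors at the levels above the base. Both families of scores sum to 1, so the
   base error is at most T times as large, and T + 1 covers every level. *)
pose bnd n : R := T.+1%:R * `|bD n|.
have bnd0 : bnd n @[n --> \oo] --> (0 : R).
  rewrite -(mulr0 (T.+1%:R : R)); apply: cvgM; first exact: cvg_cst.
  apply/cvgrPdist_le => e e0; move/cvgrPdist_le : bD0 => /(_ e e0); apply: filterS => n.
  by rewrite !sub0r !normrN normr_id.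
have XD_ae n : (0 < n)%N -> {ae law (P n), forall o, forall j, `|XD n (ox o) j 0| <= B}.
  move=> n0; apply: (@ae_law R T _ (X n) n (P n) [set o | forall j, `|XD n (ox o) j 0| <= B]).
    apply: measurable_forall => j; apply: measurable_setle => //; apply: measurableT_comp => //.
    exact: (measurableT_comp (@mXD n j) (@measurable_ox R T _ (X n))).
  apply: filterS (XD_pop n0) => z h j /=; rewrite (le_trans (h j))//.
  by rewrite /B le_max lexx orbT.
have mdot n (g : 'cV[R]_(p n)) : measurable_fun setT (fun x => dot (XD n x) g).
  by apply: measurable_fun_sum => j _; apply: measurable_funM => //; exact: mXD.
have mL n t : measurable_fun setT (fun x => logit (fun s => dot (XD n x) (gs n s)) t).
  apply: measurable_funM.
    case: (unlift _ _) => [r'|]; last exact: measurable_cst.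
    exact: (measurableT_comp (@measurable_expR R) (mdot n _)).
  apply: (measurableT_comp (@measurable_invr R)); apply: measurable_funD => //.
  apply: measurable_fun_sum => s _; exact: (measurableT_comp (@measurable_expR R) (mdot n _)).
have Ls_ae n : (0 < n)%N -> {ae law (P n), forall o, forall t,
    `|logit (fun s => dot (XD n (ox o)) (gs n s)) t - q n t (ox o)| <= bnd n}.
  move=> n0.
  have h1 : {ae law (P n), forall o, forall r' : 'I_T,
      `|logit (fun s => dot (XD n (ox o)) (gs n s)) (lift ord0 r') - ps n (lift ord0 r') (ox o)| <= bD n}.
    apply: filter_forall => r'.
    apply: (ae_of_sample_bound (S_iid n0)
      (f := fun o => logit (fun s => dot (XD n (ox o)) (gs n s)) (lift ord0 r') - ps n (lift ord0 r') (ox o)) n0).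
      apply: measurable_funB; last exact: mpso.
      exact: (measurableT_comp (mL n _) (@measurable_ox R T _ (X n))).
    by apply: filterS (spa n n0) => w [h _]; exact: h.
  apply: filterS2 h1 (ps_law n0) => o h [hq hs] t; rewrite hq.
  (* A negative [bD n] is compatible with the bounds only if there is no level above the base, in
     which case both base scores equal 1. *)
  have [Tb|Tb] := (leP 0 (bD n)); last first.
    have [t' ->|->] := unliftP ord0 t.
      by have := le_lt_trans (le_trans (normr_ge0 _) (h t')) Tb; rewrite ltxx.
    rewrite (_ : _ - _ = 0) ?normr0 ?mulr_ge0//.
    have T0 : forall r' : 'I_T, False.
      by move=> r'; have := le_lt_trans (le_trans (normr_ge0 _) (h r')) Tb; rewrite ltxx.
    have e1 := sum_logit (fun s => dot (XD n (ox o)) (gs n s)).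
    move: e1 hs; rewrite !big_ord_recl !(big1 _ (fun r' : 'I_T => _)) ?addr0; [by move=> -> ->; rewrite subrr| |].
      by move=> r'; case: (T0 r').
    by move=> r'; case: (T0 r').
  have bd1 : bD n <= bnd n by rewrite /bnd (le_trans (ler_norm _))// ler_peMl// ler1n.
  have [t' ->|->] := unliftP ord0 t; first exact: le_trans (h t') bd1.
  have -> : logit (fun s => dot (XD n (ox o)) (gs n s)) ord0 - ps n ord0 (ox o) =
      - \sum_(r' < T) (logit (fun s => dot (XD n (ox o)) (gs n s)) (lift ord0 r') - ps n (lift ord0 r') (ox o)).
    have e1 := sum_logit (fun s => dot (XD n (ox o)) (gs n s)).
    move: e1 hs; rewrite !big_ord_recl sumrB.
    move: (logit _ _) (ps n ord0 _) (\sum_(i < T) _) (\sum_(i < T) _) => a b c e' *; lra.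
  rewrite normrN (le_trans (ler_norm_sum _ _ _))// (@le_trans _ _ (\sum_(r' < T) bD n))//.
    exact: ler_sum.
  rewrite sumr_const card_ord -(mulr_natl (bD n)) /bnd ler_pM ?ler0n// ?ler_nat//.
  exact: ler_norm.
have fit n (w : n.-tuple (O n)) t i : (0 < n)%N ->
    ph w t (ox (tnth w i)) = logit (fun s => dot (XD n (ox (tnth w i))) (gh n w s)) t.
  by move=> n0; have [_ _ _ h] := pf n n0; case: (h w t i).
have L_gt0 : \forall n \near \oo, 0 < log_dim p (R := R) n.
  by apply: filterS (@log_dim_ge1 R p) => n; exact: lt_le_trans.
have a_gt0 : \forall n \near \oo, 0 < (ln (maxn (p n) n)%:R : R) `^ (- 2^-1).
  by apply: filterS L_gt0 => n h; exact: powR_gt0.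
have gh_rate s : negl S (fun n w => Num.sqrt (log_dim p (R := R) n) * norm1 (gh n w s - gs n s)).
  have mZ n : (0 < n)%N -> measurable_fun setT (fun w =>
      Num.max (\big[Num.max/0]_(r' < T) norm1 (gh n w r' - gs n r'))
              (\big[Num.max/0]_(t < T.+1) norm1 (bh n w t - bs n t))).
    move=> n0; have [m1 m2 _ _] := pf n n0.
    apply: measurable_maxr; apply: measurable_fun_bigmax => k _; apply: measurable_fun_sum => j _;
      apply: measurableT_comp => //.
      rewrite (_ : (fun w => _) = (fun w => gh n w k j 0 - gs n k j 0)); last by apply/funext => w; rewrite !mxE.
      exact: measurable_funB.
    rewrite (_ : (fun w => _) = (fun w => bh n w k j 0 - bs n k j 0)); last by apply/funext => w; rewrite !mxE.
    exact: measurable_funB.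
  apply: (negl_le (oP_negl mZ a_gt0 orate)); apply: whp_near.
  apply: filterS L_gt0 => n L0 w /=.
  rewrite powRN invrK -/(log_dim p n) powR12_sqrt ?(ltW L0)// !normrM ler_wpM2l//.
  rewrite [leLHS]ger0_norm; last by apply: sumr_ge0.
  rewrite (le_trans _ (ler_norm _))// le_max; apply/orP; left.
  exact: (le_bigmax _ (fun r' => norm1 (gh n w r' - gs n r'))).
have C4_ge0 : 0 <= T.+1%:R * B4 by rewrite mulr_ge0.
split=> [e e0|t].
  exact: (logit_overlap (Q := Q) (S := S) S_iid (q := q) (ph := ph) (gs := gs) (gh := gh) pmin_gt0 B1
    (fun n t x => clip_ge _ _) XD_ae Ls_ae bnd0 fit gh_rate e0).
exact: (logit_score_negl (Q := Q) (S := S) S_iid (q := q) (mu := mu) (ph := ph) (gs := gs) (gh := gh) pmin_gt0 B1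
  C2_ge0 C4_ge0 (fun n t x => clip_ge _ _) mq mXD resid4 resid1 resid2 resid0 resid2w p_rate XD_ae Ls_ae bnd0 fit gh_rate t).
Qed.

Lemma coverage_of_regimes XY (G : 'cV[R]_T.+1 -> R) (kappa alpha c e : R) :
  twice_unif_cont_diff G -> 0 < kappa ->
  (\forall n \near \oo, kappa <= norm2 (grad G (mean_vec (P n)))) ->
  (no_additional_randomness FS /\ fitted_overlap FS P) \/
    (exists gs bs gh bh, [/\ sparsity XD XY P ps mu gs bs, parametric_fit XD XY FS gh bh
        & union_conditions FS P ps mu gs bs gh bh]) ->
  0 < alpha < 1 -> Phi c = 1 - alpha / 2 -> 0 < e ->
  \forall n \near \oo, `|fine (smp (P n) [set w | G (mean_vec (P n)) \in
    conf_interval G c (phat (FS n) w) (muhat (FS n) w) w]) - (1 - alpha)| <= e.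
Proof.
move=> [dG dp _] kappa0 gk reg al hc e0.
have [ov sc] : well_behaved.
  case: reg => [[h1 h2]|[gs [bs [gh [bh [h1 h2 h3]]]]]]; first exact: regime1_well_behaved.
  exact: regime2_well_behaved h1 h2 h3.
have cm : 0 < cx / (1 + Bx ^+ 2) by rewrite divr_gt0// ltr_pwDl// sqr_ge0.
have cG t : continuous (partial t G) by move=> x; exact: differentiable_continuous.
exact: (coverage_aipw (Q := Q) (S := S) S_iid (q := q) (mu := mu) (ph := ph) (mh := mh) pmin_gt0
  (fun n t x => clip_ge _ _) (fun n t x => clip_le1 _ pmin_le1) mq mmu mresid resid4 resid0
  resid2_ge mu2_ui MvecE ov msep_negl msem_negl prod_negl balance_negl sc dG cG cm kappa0 gk mph mmh al hc e0).
Qed.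

End from_conditions.

(** If no tail infimum were positive, their limit could not be; one positive tail infimum is a
    uniform lower bound from its index on. *)
Lemma limn_einf_gt0 (R : realType) (u : nat -> R) : (0 < limn_einf (fun n => (u n)%:E))%E ->
  exists2 k, 0 < k & \forall n \near \oo, k <= u n.
Proof.
rewrite limn_einf_lim => h.
have [m] : exists m, (0 < einfs (fun n => (u n)%:E) m)%E.
  apply: contrapT => /forallNP hn; move: h; apply/negP; rewrite -leNgt.
  by apply: lime_le; [exact: is_cvg_einfs|near=> n; rewrite leNgt; apply/negP/hn].
set y := einfs _ m => y0.
have hy n : (m <= n)%N -> (y <= (u n)%:E)%E.
  by move=> mn; apply: ereal_inf_lbound; exists n.
have [k k0 ky] : exists2 k : R, 0 < k & (k%:E <= y)%E.
  by case: y y0 {hy} => [k k0|_|//]; [exists k|exists 1 => //; rewrite leey].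
exists k => //; near=> n; rewrite -lee_fin (le_trans ky)//; apply: hy.
by near: n; exact: nbhs_infty_ge.
Unshelve. all: by end_near. Qed.

Theorem corollary2 (R : realType) (T : nat) (T_ge1 : (1 <= T)%N)
  (p : nat -> nat) (p_ge1 : forall n, (0 < n)%N -> (1 <= p n)%N)
  (d : nat -> measure_display) (X : forall n, measurableType (d n))
  (XD XY : forall n, X n -> 'cV[R]_(p n))
  (XD_meas : forall n j, measurable_fun setT (fun x => XD n x j 0))
  (XY_meas : forall n j, measurable_fun setT (fun x => XY n x j 0))
  (FS : forall n, first_stage R T (p n) (X n) n)
  (PP : forall n, set (dgp R T (X n) n))
  (PP_nonempty : forall n, (0 < n)%N -> PP n !=set0)
  (PP_regime : forall P : (forall n, dgp R T (X n) n),
     (forall n, (0 < n)%N -> PP n (P n)) ->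
     regime1 XD XY FS P \/ regime2 XD XY FS P)
  (G : 'cV[R]_T.+1 -> R) (G_smooth : twice_unif_cont_diff G)
  (G_grad : forall P : (forall n, dgp R T (X n) n),
     (forall n, (0 < n)%N -> PP n (P n)) ->
     (0 < limn_einf (fun n => (norm2 (grad G (mean_vec (P n))))%:E))%E)
  (alpha : R) (alpha_gt0 : 0 < alpha) (alpha_lt1 : alpha < 1)
  (c_alpha : R) (c_alphaE : Phi c_alpha = 1 - alpha / 2) :
  sup [set `|fine (smp P [set w | G (mean_vec P) \in
                  conf_interval G c_alpha (phat (FS n) w) (muhat (FS n) w) w])
             - (1 - alpha)| | P in PP n] @[n --> \oo] --> (0 : R).
Proof.
pose f n (P : dgp R T (X n) n) := `|fine (smp P [set w | G (mean_vec P) \in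
  conf_interval G c_alpha (phat (FS n) w) (muhat (FS n) w) w]) - (1 - alpha)|.
apply/cvgrPdist_le => e e0.
(* A sequence that picks, whenever possible, a process violating the bound. *)
have H n : exists P : dgp R T (X n) n, ((0 < n)%N -> PP n P) /\
    ((exists2 P', PP n P' & e < f n P') -> e < f n P).
  have [[P' h1 h2]|nb] := pselect (exists2 P', PP n P' & e < f n P'); first by exists P'.
  have [n0|n0] := posnP n; last by have [P hP] := PP_nonempty n n0; exists P.
  (* At n = 0 no member of the class is available, and Dirac masses provide some process. *)
  have dflt : dgp R T (X n) n by split; exact: (\d_ point).
  by exists dflt; split=> //; rewrite n0.
pose P n := sval (cid (H n)).
have PPn n : (0 < n)%N -> PP n (P n) by rewrite /P; case: cid => /= Q [].
have worst n : (exists2 P', PP n P' & e < f n P') -> e < f n (P n).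
  by rewrite /P; case: cid => /= Q [].
have [k k0 hk] := limn_einf_gt0 (G_grad P PPn).
have al : 0 < alpha < 1 by rewrite alpha_gt0.
have cov : \forall n \near \oo, f n (P n) <= e.
  have core ps mu : (forall n, (0 < n)%N -> is_nuisance (P n) (ps n) (mu n)) ->
      identification P ps -> dgp_conditions XD XY P ps mu -> first_stage_conditions FS P ps mu ->
      (no_additional_randomness FS /\ fitted_overlap FS P) \/
      (exists gs bs gh bh, [/\ sparsity XD XY P ps mu gs bs, parametric_fit XD XY FS gh bh
        & union_conditions FS P ps mu gs bs gh bh]) -> \forall n \near \oo, f n (P n) <= e.
    move=> nuis [indep [pmin pm0 pov]] [iidP [[Bx XDB] _] [B b4] [[cx cx0 XU] _] [r [Bm [r0 mm _]]]] fsc reg.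
    have B40 : 0 <= B ^+ 4 by rewrite (exprM _ 2 2) sqr_ge0.
    have XU1 n (n0 : (0 < n)%N) j t := (XU n n0 j t).1.
    exact: (coverage_of_regimes p_ge1 XD_meas nuis indep pm0 pov fsc XDB b4 B40 cx0 XU1 r0 mm iidP
      G_smooth k0 hk reg al c_alphaE e0).
  have [[ps [mu [h1 h2 h3 h4 h5]]]|[ps [mu [gs [bs [gh [bh [h1 h2 h3 h4 h5]]]]]]]] := PP_regime P PPn.
    by apply: core h1 h2 h3 h4 _; left.
  by apply: core h1 h2 h3 h4 _; right; exists gs, bs, gh, bh.
apply: filterS2 (nbhs_infty_gt 0) cov => n n0 hn; set A := [set _ | _ in _].
(* Any process violating the bound would have made the chosen one violate it too, so the bound along
   the sequence holds for the whole class. *)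
have Ae : ubound A e.
  move=> _ [P' hP' <-]; rewrite leNgt; apply/negP => lt.
  by have := lt_le_trans (worst n (ex_intro2 _ _ P' hP' lt)) hn; rewrite ltxx.
(* Nonempty and bounded, the set has a genuine supremum, and its elements are nonnegative. *)
have A0 : A !=set0 by exists (f n (P n)); exists (P n) => //; exact: PPn.
rewrite sub0r normrN ger0_norm; first exact: ge_sup.
apply: (le_trans _ (ub_le_sup (ex_intro _ e Ae) (_ : A (f n (P n))))); first exact: normr_ge0.
by exists (P n) => //; exact: PPn.
Qed.
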